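(* Let $\mathbb{G}$ be a second countable, type I locally compact quantum group and let $T'$ be the closure of the antilinear map $\Lambda_\psi(\mathfrak{N}_\psi\cap\mathfrak{N}_\varphi^* )\ni\Lambda_\psi(x)\mapsto\Lambda_\varphi(x^* )\in L^2(\mathbb{G})$. The polar decomposition of $T'$ is \[ T'=(\nu^{\frac{i}{8}}J_\varphi)\,\big(J_\varphi\,\nu^{\frac{i}{8}}\nabla_\varphi^{-\frac12}\delta^{-\frac12}J_\varphi\big) \] (with antiunitary part $\nu^{\frac{i}{8}}J_\varphi$ and strictly positive selfadjoint part $J_\varphi\nu^{\frac{i}{8}}\nabla_\varphi^{-\frac12}\delta^{-\frac12}J_\varphi$). Moreover, we have \[ \big(J_\varphi\,\nu^{\frac{i}{8}}\nabla_\varphi^{-\frac12}\delta^{-\frac12}J_\varphi\big)^{it}=\nu^{\frac{i}{8}t^2}J_\varphi\nabla_\varphi^{it/2}\delta^{it/2}J_\varphi\qquad(t\in\mathbb{R}). \]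
   Context: $\mathbb{G}$ is a locally compact quantum group in the sense of Kustermans–Vaes: a von Neumann algebra $L^\infty(\mathbb{G})$ with comultiplication and n.s.f. left and right invariant weights $\varphi,\psi$ (Haar integrals). $\mathbb{G}$ is second countable (resp. type I) if the universal $C^*$-algebra $C_0^u(\hat{\mathbb{G}})$ of the dual is separable (resp. of type I). For a weight $\theta$, $\mathfrak{N}_\theta=\{x:\theta(x^*x)<\infty\}$, $\Lambda_\theta$ is its GNS map, and $\nabla_\theta,J_\theta$ its modular operator and modular conjugation. The GNS spaces of $\varphi,\psi$ are identified with one Hilbert space $L^2(\mathbb{G})$ through $\Lambda_\psi(x)=\Lambda_\varphi(x\delta^{1/2})$ (whenever $x\circ\delta^{1/2}$ is closable with closure in $\mathfrak{N}_\varphi$), where $\delta$ is the modular element: the strictly positive selfadjoint operator affiliated with $L^\infty(\mathbb{G})$ which is the Radon–Nikodym derivative of $\psi$ with respect to $\varphi$. $\nu>0$ is the scaling constant, $\varphi\circ\tau_t=\nu^{-t}\varphi$ with $(\tau_t)$ the scaling group; one has $\nabla_\varphi^{is}\delta^{it}=\nu^{ist}\delta^{it}\nabla_\varphi^{is}$ for $s,t\in\mathbb{R}$. For closed operators $A,B$, $A\circ B$ denotes composition on its natural domain, and if $A\circ B$ is closable $AB$ denotes its closure. *)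

(* Defs.v *)
From HB Require Import structures.
From mathcomp Require Import all_boot all_order all_algebra.
From mathcomp Require Import complex sesquilinear.
From mathcomp Require Import all_classical all_reals all_analysis.

Set Implicit Arguments.
Unset Strict Implicit.
Unset Printing Implicit Defensive.
Import Order.TTheory GRing.Theory Num.Theory.
Import numFieldNormedType.Exports.
Local Open Scope classical_set_scope.
Local Open Scope ring_scope.

(* The inner product is linear in the first variable; norms take their values
   in R[i], whose order x <= y means that y - x is real and nonnegative. *)
Record hilbert (R : realType) := Hilbert {
  hspace :> completeNormedModType R[i];
  inner : {dot hspace for Num.conj};
  inner_norm : forall x : hspace, inner x x = `|x| ^+ 2 }.

Notation "<| x , y |>" := (inner _ x y) (at level 0, x, y at level 99,
  format "<| x ,  y |>") : ring_scope.

(* Unbounded operators H -> K are represented by their graphs. *)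
Notation "H ~> K" := (set (hspace H * hspace K)%type) (at level 99) : type_scope.
Notation op H := (hspace H -> hspace H).

Section BoundedOperators.
Variable R : realType.
Implicit Types H K : hilbert R.

Definition lin_span (V : lmodType R[i]) (S : set V) : set V :=
  [set v | exists n (c : 'I_n -> R[i]) (s : 'I_n -> V),
     (forall i, S (s i)) /\ v = \sum_i c i *: s i].

Definition bounded_op H K : set (H -> K) := [set a | linear a /\ continuous a].

Definition adj H K (a : H -> K) : K -> H :=
  xget 0 [set b | bounded_op b /\ forall x y, <|a x, y|> = <|x, b y|>].

Definition positive_op H (a : op H) := forall x, 0 <= <|a x, x|>.

Definition op_le H (a b : op H) := positive_op (b - a).

Definition projection H (p : op H) :=
  [/\ bounded_op p, p \o p = p & adj p = p].

Definition unitary H (u : op H) :=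
  [/\ bounded_op u, u \o adj u = id & adj u \o u = id].

Definition commutant H (S : set (op H)) : set (op H) :=
  [set b | bounded_op b /\ forall a, S a -> a \o b = b \o a].

Definition bicommutant H (S : set (op H)) := commutant (commutant S).

Definition von_neumann H (M : set (op H)) :=
  [/\ M `<=` @bounded_op H H, (forall a, M a -> M (adj a)) & bicommutant M = M].

Definition op_near H (a b : op H) (e : R[i]) := forall x, `|a x - b x| <= e * `|x|.

(* norm-closed *-subalgebras of B(H) *)
Record cstar_algebra H (A : set (op H)) : Prop := {
  cstar_bounded : A `<=` @bounded_op H H;
  cstar0 : A 0;
  cstar_lin : forall c a b, A a -> A b -> A (c *: a + b);
  cstar_mul : forall a b, A a -> A b -> A (a \o b);
  cstar_adj : forall a, A a -> A (adj a);
  cstar_closed : forall b, bounded_op b ->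
    (forall e : R[i], 0 < e -> exists2 a, A a & op_near a b e) -> A b }.

Record star_hom H K (A : set (op H)) (B : set (op K)) (f : op H -> op K) : Prop := {
  shom_im : forall a, A a -> B (f a);
  shom_lin : forall c a b, A a -> A b -> f (c *: a + b) = c *: f a + f b;
  shom_mul : forall a b, A a -> A b -> f (a \o b) = f a \o f b;
  shom_adj : forall a, A a -> f (adj a) = adj (f a) }.

(* every nonzero central projection dominates a nonzero abelian projection *)
Definition type_I_vN H (M : set (op H)) :=
  forall z, M z -> commutant M z -> projection z -> z <> 0 ->
  exists p, [/\ M p, projection p, p <> 0, z \o p = p &
    forall a b, M a -> M b ->
      (p \o a \o p) \o (p \o b \o p) = (p \o b \o p) \o (p \o a \o p)].

Definition type_I_cstar H (A : set (op H)) :=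
  forall (K : hilbert R) (rho : op H -> op K), star_hom A (@bounded_op K K) rho ->
    closure (lin_span [set rho a x | a in A & x in setT]) = setT ->
    type_I_vN (bicommutant (rho @` A)).

Definition separable_cstar H (A : set (op H)) :=
  exists D : set (op H), [/\ countable D, D `<=` A &
    forall a, A a -> forall e : R[i], 0 < e -> exists2 d, D d & op_near d a e].

End BoundedOperators.

Section Predual.
Variable R : realType.
Implicit Types H K : hilbert R.

Definition sq_summable H (xi : nat -> H) :=
  exists c : R[i], forall n, \sum_(k < n) `|xi k| ^+ 2 <= c.

(* xi-seminorm of the sigma-strong* topology: these seminorms are directed, so
   one sequence xi at a time suffices to describe closures *)
Definition strong_star_near H (xi : nat -> H) (a b : op H) (e : R[i]) :=
  forall n, \sum_(k < n) (`|(a - b) (xi k)| ^+ 2 + `|adj (a - b) (xi k)| ^+ 2) <= e.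

Definition represents H (M : set (op H)) (w : op H -> R[i]) (xi eta : nat -> H) :=
  [/\ sq_summable xi, sq_summable eta &
    forall a, M a -> series (fun k => <|a (xi k), eta k|>) @ \oo --> (w a : R[i]^o)].

(* Elements of the predual M_* are extended by 0 outside M, so that two of them
   agreeing on M are equal as functions. *)
Definition cut H (M : set (op H)) (f : op H -> R[i]) : op H -> R[i] :=
  fun a => if `[< M a >] then f a else 0.

Definition predual H (M : set (op H)) : set (op H -> R[i]) :=
  [set w | (exists xi eta, represents M w xi eta) /\ forall a, ~ M a -> w a = 0].

Definition vector_functional H (M : set (op H)) (h k : H) : op H -> R[i] :=
  cut M (fun a => <|a h, k|>).

Definition pos H (M : set (op H)) : set (op H) := [set a | M a /\ positive_op a].

Definition predual_pos H (M : set (op H)) : set (op H -> R[i]) :=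
  [set w | predual M w /\ forall a, pos M a -> 0 <= w a].

(* unital normal *-homomorphisms *)
Definition vN_hom H K (M : set (op H)) (N : set (op K)) (f : op H -> op K) :=
  [/\ star_hom M N f, f id = id &
    forall w, predual N w -> predual M (cut M (fun a => w (f a)))].

End Predual.

Section Weights.
Variables (R : realType) (H : hilbert R) (M : set (op H)).
Implicit Types (phi : op H -> \bar R) (Lam : op H -> H).

Definition is_lub (D : set (op H)) (a : op H) :=
  [/\ pos M a, (forall b, D b -> op_le b a) &
    forall c, pos M c -> (forall b, D b -> op_le b c) -> op_le a c].

(* Only the values of phi on the positive part of M are relevant. *)
Record nsf_weight phi : Prop := {
  weight_ge0 : forall a, pos M a -> (0 <= phi a)%E;
  weightD : forall a b, pos M a -> pos M b -> phi (a + b) = (phi a + phi b)%E;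
  weightZ : forall (r : R) a, 0 <= r -> pos M a ->
    phi (r%:C%C *: a) = (r%:E * phi a)%E;
  weight_normal : forall D a, D !=set0 -> D `<=` pos M ->
    (forall b c, D b -> D c -> exists d, [/\ D d, op_le b d & op_le c d]) ->
    is_lub D a -> phi a = ereal_sup (phi @` D);
  weight_faithful : forall a, pos M a -> phi a = 0%E -> a = 0;
  weight_semifinite :
    bicommutant [set a | pos M a /\ (phi a < +oo)%E] = M }.

Definition sq_int phi : set (op H) :=
  [set x | M x /\ (phi (adj x \o x) < +oo)%E].

(* (H, Lam, inclusion of M) is a GNS construction for phi; the full relation
   <|Lam x, Lam y|> = phi (y^* x) is the polarization of gns_norm. *)
Record gns phi Lam : Prop := {
  gns_lin : forall c x y, sq_int phi x -> sq_int phi y ->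
    Lam (c *: x + y) = c *: Lam x + Lam y;
  gns_norm : forall x, sq_int phi x ->
    `|Lam x| ^+ 2 = (fine (phi (adj x \o x)))%:C%C;
  gns_dense : closure (Lam @` sq_int phi) = setT;
  gns_mul : forall a x, M a -> sq_int phi x -> Lam (a \o x) = a (Lam x) }.

End Weights.

Section Tensor.
Variable R : realType.
Implicit Types H K : hilbert R.

Record htensor H K := HTensor {
  tspace :> hilbert R;
  tens : H -> K -> tspace;
  tens_linl : forall y, linear (tens^~ y);
  tens_linr : forall x, linear (tens x);
  inner_tens : forall x y x' y',
    <|tens x y, tens x' y'|> = <|x, x'|> * <|y, y'|>;
  tens_total :
    closure (lin_span [set tens x y | x in setT & y in setT]) = setT }.

End Tensor.
Arguments tens {R H K} h : rename.

Definition otens (R : realType) (H K : hilbert R) (T : htensor H K)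
    (a : op H) (b : op K) : op T :=
  xget 0 [set c | bounded_op c /\
                  forall x y, c (tens T x y) = tens T (a x) (b y)].
Arguments otens {R H K} T a b.

Definition vtens (R : realType) (H K : hilbert R) (T : htensor H K)
    (M : set (op H)) (N : set (op K)) : set (op T) :=
  bicommutant [set otens T a b | a in M & b in N].
Arguments vtens {R H K} T M N.

Section Slices.
Variable R : realType.
Implicit Types H K : hilbert R.

(* (w (x) id) X *)
Definition lslice H K (T : htensor H K) (M : set (op H)) (w : op H -> R[i])
    (X : op T) : op K :=
  xget 0 [set y | bounded_op y /\ exists xi eta, represents M w xi eta /\
    forall u v, series (fun n => <|X (tens T (xi n) u), tens T (eta n) v|>) @ \oo
                --> (<|y u, v|> : R[i]^o)].

(* (id (x) w) X *)
Definition rslice H K (T : htensor H K) (N : set (op K)) (w : op K -> R[i])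
    (X : op T) : op H :=
  xget 0 [set y | bounded_op y /\ exists xi eta, represents N w xi eta /\
    forall u v, series (fun n => <|X (tens T u (xi n)), tens T v (eta n)|>) @ \oo
                --> (<|y u, v|> : R[i]^o)].

(* F and G below are Delta (x) id and id (x) Delta; the two bracketings of the
   triple tensor product are compared through matrix coefficients. *)
Definition coassociative H (T : htensor H H) (M : set (op H)) (Delta : op H -> op T) :=
  exists (Tl : htensor T H) (Tr : htensor H T)
         (F : op T -> op Tl) (G : op T -> op Tr),
  [/\ vN_hom (vtens T M M) (vtens Tl (vtens T M M) M) F,
      vN_hom (vtens T M M) (vtens Tr M (vtens T M M)) G,
      (forall a b, M a -> M b -> F (otens T a b) = otens Tl (Delta a) b),
      (forall a b, M a -> M b -> G (otens T a b) = otens Tr a (Delta b)) &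
      forall x, M x -> forall h1 h2 h3 k1 k2 k3,
        <|F (Delta x) (tens Tl (tens T h1 h2) h3), tens Tl (tens T k1 k2) k3|> =
        <|G (Delta x) (tens Tr h1 (tens T h2 h3)), tens Tr k1 (tens T k2 k3)|>].

End Slices.

(* Kustermans-Vaes; L^oo(G) is represented on L^2(G) by the GNS representation
   of the left Haar weight. *)
Record lcqg (R : realType) := LCQG {
  L2 : hilbert R;
  Linf : set (op L2);
  Linf_vN : von_neumann Linf;
  L2L2 : htensor L2 L2;
  Delta : op L2 -> op L2L2;
  Delta_hom : vN_hom Linf (vtens L2L2 Linf Linf) Delta;
  Delta_coassoc : coassociative Linf Delta;
  haarl : op L2 -> \bar R;
  haarl_nsf : nsf_weight Linf haarl;
  haarl_inv : forall w x, predual_pos Linf w -> pos Linf x -> (haarl x < +oo)%E ->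
    haarl (lslice Linf w (Delta x)) = ((complex.Re (w id))%:E * haarl x)%E;
  haarr : op L2 -> \bar R;
  haarr_nsf : nsf_weight Linf haarr;
  haarr_inv : forall w x, predual_pos Linf w -> pos Linf x -> (haarr x < +oo)%E ->
    haarr (rslice Linf w (Delta x)) = ((complex.Re (w id))%:E * haarr x)%E;
  Lphi : op L2 -> L2;
  Lphi_gns : gns Linf haarl Lphi }.

Section QuantumGroup.
Variables (R : realType) (G : lcqg R).
Local Notation H := (L2 G).
Local Notation M := (@Linf R G).
Local Notation "'D" := (@Delta R G).

(* p = (id (x) phi)(Delta(a^* )(1 (x) b)) and q = (id (x) phi)((1 (x) a^* )Delta(b)),
   evaluated on vector functionals *)
Definition antipode_gen : set (op H * op H)%type :=
  [set pq | exists a b, [/\ M pq.1, M pq.2, sq_int M (@haarl R G) a,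
     sq_int M (@haarl R G) b & forall h k,
     <|pq.1 h, k|> =
       <|Lphi b, Lphi (lslice M (vector_functional M k h) ('D a))|> /\
     <|pq.2 h, k|> =
       <|Lphi (lslice M (vector_functional M h k) ('D b)), Lphi a|>]].

(* graph of the antipode S, the sigma-strong* closed operator with the span of
   antipode_gen as a core *)
Definition antipode : set (op H * op H)%type :=
  [set xy | [/\ M xy.1, M xy.2 &
     forall xi : nat -> H, sq_summable xi -> forall e : R[i], 0 < e ->
     exists2 pq, lin_span antipode_gen pq &
       strong_star_near xi pq.1 xy.1 e /\ strong_star_near xi pq.2 xy.2 e]].

Record automorphism_group (tau : R -> op H -> op H) : Prop := {
  autg_hom : forall t, star_hom M M (tau t);
  autg0 : forall x, M x -> tau 0 x = x;
  autgD : forall s t x, M x -> tau (s + t) x = tau s (tau t x);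
  autg_cont : forall w x, predual M w -> M x ->
    continuous (fun t : R => w (tau t x) : R[i]^o) }.

Definition half_strip : set R[i] := [set z | - 2^-1 <= complex.Im z <= 0].

(* graph of the analytic extension tau_{-i/2} *)
Definition tau_mihalf (tau : R -> op H -> op H) : set (op H * op H)%type :=
  [set xy | exists F : R[i] -> op H,
    [/\ (forall z, half_strip z -> M (F z)),
        (forall t : R, F t%:C%C = tau t xy.1),
        M xy.1, F (0 +i* (- 2^-1))%C = xy.2 &
        forall w, predual M w ->
        (forall z : R[i]^o, half_strip z ->
           w (F u) @[u --> within half_strip (nbhs z)] --> (w (F z) : R[i]^o)) /\
        (forall z : R[i]^o, - 2^-1 < complex.Im z < 0 ->
           derivable (fun u : R[i]^o => w (F u) : R[i]^o) z 1)]].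

(* polar decomposition S = R tau_{-i/2} of the antipode, rho being the unitary
   antipode R *)
Definition scaling_group (tau : R -> op H -> op H) :=
  automorphism_group tau /\
  exists rho : op H -> op H,
  [/\ (forall x, M x -> M (rho x) /\ rho (rho x) = x),
      (forall c x y, M x -> M y -> rho (c *: x + y) = c *: rho x + rho y),
      (forall x y, M x -> M y ->
         rho (x \o y) = rho y \o rho x /\ rho (adj x) = adj (rho x)),
      (forall t x, M x -> rho (tau t x) = tau t (rho x)) &
      antipode = [set xy | exists2 y, tau_mihalf tau (xy.1, y) & xy.2 = rho y]].

Definition scaling_constant (nu : R) :=
  0 < nu /\ exists2 tau, scaling_group tau &
    forall t x, pos M x -> haarl (tau t x) = ((nu `^ (- t))%:E * haarl x)%E.

(* th = w^sharp, that is th(x) = conj (w (S(x)^* )) on the domain of S *)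
Definition sharp (w th : op H -> R[i]) :=
  [/\ predual M w, predual M th &
    forall x y, antipode (x, y) -> th x = (w (adj y))^*].

Definition L1sharp : set (op H -> R[i]) := [set w | exists th, sharp w th].

Definition convolution (w th : op H -> R[i]) : op H -> R[i] :=
  cut M (fun x => w (rslice M th ('D x))).

Record L1_rep (K : hilbert R) (pi : (op H -> R[i]) -> op K) : Prop := {
  L1_rep_bounded : forall w, L1sharp w -> bounded_op (pi w);
  L1_rep_lin : forall c w th, L1sharp w -> L1sharp th ->
    pi (fun x => c * w x + th x) = c *: pi w + pi th;
  L1_rep_conv : forall w th, L1sharp w -> L1sharp th ->
    pi (convolution w th) = pi w \o pi th;
  L1_rep_sharp : forall w th, sharp w th -> pi th = adj (pi w) }.

(* A, with lam : L1sharp -> A, is (a concrete copy of) C_0^u of the dual: the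
   enveloping C*-algebra of the *-algebra L1sharp *)
Record universal_dual (K : hilbert R) (A : set (op K))
    (lam : (op H -> R[i]) -> op K) : Prop := {
  udual_cstar : cstar_algebra A;
  udual_rep : L1_rep lam;
  udual_im : forall w, L1sharp w -> A (lam w);
  udual_dense : forall a, A a -> forall e : R[i], 0 < e ->
    exists2 w, L1sharp w & op_near (lam w) a e;
  udual_univ : forall (L : hilbert R) (pi : (op H -> R[i]) -> op L), L1_rep pi ->
    exists2 rho, star_hom A (@bounded_op R L L) rho &
      forall w, L1sharp w -> rho (lam w) = pi w }.

Definition lcqg_second_countable :=
  exists (K : hilbert R) (A : set (op K)) (lam : (op H -> R[i]) -> op K),
    universal_dual A lam /\ separable_cstar A.

Definition lcqg_type_I :=
  exists (K : hilbert R) (A : set (op K)) (lam : (op H -> R[i]) -> op K),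
    universal_dual A lam /\ type_I_cstar A.

End QuantumGroup.

Section Unbounded.
Variable R : realType.
Implicit Types H K L : hilbert R.

Definition gr H K (f : H -> K) : H ~> K := [set p | p.2 = f p.1].

Definition dom H K (A : H ~> K) : set H := [set x | exists y, A (x, y)].

Definition ran H K (A : H ~> K) : set K := [set y | exists x, A (x, y)].

Definition ocomp H K L (A : K ~> L) (B : H ~> K) : H ~> L :=
  [set p | exists y, B (p.1, y) /\ A (y, p.2)].

Definition oscale H K (c : R[i]) (A : H ~> K) : H ~> K :=
  [set p | exists2 y, A (p.1, y) & p.2 = c *: y].

Definition closable H K (A : H ~> K) :=
  forall x y y', closure A (x, y) -> closure A (x, y') -> y = y'.

Definition adjoint H K (A : H ~> K) : K ~> H :=
  [set p | forall x y, A (x, y) -> <|y, p.1|> = <|x, p.2|>].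

Definition selfadjoint H (A : H ~> H) := closure (dom A) = setT /\ adjoint A = A.

Definition positive_sa H (A : H ~> H) :=
  selfadjoint A /\ forall x y, A (x, y) -> 0 <= <|y, x|>.

Definition strictly_positive H (A : H ~> H) :=
  positive_sa A /\ forall x, A (x, 0) -> x = 0.

Definition affiliated H (M : set (op H)) (A : H ~> H) :=
  forall u, commutant M u -> unitary u -> forall x y, A (x, y) -> A (u x, u y).

Record spectral_measure H := SpectralMeasure {
  spE : set R -> op H;
  sp_proj : forall B, measurable B -> projection (spE B);
  sp_setT : spE setT = id;
  sp_setI : forall B C, measurable B -> measurable C ->
    spE (B `&` C) = spE B \o spE C;
  sp_mu : H -> {measure set (measurableTypeR R) -> \bar R};
  sp_muE : forall x B, measurable B -> (fine (sp_mu x B))%:C%C = `|spE B x| ^+ 2 /\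
                                        (sp_mu x B < +oo)%E }.

(* T is the integral of f with respect to E; by polarization T is determined by
   its domain and its quadratic form *)
Definition spectral_integral H (E : spectral_measure H) (f : R -> R[i]) (T : H ~> H) :=
  [/\ T (0, 0),
      (forall c x y x' y', T (x, y) -> T (x', y') -> T (c *: x + x', c *: y + y')),
      (forall x, dom T x <->
        (\int[sp_mu E x]_s ((complex.Re (f s)) ^+ 2 + (complex.Im (f s)) ^+ 2)%:E
           < +oo)%E) &
      forall x y, T (x, y) ->
        <|y, x|> = ((\int[sp_mu E x]_s complex.Re (f s)) +i*
                    (\int[sp_mu E x]_s complex.Im (f s)))%C].

(* T = f(A) for a selfadjoint A *)
Definition is_funcalc H (A : H ~> H) (f : R -> R[i]) (T : H ~> H) :=
  exists2 E : spectral_measure H,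
    spectral_integral E (fun s => s%:C%C) A & spectral_integral E f T.

(* s^{it} for s > 0 *)
Definition ipowR (s t : R) : R[i] := (cos (t * ln s) +i* sin (t * ln s))%C.

(* A^s and A^{it} for a strictly positive A *)
Definition rpow H (A : H ~> H) (s : R) : H ~> H :=
  xget set0 [set T | is_funcalc A (fun x => (x `^ s)%:C%C) T].

Definition ipow H (A : H ~> H) (t : R) : op H :=
  xget 0 [set U | is_funcalc A (fun x => ipowR x t) (gr U)].

Definition antilinear H K (U : H -> K) :=
  forall c x y, U (c *: x + y) = c^* *: U x + U y.

Definition antiunitary H K (U : H -> K) :=
  [/\ antilinear U, (forall x, `|U x| = `|x|) & forall y, exists x, U x = y].

(* polar decomposition T = U P of a closed antilinear T: P is positive and U is
   a partial anti-isometry with initial space the closed range of P *)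
Definition antilinear_polar H K (T : H ~> K) (U : H -> K) (P : H ~> H) :=
  [/\ positive_sa P, T = ocomp (gr U) P, antilinear U,
      (forall x, closure (ran P) x -> `|U x| = `|x|) &
      forall x, (forall y, ran P y -> <|x, y|> = 0) -> U x = 0].

End Unbounded.

Section Modular.
Variables (R : realType) (G : lcqg R).
Local Notation H := (L2 G).
Local Notation M := (@Linf R G).
Local Notation phi := (@haarl R G).
Local Notation psi := (@haarr R G).

Definition left_tomita : H ~> H :=
  [set p | exists x, [/\ sq_int M phi x, sq_int M phi (adj x) &
                         p = (Lphi x, Lphi (adj x))]].

Definition modular_operator_conj (nabla : H ~> H) (J : op H) :=
  [/\ strictly_positive nabla, antiunitary J &
      antilinear_polar (closure left_tomita) J (rpow nabla 2^-1)].

(* the closure of x o delta^{1/2} is everywhere defined and lies in N_phi *)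
Definition times_sqrt (delta : H ~> H) (x y : op H) :=
  [/\ M x, sq_int M phi y & closure (ocomp (gr x) (rpow delta 2^-1)) = gr y].

(* psi = phi(delta^{1/2} . delta^{1/2}) in the sense of Vaes, with GNS map
   Lpsi(x) = Lphi(x delta^{1/2}): the elements x with x delta^{1/2} in N_phi form
   a sigma-strong*-norm core for Lpsi *)
Record modular_element (delta : H ~> H) (Lpsi : op H -> H) : Prop := {
  modelt_pos : strictly_positive delta;
  modelt_aff : affiliated M delta;
  modelt_gns : gns M psi Lpsi;
  modelt_sqrt : forall x y, times_sqrt delta x y -> sq_int M psi x /\ Lpsi x = Lphi y;
  modelt_core : forall x, sq_int M psi x ->
    forall xi : nat -> H, sq_summable xi -> forall e : R[i], 0 < e ->
    exists x' y', [/\ times_sqrt delta x' y', strong_star_near xi x' x e &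
                      `|Lpsi x' - Lpsi x| <= e] }.

(* the map Lpsi(x) |-> Lphi(x^* ) on N_psi meet N_phi^* *)
Definition pre_T' (Lpsi : op H -> H) : H ~> H :=
  [set p | exists x, [/\ sq_int M psi x, sq_int M phi (adj x) &
                         p = (Lpsi x, Lphi (adj x))]].

End Modular.

(* Main.v *)
Require Import Defs.
From HB Require Import structures.
From mathcomp Require Import all_boot all_order all_algebra.
From mathcomp Require Import complex sesquilinear.
From mathcomp Require Import all_classical all_reals all_analysis.
From mathcomp Require Import measurable_realfun ring lra.
Set Implicit Arguments.
Unset Strict Implicit.
Unset Printing Implicit Defensive.
Import Order.TTheory GRing.Theory Num.Theory.
Import numFieldNormedType.Exports.
Local Open Scope classical_set_scope.
Local Open Scope ring_scope.

(** With e^X = nabla^(-1/2) and e^Y = delta^(-1/2), the hypothesis becomes the Weyl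
relation e^(isX) e^(itY) = e^(irst) e^(itY) e^(isX) for r = (ln nu) / 4. Conjugating X by
e^(icY^2), c = -1/(2r) (or using commuting spectral measures when r = 0), gives a
selfadjoint Z = "X + Y" with e^(itZ) = e^(-irt^2/2) e^(itX) e^(itY) and e^Z equal, up to
the phases e^(ir/2) and e^(-ir/2), to the closures of e^X e^Y and of e^Y e^X. The Gaussians
of Y serve as cores, since they map the domain of e^X to itself.

The closed Tomita map is S = e^X J, and T' turns out to be the closure of e^Y e^X J, that
is of delta^(-1/2) S. For x in N_psi and N_phi^*, multiplying x on the left by
1 - (1 + n x x^* )^-1, an element of N_phi, and replacing x by the elements of the core of
the GNS map of psi gives pairs in the graph of e^Y e^X J that converge to (x, x^* ).
Conversely, if w is in N_phi and N_phi^* and h is an entire Gaussian, then w h(Y) lies in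
N_phi by the maximality of the left Hilbert algebra of phi, whence w h(Y) delta^(-1/2) lies
in N_psi. Letting h tend to 1 exhausts the graph. The polar decomposition and the powers
are then read off from Z. *)

(** * Hilbert spaces and bounded operators *)

(** The constants come out of one computation. As e^(isX) = nabla^(-is/2) and e^(itY) =
    delta^(-it/2), the factor nu^(ist) becomes nu^(ist/4), which fixes r. Conjugation by e^(icY^2)
    turns X formally into X - 2rcY, which fixes c. The scalar e^(-irt^2/2) left by reordering
    e^(itX) and e^(itY) takes at t = -i the value e^(ir/2) = nu^(i/8), the phase of the theorem. The
    main obstacle is domains: closures of products are reached only through vectors smoothed by
    functions of Y that stay bounded after the shift l - ir, hence entire Gaussians. The same
    obstacle appears in the algebra. Since N_phi is only a left ideal, nothing algebraic places w
    h(Y) in it: its would-be vector is found in the graph of the closed Tomita map, and fullness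
    lifts the vector to an operator. Spectral measures do not come from a spectral theorem: those of
    nabla and delta are extracted from the given square roots, and for r /= 0 that of Z is a unitary
    transport of X. *)

Section ComplexModulus.
Variable R : realType.
Implicit Types (a b c : R[i]).

(** The norms of [R[i]] and of a [hilbert] are valued in [R[i]]; [cn] and, below, [hn] are their
    real values, on which estimates and limits are carried out. *)
Definition cn c : R := complex.Re `|c|.

Lemma cnE c : `|c| = (cn c)%:C%C.
Proof. by rewrite /cn normc_def. Qed.

Lemma cn_def c : cn c = Num.sqrt (complex.Re c ^+ 2 + complex.Im c ^+ 2).
Proof. by rewrite /cn normc_def. Qed.

Lemma cn_sqr c : cn c ^+ 2 = complex.Re c ^+ 2 + complex.Im c ^+ 2.
Proof. by rewrite cn_def sqr_sqrtr // addr_ge0 ?sqr_ge0. Qed.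

Lemma cn_ge0 c : 0 <= cn c.
Proof. by rewrite cn_def sqrtr_ge0. Qed.

Lemma cn0 : cn 0 = 0.
Proof. by rewrite /cn normr0. Qed.

Lemma cn1 : cn 1 = 1.
Proof. by rewrite /cn normr1. Qed.

Lemma cnM a b : cn (a * b) = cn a * cn b.
Proof. by rewrite {1}/cn normrM !cnE /= mulr0 subr0. Qed.

Lemma cnX a n : cn (a ^+ n) = cn a ^+ n.
Proof. by elim: n => [|n IHn]; rewrite ?expr0 ?cn1 // !exprS cnM IHn. Qed.

Lemma cnN a : cn (- a) = cn a.
Proof. by rewrite /cn normrN. Qed.

Lemma cn_conj a : cn a^* = cn a.
Proof. by rewrite /cn norm_conjC. Qed.

Lemma cnD a b : cn (a + b) <= cn a + cn b.
Proof. by rewrite -lecR rmorphD /= -!cnE; exact: ler_normD. Qed.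

Lemma cnB a b : cn (a - b) <= cn a + cn b.
Proof. by rewrite -(cnN b) cnD. Qed.

Lemma cn_real (r : R) : cn r%:C%C = `|r|.
Proof. by rewrite cn_def /= expr0n addr0 sqrtr_sqr. Qed.

Lemma cn0_eq0 a : cn a = 0 -> a = 0.
Proof. by move=> h; apply/eqP; rewrite -normr_eq0 cnE h. Qed.

Lemma Re_le_cn a : `|complex.Re a| <= cn a.
Proof.
by rewrite -(@ler_sqr _ _ (cn a)) ?nnegrE ?cn_ge0 // cn_sqr real_normK ?num_real // lerDl sqr_ge0.
Qed.

Lemma Im_le_cn a : `|complex.Im a| <= cn a.
Proof.
by rewrite -(@ler_sqr _ _ (cn a)) ?nnegrE ?cn_ge0 // cn_sqr real_normK ?num_real // lerDr sqr_ge0.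
Qed.

Lemma cn_le a : cn a <= `|complex.Re a| + `|complex.Im a|.
Proof.
case: a => x y; rewrite -[(x +i* y)%C]/(_) [X in cn X]complexE /=.
apply: (le_trans (cnD _ _)); rewrite cnM !cn_real lerD2l.
by rewrite cn_def /= expr0n expr1n add0r sqrtr1 mul1r.
Qed.

Lemma ReD a b : complex.Re (a + b) = complex.Re a + complex.Re b.
Proof. by case: a; case: b. Qed.

Lemma ImD a b : complex.Im (a + b) = complex.Im a + complex.Im b.
Proof. by case: a; case: b. Qed.

Lemma ReN a : complex.Re (- a) = - complex.Re a.
Proof. by case: a. Qed.

Lemma ImN a : complex.Im (- a) = - complex.Im a.
Proof. by case: a. Qed.

Lemma ReM a b : complex.Re (a * b) =
  complex.Re a * complex.Re b - complex.Im a * complex.Im b.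
Proof. by case: a; case: b. Qed.

Lemma ImM a b : complex.Im (a * b) =
  complex.Re a * complex.Im b + complex.Im a * complex.Re b.
Proof. by case: a; case: b. Qed.

Lemma ReC a : complex.Re a^* = complex.Re a.
Proof. by case: a. Qed.

Lemma ImC a : complex.Im a^* = - complex.Im a.
Proof. by case: a. Qed.

Lemma complex_eq a b : complex.Re a = complex.Re b -> complex.Im a = complex.Im b ->
  a = b.
Proof. by case: a; case: b => /= ? ? ? ? -> ->. Qed.

Lemma conjM a b : (a * b)^* = a^* * b^*.
Proof. exact: rmorphM. Qed.

Lemma conjD a b : (a + b)^* = a^* + b^*.
Proof. exact: rmorphD. Qed.

Lemma conjK a : a^*^* = a.
Proof. exact: conjCK. Qed.

Lemma conj_realC (r : R) : (r%:C%C : R[i])^* = r%:C%C.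
Proof. exact: conjc_real. Qed.

Lemma realC_ge0 (r : R) : (0 <= r%:C%C :> R[i]) = (0 <= r).
Proof. exact: ler0c. Qed.

Lemma complex_ge0P a : reflect (complex.Im a = 0 /\ 0 <= complex.Re a) (0 <= a).
Proof.
by apply: (iffP idP); rewrite lecE /=; [move=> /andP[/eqP]|move=> [-> ->]; rewrite eqxx].
Qed.

End ComplexModulus.

Section HilbertBasics.
Variable R : realType.
Implicit Types H K : hilbert R.

Definition hn H (x : H) : R := complex.Re `|x|.

Lemma hnE H (x : H) : `|x| = (hn x)%:C%C.
Proof.
have := normr_ge0 x; rewrite /hn; case: `|x| => a b /=.
by rewrite lecE /= => /andP[/eqP -> _].
Qed.

Lemma hn_ge0 H (x : H) : 0 <= hn x.
Proof. by rewrite -ler0c -hnE. Qed.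

Lemma hn0 H : hn (0 : H) = 0.
Proof. by rewrite /hn normr0. Qed.

Lemma hn0_eq0 H (x : H) : hn x = 0 -> x = 0.
Proof. by move=> h; apply/eqP; rewrite -normr_eq0 hnE h. Qed.

Lemma hnN H (x : H) : hn (- x) = hn x.
Proof. by rewrite /hn normrN. Qed.

Lemma hnBC H (x y : H) : hn (x - y) = hn (y - x).
Proof. by rewrite -hnN opprB. Qed.

Lemma hnD H (x y : H) : hn (x + y) <= hn x + hn y.
Proof. by rewrite -lecR rmorphD /= -!hnE; exact: ler_normD. Qed.

Lemma hnB H (x y : H) : hn (x - y) <= hn x + hn y.
Proof. by rewrite -(hnN y) hnD. Qed.

Lemma hn_triangle H (x y z : H) : hn (x - z) <= hn (x - y) + hn (y - z).
Proof. by rewrite -[x - z](subrKA y); exact: hnD. Qed.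

Lemma hnZ H (c : R[i]) (x : H) : hn (c *: x) = cn c * hn x.
Proof. by rewrite /hn normrZ cnE hnE /= mulr0 subr0. Qed.

Lemma ipDl H (x y z : H) : <|x + y, z|> = <|x, z|> + <|y, z|>.
Proof. by rewrite linearDl. Qed.

Lemma ipDr H (x y z : H) : <|z, x + y|> = <|z, x|> + <|z, y|>.
Proof. by rewrite linearDr. Qed.

Lemma ipNl H (x z : H) : <|- x, z|> = - <|x, z|>.
Proof. by rewrite linearNl. Qed.

Lemma ipNr H (x z : H) : <|z, - x|> = - <|z, x|>.
Proof. by rewrite linearNr. Qed.

Lemma ipBl H (x y z : H) : <|x - y, z|> = <|x, z|> - <|y, z|>.
Proof. by rewrite linearBl. Qed.

Lemma ipBr H (x y z : H) : <|z, x - y|> = <|z, x|> - <|z, y|>.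
Proof. by rewrite linearBr. Qed.

Lemma ipZl H c (x z : H) : <|c *: x, z|> = c * <|x, z|>.
Proof. by rewrite linearZl_LR. Qed.

Lemma ipZr H c (x z : H) : <|z, c *: x|> = c^* * <|z, x|>.
Proof. by rewrite linearZr_LR. Qed.

Lemma ip0l H (z : H) : <|0, z|> = 0.
Proof. by rewrite linear0l. Qed.

Lemma ip0r H (z : H) : <|z, 0|> = 0.
Proof. by rewrite linear0r. Qed.

Lemma ipC H (x y : H) : <|x, y|> = <|y, x|>^*.
Proof. by rewrite hermC expr0 mul1r. Qed.

Lemma ipxx H (x : H) : <|x, x|> = (hn x ^+ 2)%:C%C.
Proof. by rewrite inner_norm hnE rmorphXn. Qed.

Lemma hn2E H (x : H) : hn x ^+ 2 = complex.Re <|x, x|>.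
Proof. by rewrite ipxx. Qed.

Lemma hnD2 H (x y : H) :
  hn (x + y) ^+ 2 = hn x ^+ 2 + 2 * complex.Re <|x, y|> + hn y ^+ 2.
Proof.
rewrite !hn2E ipDl !ipDr !ReD [<|y, x|>]ipC ReC; ring.
Qed.

Lemma hnB2 H (x y : H) :
  hn (x - y) ^+ 2 = hn x ^+ 2 - 2 * complex.Re <|x, y|> + hn y ^+ 2.
Proof. by rewrite hnD2 ipNr ReN hnN mulrN. Qed.

Lemma ip_eq0 H (x : H) : (forall y, <|x, y|> = 0) -> x = 0.
Proof.
move=> h; apply: hn0_eq0; apply/eqP; rewrite -sqrf_eq0 hn2E h //.
Qed.

Lemma ip_inj H (x y : H) : (forall z, <|x, z|> = <|y, z|>) -> x = y.
Proof.
move=> h; apply/eqP; rewrite -subr_eq0; apply/eqP/ip_eq0 => z.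
by rewrite ipBl h subrr.
Qed.

Lemma ip_CS H (x y : H) : cn <|x, y|> <= hn x * hn y.
Proof.
have [->|y0] := eqVneq y 0; first by rewrite ip0r cn0 hn0 mulr0.
have hy : 0 < hn y.
  by rewrite lt0r hn_ge0 andbT; apply/eqP => /hn0_eq0 /eqP; apply/negP.
(* [c * r] is the coefficient of the projection of [x] onto the line of [y], where the squared
   distance is smallest. *)
set c := <|x, y|>; set r := (hn y ^+ 2)^-1.
have := sqr_ge0 (hn (x - (c * r%:C%C) *: y)).
rewrite hnB2 hnZ ipZr cnM rmorphM /=.
have -> : c^* * r%:C%C^* * <|x, y|> = (cn c ^+ 2 * r)%:C%C.
  rewrite -/c cn_sqr; case: (c) => a b; apply: complex_eq.
    by rewrite !(ReM, ImM, ReC, ImC) /=; ring.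
  by rewrite !(ReM, ImM, ReC, ImC) /=; ring.
rewrite /= cn_real ger0_norm ?invr_ge0 ?sqr_ge0 // => h.
rewrite -ler_sqr ?nnegrE ?mulr_ge0 ?hn_ge0 ?cn_ge0 //.
have e : r * hn y ^+ 2 = 1 by rewrite mulVf // sqrf_eq0 gt_eqF.
have {}h : 0 <= hn x ^+ 2 - cn c ^+ 2 * r.
  suff -> : hn x ^+ 2 - cn c ^+ 2 * r =
    hn x ^+ 2 - 2 * (cn c ^+ 2 * r) + (cn c * r * hn y) ^+ 2 by [].
  rewrite !exprMn; ring: e.
have := mulr_ge0 h (sqr_ge0 (hn y)).
by rewrite mulrBl -(mulrA (cn c ^+ 2)) e mulr1 subr_ge0 exprMn.
Qed.

Lemma Re_ip_le H (x y : H) : complex.Re <|x, y|> <= hn x * hn y.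
Proof.
exact: le_trans (le_trans (ler_norm _) (Re_le_cn _)) (ip_CS x y).
Qed.

(* [dx] and [dy] are the images of [x] and [y] under a linear map. *)
Lemma polar0 H (x y dx dy : H) : <|dx, x|> = 0 -> <|dy, y|> = 0 ->
  <|dx + dy, x + y|> = 0 -> <|dx + 'i%C *: dy, x + 'i%C *: y|> = 0 ->
  <|dx, y|> = 0.
Proof.
move=> hx hy; rewrite !ipDl !ipDr !ipZl !ipZr hx hy !add0r !addr0 !mulr0 addr0 => h1.
have -> : ('i%C : R[i])^* = - 'i%C by apply: complex_eq; rewrite /= ?oppr0.
move=> h2; have e : <|dy, x|> = - <|dx, y|>.
  by apply/eqP; rewrite -addr_eq0 addrC h1.
move: h2; rewrite e mulNr mulrN -opprD => /eqP; rewrite oppr_eq0 -mulr2n.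
rewrite mulrn_eq0 /= mulf_eq0 => /orP[|/eqP //].
by move=> /eqP [] /eqP; rewrite oner_eq0.
Qed.

(** Polarization over complex scalars. Spectral data are given through quadratic forms only, and
    this turns them into operator identities. *)
Lemma op_eq_form H (a b : op H) : linear a -> linear b ->
  (forall x, <|a x, x|> = <|b x, x|>) -> a = b.
Proof.
move=> la lb h; apply/funext => x; apply/ip_inj => y; apply/eqP.
rewrite -subr_eq0 -ipBl; apply/eqP.
have l : forall c u v, a (c *: u + v) - b (c *: u + v) =
    c *: (a u - b u) + (a v - b v).
  by move=> c u v; rewrite la lb scalerBr opprD addrACA.
have f z : <|a z - b z, z|> = 0 by rewrite ipBl h subrr.
apply: (@polar0 _ _ _ _ (a y - b y)) => //.
- by have := f (1 *: x + y); rewrite l !scale1r.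
- by have := f ('i%C *: y + x); rewrite l addrC [X in <|_, X|>]addrC.
Qed.

End HilbertBasics.

(** * Sequential limits and closures of graphs *)

Section Convergence.
Variable R : realType.
Implicit Types H K : hilbert R.

Lemma rcvg0P (u : nat -> R) : (u @ \oo --> (0 : R)) <->
  forall e, 0 < e -> exists N, forall n, (N <= n)%N -> `|u n| < e.
Proof.
split=> [/cvgr0Pnorm_lt h e e0|h].
  by have [N _ hN] := h _ e0; exists N => n nN; exact: hN.
apply/cvgr0Pnorm_lt => e e0; have [N hN] := h _ e0.
by exists N => // n /= nN; exact: hN.
Qed.

Lemma rcvg_squeeze (u v : nat -> R) l : (forall n, `|u n - l| <= v n) ->
  v @ \oo --> (0 : R) -> u @ \oo --> l.
Proof.
move=> h /rcvg0P v0; apply/subr_cvg0/rcvg0P => e /v0 [N hN]; exists N => n /hN.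
by apply: le_lt_trans; apply: (le_trans (h n)); exact: ler_norm.
Qed.

Definition cv H (u : nat -> H) (x : H) := (fun n => hn (u n - x)) @ \oo --> (0 : R).

Lemma cvP H (u : nat -> H) x : cv u x <->
  forall e, 0 < e -> exists N, forall n, (N <= n)%N -> hn (u n - x) < e.
Proof.
split=> [/rcvg0P h e /h [N hN]|h]; first exists N => n /hN.
  by rewrite ger0_norm ?hn_ge0.
apply/rcvg0P => e /h [N hN]; exists N => n /hN.
by rewrite ger0_norm ?hn_ge0.
Qed.

Lemma cv_squeeze H (u : nat -> H) x (v : nat -> R) :
  (forall n, hn (u n - x) <= v n) -> v @ \oo --> (0 : R) -> cv u x.
Proof.
move=> h v0; apply: (squeeze_cvgr _ (cvg_cst 0) v0).
by apply: nearW => n; rewrite hn_ge0 h.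
Qed.

Lemma cv_cst H (x : H) : cv (fun=> x) x.
Proof. by apply: (@cv_squeeze _ _ _ (fun=> 0)) => [n|]; rewrite ?subrr ?hn0 //; exact: cvg_cst. Qed.

Lemma cv_unique H (u : nat -> H) x y : cv u x -> cv u y -> x = y.
Proof.
move=> ux uy; apply/eqP; rewrite -subr_eq0; apply/eqP/hn0_eq0/eqP.
rewrite eq_le hn_ge0 andbT; apply/ler_addgt0Pr => e e0; rewrite add0r.
have e2 : 0 < e / 2 by rewrite divr_gt0.
have [N hN] := (cvP u x).1 ux _ e2; have [M hM] := (cvP u y).1 uy _ e2.
have := hN _ (leq_maxl N M); have := hM _ (leq_maxr N M).
set n := maxn N M => h1 h2.
apply: (le_trans (hn_triangle _ (u n) _)); rewrite hnBC.
by apply: ltW; rewrite (splitr e) ltrD.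
Qed.

Lemma cv_unique_eq H (u v : nat -> H) x y : cv u x -> cv v y -> (forall n, u n = v n) -> x = y.
Proof. by move=> cu cv_ /funext uv; apply: (cv_unique cu); rewrite uv. Qed.

Lemma cvD H (u v : nat -> H) x y : cv u x -> cv v y -> cv (fun n => u n + v n) (x + y).
Proof.
move=> ux vy; apply: (@cv_squeeze _ _ _ (fun n => hn (u n - x) + hn (v n - y))).
  by move=> n; rewrite opprD addrACA hnD.
by rewrite -[0 : R]addr0; exact: cvgD.
Qed.

Lemma cvZ H (u : nat -> H) x c : cv u x -> cv (fun n => c *: u n) (c *: x).
Proof.
move=> ux; apply: (@cv_squeeze _ _ _ (fun n => cn c * hn (u n - x))).
  by move=> n; rewrite -scalerBr hnZ.
by rewrite -[0 : R](mulr0 (cn c)); exact: cvgMr.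
Qed.

Lemma cvN H (u : nat -> H) x : cv u x -> cv (fun n => - u n) (- x).
Proof. by move=> /(@cvZ _ _ _ (-1)); rewrite scaleN1r; under eq_fun do rewrite scaleN1r. Qed.

Lemma cvB H (u v : nat -> H) x y : cv u x -> cv v y -> cv (fun n => u n - v n) (x - y).
Proof. by move=> ux /cvN; exact: cvD. Qed.

Lemma cv_subseq H (u : nat -> H) x (f : nat -> nat) : (forall n, (n <= f n)%N) ->
  cv u x -> cv (fun n => u (f n)) x.
Proof.
move=> hf /cvP ux; apply/cvP => e /ux [N hN]; exists N => n nN.
by apply: hN; apply: leq_trans (hf n).
Qed.

Lemma cv_hn H (u : nat -> H) x : cv u x -> (fun n => hn (u n)) @ \oo --> hn x.
Proof.
move=> ux; apply/subr_cvg0/rcvg0P => e e0; have [N hN] := (cvP u x).1 ux _ e0.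
exists N => n /hN; apply: le_lt_trans; rewrite ler_norml lerBrDl lerBlDr.
apply/andP; split; last by rewrite lerBlDr -{1}(subrK x (u n)) hnD.
by rewrite hnBC addrC -{1}(subrK (u n) x) hnD.
Qed.

Lemma cv_ip_re H (u v : nat -> H) x y : cv u x -> cv v y ->
  (fun n => complex.Re <|u n, v n|>) @ \oo --> complex.Re <|x, y|>.
Proof.
move=> ux vy.
apply: (@rcvg_squeeze _ (fun n => hn (u n - x) * hn (v n) + hn x * hn (v n - y))).
  move=> n.
  have -> : complex.Re <|u n, v n|> - complex.Re <|x, y|> =
     complex.Re <|u n - x, v n|> + complex.Re <|x, v n - y|>.
    by rewrite ipBl ipBr !ReD !ReN; ring.
  apply: (le_trans (ler_normD _ _)); apply: lerD;
    exact: le_trans (Re_le_cn _) (ip_CS _ _).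
rewrite -[X in _ --> X]addr0; apply: cvgD.
  by rewrite -[X in _ --> X](mul0r (hn y)); apply: cvgM => //; exact: cv_hn.
by rewrite -[X in _ --> X](mulr0 (hn x)); exact: cvgMr.
Qed.

Lemma Im_ip H (x y : H) : complex.Im <|x, y|> = - complex.Re <|'i%C *: x, y|>.
Proof. by rewrite ipZl ReM /=; ring. Qed.

Lemma cv_ip_im H (u v : nat -> H) x y : cv u x -> cv v y ->
  (fun n => complex.Im <|u n, v n|>) @ \oo --> complex.Im <|x, y|>.
Proof.
move=> ux vy; rewrite Im_ip; under eq_fun do rewrite Im_ip.
by apply: cvgN; apply: cv_ip_re => //; exact: cvZ.
Qed.

(** Symmetry and adjoint relations known on truncated vectors are carried to their limits by
    this. *)
Lemma cv_ip_eq H K (u v : nat -> H) (u' v' : nat -> K) x y x' y' :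
  cv u x -> cv v y -> cv u' x' -> cv v' y' ->
  (forall n, <|u n, v n|> = <|u' n, v' n|>) -> <|x, y|> = <|x', y'|>.
Proof.
move=> ux vy ux' vy' h; apply: complex_eq.
  apply: (cvg_unique (@Rhausdorff R) (cv_ip_re ux vy)).
  by rewrite (_ : (fun n => _) = (fun n => complex.Re <|u' n, v' n|>)) ?funeqE => [|n];
    rewrite ?h //; exact: cv_ip_re.
apply: (cvg_unique (@Rhausdorff R) (cv_ip_im ux vy)).
by rewrite (_ : (fun n => _) = (fun n => complex.Im <|u' n, v' n|>)) ?funeqE => [|n];
  rewrite ?h //; exact: cv_ip_im.
Qed.

Lemma ball_hn H (x y : H) (e : R[i]) : ball x e y <-> (hn (x - y))%:C%C < e.
Proof. by rewrite -ball_normE /ball_ /= hnE. Qed.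

Lemma gt0_complex (e : R[i]) : 0 < e -> e = (complex.Re e)%:C%C /\ 0 < complex.Re e.
Proof. by case: e => a b; rewrite ltcE /= => /andP[/eqP -> ->]. Qed.

Lemma closureE H (A : set H) x : closure A x <->
  forall e : R, 0 < e -> exists y, A y /\ hn (y - x) < e.
Proof.
split=> [h e e0|h B /nbhs_ballP [e e0 eB]].
  have e0' : 0 < e%:C%C :> R[i] by rewrite ltcR.
  have [y [Ay]] := h (ball x e%:C%C) (nbhsx_ballx _ _ e0').
  by move=> /ball_hn; rewrite ltcR hnBC; exists y.
have [-> e0'] := gt0_complex e0; have [y [Ay yx]] := h _ e0'.
exists y; split=> //; apply: eB; apply/ball_hn.
by rewrite (gt0_complex e0).1 ltcR hnBC.
Qed.

Lemma closure2E H K (A : H ~> K) x y : closure A (x, y) <->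
  forall e : R, 0 < e -> exists a b, [/\ A (a, b), hn (a - x) < e & hn (b - y) < e].
Proof.
split=> [h e e0|h B /nbhs_ballP [e e0 eB]].
  have e0' : 0 < e%:C%C :> R[i] by rewrite ltcR.
  have [[a b] [Aab]] := h (ball (x, y) e%:C%C) (nbhsx_ballx _ _ e0').
  by move=> [/= /ball_hn + /ball_hn]; rewrite !ltcR ![hn (_ - a)]hnBC ![hn (_ - b)]hnBC; exists a, b.
have [-> e0'] := gt0_complex e0; have [a [b [Aab ax bx]]] := h _ e0'.
exists (a, b); split=> //; apply: eB; split; apply/ball_hn;
by rewrite (gt0_complex e0).1 ltcR hnBC.
Qed.

Lemma cv_closure H (A : set H) (u : nat -> H) x : (forall n, A (u n)) -> cv u x ->
  closure A x.
Proof.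
move=> hA /cvP ux; apply/closureE => e /ux [N hN].
by exists (u N); split=> //; exact: hN.
Qed.

Lemma closure_cv H (A : set H) x : closure A x ->
  exists2 u : nat -> H, (forall n, A (u n)) & cv u x.
Proof.
move=> /closureE h.
have /choice [u hu] : forall n : nat, exists y, A y /\ hn (y - x) < n.+1%:R^-1.
  by move=> n; apply: h; rewrite invr_gt0.
exists u => [n|]; first by case: (hu n).
apply: cv_squeeze (@cvg_harmonic R) => n; rewrite /harmonic.
by apply: ltW; case: (hu n).
Qed.

Lemma cv_closure2 H K (A : H ~> K) (u : nat -> H) (v : nat -> K) x y :
  (forall n, A (u n, v n)) -> cv u x -> cv v y -> closure A (x, y).
Proof.
move=> hA /cvP ux /cvP vy; apply/closure2E => e e0.
have [N hN] := ux _ e0; have [M hM] := vy _ e0.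
exists (u (maxn N M)), (v (maxn N M)); split=> //.
  by apply: hN; rewrite leq_maxl.
by apply: hM; rewrite leq_maxr.
Qed.

Lemma closure2_cv H K (A : H ~> K) x y : closure A (x, y) ->
  exists (u : nat -> H) (v : nat -> K), [/\ forall n, A (u n, v n), cv u x & cv v y].
Proof.
move=> /closure2E h.
have /choice [u hu] : forall n : nat, exists p, [/\ A p, hn (p.1 - x) < n.+1%:R^-1
    & hn (p.2 - y) < n.+1%:R^-1].
  move=> n; have [|a [b [? ? ?]]] := h n.+1%:R^-1; first by rewrite invr_gt0.
  by exists (a, b).
exists (fun n => (u n).1), (fun n => (u n).2); split=> [n||].
- by rewrite -surjective_pairing; case: (hu n).
- by apply: cv_squeeze (@cvg_harmonic R) => n; apply: ltW; case: (hu n).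
- by apply: cv_squeeze (@cvg_harmonic R) => n; apply: ltW; case: (hu n).
Qed.

Lemma closure_closed2 H K (A : H ~> K) (u : nat -> H) (v : nat -> K) x y :
  (forall n, closure A (u n, v n)) -> cv u x -> cv v y -> closure A (x, y).
Proof.
move=> hA ux vy.
rewrite [closure A](closure_id (closure A)).1; last exact: closed_closure.
exact: cv_closure2 ux vy.
Qed.

Lemma hilbert_complete H (u : nat -> H) :
  (forall e : R, 0 < e -> exists N, forall m n, (N <= m)%N -> (N <= n)%N ->
     hn (u m - u n) < e) -> exists x, cv u x.
Proof.
move=> h; have /cauchy_cvgP : cauchy (u @ \oo).
  apply/cauchy_ballP => e e0; have [ee e0'] := gt0_complex e0.
  have [N hN] := h _ e0'.
  exists ([set u n | n in [set n | (N <= n)%N]], [set u n | n in [set n | (N <= n)%N]]) => /=.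
    by split; exists N => // n /= Nn; exists n.
  by case=> _ _ [/= [m Nm <-] [n Nn <-]]; apply/ball_hn; rewrite ee ltcR hN.
move=> /cvg_ex [x ux]; exists x; apply/cvP => e e0.
have e0' : 0 < e%:C%C :> R[i] by rewrite ltcR.
have [N _ hN] := cvgr_dist_lt _ _ ux _ e0'.
by exists N => n /hN /=; rewrite hnE ltcR hnBC.
Qed.

End Convergence.

(** * Bounded operators, projections onto closed subspaces, adjoints *)

Section BoundedOps.
Variable R : realType.
Implicit Types H K L : hilbert R.

Definition bdd H K (a : H -> K) (c : R) := forall x, hn (a x) <= c * hn x.

Section Lin.
Variables (H K : hilbert R) (a : H -> K).
Hypothesis la : linear a.
Lemma lin_D x y : a (x + y) = a x + a y.
Proof. by rewrite -[x]scale1r la !scale1r. Qed.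

Lemma lin_0 : a 0 = 0.
Proof. by have /eqP := lin_D 0 0; rewrite addr0 eq_sym -subr_eq0 addrK => /eqP. Qed.

Lemma lin_Z c x : a (c *: x) = c *: a x.
Proof. by rewrite -[c *: x]addr0 la lin_0 addr0. Qed.

Lemma lin_N x : a (- x) = - a x.
Proof. by rewrite -scaleN1r lin_Z scaleN1r. Qed.

Lemma lin_B x y : a (x - y) = a x - a y.
Proof. by rewrite lin_D lin_N. Qed.

End Lin.

Lemma lin_comp H K L (a : K -> L) (b : H -> K) : linear a -> linear b -> linear (a \o b).
Proof. by move=> la lb c x y; rewrite /= lb la. Qed.

Lemma bounded_opP H K (a : H -> K) :
  bounded_op a <-> linear a /\ exists2 c, 0 <= c & bdd a c.
Proof.
split=> [[la ca]|[la [c c0 hc]]]; split=> //.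
  have : \forall z \near nbhs (0 : H), ball (a 0) 1 (a z) by apply: ca; exact: nbhsx_ballx.
  move=> /nbhs_ballP [e e0 he]; have [ee e0'] := gt0_complex e0.
  exists (2 / complex.Re e); first by rewrite divr_ge0 // ltW.
  move=> x; have [->|x0] := eqVneq x 0; first by rewrite lin_0 // !hn0 mulr0.
  have hx : 0 < hn x.
    by rewrite lt0r hn_ge0 andbT; apply/eqP => /hn0_eq0 /eqP; apply/negP.
  (* Rescales [x] to half the radius within which [a] stays in the unit ball. *)
  pose t := complex.Re e / (2 * hn x).
  have t0 : 0 < t by rewrite divr_gt0 // mulr_gt0.
  have := he (t%:C%C *: x); rewrite /= => /(_ _).
  rewrite lin_Z // lin_0 // => h.
  have : ball (0 : K) (1 : R[i]) (t%:C%C *: a x).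
    apply: h; apply/ball_hn; rewrite ee ltcR sub0r hnN hnZ cn_real gtr0_norm // /t.
    have -> : complex.Re e / (2 * hn x) * hn x = complex.Re e / 2 by field; rewrite gt_eqF.
    by lra.
  move=> /ball_hn; rewrite sub0r hnN hnZ cn_real gtr0_norm //.
  rewrite -[1 : R[i]]/(1%:C%C) ltcR /t => h2.
  have : complex.Re e / (2 * hn x) * hn (a x) * (2 * hn x / complex.Re e) <
    2 * hn x / complex.Re e.
    by rewrite gtr_pMl // divr_gt0 // mulr_gt0.
  have -> : complex.Re e / (2 * hn x) * hn (a x) * (2 * hn x / complex.Re e) = hn (a x).
    by field; rewrite !gt_eqF.
  by move=> /ltW; rewrite mulrAC.
move=> x; apply/cvgrPdist_lt => e e0; have [ee e0'] := gt0_complex e0.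
near=> y; rewrite -lin_B // hnE ee ltcR.
apply: (le_lt_trans (hc _)).
apply: (@le_lt_trans _ _ ((c + 1) * hn (x - y))).
  by rewrite ler_wpM2r ?hn_ge0 // lerDl.
rewrite -ltr_pdivlMl ?ltr_wpDl // mulrC -ltcR -hnE.
near: y; apply: cvgr_dist_lt => //.
by rewrite ltcR divr_gt0 // ltr_wpDl.
Unshelve. all: by end_near.
Qed.

Lemma bop_lin H K (a : H -> K) : bounded_op a -> linear a.
Proof. by case. Qed.

Lemma bop_bdd H K (a : H -> K) : bounded_op a -> exists2 c, 0 <= c & bdd a c.
Proof. by move=> /bounded_opP []. Qed.

Lemma bop_intro H K (a : H -> K) c : linear a -> bdd a c -> bounded_op a.
Proof.
move=> la ha; apply/bounded_opP; split=> //; exists `|c|; first exact: normr_ge0.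
by move=> x; apply: (le_trans (ha x)); rewrite ler_wpM2r ?hn_ge0 // ler_norm.
Qed.

Lemma bop_id H : bounded_op (id : H -> H).
Proof. by apply: (@bop_intro _ _ _ 1) => // x; rewrite mul1r. Qed.

Lemma bop_0 H K : bounded_op (0 : H -> K).
Proof.
apply: (@bop_intro _ _ _ 0) => [c x y|x]; first by rewrite /= scaler0 addr0.
by rewrite mul0r hn0.
Qed.

Lemma bop_comp H K L (a : K -> L) (b : H -> K) : bounded_op a -> bounded_op b ->
  bounded_op (a \o b).
Proof.
move=> /bounded_opP [la [c c0 hc]] /bounded_opP [lb [d d0 hd]].
apply: (@bop_intro _ _ _ (c * d)); first exact: lin_comp.
by move=> x; apply: (le_trans (hc _)); rewrite -mulrA ler_wpM2l.
Qed.

Lemma bop_lincomb H K (c : R[i]) (a b : H -> K) : bounded_op a -> bounded_op b ->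
  bounded_op (c *: a + b).
Proof.
move=> /bounded_opP [la [k k0 hk]] /bounded_opP [lb [d d0 hd]].
apply: (@bop_intro _ _ _ (cn c * k + d)).
  have E z : (c *: a + b) z = c *: a z + b z by [].
  by move=> e x y; rewrite !E la lb !scalerDr !scalerA [c * e]mulrC addrACA.
move=> x; apply: (le_trans (hnD _ _)); rewrite hnZ mulrDl lerD //.
by rewrite -mulrA ler_wpM2l ?cn_ge0.
Qed.

Lemma bop_D H K (a b : H -> K) : bounded_op a -> bounded_op b -> bounded_op (a + b).
Proof. by move=> /(@bop_lincomb _ _ 1 a b); rewrite scale1r. Qed.

Lemma bop_Z H K c (a : H -> K) : bounded_op a -> bounded_op (c *: a).
Proof. by move=> ha; rewrite -[c *: a]addr0; exact: bop_lincomb (bop_0 H K). Qed.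

Lemma bop_B H K (a b : H -> K) : bounded_op a -> bounded_op b -> bounded_op (a - b).
Proof. by move=> ha hb; rewrite addrC -scaleN1r; exact: bop_lincomb. Qed.

Lemma bop_cv H K (a : H -> K) (u : nat -> H) x : bounded_op a -> cv u x ->
  cv (fun n => a (u n)) (a x).
Proof.
move=> /bounded_opP [la [c c0 hc]] ux.
apply: (@cv_squeeze _ _ _ _ (fun n => c * hn (u n - x))).
  by move=> n; rewrite -lin_B.
by rewrite -[X in _ --> X](mulr0 c); exact: cvgMr.
Qed.

Definition subspace H (V : set H) := V 0 /\ forall c x y, V x -> V y -> V (c *: x + y).
Definition seq_closed H (V : set H) := forall u x, (forall n, V (u n)) -> cv u x -> V x.

Lemma subspaceB H (V : set H) x y : subspace V -> V x -> V y -> V (x - y).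
Proof. by move=> [_ hV] Vx Vy; rewrite addrC -scaleN1r; exact: hV. Qed.

Lemma subspaceZ H (V : set H) c x : subspace V -> V x -> V (c *: x).
Proof. by move=> [V0 hV] Vx; rewrite -[_ *: _]addr0; exact: hV. Qed.

Lemma subspaceD H (V : set H) x y : subspace V -> V x -> V y -> V (x + y).
Proof. by move=> [_ hV] Vx Vy; rewrite -[x]scale1r; exact: hV. Qed.

Lemma parallelogram H (x y : H) :
  hn (x + y) ^+ 2 + hn (x - y) ^+ 2 = 2 * (hn x ^+ 2 + hn y ^+ 2).
Proof. rewrite hnD2 hnB2; ring. Qed.

(** A sequence minimizing the distance to [V] is Cauchy by the parallelogram identity; minimality at
    its limit [y] forces [x - y] to be orthogonal to [V]. *)
Lemma projection_theorem H (V : set H) (x : H) : subspace V -> seq_closed V ->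
  exists2 y, V y & forall v, V v -> <|x - y, v|> = 0.
Proof.
move=> sV cV; pose D : set R := [set hn (x - v) ^+ 2 | v in V].
have D0 : D !=set0 by exists (hn (x - 0) ^+ 2); exists 0 => //; case: sV.
have Dlb : has_lbound D by exists 0 => _ [v _ <-]; exact: sqr_ge0.
have Dinf : has_inf D by [].
set d := inf D.
have dle v : V v -> d <= hn (x - v) ^+ 2 by move=> Vv; apply: ge_inf => //; exists v.
have /choice [u hu] : forall n : nat, exists v, V v /\ hn (x - v) ^+ 2 < d + n.+1%:R^-1.
  move=> n; have n0 : 0 < (n.+1%:R^-1 : R) by rewrite invr_gt0.
  by have [_ [v Vv <-] h] := inf_adherent n0 Dinf; exists v.
have est m n : hn (u m - u n) ^+ 2 <= 2 * (m.+1%:R^-1 + n.+1%:R^-1).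
  have [Vm hm] := hu m; have [Vn hn'] := hu n.
  have := parallelogram (x - u m) (x - u n).
  have -> : x - u m - (x - u n) = - (u m - u n) by rewrite opprB addrC addrA subrK opprB.
  rewrite hnN.
  (* The midpoint of two near minimizers is in [V], so its squared distance to [x] is again at least
     [d]. *)
  have Vmid : V ((2^-1 : R[i]) *: (u m + u n)) by apply: subspaceZ => //; exact: subspaceD.
  have -> : x - u m + (x - u n) = 2%:R *: (x - (2^-1 : R[i]) *: (u m + u n)).
    rewrite scalerBr scalerA mulfV ?pnatr_eq0 // scale1r scaler_nat mulr2n.
    by rewrite addrACA -opprD.
  rewrite hnZ -[2%:R : R[i]]/(2%:R) (_ : cn (2 : R[i]) = 2); last first.
    by rewrite /cn normr_nat.
  have h1 := dle _ Vmid; rewrite exprMn => h2; move: hm hn' h1 h2.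
  move: (hn (x - u m) ^+ 2) (hn (x - u n) ^+ 2) (hn (u m - u n) ^+ 2) => A B U.
  by move: (hn _ ^+ 2) (m.+1%:R^-1) (n.+1%:R^-1) => W p q ? ? ? ?; lra.
have [y uy] : exists y, cv u y.
  apply: hilbert_complete => e e0.
  have e4 : 0 < e ^+ 2 / 4 by rewrite divr_gt0 // exprn_gt0.
  have [N hN] := (rcvg0P (@harmonic R)).1 (@cvg_harmonic R) _ e4.
  exists N => m n mN nN; have := est m n.
  have := hN m mN; have := hN n nN; rewrite /harmonic !ger0_norm ?invr_ge0 // => h1 h2 h3.
  rewrite -ltr_sqr ?nnegrE ?hn_ge0 ?(ltW e0) //; move: h1 h2 h3 => /=.
  by move: (hn _ ^+ 2) (m.+1%:R^-1) (n.+1%:R^-1) => W p q ? ? ?; lra.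
have Vy : V y by apply: cV uy => n; case: (hu n).
have hy : hn (x - y) ^+ 2 <= d.
  apply/ler_addgt0Pr => e e0.
  have c1 : (fun n => hn (x - u n) ^+ 2) @ \oo --> hn (x - y) ^+ 2.
    have c0 : (fun n => hn (x - u n)) @ \oo --> hn (x - y).
      by apply: cv_hn; apply: cvB => //; exact: cv_cst.
    by rewrite expr2; under eq_fun do rewrite expr2; exact: cvgM.
  have c2 : (fun n : nat => d + n.+1%:R^-1) @ \oo --> d.
    by rewrite -[X in _ --> X]addr0; apply: cvgD; [exact: cvg_cst|exact: cvg_harmonic].
  apply: (@le_trans _ _ d); last by rewrite lerDl ltW.
  apply: (ler_cvg_to c1 c2); apply: nearW => n; by apply: ltW; case: (hu n).
exists y => // v Vv.
have key (w : H) : V w -> complex.Re <|x - y, w|> <= 0.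
  move=> Vw; rewrite leNgt; apply/negP => r0; set r := complex.Re _ in r0.
  have w0 : 0 < hn w ^+ 2.
    rewrite lt0r sqr_ge0 andbT sqrf_eq0; apply/eqP => /hn0_eq0 w0.
    by move: r0; rewrite /r w0 ip0r ltxx.
  (* If [r > 0], moving [y] by [t w] lowers the squared distance by [t r], below the infimum. *)
  pose t := r / hn w ^+ 2.
  have := dle (y + t%:C%C *: w).
  have -> : x - (y + t%:C%C *: w) = x - y - t%:C%C *: w by rewrite opprD addrA.
  rewrite hnB2 ipZr ReM ReC ImC /= oppr0 mul0r subr0 -/r hnZ cn_real exprMn.
  rewrite real_normK ?num_real // =>  h0.
  have h := h0 (subspaceD sV Vy (subspaceZ _ sV Vw)).
  have : t * r > 0 by rewrite mulr_gt0 // divr_gt0.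
  have tw : t * hn w ^+ 2 = r by rewrite /t divfK // gt_eqF.
  have : t ^+ 2 * hn w ^+ 2 = t * r by rewrite expr2 -mulrA tw.
  by move: h hy; rewrite (mulrC t) => ? ? ? ?; lra.
have key0 (w : H) : V w -> complex.Re <|x - y, w|> = 0.
  move=> Vw; apply/eqP; rewrite eq_le key //=.
  have := key (- w); rewrite ipNr ReN oppr_le0; apply.
  by rewrite -scaleN1r; exact: subspaceZ.
apply: complex_eq; rewrite /= ?key0 //.
by rewrite Im_ip ipZl -['i%C]conjcK; rewrite -[X in X * _]/(('i%C^*)^*) -ipZr key0 ?oppr0 //; exact: subspaceZ.
Qed.

Lemma dense_orth H (V : set H) x : closure V = setT ->
  (forall v, V v -> <|x, v|> = 0) -> x = 0.
Proof.
move=> dV h; have : closure V x by rewrite dV.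
move=> /closure_cv [u Vu ux]; apply: hn0_eq0; apply/eqP; rewrite -sqrf_eq0 hn2E.
suff -> : <|x, x|> = <|(0 : H), 0|> by rewrite ip0l.
apply: (cv_ip_eq (cv_cst x) ux (cv_cst 0) (cv_cst 0)) => n.
by rewrite h // ip0l.
Qed.

(** The functional is determined by one vector orthogonal to its kernel, namely [x0] minus its
    projection; the representing vector is a multiple of it. *)
Lemma riesz H (f : H -> R[i]) (c : R) : (forall k x y, f (k *: x + y) = k * f x + f y) ->
  (forall x, cn (f x) <= c * hn x) -> exists z, forall x, f x = <|x, z|>.
Proof.
move=> lf bf.
have fD x y : f (x + y) = f x + f y by rewrite -[x]scale1r lf scale1r mul1r.
have f0 : f 0 = 0 by have /eqP := fD 0 0; rewrite addr0 eq_sym -subr_eq0 addrK => /eqP.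
have fZ k x : f (k *: x) = k * f x by rewrite -[k *: x]addr0 lf f0 addr0.
have fN x : f (- x) = - f x by rewrite -scaleN1r fZ mulN1r.
have [[x0 fx0]|h0] := pselect (exists x, f x <> 0); last first.
  exists 0 => x; rewrite ip0r; apply/eqP/negPn/negP => /eqP h; apply: h0; by exists x.
pose V : set H := [set x | f x = 0].
have [||y Vy hy] := @projection_theorem _ V x0.
- by split=> // k x y; rewrite /V /= lf => -> ->; rewrite mulr0 addr0.
- move=> u x hu ux; rewrite /V /=; apply: cn0_eq0; apply/eqP.
  rewrite eq_le cn_ge0 andbT; apply/ler_addgt0Pr => e e0; rewrite add0r.
  have c1 : 0 < `|c| + 1 by rewrite ltr_wpDl.
  have [N hN] := (cvP u x).1 ux _ (divr_gt0 e0 c1).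
  have -> : f x = - f (u N - x).
    by rewrite fD fN (hu N) add0r opprK.
  rewrite cnN; apply: (le_trans (bf _)).
  apply: (@le_trans _ _ ((`|c| + 1) * hn (u N - x))).
    by rewrite ler_wpM2r ?hn_ge0 // (le_trans (ler_norm c)) // lerDl.
  by rewrite -ler_pdivlMl // mulrC ltW // hN.
set w := x0 - y.
have fw : f w = f x0 by rewrite /w fD fN Vy oppr0 addr0.
have w0 : hn w ^+ 2 != 0.
  rewrite sqrf_eq0; apply/eqP => /hn0_eq0 w0; apply: fx0; by rewrite -fw w0 f0.
exists ((f w / (hn w ^+ 2)%:C%C)^* *: w) => x.
rewrite ipZr conjCK.
have hz : V (x - (f x / f w) *: w).
  rewrite /V /= fD fN fZ divfK ?subrr //.
  by rewrite fw; apply/eqP.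
have := hy _ hz; rewrite -/w ipBr ipZr ipxx => /eqP; rewrite subr_eq0 => /eqP e.
rewrite [<|x, w|>]ipC e [X in _ = _ * X]conjM conjK conj_realC.
have fw0 : f w != 0 by rewrite fw; apply/eqP.
have r0 : (hn w ^+ 2)%:C%C != 0 :> R[i] by apply/eqP => - [] /eqP; apply/negP.
by move: r0; move: (_%:C%C) => r r0; field; rewrite r0 fw0.
Qed.

Lemma adj_uniq H K (a : H -> K) (b : K -> H) : bounded_op b ->
  (forall x y, <|a x, y|> = <|x, b y|>) -> adj a = b.
Proof.
move=> hb h; rewrite /adj; case: xgetP => [d -> [_ hd]|/(_ b)]; last by case.
apply/funext => y; apply/ip_inj => z; rewrite ipC -hd h -ipC //.
Qed.

Lemma adj_spec H K (a : H -> K) : bounded_op a ->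
  bounded_op (adj a) /\ forall x y, <|a x, y|> = <|x, adj a y|>.
Proof.
move=> ha; have [la [c c0 hc]] := (bounded_opP a).1 ha.
have /choice [b hb] : forall y, exists z, forall x, <|a x, y|> = <|x, z|>.
  move=> y; apply: (@riesz _ (fun x => <|a x, y|>) (c * hn y)).
    by move=> k x z; rewrite la ipDl ipZl.
  move=> x; apply: (le_trans (ip_CS _ _)).
  by rewrite mulrAC ler_wpM2r ?hn_ge0.
have bb : bounded_op b.
  apply: (@bop_intro _ _ _ c).
    move=> k x y; apply: ip_inj => z; rewrite ipC -hb.
    by rewrite ipDr ipZr !hb -ipZr -ipDr -ipC.
  move=> y; have [->|by0] := eqVneq (b y) 0; first by rewrite hn0 mulr_ge0 ?hn_ge0.
  have h0 : 0 < hn (b y).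
    by rewrite lt0r hn_ge0 andbT; apply/eqP => /hn0_eq0 /eqP; apply/negP.
  rewrite -(ler_pM2l h0) -expr2 hn2E -hb.
  apply: (le_trans (Re_ip_le _ _)); rewrite mulrA ler_wpM2r ?hn_ge0 //.
  by rewrite mulrC.
by rewrite (adj_uniq bb (fun x y => hb y x)); split=> // x y; exact: hb.
Qed.

Lemma bop_adj H K (a : H -> K) : bounded_op a -> bounded_op (adj a).
Proof. by move=> /adj_spec []. Qed.

Lemma adjP H K (a : H -> K) x y : bounded_op a -> <|a x, y|> = <|x, adj a y|>.
Proof. by move=> /adj_spec [_]; apply. Qed.

Lemma adjP' H K (a : H -> K) x y : bounded_op a -> <|adj a x, y|> = <|x, a y|>.
Proof. by move=> ha; rewrite ipC -adjP // -ipC. Qed.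

Lemma adjK H K (a : H -> K) : bounded_op a -> adj (adj a) = a.
Proof. by move=> ha; apply: adj_uniq => // x y; exact: adjP'. Qed.

Lemma adj_comp H K L (a : K -> L) (b : H -> K) : bounded_op a -> bounded_op b ->
  adj (a \o b) = adj b \o adj a.
Proof.
move=> ha hb; apply: adj_uniq => [|x y]; first by apply: bop_comp; exact: bop_adj.
by rewrite /= adjP // adjP.
Qed.

Lemma adj_lincomb H K c (a b : H -> K) : bounded_op a -> bounded_op b ->
  adj (c *: a + b) = c^* *: adj a + adj b.
Proof.
move=> ha hb; apply: adj_uniq => [|x y]; first by apply: bop_lincomb; exact: bop_adj.
rewrite /= /GRing.add /= /GRing.scale /= ipDl ipDr ipZl ipZr conjCK adjP // adjP //.
Qed.

Lemma adj_id H : adj (id : H -> H) = id.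
Proof. by apply: adj_uniq => //; exact: bop_id. Qed.

Lemma adj0 H K : adj (0 : H -> K) = 0.
Proof. by apply: adj_uniq => [|x y]; [exact: bop_0 | rewrite ip0l ip0r]. Qed.

(** Coercivity bounds [a] from below, so its range is closed; a [z] orthogonal to the range has
    [<|a z, z|> = 0], hence [z = 0]. The resolvents and Cayley transforms below are produced this
    way. *)
Lemma lax_milgram H (a : op H) : bounded_op a ->
  (forall x, hn x ^+ 2 <= complex.Re <|a x, x|>) ->
  exists b, [/\ bounded_op b, a \o b = id, b \o a = id & bdd b 1].
Proof.
move=> ha pa; have la := bop_lin ha.
have lower x : hn x <= hn (a x).
  have [->|x0] := eqVneq x 0; first by rewrite hn0 hn_ge0.
  have h0 : 0 < hn x.
    by rewrite lt0r hn_ge0 andbT; apply/eqP => /hn0_eq0 /eqP; apply/negP.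
  rewrite -(ler_pM2r h0) -expr2; apply: (le_trans (pa x)); exact: Re_ip_le.
have surj y : exists x, a x = y.
  have [||_ [x _ <-] hx] := @projection_theorem _ (range a) y.
  - split; first by exists 0; rewrite ?lin_0.
    by move=> c _ _ [x _ <-] [z _ <-]; exists (c *: x + z); rewrite ?la.
  - move=> u z hu uz; have /choice [v hv] : forall n, exists x, a x = u n.
      by move=> n; have [x _ <-] := hu n; exists x.
    have [w vw] : exists w, cv v w.
      apply: hilbert_complete => e e0.
      have [N hN] := (cvP u z).1 uz _ (divr_gt0 e0 (ltr0n R 2)).
      exists N => m n mN nN; apply: (le_lt_trans (lower _)); rewrite lin_B // !hv.
      apply: (le_lt_trans (hn_triangle _ z _)); rewrite [hn (z - _)]hnBC (splitr e).
      by rewrite ltrD ?hN.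
    exists w => //; apply: (cv_unique (bop_cv ha vw)).
    by under eq_fun do rewrite hv.
  - exists x; apply/eqP; rewrite eq_sym -subr_eq0; set z := y - a x.
    have := hx (a z) (ex_intro2 _ _ z I erefl); rewrite -/z => e.
    have := pa z; rewrite ipC e conjC0 /= => h.
    apply/eqP/hn0_eq0/eqP; rewrite -sqrf_eq0 eq_le sqr_ge0 andbT //.
have /choice [b hb] := surj.
have ainj x y : a x = a y -> x = y.
  move=> e; apply/eqP; rewrite -subr_eq0; apply/eqP/hn0_eq0/eqP.
  by rewrite eq_le hn_ge0 andbT (le_trans (lower _)) // lin_B // e subrr hn0.
have bb : bdd b 1 by move=> x; rewrite mul1r (le_trans (lower _)) // hb.
have lb : linear b by move=> c x y; apply: ainj; rewrite la !hb.
exists b; split=> //; first exact: bop_intro bb.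
- by apply/funext => x /=; rewrite hb.
- by apply/funext => x /=; apply: ainj; rewrite hb.
Qed.

End BoundedOps.

(** * Positive operators, monotone limits and resolvents *)

Section PositiveOps.
Variable R : realType.
Implicit Types H : hilbert R.

Definition qf H (a : op H) (x : H) : R := complex.Re <|a x, x|>.

Lemma pos_qf H (a : op H) x : positive_op a -> 0 <= qf a x.
Proof. by move=> /(_ x) /complex_ge0P []. Qed.

Lemma pos_ip H (a : op H) x : positive_op a -> <|a x, x|> = (qf a x)%:C%C.
Proof. by move=> /(_ x) /complex_ge0P [h _]; apply: complex_eq. Qed.

Lemma pos_selfadj H (a : op H) : bounded_op a -> positive_op a -> adj a = a.
Proof.
move=> ha pa; apply: op_eq_form => [||x].
- exact: bop_lin (bop_adj ha).
- exact: bop_lin ha.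
by rewrite adjP' // ipC pos_ip // conj_realC.
Qed.

Lemma selfadj_ip H (a : op H) x : bounded_op a -> adj a = a ->
  <|a x, x|> = (qf a x)%:C%C.
Proof.
move=> ha sa; have : <|a x, x|> = <|a x, x|>^* by rewrite -ipC -{2}sa adjP.
rewrite /qf; case: (<|a x, x|>) => u v [] /eqP; rewrite -addr_eq0 -mulr2n mulrn_eq0 /=.
by move=> /eqP ->.
Qed.

Lemma positiveP H (a : op H) : bounded_op a -> adj a = a -> (forall x, 0 <= qf a x) ->
  positive_op a.
Proof. by move=> ha sa h x; rewrite selfadj_ip // realC_ge0. Qed.

Lemma qfB H (a b : op H) x : qf (a - b) x = qf a x - qf b x.
Proof. by rewrite /qf -[(a - b) x]/(a x - b x) ipBl ReD ReN. Qed.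

Lemma qfD H (a b : op H) x : qf (a + b) x = qf a x + qf b x.
Proof. by rewrite /qf -[(a + b) x]/(a x + b x) ipDl ReD. Qed.

Lemma qf_id H (x : H) : qf id x = hn x ^+ 2.
Proof. by rewrite hn2E. Qed.

Lemma qfZ H (r : R) (a : op H) x : qf (r%:C%C *: a) x = r * qf a x.
Proof. by rewrite /qf -[(_ *: a) x]/(_ *: a x) ipZl ReM /= mul0r subr0. Qed.

Lemma adj_B H (a b : op H) : bounded_op a -> bounded_op b -> adj (a - b) = adj a - adj b.
Proof.
by move=> ha hb; rewrite addrC -scaleN1r adj_lincomb // rmorphN1 scaleN1r addrC.
Qed.

Lemma adj_D H (a b : op H) : bounded_op a -> bounded_op b -> adj (a + b) = adj a + adj b.
Proof. by move=> ha hb; rewrite -[a]scale1r adj_lincomb // conjC1 !scale1r. Qed.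

Lemma adj_Z H c (a : op H) : bounded_op a -> adj (c *: a) = c^* *: adj a.
Proof.
by move=> ha; rewrite -[c *: a]addr0 adj_lincomb ?adj0 ?addr0 //; exact: bop_0.
Qed.

Lemma op_leP H (a b : op H) : bounded_op a -> bounded_op b -> adj a = a -> adj b = b ->
  op_le a b <-> forall x, qf a x <= qf b x.
Proof.
move=> ha hb sa sb; split=> [h x|h].
  by rewrite -subr_ge0 -qfB; exact: pos_qf.
apply: positiveP; first exact: bop_B.
  by rewrite adj_B // sa sb.
by move=> x; rewrite qfB subr_ge0.
Qed.

Lemma op_le_qf H (a b : op H) x : op_le a b -> qf a x <= qf b x.
Proof. by move=> h; rewrite -subr_ge0 -qfB; exact: pos_qf. Qed.

Lemma pos_adj_comp H (a : op H) : bounded_op a -> positive_op (adj a \o a).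
Proof. by move=> ha x; rewrite /= adjP' // ipxx realC_ge0 sqr_ge0. Qed.

Lemma qf_adj_comp H (a : op H) x : bounded_op a -> qf (adj a \o a) x = hn (a x) ^+ 2.
Proof. by move=> ha; rewrite /qf /= adjP' // -hn2E. Qed.

(** The operator inequality d^2 <= c d without square roots: the form of [d] is nonnegative at
    [x - c^-1 d x]. *)
Lemma pos_norm_le H (d : op H) c x : bounded_op d -> positive_op d -> 0 < c ->
  (forall y, qf d y <= c * hn y ^+ 2) -> hn (d x) ^+ 2 <= c * qf d x.
Proof.
move=> hd pd c0 hc; have sd := pos_selfadj hd pd; have ld := bop_lin hd.
have := pos_qf (x - (c^-1)%:C%C *: d x) pd.
have -> : qf d (x - (c^-1)%:C%C *: d x) =
    qf d x - 2 * c^-1 * hn (d x) ^+ 2 + c^-1 ^+ 2 * qf d (d x).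
  have e : <|d (d x), x|> = <|d x, d x|> by rewrite adjP // sd.
  rewrite /qf lin_B // lin_Z // !ipBl !ipBr !ipZl !ipZr e conj_realC.
  rewrite !(ReD, ReN, ReM) /= !mul0r !subr0 hn2E; ring.
move=> h; have := hc (d x); set A := hn (d x) ^+ 2 in h *.
have k0 : 0 < c^-1 ^+ 2 by rewrite exprn_gt0 // invr_gt0.
rewrite -(ler_pM2l k0) => h2.
have h3 : 0 <= qf d x - c^-1 * A.
  apply: (le_trans h); rewrite -lerBrDl.
  suff -> : qf d x - c^-1 * A - (qf d x - 2 * c^-1 * A) = c^-1 ^+ 2 * (c * A) by [].
  by field; rewrite gt_eqF.
by rewrite -ler_pdivrMl // -subr_ge0.
Qed.

(** Monotone bounded forms converge as real sequences; [pos_norm_le], applied to the differences,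
    upgrades this to Cauchy sequences of vectors. *)
Lemma vigier H (a : nat -> op H) c : (forall n, bounded_op (a n)) ->
  (forall n, positive_op (a n)) -> 0 < c ->
  (forall m n x, (m <= n)%N -> qf (a m) x <= qf (a n) x) ->
  (forall n x, qf (a n) x <= c * hn x ^+ 2) ->
  exists b, [/\ bounded_op b, positive_op b, (forall x, cv (a^~ x) (b x)) &
    forall n x, qf (a n) x <= qf b x].
Proof.
move=> ha pa c0 mono hc.
have sa n : adj (a n) = a n by apply: pos_selfadj.
have pd m n : (m <= n)%N -> positive_op (a n - a m).
  by move=> mn; apply/op_leP => // x; exact: mono.
have est m n x : (m <= n)%N -> hn (a n x - a m x) ^+ 2 <= c * (qf (a n) x - qf (a m) x).
  move=> mn; rewrite -qfB; apply: (@pos_norm_le _ (a n - a m)) => //.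
  - exact: bop_B.
  - exact: pd.
  - by move=> y; rewrite qfB; apply: le_trans (hc n y); rewrite gerBl; exact: pos_qf.
have cq x : cvgn (fun n => qf (a n) x).
  apply: nondecreasing_is_cvgn; first by move=> m n mn; exact: mono.
  by exists (c * hn x ^+ 2) => _ [n _ <-].
have /choice [b hb] : forall x, exists y, cv (a^~ x) y.
  move=> x; apply: hilbert_complete => e e0.
  set l := lim ((fun n => qf (a n) x) @ \oo).
  have c1 : 0 < e ^+ 2 / (2 * c) by rewrite divr_gt0 ?exprn_gt0 ?mulr_gt0.
  have [N _ hN] := cvgr_dist_lt _ _ (cq x) _ c1.
  have key m n : (N <= m)%N -> (m <= n)%N -> hn (a n x - a m x) < e.
    move=> Nm mn; rewrite -ltr_sqr ?nnegrE ?hn_ge0 ?(ltW e0) //.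
    apply: (le_lt_trans (est _ _ _ mn)); rewrite -ltr_pdivlMl //.
    have := hN m Nm; have := hN n (leq_trans Nm mn); rewrite /= -/l.
    rewrite !ltr_distl => /andP[h1 h2] /andP[h3 h4].
    have -> : c^-1 * e ^+ 2 = e ^+ 2 / (2 * c) + e ^+ 2 / (2 * c).
      by field; rewrite gt_eqF.
    lra.
  exists N => m n Nm Nn; have [mn|nm] := leqP m n; first by rewrite hnBC; exact: key.
  by apply: key => //; exact: ltnW.
have lb : linear b.
  move=> k x y; apply: (cv_unique (hb _)).
  under eq_fun do rewrite (bop_lin (ha _)).
  by apply: cvD => //; exact: cvZ.
have qb x : (fun n => qf (a n) x) @ \oo --> qf b x.
  by apply: cv_ip_re => //; exact: cv_cst.
have bb x : hn (b x) ^+ 2 <= c * (c * hn x ^+ 2).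
  have c1 : (fun n => hn (a n x) ^+ 2) @ \oo --> hn (b x) ^+ 2.
    by rewrite expr2; under eq_fun do rewrite expr2; apply: cvgM; exact: cv_hn.
  apply: (ler_cvg_to c1 (cvg_cst _)); apply: nearW => n.
  apply: (le_trans (pos_norm_le _ (ha n) (pa n) c0 (hc n))).
  by rewrite ler_pM2l.
have ub n x : qf (a n) x <= qf b x.
  apply: (ler_cvg_to (cvg_cst _) (qb x)); exists n => // m /= nm; exact: mono.
have bbop : bounded_op b.
  apply: (@bop_intro _ _ _ _ c) => // x.
  rewrite -ler_sqr ?nnegrE ?hn_ge0 ?mulr_ge0 ?hn_ge0 ?(ltW c0) //.
  by rewrite exprMn [c ^+ 2]expr2 -mulrA.
exists b; split=> //.
apply: positiveP => //.
  apply: adj_uniq => // x y.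
  apply: (cv_ip_eq (hb x) (cv_cst y) (cv_cst x) (hb y)) => n.
  by rewrite adjP // sa.
by move=> x; apply: le_trans (ub 0 x); exact: pos_qf.
Qed.

(* [res A] is (1 + A)^-1; the form of 1 - (1 + A)^-1 = A (1 + A)^-1 is
   x |-> min_y (|x - y|^2 + <A y, y>), whence its monotonicity in A *)
Definition res H (A : op H) : op H :=
  xget 0 [set b | [/\ bounded_op b, (id + A) \o b = id, b \o (id + A) = id & bdd b 1]].

Lemma resP H (A : op H) : bounded_op A -> positive_op A ->
  [/\ bounded_op (res A), forall x, res A x + A (res A x) = x,
      forall x, res A (x + A x) = x & bdd (res A) 1].
Proof.
move=> hA pA.
have [|b hb] := @lax_milgram _ _ (id + A) (bop_D (@bop_id _ H) hA).
  by move=> x; rewrite -/(qf _ _) qfD qf_id lerDl; exact: pos_qf.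
rewrite /res; case: xgetP => [d -> [bd e1 e2 d1]|/(_ b)]; last by [].
split=> // x; first by have := congr1 (fun f => f x) e1.
by have := congr1 (fun f => f x) e2.
Qed.

Section Res.
Variables (H : hilbert R) (A : op H).
Hypotheses (hA : bounded_op A) (pA : positive_op A).
Let ps := resP hA pA.

Lemma res_bop : bounded_op (res A). Proof. by case: ps. Qed.

Lemma resD x : res A x + A (res A x) = x. Proof. by case: ps. Qed.

Lemma resDr x : res A (x + A x) = x. Proof. by case: ps. Qed.

Lemma res_bdd x : hn (res A x) <= hn x.
Proof. by case: ps => _ _ _ /(_ x); rewrite mul1r. Qed.

Lemma res_sub x : x - res A x = A (res A x).
Proof. by rewrite -{1}(resD x) addrAC subrr add0r. Qed.

Lemma res_ip x y : <|res A x, y|> = <|x, res A y|>.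
Proof.
have sA := pos_selfadj hA pA.
rewrite -{1}(resD y) -{2}(resD x) ipDl ipDr; congr (_ + _).
by rewrite (adjP _ _ hA) sA.
Qed.

Lemma res_adj : adj (res A) = res A.
Proof. by apply: adj_uniq; [exact: res_bop | exact: res_ip]. Qed.

Lemma res_pos : positive_op (res A).
Proof.
apply: positiveP; [exact: res_bop|exact: res_adj|move=> x].
rewrite /qf -{2}(resD x) ipDr ReD -hn2E addr_ge0 ?sqr_ge0 //.
by rewrite ipC ReC -/(qf A _) pos_qf.
Qed.

Lemma res_min x y : qf (id - res A) x <= hn (x - y) ^+ 2 + qf A y.
Proof.
have sA := pos_selfadj hA pA; have lA := bop_lin hA.
set e := res A x; have ex : x = e + A e by rewrite resD.
have -> : qf (id - res A) x = hn (A e) ^+ 2 + qf A e.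
  rewrite /qf -[(id - res A) x]/(x - e) {1}ex addrAC subrr add0r {1}ex ipDr ReD.
  by rewrite -hn2E addrC.
(* Around the minimizer [e] the two sides differ by [|z|^2 + <A z, z>]. *)
have [z ->] : exists z, y = e + z by exists (y - e); rewrite addrC subrK.
have -> : x - (e + z) = A e - z by rewrite opprD addrA {1}ex [e + _]addrC addrK.
rewrite hnB2 /qf lin_D // !ipDl !ipDr !ReD.
have -> : <|A z, e|> = <|A e, z|>^* by rewrite adjP // sA -ipC.
rewrite ReC -subr_ge0.
set u := complex.Re <|A e, z|>; set v := complex.Re <|A e, e|>.
have -> : hn (A e) ^+ 2 - 2 * u + hn z ^+ 2 + (v + u + (u + complex.Re <|A z, z|>)) -
   (hn (A e) ^+ 2 + v) = hn z ^+ 2 + qf A z by rewrite /qf; ring.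
by rewrite addr_ge0 ?sqr_ge0 ?pos_qf.
Qed.

Lemma res_minE x : qf (id - res A) x = hn (x - res A x) ^+ 2 + qf A (res A x).
Proof.
rewrite res_sub /qf -[(id - res A) x]/(x - res A x) res_sub.
by rewrite -{2}(resD x) ipDr ReD -hn2E addrC.
Qed.

Lemma res_compl_bop : bounded_op (id - res A).
Proof. by apply: bop_B; [exact: bop_id|exact: res_bop]. Qed.

Lemma res_compl_adj : adj (id - res A) = id - res A.
Proof. by rewrite adj_B ?adj_id ?res_adj //; [exact: bop_id|exact: res_bop]. Qed.

Lemma res_compl_pos : positive_op (id - res A).
Proof.
apply: positiveP; [exact: res_compl_bop|exact: res_compl_adj|move=> x].
by rewrite res_minE addr_ge0 ?sqr_ge0 ?pos_qf.
Qed.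

Lemma res_compl_le x : qf (id - res A) x <= qf A x.
Proof. by have := res_min x x; rewrite subrr hn0 expr0n add0r. Qed.

Lemma res_compl_le1 x : qf (id - res A) x <= hn x ^+ 2.
Proof. by rewrite qfB qf_id gerBl pos_qf //; exact: res_pos. Qed.

End Res.

Lemma res_mono H (A B : op H) x : bounded_op A -> positive_op A ->
  bounded_op B -> positive_op B -> (forall y, qf A y <= qf B y) ->
  qf (id - res A) x <= qf (id - res B) x.
Proof.
move=> hA pA hB pB AB; rewrite (res_minE hB pB).
by apply: (le_trans (res_min hA pA x (res B x))); rewrite lerD2l.
Qed.

End PositiveOps.

(** * Von Neumann algebras and the unitaries of the commutant *)

Section VonNeumann.
Variables (R : realType) (H : hilbert R) (M : set (op H)).
Hypothesis HM : von_neumann M.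
Implicit Types a b c : op H.

Lemma vn_bop a : M a -> bounded_op a.
Proof. by case: HM => h _ _; exact: h. Qed.

Lemma vn_adj a : M a -> M (adj a).
Proof. by case: HM => _ h _; exact: h. Qed.

Lemma vn_mem b : bounded_op b -> (forall c, commutant M c -> c \o b = b \o c) -> M b.
Proof. by move=> hb h; case: HM => _ _ <-; split. Qed.

Lemma vn_comm a c : M a -> commutant M c -> c \o a = a \o c.
Proof. by move=> Ma [_ /(_ a Ma)]. Qed.

Lemma commutant_adj c : commutant M c -> commutant M (adj c).
Proof.
move=> [hc h]; split; first exact: bop_adj.
move=> a Ma; have ha := vn_bop Ma; have ha' := bop_adj ha.
have := congr1 (@adj _ _ _) (h _ (vn_adj Ma)).
by rewrite (adj_comp ha' hc) (adj_comp hc ha') (adjK ha).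
Qed.

Lemma vn_id : M id.
Proof. by apply: vn_mem => //; exact: bop_id. Qed.

Lemma vn_comp a b : M a -> M b -> M (a \o b).
Proof.
move=> Ma Mb; apply: vn_mem; first by apply: bop_comp; exact: vn_bop.
move=> c hc; apply/funext => x /=.
have := congr1 (fun f => f (b x)) (vn_comm Ma hc); rewrite /= => ->.
by have := congr1 (fun f => f x) (vn_comm Mb hc); rewrite /= => ->.
Qed.

Lemma vn_lincomb k a b : M a -> M b -> M (k *: a + b).
Proof.
move=> Ma Mb; apply: vn_mem; first by apply: bop_lincomb; exact: vn_bop.
move=> c hc; apply/funext => x /=.
have := congr1 (fun f => f x) (vn_comm Ma hc); rewrite /= => ea.
have := congr1 (fun f => f x) (vn_comm Mb hc); rewrite /= => eb.
have E z : (k *: a + b) z = k *: a z + b z by [].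
by rewrite !E (bop_lin hc.1) ea eb.
Qed.

Lemma vn_D a b : M a -> M b -> M (a + b).
Proof. by move=> Ma; rewrite -[a]scale1r; exact: vn_lincomb. Qed.

Lemma vn_0 : M 0.
Proof.
apply: vn_mem; first exact: bop_0.
by move=> c [hc _]; apply/funext => x /=; rewrite -[LHS]/(c 0) lin_0 //; exact: bop_lin.
Qed.

Lemma vn_Z k a : M a -> M (k *: a).
Proof. by move=> Ma; rewrite -[k *: a]addr0; apply: vn_lincomb => //; exact: vn_0. Qed.

Lemma vn_B a b : M a -> M b -> M (a - b).
Proof. by move=> Ma Mb; rewrite addrC -scaleN1r; exact: vn_lincomb. Qed.

Lemma vn_res a : M a -> positive_op a -> M (res a).
Proof.
move=> Ma pa; have ha := vn_bop Ma; have hr := res_bop ha pa.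
apply: vn_mem => // c hc; apply/funext => x /=.
have lc := bop_lin hc.1.
have e : c (res a x) + a (c (res a x)) = c x.
  have := congr1 (fun f => f (res a x)) (vn_comm Ma hc); rewrite /= => <-.
  by rewrite -lin_D // resD.
by rewrite -e resDr.
Qed.

Lemma vn_strong (a : nat -> op H) b : (forall n, M (a n)) -> bounded_op b ->
  (forall x, cv (a^~ x) (b x)) -> M b.
Proof.
move=> Ma hb ab; apply: vn_mem => // c hc; apply/funext => x /=.
apply: (cv_unique (bop_cv hc.1 (ab x))).
rewrite (_ : (fun n => _) = (fun n => a n (c x))); first exact: ab.
by apply/funext => n; have := congr1 (fun f => f x) (vn_comm (Ma n) hc).
Qed.

Lemma vn_adj_comp a : M a -> pos M (adj a \o a).
Proof.
move=> Ma; split; first by apply: vn_comp => //; exact: vn_adj.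
exact: pos_adj_comp (vn_bop Ma).
Qed.

Section Cayley.
Variable k : op H.
Hypotheses (Mk : commutant M k) (sk : adj k = k).
Let hk : bounded_op k. Proof. by case: Mk. Qed.

Let lk : linear k. Proof. exact: bop_lin. Qed.

Let kip x y : <|k x, y|> = <|x, k y|>. Proof. by rewrite adjP // sk. Qed.

(** For [k] selfadjoint and [z] imaginary the form of [1 + z k] has real part [|x|^2], so
    [lax_milgram] inverts it. *)
Lemma cayley_inv (z : R[i]) : complex.Re z = 0 -> exists r, [/\ bounded_op r,
  forall x, r x + z *: k (r x) = x, forall x, r (x + z *: k x) = x & commutant M r].
Proof.
move=> z0; have hb : bounded_op (id + z *: k) by apply: bop_D; [exact: bop_id|exact: bop_Z].
have [|r [hr e1 e2 _]] := lax_milgram hb.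
  move=> x; rewrite -/(qf _ _) qfD qf_id lerDl /qf -[(z *: k) x]/(z *: k x) ipZl.
  by rewrite selfadj_ip // ReM /= z0 mul0r mulr0 subr0.
have f1 x : r x + z *: k (r x) = x by have := congr1 (fun f => f x) e1.
have f2 x : r (x + z *: k x) = x by have := congr1 (fun f => f x) e2.
exists r; split=> //; split=> // m Mm; apply/funext => x /=.
have hm := vn_bop Mm; have lm := bop_lin hm.
rewrite -{2}(f1 x) lin_D // lin_Z //.
have := congr1 (fun f => f (r x)) (vn_comm Mm Mk); rewrite /= => <-.
by rewrite f2.
Qed.

(** A selfadjoint [k] is recovered from its Cayley transform [u = 2 (1 - i k)^-1 - 1], a unitary of
    the commutant; what commutes with [u] commutes with [k]. *)
Lemma cayley_comm e : bounded_op e ->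
  (forall u, commutant M u -> unitary u -> u \o e = e \o u) -> k \o e = e \o k.
Proof.
move=> he h; have le := bop_lin he.
have [|r [hr r1 r2 Mr]] := @cayley_inv (- 'i%C); first by rewrite /= oppr0.
have [|s [hs s1 s2 Ms]] := @cayley_inv 'i%C; first by [].
pose u := (2 : R[i]) *: r - id; pose v := (2 : R[i]) *: s - id.
have hu : bounded_op u by apply: bop_B; [exact: bop_Z|exact: bop_id].
have hv : bounded_op v by apply: bop_B; [exact: bop_Z|exact: bop_id].
have uE y : u (y - 'i%C *: k y) = y + 'i%C *: k y.
  rewrite -[LHS]/(2 *: r (y - 'i%C *: k y) - (y - 'i%C *: k y)) -scaleNr r2.
  by rewrite scaler_nat mulr2n scaleNr opprD opprK addrA addrK.
have vE y : v (y + 'i%C *: k y) = y - 'i%C *: k y.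
  rewrite -[LHS]/(2 *: s (y + 'i%C *: k y) - (y + 'i%C *: k y)) s2.
  by rewrite scaler_nat mulr2n opprD addrA addrK.
have rE x : exists y, x = y - 'i%C *: k y by exists (r x); rewrite -scaleNr r1.
have sE x : exists y, x = y + 'i%C *: k y by exists (s x); rewrite s1.
have uv x : u (v x) = x by have [y ->] := sE x; rewrite vE uE.
have vu x : v (u x) = x by have [y ->] := rE x; rewrite uE vE.
have uadj : adj u = v.
  apply: adj_uniq => // x z; have [y ->] := rE x; have [w ->] := sE z.
  rewrite uE vE !ipDl !ipDr !ipNl !ipNr !ipZl !ipZr kip.
  have -> : ('i%C : R[i])^* = - 'i%C by apply: complex_eq; rewrite /= ?oppr0.
  ring.
have Mu : commutant M u.
  split=> // m Mm; apply/funext => x /=.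
  have lm := bop_lin (vn_bop Mm).
  have := congr1 (fun f => f x) (vn_comm Mm Mr); rewrite /= => rm.
  by rewrite -[u (m x)]/(2 *: r (m x) - m x) -[u x]/(2 *: r x - x) lin_B // lin_Z // rm.
have Uu : unitary u.
  by split=> //; rewrite uadj; apply/funext => x /=; rewrite ?uv ?vu.
have re x : r (e x) = e (r x).
  have := congr1 (fun f => f x) (h u Mu Uu); rewrite /=.
  rewrite -[u (e x)]/(2 *: r (e x) - e x) -[u x]/(2 *: r x - x) lin_B // lin_Z //.
  move=> /addIr /(congr1 (fun z => 2^-1 *: z)).
  by rewrite !scalerA mulVf ?scale1r // pnatr_eq0.
apply/funext => x /=.
pose b y := y - 'i%C *: k y.
have be y : b (e y) = e (b y).
  have -> : e y = r (e (b y)) by rewrite re /b -scaleNr r2.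
  by rewrite {1}/b -scaleNr r1.
have := be x; rewrite /b (lin_B le) (lin_Z le) => /addrI /(congr1 (fun z => - z)); rewrite !opprK.
move=> /(congr1 (fun z => ('i%C)^-1 *: z)); rewrite !scalerA mulVf ?scale1r //.
by apply/eqP => - [] /eqP; rewrite oner_eq0.
Qed.

End Cayley.

(** The commutant is spanned by its selfadjoint elements [c + c^*] and [i (c - c^* )], to which
    [cayley_comm] applies. Affiliation of [delta] is tested on unitaries only, and this is what
    brings its functions into the algebra. *)
Lemma vn_unitary e : bounded_op e ->
  (forall u, commutant M u -> unitary u -> u \o e = e \o u) -> M e.
Proof.
move=> he h; apply: vn_mem => // c hc; have hca := commutant_adj hc.
have bc := hc.1; have bca := hca.1; have le := bop_lin he.
have comb x y z : commutant M x -> commutant M y -> commutant M (z *: x + y).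
  move=> [bx hx] [by_ hy]; split; first exact: bop_lincomb.
  move=> m Mm; apply/funext => w; have lm := bop_lin (vn_bop Mm).
  have := congr1 (fun f => f w) (hx m Mm); have := congr1 (fun f => f w) (hy m Mm).
  have E v : (z *: x + y) v = z *: x v + y v by [].
  by rewrite /= !E lm => -> ->.
have e1 : (c + adj c) \o e = e \o (c + adj c).
  apply: cayley_comm => //; first by rewrite -[X in X + _]scale1r; exact: comb.
  by rewrite adj_D // adjK // addrC.
have e2 : ('i%C *: (c - adj c)) \o e = e \o ('i%C *: (c - adj c)).
  have E : 'i%C *: (c - adj c) = (- 'i%C) *: adj c + ('i%C *: c + 0).
    by rewrite addr0 scalerBr scaleNr addrC.
  apply: cayley_comm => //.
    rewrite E; apply: (comb (adj c)) => //; apply: (comb c) => //; split; first exact: bop_0.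
    by move=> m Mm; apply/funext => x; exact: lin_0 (bop_lin (vn_bop Mm)).
  rewrite adj_Z ?adj_B ?adjK //; last exact: bop_B.
  have -> : ('i%C : R[i])^* = - 'i%C by apply: complex_eq; rewrite /= ?oppr0.
  by rewrite scaleNr -scalerN opprB.
apply/funext => x /=.
have := congr1 (fun f => f x) e1; have := congr1 (fun f => f x) e2; rewrite /=.
rewrite -[(_ *: (c - adj c)) (e x)]/('i%C *: (c (e x) - adj c (e x))).
rewrite -[(_ *: (c - adj c)) x]/('i%C *: (c x - adj c x)) (lin_Z le) (lin_B le).
rewrite -[(c + adj c) (e x)]/(c (e x) + adj c (e x)) -[(c + adj c) x]/(c x + adj c x) (lin_D le).
move=> /(congr1 (fun z => ('i%C)^-1 *: z)); rewrite !scalerA mulVf; last first.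
  by apply/eqP => - [] /eqP; rewrite oner_eq0.
rewrite !scale1r => f1 f2.
have : (2 : R[i]) *: c (e x) = 2 *: e (c x).
  rewrite !scaler_nat !mulr2n.
  have <- : (c (e x) - adj c (e x)) + (c (e x) + adj c (e x)) = c (e x) + c (e x).
    by rewrite addrACA addNr addr0.
  by rewrite f1 f2 addrACA addNr addr0.
move=> /(congr1 (fun z => 2^-1 *: z)).
by rewrite !scalerA mulVf ?scale1r // pnatr_eq0.
Qed.

End VonNeumann.

(** * Borel functional calculus *)

Section ComplexIntegral.
Variable R : realType.
Local Notation T := (measurableTypeR R).
Implicit Types (f g h : R -> R[i]) (B : set R).

Definition mC f := measurable_fun [set: T] (fun s : T => complex.Re (f s) : R) /\
  measurable_fun [set: T] (fun s : T => complex.Im (f s) : R).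
Definition bm f := mC f /\ exists c, forall s, cn (f s) <= c.

Lemma mC_cst c : mC (fun=> c).
Proof. by split; exact: measurable_cst. Qed.

Lemma mC_real (f : R -> R) : measurable_fun [set: T] (f : T -> R) -> mC (fun s => (f s)%:C%C).
Proof. by move=> mf; split => //=; exact: measurable_cst. Qed.

Lemma mC_D f g : mC f -> mC g -> mC (fun s => f s + g s).
Proof.
move=> [f1 f2] [g1 g2]; split.
  rewrite (_ : (fun s => _) = (fun s => complex.Re (f s) + complex.Re (g s))).
    exact: measurable_funD.
  by apply/funext => s; rewrite ReD.
rewrite (_ : (fun s => _) = (fun s => complex.Im (f s) + complex.Im (g s))).
  exact: measurable_funD.
by apply/funext => s; rewrite ImD.
Qed.

Lemma mC_M f g : mC f -> mC g -> mC (fun s => f s * g s).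
Proof.
move=> [f1 f2] [g1 g2]; split.
  rewrite (_ : (fun s => _) = (fun s => complex.Re (f s) * complex.Re (g s) -
     complex.Im (f s) * complex.Im (g s))).
    by apply: measurable_funB; exact: measurable_funM.
  by apply/funext => s; rewrite ReM.
rewrite (_ : (fun s => _) = (fun s => complex.Re (f s) * complex.Im (g s) +
     complex.Im (f s) * complex.Re (g s))).
  by apply: measurable_funD; exact: measurable_funM.
by apply/funext => s; rewrite ImM.
Qed.

Lemma mC_conj f : mC f -> mC (fun s => (f s)^*).
Proof.
move=> [f1 f2]; split.
  by rewrite (_ : (fun s => _) = (fun s => complex.Re (f s))) //; apply/funext => s; rewrite ReC.
rewrite (_ : (fun s => _) = (fun s => - complex.Im (f s))).
  exact: measurable_funN.
by apply/funext => s; rewrite ImC.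
Qed.

Lemma mC_N f : mC f -> mC (fun s => - f s).
Proof.
move=> mf; rewrite (_ : (fun s => _) = (fun s => -1 * f s)).
  by apply: mC_M => //; exact: mC_cst.
by apply/funext => s; rewrite mulN1r.
Qed.

Lemma mC_B f g : mC f -> mC g -> mC (fun s => f s - g s).
Proof. by move=> mf mg; apply: mC_D => //; exact: mC_N. Qed.

Lemma mC_cn f : mC f -> measurable_fun [set: T] (fun s : T => cn (f s) : R).
Proof.
move=> [f1 f2].
rewrite (_ : (fun s => _) = Num.sqrt \o
  (fun s => complex.Re (f s) ^+ 2 + complex.Im (f s) ^+ 2)).
  apply: measurableT_comp; last by apply: measurable_funD; exact: measurable_funX.
  by apply: continuous_measurable_fun; exact: sqrt_continuous.
by apply/funext => s; rewrite cn_def.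
Qed.

Lemma mC_X f n : mC f -> mC (fun s => f s ^+ n).
Proof.
move=> mf; elim: n => [|n IHn].
  by rewrite (_ : (fun s => _) = (fun s => 1)); [exact: mC_cst|apply/funext => s; rewrite expr0].
rewrite (_ : (fun s => _) = (fun s => f s * f s ^+ n)); first exact: mC_M.
by apply/funext => s; rewrite exprS.
Qed.

Lemma mC_comp f (u : R -> R) : mC f -> measurable_fun [set: T] (u : T -> T) ->
  mC (fun s => f (u s)).
Proof. by move=> [f1 f2] mu; split; [exact: (measurableT_comp f1 mu)|exact: (measurableT_comp f2 mu)]. Qed.

Definition cind B (s : R) : R[i] := (\1_B s)%:C%C.

Lemma mC_cind B : measurable B -> mC (cind B).
Proof. by move=> mB; apply: mC_real; exact: measurable_indic. Qed.

Lemma cindE B s : cind B s = if s \in B then 1 else 0.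
Proof. by rewrite /cind indicE; case: (s \in B). Qed.

Lemma cind_in B s : B s -> cind B s = 1.
Proof. by move=> /mem_set h; rewrite cindE h. Qed.

Lemma cind_out B s : ~ B s -> cind B s = 0.
Proof. by move=> h; rewrite cindE memNset. Qed.

Lemma cn_cind B s : cn (cind B s) <= 1.
Proof. by rewrite cindE; case: ifP => _; rewrite ?cn1 ?cn0. Qed.

Lemma bm_cind B : measurable B -> bm (cind B).
Proof. by move=> mB; split; [exact: mC_cind|exists 1 => s; exact: cn_cind]. Qed.

Lemma bm_cst c : bm (fun=> c).
Proof. by split; [exact: mC_cst|exists (cn c)]. Qed.

Lemma bm_D f g : bm f -> bm g -> bm (fun s => f s + g s).
Proof.
move=> [mf [c hc]] [mg [d hd]]; split; first exact: mC_D.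
by exists (c + d) => s; apply: (le_trans (cnD _ _)); rewrite lerD.
Qed.

Lemma bm_M f g : bm f -> bm g -> bm (fun s => f s * g s).
Proof.
move=> [mf [c hc]] [mg [d hd]]; split; first exact: mC_M.
by exists (c * d) => s; rewrite cnM ler_pM ?cn_ge0.
Qed.

Lemma bm_Z c f : bm f -> bm (fun s => c * f s).
Proof. by move=> hf; apply: bm_M => //; exact: bm_cst. Qed.

Lemma bm_lincomb c f g : bm f -> bm g -> bm (fun s => c * f s + g s).
Proof. by move=> hf hg; apply: bm_D => //; exact: bm_Z. Qed.

Lemma bm_B f g : bm f -> bm g -> bm (fun s => f s - g s).
Proof.
move=> [mf [c hc]] [mg [d hd]]; split; first exact: mC_B.
by exists (c + d) => s; apply: (le_trans (cnB _ _)); rewrite lerD.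
Qed.

Lemma bm_conj f : bm f -> bm (fun s => (f s)^*).
Proof.
move=> [mf [c hc]]; split; first exact: mC_conj.
by exists c => s; rewrite cn_conj.
Qed.

Lemma bm_X f n : bm f -> bm (fun s => f s ^+ n).
Proof.
move=> [mf [c hc]]; split; first exact: mC_X.
exists (c ^+ n) => s; rewrite cnX; apply: lerXn2r => //; rewrite nnegrE ?cn_ge0 //.
by apply: le_trans (hc s); rewrite cn_ge0.
Qed.

Lemma bm_comp f (u : R -> R) : bm f -> measurable_fun [set: T] (u : T -> T) ->
  bm (fun s => f (u s)).
Proof. by move=> [mf [c hc]] mu; split; [exact: mC_comp|exists c]. Qed.

Lemma bm_ge0 f : bm f -> exists2 c, 0 <= c & forall s, cn (f s) <= c.
Proof. by move=> [_ [c hc]]; exists c => //; apply: le_trans (hc 0); exact: cn_ge0. Qed.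

(** The sum counts the integers [k + 1 <= y], so it is the integer part of [y]. *)
Lemma floor_sum_approx (N : nat) (y : R) : 0 <= y <= N%:R ->
  `|y - \sum_(k < N) \1_[set t : R | k.+1%:R <= t] y| <= 1.
Proof.
elim: N y => [|N IHN] y /andP[y0 yN].
  by rewrite big_ord0 subr0 ger0_norm // (le_trans yN).
rewrite big_ord_recr /= indicE.
have [h|h] := boolP (y \in _).
  move: h; rewrite inE /= => h.
  have -> : y = N.+1%:R by apply/eqP; rewrite eq_le yN h.
  rewrite (eq_bigr (fun=> 1)); last first.
    by move=> k _; rewrite indicE mem_set //= ler_nat ltnS ltnW.
  by rewrite sumr_const card_ord -[1 *+ N]/(N%:R) natr1 subrr normr0.
move: h; rewrite notin_setE /= => /negP; rewrite -ltNge => h.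
rewrite addr0.
have [yN'|yN'] := leP y N%:R; first by apply: IHN; rewrite y0.
rewrite (eq_bigr (fun=> 1)); last first.
  by move=> k _; rewrite indicE mem_set //= (le_trans _ (ltW yN')) // ler_nat.
rewrite sumr_const card_ord -[1 *+ N]/(N%:R) ger0_norm ?subr_ge0 ?(ltW yN') //.
by rewrite lerBlDr addrC natr1 ltW.
Qed.

(** Indicators, linear combinations and uniform limits exhaust the bounded Borel functions. The
    algebraic rules of the calculus and its uniqueness are proved by this induction. *)
Lemma bm_ind (P : (R -> R[i]) -> Prop) :
  (forall B, measurable B -> P (cind B)) ->
  (forall c f g, bm f -> bm g -> P f -> P g -> P (fun s => c * f s + g s)) ->
  (forall f, bm f -> (forall e : R, 0 < e -> exists g,
     [/\ bm g, P g & forall s, cn (f s - g s) <= e]) -> P f) ->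
  forall f, bm f -> P f.
Proof.
move=> Pind Plin Plim.
have P0 : P (fun=> 0).
  have := Pind set0 measurable0; congr P; apply/funext => s.
  by rewrite cind_out.
have PZ c f : bm f -> P f -> P (fun s => c * f s).
  move=> bf Pf; have := Plin c _ _ bf (bm_cst 0) Pf P0; congr P.
  by apply/funext => s; rewrite addr0.
have PD f g : bm f -> bm g -> P f -> P g -> P (fun s => f s + g s).
  move=> bf bg Pf Pg; have := Plin 1 _ _ bf bg Pf Pg; congr P.
  by apply/funext => s; rewrite mul1r.
have P1 : P (fun=> 1).
  by have := Pind setT measurableT; congr P; apply/funext => s; rewrite cind_in.
have Psum (N : nat) (B : nat -> set R) : (forall k, measurable (B k)) ->
   bm (fun s => \sum_(k < N) cind (B k) s) /\ P (fun s => \sum_(k < N) cind (B k) s).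
  move=> mB; elim: N => [|N [b1 b2]].
    rewrite (_ : (fun s => _) = (fun=> 0)); first by split; [exact: bm_cst|].
    by apply/funext => s; rewrite big_ord0.
  rewrite (_ : (fun s => _) = (fun s => \sum_(k < N) cind (B k) s + cind (B N) s)).
    by split; [apply: bm_D => //; exact: bm_cind|apply: PD => //; [exact: bm_cind|exact: Pind]].
  by apply/funext => s; rewrite big_ord_recr.
have Preal (f : R -> R) c : measurable_fun [set: T] (f : T -> R) ->
    (forall s, `|f s| <= c) -> P (fun s => (f s)%:C%C).
  move=> mf hc; apply: Plim.
    by split; [exact: mC_real|exists c => s; rewrite cn_real].
  move=> e e0; have c0 : 0 <= c by apply: le_trans (hc 0).
  have [k ck] : exists k : nat, c / e <= k%:R.
    by exists (Num.bound (c / e)); apply/ltW/archi_boundP; rewrite divr_ge0 // ltW.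
  pose N := (2 * k)%N; have NE : N = (2 * k)%N by [].
  (* Since [c <= k e], the function [(f + k e) / e] is valued in [[0, 2 k]]; its integer part is a
     finite sum of indicators at distance at most 1. *)
  pose B (j : nat) : set R := [set s | j.+1%:R <= (f s + k%:R * e) / e].
  have mB j : measurable (B j).
    rewrite (_ : B j = setT `&` (fun s : T => (f s + k%:R * e) / e) @^-1` `[j.+1%:R, +oo[).
      have : measurable_fun [set: T] (fun s : T => (f s + k%:R * e) / e : R).
        by apply: measurable_funM; [apply: measurable_funD => //|]; exact: measurable_cst.
      by apply => //; exact: measurable_itv.
    by apply/seteqP; split=> s /=; rewrite in_itv /= andbT; [|case].
  have [bS PS] := Psum N B mB.
  exists (fun s => e%:C%C * (\sum_(j < N) cind (B j) s) + (- (k%:R * e))%:C%C * 1).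
  have b2 : bm (fun s : R => (- (k%:R * e))%:C%C * 1 : R[i]) by apply: bm_Z; exact: bm_cst.
  split; [exact: bm_lincomb|apply: Plin => //; apply: PZ => //; exact: bm_cst|].
  move=> s; pose y := (f s + k%:R * e) / e.
  have kc : c <= k%:R * e by rewrite -ler_pdivrMr.
  have yN : 0 <= y <= N%:R.
    have := hc s; rewrite ler_norml => /andP[h1 h2]; rewrite /y NE.
    rewrite divr_ge0 ?(ltW e0) //=; last by lra.
    by rewrite ler_pdivrMr // natrM; lra.
  have := floor_sum_approx yN; set S := \sum_(j < N) _ => hS.
  have -> : \sum_(j < N) cind (B j) s = S%:C%C.
    rewrite /S rmorph_sum /=; apply: eq_bigr => j _.
    by rewrite /cind !indicE; congr ((nat_of_bool _)%:R)%:C%C; apply/idP/idP; rewrite !inE.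
  rewrite mulr1 -rmorphM -rmorphD -rmorphB cn_real /=.
  have -> : f s - (e * S + - (k%:R * e)) = e * (y - S) by rewrite /y; field; rewrite gt_eqF.
  by rewrite normrM gtr0_norm // ler_piMr // ltW.
move=> f [[m1 m2] [c hc]].
have h1 : P (fun s => (complex.Re (f s))%:C%C).
  by apply: (Preal _ c) => // s; exact: le_trans (Re_le_cn _) (hc s).
have h2 : P (fun s => (complex.Im (f s))%:C%C).
  by apply: (Preal _ c) => // s; exact: le_trans (Im_le_cn _) (hc s).
have b1 : bm (fun s => (complex.Re (f s))%:C%C).
  split; first exact: mC_real.
  by exists c => s; rewrite cn_real; exact: le_trans (Re_le_cn _) (hc s).
have b2 : bm (fun s => (complex.Im (f s))%:C%C).
  split; first exact: mC_real.
  by exists c => s; rewrite cn_real; exact: le_trans (Im_le_cn _) (hc s).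
have := Plin 'i%C _ _ b2 b1 h2 h1; congr P; apply/funext => s.
by rewrite [RHS]complexE addrC.
Qed.

Definition CI (mu : {measure set T -> \bar R}) (g : R -> R[i]) : R[i] :=
  ((\int[mu]_s complex.Re (g s)) +i* (\int[mu]_s complex.Im (g s)))%C.

Section Finite.
Variable mu : {measure set T -> \bar R}.
Hypothesis fin : (mu setT < +oo)%E.

Lemma bm_integrable (f : R -> R) c : measurable_fun [set: T] (f : T -> R) ->
  (forall s, `|f s| <= c) -> mu.-integrable setT (EFin \o f).
Proof.
move=> mf hc; apply: measurable_bounded_integrable => //.
exists c; split; first exact: num_real.
by move=> y cy s _; apply: le_trans (hc s) (ltW cy).
Qed.

Lemma bm_int_Re g : bm g -> mu.-integrable setT (EFin \o (fun s : T => complex.Re (g s) : R)).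
Proof.
by move=> [[m1 m2] [c hc]]; apply: (@bm_integrable _ c) => // s; exact: le_trans (Re_le_cn _) (hc s).
Qed.

Lemma bm_int_Im g : bm g -> mu.-integrable setT (EFin \o (fun s : T => complex.Im (g s) : R)).
Proof.
by move=> [[m1 m2] [c hc]]; apply: (@bm_integrable _ c) => // s; exact: le_trans (Im_le_cn _) (hc s).
Qed.

Lemma CI_D f g : bm f -> bm g -> CI mu (fun s => f s + g s) = CI mu f + CI mu g.
Proof.
move=> bf bg; rewrite /CI; apply: complex_eq; rewrite ?ReD ?ImD /=.
  rewrite -RintegralD //; [|exact: bm_int_Re|exact: bm_int_Re].
  by apply: eq_Rintegral => s _; rewrite ReD.
rewrite -RintegralD //; [|exact: bm_int_Im|exact: bm_int_Im].
by apply: eq_Rintegral => s _; rewrite ImD.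
Qed.

Lemma CI_Zr (r : R) f : bm f -> CI mu (fun s => r%:C%C * f s) = r%:C%C * CI mu f.
Proof.
move=> bf; rewrite /CI; apply: complex_eq; rewrite ?ReM ?ImM /= mul0r ?subr0 ?addr0.
  rewrite -RintegralZl //; last exact: bm_int_Re.
  by apply: eq_Rintegral => s _; rewrite ReM /= mul0r subr0.
rewrite -RintegralZl //; last exact: bm_int_Im.
by apply: eq_Rintegral => s _; rewrite ImM /= mul0r addr0.
Qed.

Lemma CI_i f : bm f -> CI mu (fun s => 'i%C * f s) = 'i%C * CI mu f.
Proof.
move=> bf; rewrite /CI; apply: complex_eq; rewrite ?ReM ?ImM /= mul0r ?mul1r ?sub0r ?add0r.
  rewrite -mulN1r -RintegralZl //; last exact: bm_int_Im.
  by apply: eq_Rintegral => s _; rewrite ReM /= mul0r mul1r sub0r mulN1r.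
by apply: eq_Rintegral => s _; rewrite ImM /= mul0r mul1r add0r.
Qed.

Lemma CI_lin c f g : bm f -> bm g ->
  CI mu (fun s => c * f s + g s) = c * CI mu f + CI mu g.
Proof.
move=> bf bg; rewrite CI_D //; last exact: bm_Z.
congr (_ + _); rewrite {2}[c]complexE mulrDl -CI_Zr // -mulrA -CI_Zr // -CI_i; last exact: bm_Z.
rewrite -CI_D; [|exact: bm_Z|by apply: bm_Z; exact: bm_Z].
by congr CI; apply/funext => s; rewrite mulrA -mulrDl -complexE.
Qed.

(** The factor 2 comes from treating real and imaginary parts separately; the sharp operator bound
    is recovered in [Phi_bdd]. *)
Lemma CI_bound g c : bm g -> (forall s, cn (g s) <= c) ->
  cn (CI mu g) <= 2 * c * fine (mu setT).
Proof.
move=> bg hc; apply: (le_trans (cn_le _)) => /=.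
have [[m1 m2] _] := bg.
have bound (u : R -> R) : measurable_fun [set: T] (u : T -> R) ->
    (forall s, `|u s| <= c) -> `|\int[mu]_s u s| <= c * fine (mu setT).
  move=> mu' hu; apply: (le_trans (le_normr_Rintegral _ _)) => //.
    exact: (@bm_integrable _ c).
  rewrite -Rintegral_cst //; apply: le_Rintegral => //.
  - apply: (@bm_integrable (fun s => `|u s|) c); last by move=> s; rewrite normr_id.
    by apply: measurableT_comp => //; exact: normr_measurable.
  - apply: (@bm_integrable (fun=> c) `|c|) => //; exact: measurable_cst.
rewrite -mulrA mulr2n mulrDl mul1r; apply: lerD; apply: bound => // s.
  exact: le_trans (Re_le_cn _) (hc s).
exact: le_trans (Im_le_cn _) (hc s).
Qed.

Lemma CI_conj g : bm g -> CI mu (fun s => (g s)^*) = (CI mu g)^*.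
Proof.
move=> bg; apply: complex_eq; rewrite ?ReC ?ImC /CI /=.
  by apply: eq_Rintegral => s _; rewrite ReC.
rewrite -mulN1r -RintegralZl //; last exact: bm_int_Im.
by apply: eq_Rintegral => s _; rewrite ImC mulN1r.
Qed.

Lemma CI_cind B : measurable B -> CI mu (cind B) = (fine (mu B))%:C%C.
Proof.
move=> mB; apply: complex_eq; rewrite /CI /=; last by rewrite Rintegral_cst // mul0r.
by rewrite /Rintegral integral_indic // setIT.
Qed.

End Finite.

End ComplexIntegral.

(** * Bounded Borel functions of a spectral measure *)

Section Calculus.
Variables (R : realType) (H : hilbert R).
Local Notation T := (measurableTypeR R).
Implicit Types (f g h : R -> R[i]) (B : set R) (x y : H).

Lemma conj_i : ('i%C : R[i])^* = - 'i%C.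
Proof. by apply: complex_eq; rewrite /= ?oppr0. Qed.

Lemma cn_i : cn ('i%C : R[i]) = 1.
Proof. by rewrite cn_def /= expr0n expr1n add0r sqrtr1. Qed.

Lemma mul_ii : 'i%C * 'i%C = -1 :> R[i].
Proof. by rewrite -expr2 sqr_i. Qed.

(** The norm is at most twice the numerical radius: [<|d x, y|>] is polarized at the multiple [y] of
    [d x] that has the norm of [x]. *)
Lemma num_radius (d : op H) e : linear d -> (forall x, cn <|d x, x|> <= e * hn x ^+ 2) ->
  forall x, hn (d x) <= 2 * e * hn x.
Proof.
move=> ld hd x.
have [->|dx0] := eqVneq (d x) 0.
  rewrite hn0; have [->|x0] := eqVneq x 0; first by rewrite hn0 mulr0.
  have hx : 0 < hn x.
    by rewrite lt0r hn_ge0 andbT; apply/eqP => /hn0_eq0 /eqP; apply/negP.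
  rewrite mulr_ge0 ?hn_ge0 // mulr_ge0 //.
  have := le_trans (cn_ge0 _) (hd x).
  by rewrite pmulr_lge0 // exprn_gt0.
have hx : 0 < hn (d x).
  by rewrite lt0r hn_ge0 andbT; apply/eqP => /hn0_eq0 /eqP; apply/negP.
pose y := (hn x / hn (d x))%:C%C *: d x.
have hy : hn y = hn x.
  by rewrite hnZ cn_real ger0_norm ?divr_ge0 ?hn_ge0 // divfK // gt_eqF.
have pol z w : 4%:R * <|d z, w|> = <|d (z + w), z + w|> - <|d (z - w), z - w|> +
     ('i%C * <|d (z + 'i%C *: w), z + 'i%C *: w|> -
      'i%C * <|d (z - 'i%C *: w), z - 'i%C *: w|>).
  rewrite !(lin_B ld, lin_D ld, lin_Z ld, lin_N ld).
  rewrite !(ipDl, ipDr, ipNl, ipNr, ipZl, ipZr) conj_i.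
  by ring: (mul_ii).
have key : cn (4%:R * <|d x, y|>) <= 4 * e * (hn x ^+ 2 + hn y ^+ 2).
  rewrite pol.
  have hi (c : R[i]) : cn ('i%C * c) = cn c.
    by rewrite cnM cn_i mul1r.
  apply: (le_trans (cnD _ _)).
  have := cnB <|d (x + y), x + y|> <|d (x - y), x - y|>.
  have := cnB ('i%C * <|d (x + 'i%C *: y), x + 'i%C *: y|>)
     ('i%C * <|d (x - 'i%C *: y), x - 'i%C *: y|>).
  rewrite !hi.
  have := hd (x + y); have := hd (x - y); have := hd (x + 'i%C *: y); have := hd (x - 'i%C *: y).
  have p1 := parallelogram x y; have p2 := parallelogram x ('i%C *: y).
  have hiy : hn ('i%C *: y) = hn y.
    by rewrite hnZ cn_i mul1r.
  rewrite hiy in p2.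
  move: p1 p2; move: (hn (x + y) ^+ 2) (hn (x - y) ^+ 2) (hn (x + 'i%C *: y) ^+ 2)
    (hn (x - 'i%C *: y) ^+ 2) (hn x ^+ 2) (hn y ^+ 2) => a b c d' u v p1 p2 h1 h2 h3 h4 h5 h6.
  have -> : 4 * e * (u + v) = e * (a + b) + e * (c + d') by rewrite p1 p2; ring.
  lra.
move: key; rewrite cnM (_ : cn 4%:R = 4); last by rewrite /cn normr_nat.
rewrite {1}/y ipZr conj_realC ipxx cnM !cn_real ger0_norm ?divr_ge0 ?hn_ge0 //.
rewrite ger0_norm ?sqr_ge0 // hy => key.
have {}key : 4 * (hn x * hn (d x)) <= 4 * e * (hn x ^+ 2 + hn x ^+ 2).
  suff <- : 4 * (hn x / hn (d x) * hn (d x) ^+ 2) = 4 * (hn x * hn (d x)) by [].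
  by field; rewrite gt_eqF.
have [x0|x0] := eqVneq (hn x) 0.
  by move: dx0; rewrite (hn0_eq0 x0) lin_0 // eqxx.
have hx0 : 0 < hn x by rewrite lt0r x0 hn_ge0.
rewrite -(ler_pM2l hx0); lra.
Qed.

Variable E : spectral_measure H.
Local Notation mu := (sp_mu E).

Lemma mu_fin x B : measurable B -> (mu x B < +oo)%E.
Proof. by move=> mB; case: (sp_muE E x mB). Qed.

Lemma mu_finT x : (mu x setT < +oo)%E.
Proof. exact: mu_fin. Qed.

Lemma mu_hn x B : measurable B -> fine (mu x B) = hn (spE E B x) ^+ 2.
Proof.
move=> mB; case: (sp_muE E x mB) => h _; move: h; rewrite hnE -rmorphXn /=.
by move=> /complexI.
Qed.

Lemma mu_muE x B : measurable B -> mu x B = (hn (spE E B x) ^+ 2)%:E.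
Proof.
by move=> mB; rewrite -mu_hn // fineK // ge0_fin_numE // mu_fin.
Qed.

Lemma muT x : fine (mu x setT) = hn x ^+ 2.
Proof. by rewrite mu_hn // sp_setT. Qed.

Lemma spE_bop B : measurable B -> bounded_op (spE E B).
Proof. by move=> /(sp_proj E) []. Qed.

Lemma spE_adj B : measurable B -> adj (spE E B) = spE E B.
Proof. by move=> /(sp_proj E) []. Qed.

Lemma spE_idem B x : measurable B -> spE E B (spE E B x) = spE E B x.
Proof. by move=> /(sp_proj E) [_ h _]; rewrite -{3}h. Qed.

Lemma spE_form B x : measurable B -> <|spE E B x, x|> = (fine (mu x B))%:C%C.
Proof.
move=> mB; rewrite mu_hn // -ipxx -{1}(spE_idem _ mB) (adjP _ _ (spE_bop mB)).
by rewrite spE_adj.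
Qed.

Definition Phi_ok g (a : op H) := bounded_op a /\ forall x, <|a x, x|> = CI (mu x) g.

Lemma Phi_ok_uniq g a b : Phi_ok g a -> Phi_ok g b -> a = b.
Proof.
move=> [ha fa] [hb fb]; apply: op_eq_form; first exact: bop_lin.
  exact: bop_lin.
by move=> x; rewrite fa fb.
Qed.

Lemma Phi_ok_lin c f g a b : bm f -> bm g -> Phi_ok f a -> Phi_ok g b ->
  Phi_ok (fun s => c * f s + g s) (c *: a + b).
Proof.
move=> bf bg [ha fa] [hb fb]; split; first exact: bop_lincomb.
move=> x; rewrite -[(c *: a + b) x]/(c *: a x + b x) ipDl ipZl fa fb CI_lin //.
exact: mu_finT.
Qed.

Lemma Phi_ok_dist f g a b e : bm f -> bm g -> Phi_ok f a -> Phi_ok g b ->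
  (forall s, cn (f s - g s) <= e) -> forall x, hn (a x - b x) <= 4 * e * hn x.
Proof.
move=> bf bg fa gb he x; have [ha _] := fa; have [hb _] := gb.
have [hd fd] := Phi_ok_lin (-1) bg bf gb fa.
have -> : a x - b x = (-1 *: b + a) x.
  by rewrite -[RHS]/(-1 *: b x + a x) scaleN1r addrC.
have -> : 4 * e * hn x = 2 * (2 * e) * hn x by ring.
apply: num_radius; first exact: bop_lin.
move=> y; rewrite fd -muT; apply: CI_bound.
- exact: mu_finT.
- exact: bm_lincomb.
- by move=> s; rewrite mulN1r addrC.
Qed.

(** The measures give forms, not operators. By [num_radius], uniformly close functions have
    operators close in norm, so the operator of a uniform limit is obtained as a limit of
    operators. *)
Lemma Phi_exists g : bm g -> exists a, Phi_ok g a.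
Proof.
move=> bg; move: g bg; apply: bm_ind.
- move=> B mB; exists (spE E B); split; first exact: spE_bop.
  by move=> x; rewrite CI_cind // spE_form.
- move=> c f g bf bg [a fa] [b gb]; exists (c *: a + b); exact: Phi_ok_lin.
move=> f bf hf.
have /choice [u hu] : forall n : nat, exists p : (R -> R[i]) * op H,
    [/\ bm p.1, Phi_ok p.1 p.2 & forall s, cn (f s - p.1 s) <= n.+1%:R^-1].
  move=> n; have [|g [bg [a ga] fg]] := hf n.+1%:R^-1; first by rewrite invr_gt0.
  by exists (g, a).
pose g n := (u n).1; pose a n := (u n).2.
have bg n : bm (g n) by case: (hu n).
have ga n : Phi_ok (g n) (a n) by case: (hu n).
have fg n s : cn (f s - g n s) <= n.+1%:R^-1 by case: (hu n).
have dist m n x : hn (a m x - a n x) <= 4 * (m.+1%:R^-1 + n.+1%:R^-1) * hn x.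
  apply: Phi_ok_dist => // s.
  have -> : g m s - g n s = (f s - g n s) - (f s - g m s) by ring.
  by apply: (le_trans (cnB _ _)); rewrite addrC lerD.
have /choice [b ab] : forall x, exists y, cv (a^~ x) y.
  move=> x; apply: hilbert_complete => e e0.
  have c0 : 0 < 8 * (hn x + 1) by rewrite mulr_gt0 // ltr_wpDl ?hn_ge0.
  have [N hN] := (rcvg0P (@harmonic R)).1 (@cvg_harmonic R) _ (divr_gt0 e0 c0).
  exists N => m n Nm Nn; apply: (le_lt_trans (dist _ _ _)).
  have := hN m Nm; have := hN n Nn; rewrite /harmonic /= !ger0_norm ?invr_ge0 //.
  rewrite !ltr_pdivlMr //; have := hn_ge0 x.
  have : 0 < (m.+1%:R^-1 : R) by rewrite invr_gt0.
  have : 0 < (n.+1%:R^-1 : R) by rewrite invr_gt0.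
  move: (m.+1%:R^-1) (n.+1%:R^-1) (hn x) => p q z; nra.
have lb : linear b.
  move=> k x y; apply: (cv_unique (ab _)).
  under eq_fun do rewrite (bop_lin (ga _).1).
  by apply: cvD => //; exact: cvZ.
exists b; split.
  have [c c0 hc] := bop_bdd (ga 0%N).1.
  apply: (@bop_intro _ _ _ _ (c + 8)) => // x.
  apply: (ler_cvg_to (cv_hn (ab x)) (cvg_cst _)); apply: nearW => n.
  rewrite -[a n x](subrK (a 0%N x)); apply: (le_trans (hnD _ _)).
  rewrite mulrDl addrC; apply: lerD => //; apply: (le_trans (dist _ _ _)).
  rewrite ler_wpM2r ?hn_ge0 //.
  have : (n.+1%:R^-1 : R) <= 1 by rewrite invf_le1 // ler1n.
  have -> : (1%:R^-1 : R) = 1 by rewrite invr1.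
  by move: (n.+1%:R^-1) => q ?; lra.
move=> x.
have c0 : 0 <= 2 * hn x ^+ 2 by rewrite mulr_ge0 ?sqr_ge0.
have est n : cn (<|b x, x|> - CI (mu x) f) <=
   hn (b x - a n x) * hn x + 2 * n.+1%:R^-1 * hn x ^+ 2.
  have -> : <|b x, x|> - CI (mu x) f = <|b x - a n x, x|> - CI (mu x) (fun s => -1 * g n s + f s).
    rewrite CI_lin ?mulN1r //; last exact: mu_finT.
    by rewrite -(ga n).2 ipBl; ring.
  apply: (le_trans (cnB _ _)); apply: lerD; first exact: ip_CS.
  rewrite -muT; apply: CI_bound.
  - exact: mu_finT.
  - exact: bm_lincomb.
  - by move=> s; rewrite mulN1r addrC.
apply/eqP; rewrite -subr_eq0; apply/eqP/cn0_eq0/eqP; rewrite eq_le cn_ge0 andbT.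
have l : (fun n : nat => hn (b x - a n x) * hn x + 2 * n.+1%:R^-1 * hn x ^+ 2) @ \oo --> (0 : R).
  rewrite -[X in _ --> X]addr0; apply: cvgD.
    rewrite -[X in _ --> X](mul0r (hn x)); apply: cvgMl.
    by under eq_fun do rewrite hnBC; exact: ab.
  rewrite -[X in _ --> X](mul0r (hn x ^+ 2)); apply: cvgMl.
  rewrite -[X in _ --> X](mulr0 2); apply: cvgMr; exact: cvg_harmonic.
by apply: (ler_cvg_to (cvg_cst _) l); apply: nearW.
Qed.

Definition Phi g : op H := xget 0 [set a | Phi_ok g a].

Lemma PhiP g : bm g -> Phi_ok g (Phi g).
Proof. by move=> /Phi_exists [a ha]; rewrite /Phi; case: xgetP => [b -> //|/(_ a)]. Qed.

Lemma Phi_uniq g a : bm g -> Phi_ok g a -> Phi g = a.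
Proof. by move=> bg ha; apply: (@Phi_ok_uniq g) => //; exact: PhiP. Qed.

Lemma Phi_bop g : bm g -> bounded_op (Phi g).
Proof. by move=> /PhiP []. Qed.

Lemma Phi_linear g : bm g -> linear (Phi g).
Proof. by move=> /Phi_bop /bop_lin. Qed.

Lemma Phi_form g x : bm g -> <|Phi g x, x|> = CI (mu x) g.
Proof. by move=> /PhiP []. Qed.

Lemma Phi_lin c f g : bm f -> bm g ->
  Phi (fun s => c * f s + g s) = c *: Phi f + Phi g.
Proof.
move=> bf bg; apply: Phi_uniq; first exact: bm_lincomb.
by apply: Phi_ok_lin => //; exact: PhiP.
Qed.

Lemma Phi_cind B : measurable B -> Phi (cind B) = spE E B.
Proof.
move=> mB; apply: Phi_uniq; first exact: bm_cind.
by split; [exact: spE_bop|move=> x; rewrite CI_cind // spE_form].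
Qed.

Lemma Phi_1 : Phi (fun=> 1) = id.
Proof.
rewrite -(sp_setT E) -Phi_cind //; congr Phi; apply/funext => s.
by rewrite cind_in.
Qed.

Lemma Phi_Z c g x : bm g -> Phi (fun s => c * g s) x = c *: Phi g x.
Proof.
move=> bg; have := Phi_lin c bg (bm_cst 0).
have -> : (fun s => c * g s + 0) = (fun s => c * g s) by apply/funext => s; rewrite addr0.
move=> ->; rewrite -[LHS]/(c *: Phi g x + Phi (fun=> 0) x).
suff -> : Phi (fun=> 0) x = 0 by rewrite addr0.
rewrite (@Phi_uniq _ 0) //; first exact: bm_cst.
split; [exact: bop_0|move=> y; rewrite ip0l /CI; apply: complex_eq => /=].
  by rewrite Rintegral_cst // mul0r.
by rewrite Rintegral_cst // mul0r.
Qed.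

Lemma Phi_cst c x : Phi (fun=> c) x = c *: x.
Proof.
have := Phi_Z c x (bm_cst 1); rewrite Phi_1 => <-; congr (Phi _ x).
by apply/funext => s; rewrite mulr1.
Qed.

Lemma Phi_D f g x : bm f -> bm g -> Phi (fun s => f s + g s) x = Phi f x + Phi g x.
Proof.
move=> bf bg; have := Phi_lin 1 bf bg.
have -> : (fun s => 1 * f s + g s) = (fun s => f s + g s) by apply/funext => s; rewrite mul1r.
by move=> ->; rewrite scale1r.
Qed.

Lemma Phi_B f g x : bm f -> bm g -> Phi (fun s => f s - g s) x = Phi f x - Phi g x.
Proof.
move=> bf bg; have := Phi_lin (-1) bg bf.
have -> : (fun s => -1 * g s + f s) = (fun s => f s - g s).
  by apply/funext => s; rewrite mulN1r addrC.
by move=> ->; rewrite scaleN1r addrC.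
Qed.

Lemma Phi_conj g : bm g -> adj (Phi g) = Phi (fun s => (g s)^*).
Proof.
move=> bg; apply/esym/Phi_uniq; first exact: bm_conj.
split; first exact: bop_adj (Phi_bop bg).
move=> x; rewrite adjP'; last exact: Phi_bop.
by rewrite ipC Phi_form // CI_conj //; exact: mu_finT.
Qed.

Lemma Phi_ip g x y : bm g -> <|Phi g x, y|> = <|x, Phi (fun s => (g s)^*) y|>.
Proof. by move=> bg; rewrite adjP ?Phi_conj //; exact: Phi_bop. Qed.

Lemma Phi_dist f g e x : bm f -> bm g -> (forall s, cn (f s - g s) <= e) ->
  hn (Phi f x - Phi g x) <= 4 * e * hn x.
Proof. by move=> bf bg he; apply: (Phi_ok_dist bf bg) => //; exact: PhiP. Qed.

(** Settles the uniform-limit case in inductions by [bm_ind]. *)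
Lemma op_le0 (u v : H) (c : R) : (forall e, 0 < e -> hn (u - v) <= e * c) -> u = v.
Proof.
move=> h; apply/eqP; rewrite -subr_eq0; apply/eqP/hn0_eq0/eqP; rewrite eq_le hn_ge0 andbT.
apply/ler_addgt0Pr => e e0; rewrite add0r.
have c1 : 0 < `|c| + 1 by rewrite ltr_wpDl.
apply: (le_trans (h (e / (`|c| + 1)) _)); first exact: divr_gt0.
rewrite -mulrA ler_piMr ?(ltW e0) // ler_pdivrMl // mulr1.
by rewrite (le_trans (ler_norm c)) // lerDl.
Qed.

(** When [g] is an indicator this is [sp_setI]. The general product takes a second induction, in the
    other factor. *)
Lemma Phi_mul_cind g B x : bm g -> measurable B ->
  Phi (fun s => g s * cind B s) x = Phi g (spE E B x).
Proof.
move=> bg mB; move: g bg x.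
apply: (@bm_ind _ (fun g => forall x, Phi (fun s => g s * cind B s) x = Phi g (spE E B x))).
- move=> C mC' x; rewrite Phi_cind // -[RHS]/((spE E C \o spE E B) x) -sp_setI //.
  rewrite -Phi_cind; last exact: measurableI.
  congr (Phi _ x); apply/funext => s; rewrite !cindE in_setI.
  by case: (s \in C); case: (s \in B); rewrite ?(mul1r, mul0r).
- move=> c f g bf bg hf hg x.
  rewrite Phi_lin // -[RHS]/(c *: Phi f _ + Phi g _) -hf -hg.
  have bB := bm_cind mB.
  have -> : (fun s => (c * f s + g s) * cind B s) =
    (fun s => c * (f s * cind B s) + g s * cind B s).
    by apply/funext => s; rewrite mulrDl mulrA.
  by rewrite Phi_lin //; exact: bm_M.
- move=> f bf hf x; have bB := bm_cind mB.
  apply: (@op_le0 _ _ (4 * hn x + 4 * hn (spE E B x))) => e e0.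
  have [g [bg gP fg]] := hf e e0.
  apply: (le_trans (hn_triangle _ (Phi g (spE E B x)) _)); rewrite -{1}gP mulrDr lerD //.
    rewrite mulrCA mulrA; apply: Phi_dist; [exact: bm_M|exact: bm_M|].
    move=> s; rewrite -mulrBl cnM; apply: le_trans (fg s).
    by rewrite ler_piMr ?cn_ge0 ?cn_cind.
  rewrite mulrCA mulrA; apply: Phi_dist => // s.
  by rewrite -cnN opprB.
Qed.

Lemma Phi_mul f g x : bm f -> bm g -> Phi (fun s => f s * g s) x = Phi f (Phi g x).
Proof.
move=> bf bg; move: g bg x.
have [c c0 hc] := bm_ge0 bf.
have [d d0 hd] := bop_bdd (Phi_bop bf).
apply: (@bm_ind _ (fun g => forall x, Phi (fun s => f s * g s) x = Phi f (Phi g x))).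
- by move=> B mB x; rewrite Phi_mul_cind // Phi_cind.
- move=> k g h bg bh hg hh x.
  rewrite (Phi_lin k) // -[(k *: Phi g + Phi h) x]/(k *: Phi g x + Phi h x).
  rewrite (Phi_linear bf) -hg -hh.
  have -> : (fun s => f s * (k * g s + h s)) = (fun s => k * (f s * g s) + f s * h s).
    by apply/funext => s; rewrite mulrDr mulrCA.
  by rewrite Phi_lin //; exact: bm_M.
- move=> g bg hg x.
  apply: (@op_le0 _ _ (4 * c * hn x + 4 * d * hn x)) => e e0.
  have [h [bh hP gh]] := hg e e0.
  apply: (le_trans (hn_triangle _ (Phi f (Phi h x)) _)); rewrite -{1}hP mulrDr lerD //.
    have -> : e * (4 * c * hn x) = 4 * (c * e) * hn x by ring.
    apply: Phi_dist; [exact: bm_M|exact: bm_M|].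
    by move=> s; rewrite -mulrBr cnM ler_pM ?cn_ge0.
  rewrite -(lin_B (Phi_linear bf)); apply: (le_trans (hd _)).
  have -> : e * (4 * d * hn x) = d * (4 * e * hn x) by ring.
  rewrite ler_wpM2l //; apply: Phi_dist => // s.
  by rewrite -cnN opprB.
Qed.

Lemma Phi_comm f g x : bm f -> bm g -> Phi f (Phi g x) = Phi g (Phi f x).
Proof.
move=> bf bg; rewrite -!Phi_mul //; congr (Phi _ x).
by apply/funext => s; rewrite mulrC.
Qed.

Lemma bm_cn2 g : bm g -> bm (fun s => ((cn (g s)) ^+ 2)%:C%C).
Proof.
move=> [mg [c hc]]; split.
  by apply: mC_real; apply: measurable_funX; exact: mC_cn.
exists (c ^+ 2) => s; rewrite cn_real ger0_norm ?sqr_ge0 //.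
by rewrite ler_sqr ?nnegrE ?cn_ge0 // (le_trans _ (hc s)) ?cn_ge0.
Qed.

Lemma conj_mul (c : R[i]) : c^* * c = (cn c ^+ 2)%:C%C.
Proof. by rewrite cn_sqr; case: c => a b; apply: complex_eq; rewrite !(ReM, ImM, ReC, ImC) /=; ring. Qed.

Lemma Phi_hn2 g x : bm g -> hn (Phi g x) ^+ 2 = \int[mu x]_s (cn (g s) ^+ 2).
Proof.
move=> bg; rewrite hn2E Phi_ip // -Phi_mul //; last exact: bm_conj.
rewrite (_ : (fun s => _) = (fun s => (cn (g s) ^+ 2)%:C%C)); last first.
  by apply/funext => s; rewrite conj_mul.
rewrite ipC Phi_form; last exact: bm_cn2.
by rewrite ReC /CI.
Qed.

Lemma Phi_bdd g c x : bm g -> (forall s, cn (g s) <= c) -> hn (Phi g x) <= c * hn x.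
Proof.
move=> bg hc; have c0 : 0 <= c by apply: le_trans (hc 0); exact: cn_ge0.
rewrite -ler_sqr ?nnegrE ?mulr_ge0 ?hn_ge0 // Phi_hn2 // exprMn -muT -Rintegral_cst //.
have sq s : cn (g s) ^+ 2 <= c ^+ 2 by rewrite ler_sqr ?nnegrE ?cn_ge0.
apply: le_Rintegral => //.
- apply: (@bm_integrable _ _ _ _ (c ^+ 2)) => //; first exact: mu_finT.
    by apply: measurable_funX; apply: mC_cn; case: bg.
  by move=> s; rewrite ger0_norm ?sqr_ge0.
- by apply: (@bm_integrable _ _ _ (fun=> c ^+ 2) `|c ^+ 2|) => //; exact: mu_finT.
Qed.

(** Allows identities that hold only on a set carrying [E], such as [expR (ln s) = s] on the
    positive half-line. *)
Definition concentrated (D : set R) := measurable D /\ spE E D = id.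

Lemma concentrated_null D x : concentrated D -> mu x (~` D) = 0%E.
Proof.
move=> [mD eD]; have mDc : measurable (~` D) by exact: measurableC.
rewrite mu_muE //; have -> : spE E (~` D) x = 0; last by rewrite hn0 expr0n.
have h : spE E (~` D) (spE E D x) = 0.
  rewrite -[LHS]/((spE E (~` D) \o spE E D) x) -sp_setI // setICl -Phi_cind //.
  rewrite (_ : cind set0 = fun=> 0) ?Phi_cst ?scale0r //.
  by apply/funext => s; rewrite cind_out.
by rewrite eD in h.
Qed.

Lemma concentratedT : concentrated setT.
Proof. by split=> //; exact: sp_setT. Qed.

(** By [Phi_hn2] the squared distance of the two vectors is the integral of [|g n - f|^2] against a
    finite measure, to which dominated convergence applies. *)
Lemma Phi_cv D (g : nat -> R -> R[i]) f c x : concentrated D ->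
  (forall n, bm (g n)) -> bm f -> (forall n s, D s -> cn (g n s) <= c) ->
  (forall s, D s -> (fun n => cn (g n s - f s)) @ \oo --> (0 : R)) ->
  cv (fun n => Phi (g n) x) (Phi f x).
Proof.
move=> cD bg bf hc hl; have [mD _] := cD; have [d d0 hd] := bm_ge0 bf.
have nD := concentrated_null x cD.
have bgf n : bm (fun s => g n s - f s) by exact: bm_B.
have ae (P : R -> Prop) : (forall s, D s -> P s) -> \forall s \ae (mu x : {measure set T -> \bar R}), P s.
  move=> hP; exists (~` D); split => //; first exact: measurableC.
  by move=> s /= nP Ds; apply: nP; exact: hP.
have m2 n : measurable_fun [set: T] (fun s : T => cn (g n s - f s) ^+ 2 : R).
  by apply: measurable_funX; apply: mC_cn; case: (bgf n).
pose F n (s : T) := (cn (g n s - f s) ^+ 2)%:E.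
have mF n : measurable_fun setT (F n) by apply/measurable_EFinP; exact: m2.
have Fcv : \forall s \ae mu x, setT s -> F n s @[n --> \oo] --> (fun _ : T => 0%:E) s.
  apply: ae => s Ds _; apply/cvg_EFin; first exact: nearW.
  rewrite -[X in _ --> X](mulr0 0) /=.
  have -> : fine \o F^~ s = (fun n => cn (g n s - f s) * cn (g n s - f s)).
    by apply/funext => n; rewrite /= expr2.
  by apply: cvgM; exact: hl.
have Gint : (mu x).-integrable setT (fun _ : T => ((`|c| + d) ^+ 2)%:E).
  apply: (@bm_integrable _ _ _ (fun=> (`|c| + d) ^+ 2) `|(`|c| + d) ^+ 2|) => //; exact: mu_finT.
have Fdom : \forall s \ae mu x, forall n, setT s -> (`|F n s| <= ((`|c| + d) ^+ 2)%:E)%E.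
  apply: ae => s Ds n _; rewrite /F abse_EFin lee_fin ger0_norm ?sqr_ge0 //.
  rewrite ler_sqr ?nnegrE ?cn_ge0 ?addr_ge0 //; apply: (le_trans (cnB _ _)); rewrite lerD //.
  exact: le_trans (hc n s Ds) (ler_norm _).
have [_ _] := dominated_convergence measurableT mF (measurable_cst _) Fcv Gint Fdom.
rewrite integral0.
move=> /fine_cvg /= c0.
have {}c0 : (fun n => hn (Phi (g n) x - Phi f x) ^+ 2) @ \oo --> (0 : R).
  rewrite (_ : (fun n => _) = fine \o (fun n => (\int[mu x]_s F n s)%E)) //.
  by apply/funext => n; rewrite -Phi_B // Phi_hn2.
apply/cvP => e e0; have [N hN] := (rcvg0P _).1 c0 _ (exprn_gt0 2 e0).
exists N => n /hN; rewrite ger0_norm ?sqr_ge0 // ltr_sqr ?nnegrE ?hn_ge0 ?(ltW e0) //.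
Qed.

Lemma Phi_eq D f g x : concentrated D -> bm f -> bm g -> (forall s, D s -> f s = g s) ->
  Phi f x = Phi g x.
Proof.
move=> cD bf bg fg; apply: (@cv_unique _ _ (fun=> Phi f x)); first exact: cv_cst.
have [c _ hc] := bm_ge0 bf.
apply: (@Phi_cv D _ _ c) => // s Ds; rewrite fg // subrr.
by under eq_fun do rewrite cn0; exact: cvg_cst.
Qed.

End Calculus.

(** * Unbounded Borel functions, as graphs tested on level sets *)

Section UnboundedCalculus.
Variables (R : realType) (H : hilbert R).
Local Notation T := (measurableTypeR R).
Implicit Types (f g h : R -> R[i]) (B : set R) (x y : H) (E : spectral_measure H).

Definition lev f (n : nat) : set R := [set s | cn (f s) <= n%:R].

Lemma measurable_lev f n : mC f -> measurable (lev f n : set R).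
Proof.
move=> mf; rewrite (_ : lev f n = setT `&` (fun s : T => cn (f s)) @^-1` `]-oo, n%:R]).
  by apply: (mC_cn mf) => //; exact: measurable_itv.
by apply/seteqP; split=> s /=; rewrite in_itv /=; [|case].
Qed.

Lemma bm_lev f n : mC f -> bm (cind (lev f n)).
Proof. by move=> mf; apply: bm_cind; exact: measurable_lev. Qed.

Lemma bm_cut f n : mC f -> bm (fun s => f s * cind (lev f n) s).
Proof.
move=> mf; split; first by apply: mC_M => //; case: (bm_lev n mf).
exists n%:R => s; rewrite cindE; case: ifPn => [|_]; rewrite ?mulr1 ?mulr0 ?cn0 //.
by rewrite inE.
Qed.

Lemma lev_in f s (n : nat) : (Num.bound (cn (f s)) <= n)%N -> lev f n s.
Proof.
move=> h; rewrite /lev /=; apply: (le_trans (ltW (archi_boundP (cn_ge0 _)))).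
by rewrite ler_nat.
Qed.

Lemma lev_eventually f s : (fun n => cn (cind (lev f n) s - 1)) @ \oo --> (0 : R).
Proof.
apply/rcvg0P => e e0; exists (Num.bound (cn (f s))) => n h.
by rewrite cind_in ?subrr ?cn0 ?normr0 //; exact: lev_in.
Qed.

(* The (unbounded) integral of [f]: [y = f(E) x] is tested on the sets where [|f| <= n]. *)
Definition Fop E f : H ~> H := [set p | forall n,
  Phi E (cind (lev f n)) p.2 = Phi E (fun s => f s * cind (lev f n) s) p.1].

Variable E : spectral_measure H.
Local Notation mu := (sp_mu E).
Local Notation Ph := (Phi E).
Local Notation Op := (Fop E).

Lemma Phi_approx_id D (e : nat -> R -> R[i]) c x : concentrated E D ->
  (forall n, bm (e n)) -> (forall n s, D s -> cn (e n s) <= c) ->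
  (forall s, D s -> (fun n => cn (e n s - 1)) @ \oo --> (0 : R)) ->
  cv (fun n => Ph (e n) x) x.
Proof.
move=> cD be ec e1; rewrite -{2}[x]/(id x) -(Phi_1 E).
by apply: (@Phi_cv _ _ _ D _ _ c) => //; exact: bm_cst.
Qed.

Lemma lev_cv f x : mC f -> cv (fun n => Ph (cind (lev f n)) x) x.
Proof.
move=> mf; apply: (Phi_approx_id (c := 1) _ (concentratedT E)).
- by move=> n; exact: bm_lev.
- by move=> n s _; exact: cn_cind.
- by move=> s _; exact: lev_eventually.
Qed.

Lemma Op_mul f h x y : mC f -> Op f (x, y) -> bm h -> bm (fun s => h s * f s) ->
  Ph h y = Ph (fun s => h s * f s) x.
Proof.
move=> mf Oxy bh bhf.
apply: (@cv_unique _ _ (fun n => Ph h (Ph (cind (lev f n)) y))).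
  by apply: bop_cv; [exact: Phi_bop|exact: lev_cv].
rewrite (_ : (fun n => _) = (fun n => Ph (fun s => h s * f s) (Ph (cind (lev f n)) x))).
  by apply: bop_cv; [exact: Phi_bop|exact: lev_cv].
apply/funext => n; have := Oxy n => /= ->.
rewrite -Phi_mul //; last exact: bm_cut.
rewrite -Phi_mul //; last exact: bm_lev.
by congr (Phi _ _ x); apply/funext => s; rewrite mulrA.
Qed.

(** Any bounded approximate unit [e n] with [e n * f] bounded may replace the level sets of [f] in
    the definition of [Fop]; in this way several functions are cut at once. *)
Lemma Op_intro D (e : nat -> R -> R[i]) c f x y : concentrated E D -> mC f ->
  (forall n, bm (e n)) -> (forall n, bm (fun s => e n s * f s)) ->
  (forall n s, D s -> cn (e n s) <= c) ->
  (forall s, D s -> (fun n => cn (e n s - 1)) @ \oo --> (0 : R)) ->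
  (forall n, Ph (e n) y = Ph (fun s => e n s * f s) x) -> Op f (x, y).
Proof.
move=> cD mf be bef ec e1 hxy k /=.
have bk := bm_lev k mf; have bck := bm_cut k mf.
apply: (@cv_unique _ _ (fun n => Ph (cind (lev f k)) (Ph (e n) y))).
  by apply: bop_cv; [exact: Phi_bop|exact: (Phi_approx_id y cD be ec e1)].
rewrite (_ : (fun n => _) = (fun n => Ph (e n) (Ph (fun s => f s * cind (lev f k) s) x))).
  exact: (Phi_approx_id _ cD be ec e1).
apply/funext => n; rewrite hxy -Phi_mul // -Phi_mul //.
by congr (Phi _ _ x); apply/funext => s; ring.
Qed.

Lemma Op_bm f h x : mC f -> bm h -> bm (fun s => f s * h s) ->
  Op f (Ph h x, Ph (fun s => f s * h s) x).
Proof.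
move=> mf bh bfh n /=; rewrite -Phi_mul //; last exact: bm_lev.
rewrite -Phi_mul //; last exact: bm_cut.
by congr (Phi _ _ x); apply/funext => s; rewrite mulrCA mulrA.
Qed.

Lemma Op_fun f x y y' : mC f -> Op f (x, y) -> Op f (x, y') -> y = y'.
Proof.
move=> mf h h'; apply: (cv_unique (lev_cv y mf)).
rewrite (_ : (fun n => _) = (fun n => Ph (cind (lev f n)) y')); first exact: lev_cv.
by apply/funext => n; have := h n; have := h' n => /= -> ->.
Qed.

Lemma Op_lin f c x y x' y' : mC f -> Op f (x, y) -> Op f (x', y') ->
  Op f (c *: x + x', c *: y + y').
Proof.
move=> mf h h' n /=; rewrite !(Phi_linear _ (bm_lev n mf)) !(Phi_linear _ (bm_cut n mf)).
by have := h n; have := h' n => /= -> ->.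
Qed.

Lemma Op_0 f : mC f -> Op f (0, 0).
Proof.
by move=> mf n /=; rewrite (lin_0 (Phi_linear _ (bm_lev n mf))) (lin_0 (Phi_linear _ (bm_cut n mf))).
Qed.

Lemma Op_closed f (u v : nat -> H) x y : mC f -> (forall n, Op f (u n, v n)) ->
  cv u x -> cv v y -> Op f (x, y).
Proof.
move=> mf h ux vy n /=.
apply: (cv_unique (bop_cv (Phi_bop E (bm_lev n mf)) vy)).
rewrite (_ : (fun k => _) = (fun k => Ph (fun s => f s * cind (lev f n) s) (u k))).
  by apply: bop_cv => //; apply: Phi_bop; exact: bm_cut.
by apply/funext => k; have := h k n.
Qed.

Lemma Op_comm f h x y : mC f -> bm h -> Op f (x, y) -> Op f (Ph h x, Ph h y).
Proof.
move=> mf bh Oxy n /=; have bl := bm_lev n mf; have bc := bm_cut n mf.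
by rewrite Phi_comm //; have := Oxy n => /= ->; rewrite Phi_comm.
Qed.

Lemma Op_dense f : mC f -> closure (dom (Op f)) = setT.
Proof.
move=> mf; apply/seteqP; split=> // x _.
apply: (@cv_closure _ _ _ (fun n => Ph (cind (lev f n)) x)); last exact: lev_cv.
move=> n; exists (Ph (fun s => f s * cind (lev f n) s) x).
by apply: Op_bm => //; [exact: bm_lev|exact: bm_cut].
Qed.

Lemma lev_conj f n : lev (fun s => (f s)^*) n = lev f n.
Proof. by apply/seteqP; split=> s; rewrite /lev /= cn_conj. Qed.

Lemma conj_cind B s : (cind B s)^* = cind B s :> R[i].
Proof. by rewrite /cind conj_realC. Qed.

(** Truncated vectors lie in the domain, and pairing with them tests the adjoint relation level by
    level. *)
Lemma Op_adjoint f : mC f -> adjoint (Op f) = Op (fun s => (f s)^*).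
Proof.
move=> mf; have mfc := mC_conj mf; apply/seteqP; split=> [[a b] h|[a b] Oab].
- move=> n /=; rewrite lev_conj; apply: ip_inj => z.
  have bl := bm_lev n mf; have bc := bm_cut n mf.
  have := h _ _ (Op_bm z mf bl bc) => /= e.
  rewrite ipC [RHS]ipC; congr (_^*).
  have bl' : bm (fun s => (cind (lev f n) s)^*) by apply: bm_conj.
  rewrite !Phi_ip // in e.
  have <- : (fun s => (cind (lev f n) s)^*) = cind (lev f n) by apply/funext => s; rewrite conj_cind.
  rewrite -e; congr (<|z, Phi _ _ a|>); apply/funext => s.
  by rewrite conjM.
- move=> x y Oxy /=.
  have c1 := lev_cv y mf; have c2 := lev_cv b mf.
  apply: (cv_ip_eq c1 (cv_cst a) (cv_cst x) c2) => n.
  have := Oxy n => /= ->; have := Oab n; rewrite lev_conj /= => ->.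
  rewrite Phi_ip; last exact: bm_cut.
  by congr (<|x, Phi _ _ a|>); apply/funext => s; rewrite conjM conj_cind.
Qed.

Lemma Op_bounded f : bm f -> Op f = gr (Ph f).
Proof.
move=> bf; have [mf _] := bf; apply/seteqP; split=> [[x y] h|[x y] /= h].
  have := Op_mul mf h (bm_cst 1).
  rewrite Phi_1 (_ : (fun s => 1 * f s) = f); first by apply.
  by apply/funext => s; rewrite mul1r.
rewrite /gr /= in h; rewrite h.
have := Op_bm x mf (bm_cst 1); rewrite Phi_1 (_ : (fun s => f s * 1) = f); first by apply.
by apply/funext => s; rewrite mulr1.
Qed.

Lemma Op_eqD D f g : concentrated E D -> mC f -> mC g -> (forall s, D s -> f s = g s) ->
  Op f = Op g.
Proof.
move=> cD; suff sub f' g' : mC f' -> mC g' -> (forall s, D s -> f' s = g' s) -> Op f' `<=` Op g'.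
  by move=> mf mg fg; apply/seteqP; split; apply: sub => // s Ds; rewrite fg.
move=> mf mg fg [x y] h n /=.
have := h n => /= hn1.
rewrite -(Phi_eq y cD (bm_lev n mf) (bm_lev n mg)) ?hn1.
  apply: (Phi_eq _ cD) => [||s Ds]; [exact: bm_cut|exact: bm_cut|].
  rewrite fg //; congr (_ * _); rewrite !cindE; congr (if _ then _ else _).
  by apply/idP/idP; rewrite !inE /lev /= fg.
move=> s Ds; rewrite !cindE; congr (if _ then _ else _).
by apply/idP/idP; rewrite !inE /lev /= fg.
Qed.

Lemma lev2_cv f g s :
  (fun n => cn (cind (lev f n) s * cind (lev g n) s - 1)) @ \oo --> (0 : R).
Proof.
apply/rcvg0P => e e0; exists (maxn (Num.bound (cn (f s))) (Num.bound (cn (g s)))) => n h.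
rewrite cind_in; last by apply: lev_in; apply: leq_trans h; rewrite leq_maxl.
rewrite cind_in; last by apply: lev_in; apply: leq_trans h; rewrite leq_maxr.
by rewrite mulr1 subrr cn0 normr0.
Qed.

Section Comp.
Variables (f g : R -> R[i]).
Hypotheses (mf : mC f) (mg : mC g).
(** Cuts [f] and [g] together, so that its products with [f], with [g] and with [g f] are all
    bounded. *)
Let e n s := cind (lev f n) s * cind (lev g n) s.
Let be n : bm (e n). Proof. by apply: bm_M; exact: bm_lev. Qed.

Let bef n : bm (fun s => e n s * f s).
Proof.
rewrite (_ : (fun s => _) = (fun s => (f s * cind (lev f n) s) * cind (lev g n) s)).
  by apply: bm_M; [exact: bm_cut|exact: bm_lev].
by apply/funext => s; rewrite /e; ring.
Qed.

Let beg n : bm (fun s => e n s * g s).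
Proof.
rewrite (_ : (fun s => _) = (fun s => (g s * cind (lev g n) s) * cind (lev f n) s)).
  by apply: bm_M; [exact: bm_cut|exact: bm_lev].
by apply/funext => s; rewrite /e; ring.
Qed.

Let begf n : bm (fun s => e n s * g s * f s).
Proof.
rewrite (_ : (fun s => _) = (fun s => (f s * cind (lev f n) s) * (g s * cind (lev g n) s))).
  by apply: bm_M; exact: bm_cut.
by apply/funext => s; rewrite /e; ring.
Qed.

Let ec n s : setT s -> cn (e n s) <= 1.
Proof.
by move=> _; rewrite cnM -[leRHS]mulr1 ler_pM ?cn_ge0 ?cn_cind.
Qed.

Lemma Op_comp x y z : Op f (x, y) -> Op g (y, z) -> Op (fun s => g s * f s) (x, z).
Proof.
move=> h1 h2; apply: (Op_intro (concentratedT E) _ be _ ec); first exact: mC_M.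
- move=> n; rewrite (_ : (fun s => _) = (fun s => e n s * g s * f s)) //.
  by apply/funext => s; rewrite mulrA.
- by move=> s _; exact: lev2_cv.
move=> n; rewrite (Op_mul mg h2) // (Op_mul mf h1) //.
by congr (Phi _ _ x); apply/funext => s; rewrite mulrA.
Qed.

Lemma Op_decomp x y z : Op f (x, y) -> Op (fun s => g s * f s) (x, z) -> Op g (y, z).
Proof.
move=> h1 h2; apply: (Op_intro (concentratedT E) _ be _ ec) => //.
- by move=> s _; exact: lev2_cv.
have begf' n : bm (fun s => e n s * (g s * f s)).
  by rewrite (_ : (fun s => _) = (fun s => e n s * g s * f s)) //; apply/funext => s; rewrite mulrA.
move=> n; rewrite (Op_mul (mC_M mg mf) h2) // (Op_mul mf h1) //.
by congr (Phi _ _ x); apply/funext => s; rewrite mulrA.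
Qed.

End Comp.

Lemma Op_inv D f g x y : concentrated E D -> mC f -> mC g ->
  (forall s, D s -> g s * f s = 1) -> Op f (x, y) -> Op g (y, x).
Proof.
move=> cD mf mg gf h; apply: (Op_decomp mf mg h).
rewrite (Op_eqD cD (mC_M mg mf) (mC_cst 1) gf) Op_bounded; last exact: bm_cst.
by rewrite /gr /= Phi_1.
Qed.

(** On a level set of [f] the form is the squared norm of the vector obtained from [x] by the
    truncated square root of [f]. *)
Lemma Op_ge0 D (f : R -> R) x y : concentrated E D -> mC (fun s => (f s)%:C%C) ->
  (forall s, D s -> 0 <= f s) -> Op (fun s => (f s)%:C%C) (x, y) -> 0 <= <|y, x|>.
Proof.
move=> cD mf f0 h; set F := (fun s => _) in mf h.
pose g s : R[i] := (Num.sqrt (f s))%:C%C.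
have m1 : measurable_fun [set: T] (f : T -> R).
  by have [m1 _] := mf.
have mg : mC g.
  apply: mC_real; apply: (measurableT_comp _ m1).
  by apply: continuous_measurable_fun; exact: sqrt_continuous.
have key n : <|Ph (cind (lev F n)) y, x|> =
    ((hn (Ph (fun s => g s * cind (lev F n) s) x)) ^+ 2)%:C%C.
  have := h n => /= ->.
  have bgc : bm (fun s => g s * cind (lev F n) s).
    split; first by apply: mC_M => //; case: (bm_lev n mf).
    exists (n%:R + 1) => s; rewrite cindE; case: ifPn => [|_]; last by rewrite mulr0 cn0 addr_ge0.
    rewrite inE /lev /= /F cn_real => hf; rewrite mulr1 /g cn_real ger0_norm ?sqrtr_ge0 //.
    rewrite -ler_sqr ?nnegrE ?sqrtr_ge0 ?addr_ge0 //.
    have [f0'|f0'] := leP 0 (f s); last by rewrite ler0_sqrtr ?(ltW f0') // expr0n sqr_ge0.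
    rewrite sqr_sqrtr //; have := le_trans (ler_norm _) hf; have : 0 <= n%:R :> R by []. 
    by move: (n%:R) => q; nra.
  rewrite -ipxx [RHS]Phi_ip // -Phi_mul //; last exact: bm_conj.
  rewrite Phi_ip; last exact: bm_cut.
  apply: congr1; apply: (Phi_eq _ cD).
  - by apply: bm_conj; exact: bm_cut.
  - by apply: bm_M => //; exact: bm_conj.
  move=> s Ds; rewrite !conjM !conj_cind /F /g !conj_realC.
  have gg : (Num.sqrt (f s))%:C%C * (Num.sqrt (f s))%:C%C = (f s)%:C%C :> R[i].
    by rewrite -rmorphM -expr2 sqr_sqrtr ?f0.
  rewrite mulrACA gg.
  by congr (_ * _); rewrite !cindE; case: ifP; rewrite ?(mulr1, mulr0).
apply/complex_ge0P; split.
  have := cv_ip_im (lev_cv y mf) (cv_cst x).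
  rewrite (_ : (fun n => _) = fun=> 0); last by apply/funext => n; rewrite key.
  by move=> c1; apply: (cvg_unique (@Rhausdorff R) c1); exact: cvg_cst.
have c1 := cv_ip_re (lev_cv y mf) (cv_cst x).
apply: (ler_cvg_to (cvg_cst 0) c1); apply: nearW => n.
by rewrite key /= sqr_ge0.
Qed.

End UnboundedCalculus.

Lemma ltr_dist_half (R : realType) (a b c d : R) :
  `|a - b| < d / 2 -> `|a - c| < d / 2 -> b - c < d.
Proof. by rewrite !ltr_distl => /andP[? ?] /andP[? ?]; lra. Qed.

(** * Spectral integrals are the concrete operators [Fop] *)

Section SpectralIntegral.
Variables (R : realType) (H : hilbert R) (E : spectral_measure H).
Local Notation T := (measurableTypeR R).
Local Notation mu := (sp_mu E).
Local Notation Ph := (Phi E).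
Local Notation Op := (Fop E).
Implicit Types (f g h : R -> R[i]) (x y : H).

Section Dom.
Variables (f : R -> R[i]) (x : H).
Hypothesis mf : mC f.
Let u n := Ph (fun s => f s * cind (lev f n) s) x.
Let F n (s : T) : \bar R := (cn (f s * cind (lev f n) s) ^+ 2)%:E.
Let bc n := bm_cut n mf.
Let bl n := bm_lev n mf.

Let mF n : measurable_fun setT (F n).
Proof. by apply/measurable_EFinP; apply: measurable_funX; apply: mC_cn; case: (bc n). Qed.

Let FE n : (\int[mu x]_s F n s)%E = (hn (u n) ^+ 2)%:E.
Proof.
rewrite /u (Phi_hn2 _ _ (bc n)) /Rintegral fineK //.
have [c c0 hc] := bm_ge0 (bc n).
apply: integrable_fin_num => //.
apply: (@bm_integrable _ (mu x) _ (fun s => cn (f s * cind (lev f n) s) ^+ 2) (c ^+ 2)).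
- exact: mu_finT.
- by apply: measurable_funX; apply: mC_cn; case: (bc n).
- by move=> s; rewrite ger0_norm ?sqr_ge0 // ler_sqr ?nnegrE ?cn_ge0.
Qed.

Let umn m n : (m <= n)%N -> u m = Ph (cind (lev f m)) (u n).
Proof.
move=> mn; rewrite /u -Phi_mul //; congr (Phi _ _ x); apply/funext => s.
rewrite !cindE; case: ifPn => [|_]; last by rewrite mul0r mulr0.
by rewrite inE /lev /= => h; rewrite mem_set ?mul1r //= (le_trans h) // ler_nat.
Qed.

Let u_dist m n : (m <= n)%N -> hn (u n - u m) ^+ 2 = hn (u n) ^+ 2 - hn (u m) ^+ 2.
Proof.
move=> mn; rewrite hnB2; suff -> : complex.Re <|u n, u m|> = hn (u m) ^+ 2 by ring.
rewrite {1}(umn mn) hn2E (umn mn).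
rewrite [in RHS]Phi_ip // -[in RHS]Phi_mul; [|by apply: bm_conj|by []].
rewrite (_ : (fun s => (cind (lev f m) s)^* * _) = cind (lev f m)) //.
by apply/funext => s; rewrite conj_cind cindE; case: ifP; rewrite ?mulr1 ?mulr0.
Qed.

Let F_cvg : (fun n => (\int[mu x]_s F n s)%E) @ \oo -->
  (\int[mu x]_s (complex.Re (f s) ^+ 2 + complex.Im (f s) ^+ 2)%:E)%E.
Proof.
have := @cvg_monotone_convergence _ T R (mu x) setT measurableT F mF.
have F0 n (s : T) : setT s -> (0 <= F n s)%E by rewrite lee_fin sqr_ge0.
have Fnd (s : T) : setT s -> {homo F^~ s : n m / (n <= m)%N >-> (n <= m)%E}.
  move=> _ m n mn; rewrite lee_fin ler_sqr ?nnegrE ?cn_ge0 //.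
  rewrite !cindE; case: ifPn => [|_]; last by rewrite mulr0 cn0 cn_ge0.
  by rewrite inE /lev /= => h; rewrite mem_set //= (le_trans h) // ler_nat.
move=> /(_ F0 Fnd).
rewrite (_ : (\int[mu x]_s limn (F^~ s))%E =
  (\int[mu x]_s (complex.Re (f s) ^+ 2 + complex.Im (f s) ^+ 2)%:E)%E) //.
apply: eq_integral => s _.
apply/cvg_lim => //; apply/cvg_EFin; first exact: nearW.
rewrite -cn_sqr; apply: (@cvg_near_cst _ _ _ _ _ _) => //=.
exists (Num.bound (cn (f s))) => // n /= h.
by rewrite /F /= cind_in ?mulr1 //; exact: lev_in.
Qed.

(** [|u n|^2] increases to the integral by monotone convergence. If the integral is finite, the
    increments of [u], being orthogonal, make it Cauchy, and its limit is the image of [x]. *)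
Lemma Op_dom : (exists y, Op f (x, y)) <->
  (\int[mu x]_s (complex.Re (f s) ^+ 2 + complex.Im (f s) ^+ 2)%:E < +oo)%E.
Proof.
split=> [[y Oxy]|fin].
  apply: (@le_lt_trans _ _ (hn y ^+ 2)%:E); last exact: ltry.
  rewrite -(cvg_lim _ F_cvg) //; apply: lime_le; first by apply: cvgP F_cvg.
  apply: nearW => n; rewrite FE lee_fin ler_sqr ?nnegrE ?hn_ge0 //.
  have := Oxy n; rewrite /u /= => <-.
  by rewrite -[leRHS]mul1r; apply: Phi_bdd => // s; exact: cn_cind.
set L := (\int[mu x]_s _)%E in fin.
have L0 : (0 <= L)%E.
  by apply: integral_ge0 => s _; rewrite lee_fin addr_ge0 ?sqr_ge0.
have Lf : L \is a fin_num by rewrite ge0_fin_numE.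
have uc : (fun n => hn (u n) ^+ 2) @ \oo --> fine L.
  rewrite (_ : (fun n => _) = fine \o (fun n => (\int[mu x]_s F n s)%E)).
    by apply: fine_cvg; rewrite (fineK Lf).
  by apply/funext => n; rewrite /= FE.
have [y uy] : exists y, cv u y.
  apply: hilbert_complete => e e0.
  have e2 : 0 < e ^+ 2 / 2 by rewrite divr_gt0 // exprn_gt0.
  have [N _ hN] := cvgr_dist_lt _ _ uc _ e2.
  have key m n : (N <= m)%N -> (m <= n)%N -> hn (u n - u m) < e.
    move=> Nm mn; rewrite -ltr_sqr ?nnegrE ?hn_ge0 ?(ltW e0) // u_dist //.
    exact: ltr_dist_half (hN n (leq_trans Nm mn)) (hN m Nm).
  exists N => m n Nm Nn; have [mn|nm] := leqP m n; first by rewrite hnBC; exact: key.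
  by apply: key => //; exact: ltnW.
exists y => k /=.
apply: (cv_unique (bop_cv (Phi_bop E (bl k)) uy)).
apply/cvP => e e0; exists k => n kn.
by rewrite -(umn kn) /u subrr hn0.
Qed.

Lemma Op_form y : Op f (x, y) -> <|y, x|> = CI (mu x) f.
Proof.
move=> Oxy.
have fin : (\int[mu x]_s (complex.Re (f s) ^+ 2 + complex.Im (f s) ^+ 2)%:E < +oo)%E.
  by apply/Op_dom; exists y.
have mf2 : measurable_fun [set: T] (fun s : T => 1 + cn (f s) ^+ 2).
  by apply: measurable_funD; [exact: measurable_cst|apply: measurable_funX; exact: mC_cn].
(* [1 + |f|^2] dominates [|f|] and is integrable because [x] is in the domain. *)
have Gint : (mu x).-integrable setT (fun s : T => (1 + cn (f s) ^+ 2)%:E).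
  apply/integrableP; split; first exact/measurable_EFinP.
  have -> : (\int[mu x]_s `|(1 + cn (f s) ^+ 2)%:E| =
     \int[mu x]_s (1%:E + (complex.Re (f s) ^+ 2 + complex.Im (f s) ^+ 2)%:E))%E.
    by apply: eq_integral => s _; rewrite abse_EFin ger0_norm ?addr_ge0 ?sqr_ge0 // cn_sqr.
  rewrite ge0_integralD //; last 2 first.
  - by move=> s _; rewrite lee_fin addr_ge0 ?sqr_ge0.
  - apply/measurable_EFinP; have [m1 m2] := mf.
    by apply: measurable_funD; exact: measurable_funX.
  apply: lte_add_pinfty => //; rewrite integral_cst // mul1e.
  exact: mu_finT.
have lem (v : nat -> T -> R) (w : T -> R) : (forall n, measurable_fun [set: T] (v n)) ->
   measurable_fun [set: T] w ->
   (forall n s, `|v n s| <= cn (f s)) -> (forall s, (fun n => v n s) @ \oo --> w s) ->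
   (fun n => \int[mu x]_s v n s) @ \oo --> \int[mu x]_s w s.
  move=> mv mw vf vw.
  have mv' n : measurable_fun setT (EFin \o v n) by exact/measurable_EFinP.
  have mw' : measurable_fun setT (EFin \o w) by exact/measurable_EFinP.
  have h1 : \forall s \ae mu x, setT s -> (EFin \o v n) s @[n --> \oo] --> (EFin \o w) s.
    apply: aeW => s _; apply/cvg_EFin; first exact: nearW.
    exact: vw.
  have h2 : \forall s \ae mu x, forall n, setT s -> (`|(EFin \o v n) s| <= (1 + cn (f s) ^+ 2)%:E)%E.
    apply: aeW => s n _; rewrite /= lee_fin; apply: (le_trans (vf n s)).
    have := cn_ge0 (f s); move: (cn (f s)) => c c0.
    by have := sqr_ge0 (c - 1); nra.
  have [wi _ cw] := dominated_convergence measurableT mv' mw' h1 Gint h2.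
  apply: fine_cvg; rewrite fineK //.
  exact: integrable_fin_num.
have [m1 m2] := mf.
have key n : <|Ph (cind (lev f n)) y, x|> = CI (mu x) (fun s => f s * cind (lev f n) s).
  by have := Oxy n => /= ->; rewrite Phi_form.
have ev s : (fun n => f s * cind (lev f n) s - f s) = (fun n => f s * (cind (lev f n) s - 1)).
  by apply/funext => n; rewrite mulrBr mulr1.
have evc s : (fun n => cn (f s * cind (lev f n) s - f s)) @ \oo --> (0 : R).
  rewrite -[X in _ --> X](mulr0 (cn (f s))).
  under eq_fun do rewrite -[X in _ - X]mulr1 -mulrBr cnM.
  by apply: cvgMr; exact: lev_eventually.
have cutle n s : cn (f s * cind (lev f n) s) <= cn (f s).
  by rewrite cnM ler_piMr ?cn_ge0 ?cn_cind.
apply: complex_eq.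
  have := cv_ip_re (lev_cv E y mf) (cv_cst x).
  rewrite (_ : (fun n => _) = fun n => \int[mu x]_s complex.Re (f s * cind (lev f n) s)); last first.
    by apply/funext => n; rewrite key.
  move=> c1; apply: (cvg_unique (@Rhausdorff R) c1).
  apply: lem => // [n|n s|s].
  - by case: (bc n) => - [].
  - exact: le_trans (Re_le_cn _) (cutle n s).
  - apply: rcvg_squeeze (evc s) => n.
    by rewrite -ReN -ReD; exact: Re_le_cn.
have := cv_ip_im (lev_cv E y mf) (cv_cst x).
rewrite (_ : (fun n => _) = fun n => \int[mu x]_s complex.Im (f s * cind (lev f n) s)); last first.
  by apply/funext => n; rewrite key.
move=> c1; apply: (cvg_unique (@Rhausdorff R) c1).
apply: lem => // [n|n s|s].
- by case: (bc n) => - [].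
- exact: le_trans (Im_le_cn _) (cutle n s).
- apply: rcvg_squeeze (evc s) => n.
  by rewrite -ImN -ImD; exact: Im_le_cn.
Qed.

End Dom.

Lemma spectral_integral_Op f : mC f -> spectral_integral E f (Op f).
Proof.
move=> mf; split.
- exact: Op_0.
- by move=> c x y x' y'; exact: Op_lin.
- by move=> x; rewrite -Op_dom.
- by move=> x y /Op_form -> .
Qed.

(** The predicate fixes only a domain and a form; on the common dense domain polarization determines
    the values. *)
Lemma spectral_integral_uniq f T' : mC f -> spectral_integral E f T' -> T' = Op f.
Proof.
move=> mf [T0 Tl Td Tf].
have dE x : dom T' x <-> dom (Op f) x by rewrite Td -Op_dom.
have key x a b : T' (x, a) -> Op f (x, b) -> <|a - b, x|> = 0.
  by move=> ha hb; rewrite ipBl Tf // (Op_form mf hb) subrr.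
have T'D x a x' a' : T' (x, a) -> T' (x', a') -> T' (x + x', a + a').
  by move=> h h'; have := Tl 1 _ _ _ _ h h'; rewrite !scale1r.
have OD x a x' a' : Op f (x, a) -> Op f (x', a') -> Op f (x + x', a + a').
  by move=> h h'; have := Op_lin 1 mf h h'; rewrite !scale1r.
have eqTO x a b : T' (x, a) -> Op f (x, b) -> a = b.
  move=> ha hb; apply/eqP; rewrite -subr_eq0; apply/eqP.
  apply: (dense_orth (Op_dense E mf)) => x' [b' hb'].
  have [a' ha'] : dom T' x' by apply/dE; exists b'.
  apply: (@polar0 _ _ x x' (a - b) (a' - b')).
  - exact: key.
  - exact: key.
  - by rewrite addrACA -opprD; apply: key; [exact: T'D|exact: OD].
  - rewrite scalerBr addrACA -opprD.
    apply: key; first by rewrite [x + _]addrC [a + _]addrC; exact: Tl.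
    by rewrite [x + _]addrC [b + _]addrC; exact: Op_lin.
apply/seteqP; split=> [[x a] ha|[x b] hb].
  have [b hb] : dom (Op f) x by apply/dE; exists a.
  by rewrite (eqTO _ _ _ ha hb).
have [a ha] : dom T' x by apply/dE; exists b.
by rewrite -(eqTO _ _ _ ha hb).
Qed.

Lemma Op_dom_le f g x z : mC f -> mC g -> (forall s, cn (f s) <= cn (g s) + 1) ->
  Op g (x, z) -> exists y, Op f (x, y).
Proof.
move=> mf mg fg Oxz; have [m1 m2] := mf; have [n1 n2] := mg.
have fin : (\int[mu x]_s (complex.Re (g s) ^+ 2 + complex.Im (g s) ^+ 2)%:E < +oo)%E.
  by apply/Op_dom => //; exists z.
apply/Op_dom => //.
apply: (@le_lt_trans _ _ (\int[mu x]_s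
   (2%:E * (complex.Re (g s) ^+ 2 + complex.Im (g s) ^+ 2)%:E + 2%:E))%E).
  apply: ge0_le_integral => //.
  - by move=> s _; rewrite lee_fin addr_ge0 ?sqr_ge0.
  - by apply/measurable_EFinP; apply: measurable_funD; exact: measurable_funX.
  - apply: emeasurable_funD => //; apply: emeasurable_funM => //.
    by apply/measurable_EFinP; apply: measurable_funD; exact: measurable_funX.
  - move=> s _; rewrite -EFinM -EFinD lee_fin -!cn_sqr.
    have := fg s; have := cn_ge0 (f s); have := cn_ge0 (g s).
    move: (cn (f s)) (cn (g s)) => a b b0 a0 ab.
    have := sqr_ge0 (b - 1); nra.
rewrite ge0_integralD //.
- rewrite ge0_integralZl //.
  + apply: lte_add_pinfty; last by rewrite integral_cst //; apply: lte_mul_pinfty => //; exact: mu_finT.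
    by apply: lte_mul_pinfty.
  + by apply/measurable_EFinP; apply: measurable_funD; exact: measurable_funX.
  + by move=> s _; rewrite lee_fin addr_ge0 ?sqr_ge0.
- by move=> s _; rewrite -EFinM lee_fin mulr_ge0 // addr_ge0 ?sqr_ge0.
- apply: emeasurable_funM => //.
  by apply/measurable_EFinP; apply: measurable_funD; exact: measurable_funX.
Qed.

End SpectralIntegral.

Section ElementaryBounds.
Variable R : realType.
Implicit Types x y : R.

Lemma mvt_bound (f df : R -> R) (k x : R) : (forall y, is_derive y 1 f (df y)) ->
  (forall y, `|y| <= `|x| -> `|df y| <= k) -> `|f x - f 0| <= k * `|x|.
Proof.
move=> fdf hk.
have cf (a b : R) : {within `[a, b], continuous f}.
  apply: continuous_subspaceT => y; apply: differentiable_continuous.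
  by apply/derivable1_diffP; case: (fdf y).
have [x0|x0] := leP 0 x.
  have [c /andP[c0 cx] ->] := @MVT_segment _ f df 0 x x0 (fun y _ => fdf y) (cf _ _).
  rewrite subr0 normrM ler_wpM2r // hk // !ger0_norm //.
have [c /andP[c0 cx] e] := @MVT_segment _ f df x 0 (ltW x0) (fun y _ => fdf y) (cf _ _).
rewrite distrC e sub0r normrM normrN ler_wpM2r // hk //.
by rewrite !ler0_norm ?lerN2 // ltW.
Qed.

Lemma norm_sin_le x : `|sin x| <= `|x|.
Proof.
have := @mvt_bound sin cos 1 x _ _; rewrite sin0 subr0 mul1r; apply => y //.
by rewrite cos_max.
Qed.

Lemma norm_cosB1_le x : `|cos x - 1| <= `|x| ^+ 2.
Proof.
have := @mvt_bound cos (fun y => - sin y) `|x| x _ _; rewrite cos0 expr2; apply => y //.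
by rewrite normrN => h; apply: le_trans h; exact: norm_sin_le.
Qed.

Lemma norm_sinB_le x : `|sin x - x| <= `|x| ^+ 3.
Proof.
have := @mvt_bound (fun y => sin y - y) (fun y => cos y - 1) (`|x| ^+ 2) x _ _.
rewrite sin0 !subr0 -exprSr; apply => y h.
by apply: (le_trans (norm_cosB1_le y)); rewrite ler_sqr ?nnegrE.
Qed.

End ElementaryBounds.

Section Cis.
Variable R : realType.
Local Notation T := (measurableTypeR R).

Definition cis (x : R) : R[i] := (cos x +i* sin x)%C.

Lemma cn_cis x : cn (cis x) = 1.
Proof. by rewrite cn_def /= cos2Dsin2 sqrtr1. Qed.

Lemma cis0 : cis 0 = 1.
Proof. by rewrite /cis cos0 sin0. Qed.

Lemma cisD x y : cis (x + y) = cis x * cis y.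
Proof. by apply: complex_eq; rewrite !(ReM, ImM) /= ?cosD ?sinD; ring. Qed.

Lemma cisN x : cis (- x) = (cis x)^*.
Proof. by apply: complex_eq; rewrite !(ReC, ImC) /= ?cosN ?sinN. Qed.

Lemma cisNK x : cis (- x) * cis x = 1.
Proof. by rewrite -cisD addNr cis0. Qed.

Lemma bm_cis (u : R -> R) : measurable_fun [set: T] (u : T -> R) ->
  bm (fun s => cis (u s)).
Proof.
move=> mu; split; last by exists 1 => s; rewrite cn_cis.
split; apply: (measurableT_comp _ mu); apply: continuous_measurable_fun.
  exact: continuous_cos.
exact: continuous_sin.
Qed.

Lemma bm_cisM (t : R) : bm (fun s => cis (t * s)).
Proof. by apply: bm_cis; apply: mulrl_measurable. Qed.

Lemma cn_cisB1_le x : cn (cis x - 1) <= `|x| + `|x|.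
Proof.
apply: (le_trans (cn_le _)); apply: lerD; rewrite /= ?oppr0 ?addr0.
  have := @mvt_bound R cos (fun y => - sin y) 1 x _ _; rewrite cos0 mul1r; apply => y //.
  by rewrite normrN sin_max.
exact: norm_sin_le.
Qed.

(* [k (cis (s / k) - 1)] tends to [i s], for [k = n + 1] and [k = - (n + 1)] alike *)
Definition cisq (n : nat) (b : bool) (s : R) : R[i] :=
  ((-1) ^+ b * n.+1%:R)%:C%C * (cis ((-1) ^+ b / n.+1%:R * s) - 1).

Lemma bm_cisq n b : bm (cisq n b).
Proof. by apply: bm_Z; apply: bm_B; [exact: bm_cisM|exact: bm_cst]. Qed.

Lemma cn_cisq n b s : cn (cisq n b s) <= 2 * `|s|.
Proof.
rewrite cnM cn_real normrM normrX normrN1 expr1n mul1r ger0_norm //.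
apply: (le_trans (ler_wpM2l _ (cn_cisB1_le _))) => //.
rewrite normrM normrM normrX normrN1 expr1n mul1r ger0_norm ?invr_ge0 //.
have : (n.+1%:R : R) != 0 by rewrite pnatr_eq0.
move: (n.+1%:R : R) (`|s|) => m a m0.
by suff -> : m * (m^-1 * a + m^-1 * a) = 2 * a by []; field.
Qed.

Lemma cisq_cvg b s : (fun n => cn (cisq n b s - 'i%C * s%:C%C)) @ \oo --> (0 : R).
Proof.
have sgn2 : (-1) ^+ b * (-1) ^+ b = 1 :> R by rewrite -expr2 sqrr_sign.
pose B n : R := n.+1%:R^-1 * `|s| ^+ 2 + n.+1%:R^-1 * `|s| ^+ 3.
have BE n m : m = n.+1%:R -> B n = m^-1 * `|s| ^+ 2 + m^-1 * `|s| ^+ 3 by move=> ->.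
apply: (@rcvg_squeeze _ _ B) => [n|]; last first.
  rewrite -[X in _ --> X]addr0; apply: cvgD.
    by rewrite -[X in _ --> X](mul0r (`|s| ^+ 2)); apply: cvgMl; exact: cvg_harmonic.
  by rewrite -[X in _ --> X](mul0r (`|s| ^+ 3)); apply: cvgMl; exact: cvg_harmonic.
rewrite subr0 ger0_norm ?cn_ge0 //; apply: (le_trans (cn_le _)).
set e := (-1) ^+ b in sgn2 *; set m : R := n.+1%:R.
have m0 : 0 < m by rewrite ltr0n.
have m1 : m^-1 <= 1 by rewrite invf_le1 // ler1n.
have mi0 : 0 <= m^-1 by rewrite invr_ge0 ltW.
have e1 : `|e| = 1 by rewrite /e normrX normrN1 expr1n.
have -> : complex.Re (cisq n b s - 'i%C * s%:C%C) = e * m * (cos (e / m * s) - 1).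
  by rewrite /cisq -/e -/m !(ReD, ReN, ReM, ImD, ImN, ImM) /=; ring.
have -> : complex.Im (cisq n b s - 'i%C * s%:C%C) = e * m * (sin (e / m * s) - e / m * s).
  rewrite /cisq -/e -/m !(ReD, ReN, ReM, ImD, ImN, ImM) /=.
  have -> : e * m * (sin (e / m * s) - e / m * s) = e * m * sin (e / m * s) - (e * e) * s.
    by field; rewrite gt_eqF.
  by rewrite sgn2; ring.
rewrite !normrM e1 mul1r (ger0_norm (ltW m0)) (BE n m) //; apply: lerD.
  apply: (le_trans (ler_wpM2l (ltW m0) (norm_cosB1_le _))).
  rewrite !normrM e1 mul1r (ger0_norm mi0).
  by have -> : m * (m^-1 * `|s|) ^+ 2 = m^-1 * `|s| ^+ 2 by field; rewrite gt_eqF.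
apply: (le_trans (ler_wpM2l (ltW m0) (norm_sinB_le _))).
rewrite !normrM e1 mul1r (ger0_norm mi0).
have -> : m * (m^-1 * `|s|) ^+ 3 = m^-1 * (m^-1 * `|s| ^+ 3) by field; rewrite gt_eqF.
by apply: ler_piMl => //; rewrite mulr_ge0 // exprn_ge0.
Qed.

End Cis.

(** * Uniqueness of the spectral measure of a selfadjoint operator *)

Section SameSpectral.
Variables (R : realType) (H : hilbert R).
Local Notation T := (measurableTypeR R).
Implicit Types (E : spectral_measure H) (x y : H) (f g : R -> R[i]).

Definition idc (s : R) : R[i] := s%:C%C.

Lemma mC_idc : mC idc.
Proof. by apply: mC_real; exact: measurable_id. Qed.

(** A [spectral_measure] also carries the measures [sp_mu]; agreement of the projections takes the
    place of equality of records. *)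
Definition same E E' := forall B, measurable B -> spE E B = spE E' B.

Lemma same_sym E E' : same E E' -> same E' E.
Proof. by move=> h B mB; rewrite h. Qed.

Lemma same_Phi E E' g : same E E' -> bm g -> Phi E g = Phi E' g.
Proof.
move=> h; move: g; apply: bm_ind.
- by move=> B mB; rewrite !Phi_cind // h.
- by move=> c f g bf bg ef eg; rewrite !Phi_lin // ef eg.
- move=> f bf hf; apply/funext => x; apply: (@op_le0 _ _ _ _ (8 * hn x)) => e e0.
  have [g [bg gP fg]] := hf e e0.
  apply: (le_trans (hn_triangle _ (Phi E g x) _)).
  have -> : e * (8 * hn x) = 4 * e * hn x + 4 * e * hn x by ring.
  apply: lerD; first exact: Phi_dist.
  by rewrite gP; apply: Phi_dist => // s; rewrite -cnN opprB.
Qed.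

Lemma same_Fop E E' f : same E E' -> mC f -> Fop E f = Fop E' f.
Proof.
move=> h mf; apply/seteqP; split=> - [x y] hxy n /=; have := hxy n; rewrite /=;
  by rewrite !(same_Phi h) //; first [exact: bm_lev|exact: bm_cut].
Qed.

Lemma same_mu E E' : (forall x B, measurable B -> sp_mu E x B = sp_mu E' x B) -> same E E'.
Proof.
move=> h B mB; apply: op_eq_form; [exact: bop_lin (spE_bop E mB)|exact: bop_lin (spE_bop E' mB)|].
by move=> x; rewrite !spE_form // h.
Qed.

Lemma same_ocitv E E' : (forall a b : R, spE E `]a, b]%classic = spE E' `]a, b]%classic) ->
  same E E'.
Proof.
move=> h; apply: same_mu => x B mB.
have mI (a b : R) : measurable `]a, b]%classic by exact: measurable_itv.
have eqI (a b : R) : sp_mu E x `]a, b]%classic = sp_mu E' x `]a, b]%classic.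
  by rewrite !mu_muE // h.
apply: (@g_sigma_algebra_measure_unique _ R T (@ocitv R) _
   (fun k : nat => `](- k%:R), k%:R]%classic) _ _ (sp_mu E x) (sp_mu E' x)) => //.
- by move=> _ [[a b] _ <-]; exact: mI.
- by move=> k; exists (- k%:R, k%:R).
- apply/seteqP; split=> // s _; exists (Num.bound `|s|).+1 => //=.
  rewrite in_itv /=; have := archi_boundP (normr_ge0 s); rewrite ltr_norml => /andP[h1 h2].
  have h3 : (Num.bound `|s|)%:R <= (Num.bound `|s|).+1%:R :> R by rewrite ler_nat.
  apply/andP; split; last by rewrite (le_trans (ltW h2)).
  by rewrite (le_lt_trans _ h1) // lerN2.
- exact: ocitvI.
- by move=> _ [[a b] _ <-]; exact: eqI.
- by move=> k; apply: mu_fin.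
Qed.

Section Uniqueness.
Variables (E E' : spectral_measure H).
Hypothesis EE' : Fop E idc `<=` Fop E' idc.

(* The rational functions 1 / (1 + f^2n), whose limits generate all intervals, agree on
   E and E' because the identity function does. *)
Section Interval.
Variables (c a : R).
Hypothesis a0 : 0 < a.
Let u (s : R) : R := (s - c) / a.
Let f (s : R) : R[i] := (u s)%:C%C.

Let cu : continuous u.
Proof.
move=> s; apply: (@continuousM _ R (fun s => s - c) (fun=> a^-1)); last exact: cst_continuous.
by apply: (@continuousB _ R R id (fun=> c)); [exact: cvg_id|exact: cst_continuous].
Qed.

Let mu_ : measurable_fun [set: T] (u : T -> R).
Proof. exact: continuous_measurable_fun. Qed.

Let hr n (s : R) : R := (1 + u s ^+ n.*2)^-1.

Let u2n n s : 0 <= u s ^+ n.*2.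
Proof. by rewrite -muln2 mulnC exprM exprn_ge0 // sqr_ge0. Qed.

Let d_gt0 n s : 0 < 1 + u s ^+ n.*2.
Proof. by apply: (lt_le_trans ltr01); rewrite lerDl. Qed.

Let m_hr n : measurable_fun [set: T] (hr n : T -> R).
Proof.
apply: continuous_measurable_fun => s.
apply: (@continuousV R R (fun s => 1 + u s ^+ n.*2)); first by rewrite gt_eqF.
apply: (@continuousD _ R R (fun=> 1) (fun s => u s ^+ n.*2)); first exact: cst_continuous.
apply: (@continuous_comp _ _ _ u (fun t => t ^+ n.*2)); first exact: cu.
exact: exprn_continuous.
Qed.

Let h n (s : R) : R[i] := (hr n s)%:C%C.

Let bfh n j : (j <= n.*2)%N -> bm (fun s => f s ^+ j * h n s).
Proof.
move=> jn; split; first by apply: mC_M; [apply: mC_X; exact: mC_real|apply: mC_real; exact: m_hr].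
exists 1 => s; rewrite cnM cnX !cn_real normfV (gtr0_norm (d_gt0 n s)).
rewrite ler_pdivrMr // mul1r.
have -> : u s ^+ n.*2 = `|u s| ^+ n.*2.
  by rewrite -normrX ger0_norm.
have [h1|h1] := leP `|u s| 1.
  by apply: (@le_trans _ _ 1); [exact: exprn_ile1|rewrite lerDl exprn_ge0].
apply: (@le_trans _ _ (`|u s| ^+ n.*2)); last by rewrite lerDr.
by apply: ler_weXn2l => //; exact: ltW.
Qed.

Let bfh' n j : (j <= n.*2)%N -> bm (fun s => h n s * f s ^+ j).
Proof.
by move=> /bfh; congr (bm _); apply/funext => s; rewrite mulrC.
Qed.

Let idE s : idc s = a%:C%C * f s + c%:C%C.
Proof.
rewrite /idc /f /u -rmorphM -rmorphD /=; congr (_%:C)%C.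
by field; rewrite gt_eqF.
Qed.

(** With [y j = f^j h (E) x], the factors [f] move one at a time from [E] to [E'], because
    [y (j + 1) = f (E) y j] is a pair of both graphs. Since [h + h f^2n = 1], one has
    [x = y 0 + y 2n] and [h (E') x = (h + h f^2n) (E') y 0 = y 0 = h (E) x]. *)
Let Phi_h_eq n x : Phi E (h n) x = Phi E' (h n) x.
Proof.
pose y j := Phi E (fun s => f s ^+ j * h n s) x.
have aC : (a%:C%C : R[i]) != 0 by apply/eqP => - [] /eqP; rewrite gt_eqF.
have step k j : (j < n.*2)%N -> bm k -> bm (fun s => k s * f s) ->
    Phi E' k (y j.+1) = Phi E' (fun s => k s * f s) (y j).
  move=> jn bk bkf; have bj := bfh (ltnW jn); have bj1 := bfh jn.
  have e1 : (fun s => idc s * (f s ^+ j * h n s)) =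
            (fun s => a%:C%C * (f s ^+ j.+1 * h n s) + c%:C%C * (f s ^+ j * h n s)).
    by apply/funext => s; rewrite idE exprS; ring.
  have b1 : bm (fun s => idc s * (f s ^+ j * h n s)).
    by rewrite e1; apply: bm_D; apply: bm_Z.
  have := EE' (Op_bm E x mC_idc bj b1); rewrite -/(y j) e1 Phi_D ?Phi_Z; try exact: bm_Z.
  2, 3: by [].
  rewrite -/(y j) -/(y j.+1) => hE.
  have e2 : (fun s => k s * idc s) = (fun s => a%:C%C * (k s * f s) + c%:C%C * k s).
    by apply/funext => s; rewrite idE; ring.
  have b2 : bm (fun s => k s * idc s) by rewrite e2; apply: bm_D; apply: bm_Z.
  have := Op_mul mC_idc hE bk b2; rewrite e2 Phi_D ?Phi_Z; try exact: bm_Z.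
  2, 3: by [].
  rewrite (lin_D (Phi_linear _ bk)) !(lin_Z (Phi_linear _ bk)) => /addIr.
  by move=> /(congr1 (fun v => (a%:C%C)^-1 *: v)); rewrite !scalerA mulVf // !scale1r.
have main j i : (i + j <= n.*2)%N ->
    Phi E' (fun s => h n s * f s ^+ i) (y j) = Phi E' (fun s => h n s * f s ^+ (i + j)) (y 0%N).
  elim: j i => [i|j IH i hij]; first by rewrite addn0.
  have hij1 : (i.+1 + j <= n.*2)%N by rewrite addSnnS.
  have e3 : (fun s => h n s * f s ^+ i * f s) = (fun s => h n s * f s ^+ i.+1).
    by apply/funext => s; rewrite exprSr mulrA.
  rewrite step; last 1 first.
  - by rewrite e3; apply: bfh'; apply: leq_trans hij1; rewrite leq_addr.
  - by rewrite e3 IH // addSnnS.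
  - by apply: leq_trans hij; exact: leq_addl.
  - by apply: bfh'; apply: leq_trans hij; rewrite leq_addr.
have b0 : bm (h n) by have := @bfh n 0 isT; congr (bm _); apply/funext => s; rewrite expr0 mul1r.
have hd s : h n s + h n s * f s ^+ n.*2 = 1.
  have -> : h n s + h n s * f s ^+ n.*2 = h n s * (1 + f s ^+ n.*2) by ring.
  by rewrite /h /f -rmorphXn -[1]/(1%:C%C) -rmorphD -rmorphM mulVf // gt_eqF.
have bn := bfh (leqnn n.*2); have bn' := bfh' (leqnn n.*2).
have xE : x = y 0%N + y n.*2.
  rewrite /y -Phi_D //; last by apply: (@bfh n 0).
  rewrite -[LHS]/(id x) -(Phi_1 E); congr (Phi E _ x); apply/funext => s.
  by rewrite expr0 mul1r -(hd s); congr (_ + _); rewrite mulrC.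
have y0 : Phi E (h n) x = y 0%N.
  by congr (Phi E _ x); apply/funext => s; rewrite expr0 mul1r.
have := main n.*2 0%N (leqnn _); have := main 0%N 0%N isT.
have -> : (fun s => h n s * f s ^+ 0) = h n by apply/funext => s; rewrite expr0 mulr1.
move=> _ h2; rewrite y0 [X in _ = Phi E' _ X]xE (lin_D (Phi_linear _ b0)) h2 -Phi_D //.
by rewrite [X in Phi E' X _](_ : _ = fun=> 1) ?Phi_1 //; apply/funext => s; rewrite hd.
Qed.

Let I1 : set R := [set s | `|s - c| < a].
Let I2 : set R := [set s | `|s - c| = a].
(** The pointwise limit of the [h n]: the two endpoints, where [u^2n = 1], receive the value
    [1/2]. *)
Let g s : R[i] := cind I1 s + 2^-1 * cind I2 s.

Let abs_u s : `|u s| = `|s - c| / a.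
Proof. by rewrite normrM normfV (gtr0_norm a0). Qed.

Let m_abs : measurable_fun [set: T] (fun s : T => `|s - c| : R).
Proof.
apply: measurableT_comp; first exact: normr_measurable.
by apply: measurable_funB => //; exact: measurable_cst.
Qed.

Let mI1 : measurable I1.
Proof.
rewrite (_ : I1 = setT `&` (fun s : T => `|s - c|) @^-1` `]-oo, a[).
  by apply: m_abs => //; exact: measurable_itv.
by apply/seteqP; split=> s /=; rewrite in_itv /=; [|case].
Qed.

Let mI2 : measurable I2.
Proof.
rewrite (_ : I2 = setT `&` (fun s : T => `|s - c|) @^-1` [set a]).
  by apply: m_abs => //; exact: measurable_set1.
by apply/seteqP; split=> s /=; [|case].
Qed.

Let bg : bm g.
Proof. by apply: bm_D; [exact: bm_cind|apply: bm_Z; exact: bm_cind]. Qed.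

Let bh n : bm (h n).
Proof. by have := @bfh n 0 isT; congr (bm _); apply/funext => s; rewrite expr0 mul1r. Qed.

Let hg_cv s : (fun n => cn (h n s - g s)) @ \oo --> (0 : R).
Proof.
pose v := `|u s|.
have hv n : hr n s = (1 + (v ^+ 2) ^+ n)^-1.
  by rewrite /hr /v -exprM mulnC muln2 -normrX ger0_norm.
have v2 : 0 <= v ^+ 2 by exact: sqr_ge0.
have vn n : 0 <= (v ^+ 2) ^+ n by exact: exprn_ge0.
case: (ltgtP `|s - c| a) => hs.
- have v1 : v ^+ 2 < 1 by rewrite expr_lt1 ?normr_ge0 // /v abs_u ltr_pdivrMr ?mul1r.
  have -> : g s = 1.
    rewrite /g cind_in // cind_out ?mulr0 ?addr0 // /I2 /= => e.
    by rewrite e ltxx in hs.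
  apply: (@rcvg_squeeze _ _ (fun n => (v ^+ 2) ^+ n)); last first.
    by apply: cvg_expr; rewrite ger0_norm.
  move=> n; rewrite subr0 ger0_norm ?cn_ge0 // /h -[1]/(1%:C%C) -rmorphB cn_real hv.
  have -> : (1 + (v ^+ 2) ^+ n)^-1 - 1 = - ((v ^+ 2) ^+ n / (1 + (v ^+ 2) ^+ n)).
    by move: (vn n); move: ((v ^+ 2) ^+ n) => t t0; field; rewrite gt_eqF //; lra.
  rewrite normrN ger0_norm; last by rewrite divr_ge0 // addr_ge0.
  by rewrite ler_pdivrMr ?ler_peMr ?lerDl // (lt_le_trans ltr01) // lerDl.
- have v1 : 1 < v ^+ 2 by rewrite exprn_egt1 // /v abs_u ltr_pdivlMr ?mul1r.
  have -> : g s = 0.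
    rewrite /g !cind_out ?mulr0 ?addr0 // /I1 /I2 /= => e; last first.
      by move: e; rewrite ltNge ltW.
    by rewrite e ltxx in hs.
  apply: (@rcvg_squeeze _ _ (fun n => ((v ^+ 2)^-1) ^+ n)); last first.
    by apply: cvg_expr; rewrite ger0_norm ?invr_ge0 // invf_lt1 // (lt_trans ltr01).
  move=> n; rewrite !subr0 ger0_norm ?cn_ge0 // /h cn_real hv ger0_norm; last first.
    by rewrite invr_ge0 addr_ge0.
  rewrite exprVn lef_pV2 ?posrE ?lerDr //; last by apply: exprn_gt0; exact: lt_trans v1.
  by rewrite (lt_le_trans ltr01) // lerDl.
- have v1 : v = 1 by rewrite /v abs_u hs divff // gt_eqF.
  have -> : (fun n => cn (h n s - g s)) = fun=> 0; last exact: cvg_cst.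
  apply/funext => n; rewrite /h hv v1 !expr1n /g cind_out; last by rewrite /I1 /= hs ltxx.
  rewrite cind_in // add0r mulr1 (_ : 1 + 1 = 2) // fmorphV /=.
  by rewrite (rmorph_nat _ 2) subrr cn0.
Qed.

Let Phi_g_eq x : Phi E g x = Phi E' g x.
Proof.
have hb n s : setT s -> cn (h n s) <= 1.
  move=> _; rewrite /h cn_real ger0_norm /hr; last by rewrite invr_ge0 ltW.
  by rewrite invf_le1 // lerDl.
have h1 := Phi_cv x (concentratedT E) bh bg hb (fun s _ => hg_cv s).
have h2 := Phi_cv x (concentratedT E') bh bg hb (fun s _ => hg_cv s).
by apply: (cv_unique_eq h1 h2) => n; rewrite Phi_h_eq.
Qed.

(** High powers of the limit [g] remove the value [1/2] at the endpoints. *)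
Lemma spE_ball_eq : spE E [set s | `|s - c| < a] = spE E' [set s | `|s - c| < a].
Proof.
rewrite -/I1 -!Phi_cind //; apply/funext => x.
have bgn n : bm (fun s => g s ^+ n.+1) by exact: bm_X.
have eqn n y : Phi E (fun s => g s ^+ n.+1) y = Phi E' (fun s => g s ^+ n.+1) y.
  elim: n y => [|n IH] y; first exact: Phi_g_eq.
  have -> : (fun s => g s ^+ n.+2) = (fun s => g s * g s ^+ n.+1).
    by apply/funext => s; rewrite exprS.
  by rewrite !Phi_mul // IH Phi_g_eq.
have hb n s : setT s -> cn (g s ^+ n.+1) <= 1.
  move=> _; rewrite cnX exprn_ile1 ?cn_ge0 // /g !cindE.
  case: ifPn; case: ifPn; rewrite ?inE /I1 /I2 /= => h2 h1.
  - by rewrite h2 ltxx in h1.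
  - by rewrite mulr0 addr0 cn1.
  - rewrite add0r mulr1 -(rmorph_nat (real_complex R) 2) -fmorphV cn_real ger0_norm //.
    by rewrite invf_le1 // ler1n.
  - by rewrite mulr0 addr0 cn0.
have hc s : setT s -> (fun n => cn (g s ^+ n.+1 - cind I1 s)) @ \oo --> (0 : R).
  move=> _; rewrite /g !cindE; case: ifPn; case: ifPn; rewrite ?inE /I1 /I2 /= => h2 h1.
  - by rewrite h2 ltxx in h1.
  - rewrite (_ : (fun _ => _) = fun=> 0); first exact: cvg_cst.
    by apply/funext => n; rewrite mulr0 addr0 expr1n subrr cn0.
  - apply: (@rcvg_squeeze _ _ (fun n => (2^-1) ^+ n)); last first.
      by apply: cvg_expr; rewrite ger0_norm // invf_lt1 // ltr1n.
    move=> n; rewrite !subr0 ger0_norm ?cn_ge0 // add0r mulr1.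
    rewrite -(rmorph_nat (real_complex R) 2) -fmorphV cnX cn_real ger0_norm // exprS.
    by rewrite ler_piMl ?exprn_ge0 // invf_le1 // ler1n.
  - rewrite (_ : (fun _ => _) = fun=> 0); first exact: cvg_cst.
    by apply/funext => n; rewrite mulr0 addr0 expr0n /= subrr cn0.
have h1 := Phi_cv x (concentratedT E) bgn (bm_cind mI1) hb hc.
have h2 := Phi_cv x (concentratedT E') bgn (bm_cind mI1) hb hc.
by apply: (cv_unique_eq h1 h2) => n; rewrite eqn.
Qed.

End Interval.

Lemma spE_oo_eq (a b : R) : spE E `]a, b[%classic = spE E' `]a, b[%classic.
Proof.
have [ab|ba] := ltP a b; last first.
  by rewrite set_itv_ge ?bnd_simp -?leNgt // -!Phi_cind //; apply/funext => x;
     rewrite (_ : cind set0 = fun=> 0) ?Phi_cst // ; apply/funext => s; rewrite cind_out.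
have := @spE_ball_eq ((a + b) / 2) ((b - a) / 2) _.
rewrite (_ : [set s | _] = `]a, b[%classic); first by apply; lra.
by apply/seteqP; split=> s /=; rewrite in_itv /= ltr_norml => /andP[h1 h2]; apply/andP; split; lra.
Qed.

(** []a, b]] is the limit of the open intervals []a, b + 1/(n+1)[]. An inclusion of graphs is
    enough, as factors are only moved from [E] to [E']. *)
Lemma Fop_id_same : same E E'.
Proof.
apply: same_ocitv => a b; rewrite -!Phi_cind //; apply/funext => x.
pose g n : R -> R[i] := cind (`]a, b + n.+1%:R^-1[%classic : set R).
have bg n : bm (g n) by apply: bm_cind; exact: measurable_itv.
have hb n s : setT s -> cn (g n s) <= 1 by move=> _; exact: cn_cind.
have hc s : setT s -> (fun n => cn (g n s - cind `]a, b]%classic s)) @ \oo --> (0 : R).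
  move=> _; have [as_|sa] := ltP a s; last first.
    rewrite (_ : (fun _ => _) = fun=> 0); first exact: cvg_cst.
    by apply/funext => n; rewrite /g !cind_out ?subrr ?cn0 //= in_itv /= ltNge sa.
  have [sb|bs] := leP s b.
    rewrite (_ : (fun _ => _) = fun=> 0); first exact: cvg_cst.
    apply/funext => n; rewrite /g !cind_in ?subrr ?cn0 //= in_itv /= as_ //=.
    by rewrite (le_lt_trans sb) // ltrDl.
  apply/rcvg0P => e e0; have /cvgr_dist_lt/(_ _) h := @cvg_harmonic R.
  have [|N _ hN] := h (s - b); first by rewrite subr_gt0.
  exists N => n Nn; rewrite /g !cind_out ?subrr ?cn0 ?normr0 //= in_itv /= as_ /=; apply/negP.
    by rewrite -ltNge.
  rewrite -leNgt; have := hN n Nn; rewrite /= sub0r normrN ger0_norm // /harmonic /=.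
  by move=> h1; rewrite -lerBrDl ltW.
have mab : measurable (`]a, b]%classic : set T) by exact: measurable_itv.
have h1 := Phi_cv x (concentratedT E) bg (bm_cind mab) hb hc.
have h2 := Phi_cv x (concentratedT E') bg (bm_cind mab) hb hc.
by apply: (cv_unique_eq h1 h2) => n; rewrite /g !Phi_cind ?spE_oo_eq //; exact: measurable_itv.
Qed.

End Uniqueness.

End SameSpectral.

(** * Images of spectral measures under Borel maps, unitaries and antiunitaries *)

Section PushForward.
Variables (R : realType) (H : hilbert R).
Local Notation T := (measurableTypeR R).
Implicit Types (E : spectral_measure H) (x y : H) (f g : R -> R[i]) (B : set R).

(** Identifies a candidate calculus with that of [E]; it serves both for images under a Borel map
    and for conjugation. *)
Lemma Phi_ext E (P : (R -> R[i]) -> op H) :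
  (forall B, measurable B -> P (cind B) = Phi E (cind B)) ->
  (forall c f g, bm f -> bm g -> P (fun s => c * f s + g s) = c *: P f + P g) ->
  (forall f g e x, bm f -> bm g -> (forall s, cn (f s - g s) <= e) ->
     hn (P f x - P g x) <= 4 * e * hn x) ->
  forall g, bm g -> P g = Phi E g.
Proof.
move=> hB hl hd; apply: bm_ind.
- by move=> B mB; rewrite hB.
- by move=> c f g bf bg ef eg; rewrite hl // Phi_lin // ef eg.
- move=> f bf hf; apply/funext => x; apply: (@op_le0 _ _ _ _ (8 * hn x)) => e e0.
  have [g [bg gP fg]] := hf e e0.
  apply: (le_trans (hn_triangle _ (P g x) _)).
  have -> : e * (8 * hn x) = 4 * e * hn x + 4 * e * hn x by ring.
  apply: lerD; first exact: hd.
  by rewrite gP; apply: Phi_dist => // s; rewrite -cnN opprB.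
Qed.

Section Push.
Variables (E : spectral_measure H) (u : R -> R).
Hypothesis mu_ : measurable_fun [set: T] (u : T -> T).

Let mpre B : measurable B -> measurable (u @^-1` B).
Proof. by move=> mB; rewrite -[_ @^-1` _]setTI; exact: mu_. Qed.

Definition push_mu x : {measure set T -> \bar R} :=
  [the {measure set T -> \bar R} of measure_function_pushforward__canonical__measure_function_Measure (sp_mu E x) mu_].

Lemma push_proj B : measurable B -> projection (spE E (u @^-1` B)).
Proof. by move=> mB; apply: sp_proj; exact: mpre. Qed.

Lemma push_setI B C : measurable B -> measurable C ->
  spE E (u @^-1` (B `&` C)) = spE E (u @^-1` B) \o spE E (u @^-1` C).
Proof. by move=> mB mC; rewrite preimage_setI sp_setI //; exact: mpre. Qed.

Lemma push_muE x B : measurable B ->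
  (fine (push_mu x B))%:C%C = `|spE E (u @^-1` B) x| ^+ 2 /\ (push_mu x B < +oo)%E.
Proof. by move=> mB; apply: sp_muE; exact: mpre. Qed.

(** If [E] belongs to the selfadjoint operator A, this one belongs to u(A). *)
Definition push : spectral_measure H :=
  SpectralMeasure push_proj (sp_setT E) push_setI push_muE.

Lemma Phi_push g : bm g -> Phi push g = Phi E (fun s => g (u s)).
Proof.
move=> bg; symmetry; move: g bg; apply: Phi_ext => [B mB|c f g bf bg|f g e x bf bg h].
- by rewrite Phi_cind // (_ : (fun s => _) = cind (u @^-1` B)) ?Phi_cind //; exact: mpre.
- by rewrite Phi_lin //; exact: bm_comp.
- by apply: Phi_dist => //; exact: bm_comp.
Qed.

Lemma Fop_push f : mC f -> Fop push f = Fop E (fun s => f (u s)).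
Proof.
move=> mf; apply/seteqP; split=> - [x y] h n; have := h n;
  by rewrite /= !Phi_push //; first [exact: bm_lev|exact: bm_cut].
Qed.

End Push.

End PushForward.

Section Transport.
Variables (R : realType) (H : hilbert R).
Local Notation T := (measurableTypeR R).
Implicit Types (E : spectral_measure H) (x y : H) (f g : R -> R[i]) (B : set R).

(** One treatment covers unitaries and antiunitaries: the latter conjugate scalars, hence also the
    functions in the transport formulas. *)
Definition cif (b : bool) (c : R[i]) : R[i] := if b then c^* else c.

Lemma cifM b c d : cif b (c * d) = cif b c * cif b d.
Proof. by case: b => //=; rewrite conjM. Qed.

Lemma cifD b c d : cif b (c + d) = cif b c + cif b d.
Proof. by case: b => //=; rewrite conjD. Qed.

Lemma cifK b : involutive (cif b).
Proof. by case: b => c //=; rewrite conjK. Qed.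

Lemma cif_real b (r : R) : cif b r%:C%C = r%:C%C.
Proof. by case: b => //=; rewrite conj_realC. Qed.

Lemma cn_cif b c : cn (cif b c) = cn c.
Proof. by case: b => //=; rewrite cn_conj. Qed.

Lemma bm_cif b g : bm g -> bm (fun s => cif b (g s)).
Proof. by case: b => //=; exact: bm_conj. Qed.

(* [W] is a unitary ([b = false]) or an antiunitary ([b = true]) with inverse [W'] *)
Definition semiunitary b (W W' : op H) :=
  [/\ forall c x y, W (c *: x + y) = cif b c *: W x + W y,
      forall x, hn (W x) = hn x, cancel W W' & cancel W' W].

Lemma semiunitary_sym b (W W' : op H) : semiunitary b W W' -> semiunitary b W' W.
Proof.
move=> [lW nW K K']; split=> // [c x y|x]; last by rewrite -nW K'.
by apply: (can_inj K); rewrite K' lW !K' cifK.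
Qed.

Section One.
Variables (b : bool) (W W' : op H).
Hypothesis hW : semiunitary b W W'.

Lemma suD x y : W (x + y) = W x + W y.
Proof. by case: hW => lW _ _ _; have := lW 1 x y; rewrite !scale1r (cif_real b 1) scale1r. Qed.

Lemma su0 : W 0 = 0.
Proof. by apply: (@addrI _ (W 0)); rewrite -suD !addr0. Qed.

Lemma suZ c x : W (c *: x) = cif b c *: W x.
Proof. by case: hW => lW _ _ _; have := lW c x 0; rewrite su0 !addr0. Qed.

Lemma suN x : W (- x) = - W x.
Proof. by apply: (addrI (W x)); rewrite -suD !subrr su0. Qed.

Lemma suB x y : W (x - y) = W x - W y.
Proof. by rewrite suD suN. Qed.

Lemma su_hn x : hn (W x) = hn x.
Proof. by case: hW. Qed.

Lemma suK : cancel W W'.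
Proof. by case: hW. Qed.

Lemma suK' : cancel W' W.
Proof. by case: hW. Qed.

Lemma su_cv (s : nat -> H) x : cv s x -> cv (fun n => W (s n)) (W x).
Proof. by rewrite /cv; under eq_fun do rewrite -su_hn suB. Qed.

Lemma su_Re_ip x y : complex.Re <|W x, W y|> = complex.Re <|x, y|>.
Proof. by have := hnD2 (W x) (W y); rewrite -suD !su_hn hnD2 => h; lra. Qed.

(** Norms determine real parts; imaginary parts follow by replacing [x] by [i x], where [b] decides
    the sign. *)
Lemma su_ip x y : <|W x, W y|> = cif b <|x, y|>.
Proof.
have h2 := su_Re_ip ('i%C *: x) y; have := Im_ip x y; rewrite -h2 suZ => e.
apply: complex_eq; first by rewrite su_Re_ip; case: (b) => //=; rewrite ReC.
case: (b) e => /= e; last by rewrite Im_ip -e.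
by rewrite Im_ip ImC e conj_i scaleNr ipNl ReN opprK.
Qed.

Lemma su_ipl x y : <|W x, y|> = cif b <|x, W' y|>.
Proof. by rewrite -[X in <|_, X|>]suK' su_ip. Qed.

Lemma su_lin a : linear a -> linear (W' \o a \o W).
Proof.
have [lW' _ _ _] := semiunitary_sym hW; case: hW => lW _ _ _ la c x y /=.
by rewrite lW la lW' cifK.
Qed.

Lemma su_bop a : bounded_op a -> bounded_op (W' \o a \o W).
Proof.
move=> ba; have [c c0 hc] := bop_bdd ba; apply: (@bop_intro _ _ _ _ c).
  by apply: su_lin; exact: bop_lin.
have [_ nW' _ _] := semiunitary_sym hW.
by move=> x /=; rewrite nW' (le_trans (hc _)) // su_hn.
Qed.

Lemma su_adj a : bounded_op a -> adj (W' \o a \o W) = W' \o adj a \o W.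
Proof.
move=> ba; apply: adj_uniq; first by apply: su_bop; exact: bop_adj.
move=> x y /=; rewrite -[in RHS](suK x) -[y in LHS]suK.
have h := su_ipl; have e u v : <|W' u, W' v|> = cif b <|u, v|>.
  by rewrite -[LHS](cifK b) -su_ip !suK'.
by rewrite !e adjP.
Qed.

Variable E : spectral_measure H.

Lemma tr_proj B : measurable B -> projection (W' \o spE E B \o W).
Proof.
move=> mB; have [ba ia aa] := sp_proj E mB; split; first exact: su_bop.
  by apply/funext => x /=; rewrite suK' spE_idem.
by rewrite su_adj // aa.
Qed.

Lemma tr_setT : W' \o spE E setT \o W = id.
Proof. by rewrite sp_setT; apply/funext => x /=; rewrite suK. Qed.

Lemma tr_setI B C : measurable B -> measurable C ->
  W' \o spE E (B `&` C) \o W = (W' \o spE E B \o W) \o (W' \o spE E C \o W).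
Proof. by move=> mB mC; apply/funext => x /=; rewrite suK' sp_setI. Qed.

Lemma tr_muE x B : measurable B ->
  (fine (sp_mu E (W x) B))%:C%C = `|(W' \o spE E B \o W) x| ^+ 2 /\ (sp_mu E (W x) B < +oo)%E.
Proof.
move=> mB; have [-> ?] := sp_muE E (W x) mB; split=> //.
by have [_ nW' _ _] := semiunitary_sym hW; rewrite !hnE /= nW'.
Qed.

(** The spectral measure of W^-1 A W, when [E] is that of A. *)
Definition transport : spectral_measure H := SpectralMeasure tr_proj tr_setT tr_setI tr_muE.

Lemma Phi_tr g : bm g -> Phi transport g = W' \o Phi E (fun s => cif b (g s)) \o W.
Proof.
have hW' := semiunitary_sym hW; have [lW' nW' _ _] := hW'.
move=> bg; symmetry; move: g bg; apply: Phi_ext => [B mB|c f g bf bg|f g e x bf bg h].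
- rewrite Phi_cind // (_ : (fun s => _) = cind B) ?Phi_cind //.
  by apply/funext => s; exact: cif_real.
- rewrite (_ : (fun s => _) = fun s => cif b c * cif b (f s) + cif b (g s)); last first.
    by apply/funext => s; rewrite cifD cifM.
  rewrite Phi_lin; try exact: bm_cif.
  by apply/funext => x /=; rewrite lW' cifK.
- rewrite /= -[X in hn X]/(W' _ - W' _).
  have -> : forall u v, W' u - W' v = W' (u - v).
    by move=> u v; rewrite -[RHS](suK (W' _)) suK'; apply: (can_inj suK); rewrite suB !suK'.
  rewrite nW' -(su_hn x); apply: Phi_dist; try exact: bm_cif.
  by move=> s; case: (b) => //=; rewrite -rmorphB cn_conj.
Qed.

Lemma Fop_tr f x y : mC f ->
  Fop transport f (x, y) <-> Fop E (fun s => cif b (f s)) (W x, W y).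
Proof.
have hW' := semiunitary_sym hW; have [lW' nW' _ _] := hW'.
have le n : lev (fun s => cif b (f s)) n = lev f n.
  by apply/seteqP; split=> s; rewrite /lev /= cn_cif.
have ec n : (fun s => cif b (cind (lev f n) s)) = cind (lev f n).
  by apply/funext => s; exact: cif_real.
have ef n : (fun s => cif b (f s * cind (lev f n) s)) = (fun s => cif b (f s) * cind (lev f n) s).
  by apply/funext => s; rewrite cifM cif_real.
move=> mf; split=> h n; have := h n; rewrite /= ?le !Phi_tr; try exact: bm_lev; try exact: bm_cut.
  by rewrite /= ec ef => /(can_inj suK').
by rewrite /= ec ef => ->.
Qed.

End One.

End Transport.
Arguments idc {R} s.

(** * A one-parameter unitary group determines its spectral measure *)

Section StoneUniqueness.
Variables (R : realType) (H : hilbert R).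
Implicit Types (E : spectral_measure H) (x y : H).

Lemma cisq_conj n b (s : R) : (cisq n b s)^* = - cisq n (~~ b) s.
Proof.
rewrite /cisq conjM conj_realC conjD rmorphN rmorph1 -cisN -mulNr.
have -> : (-1) ^+ (~~ b) = - (-1) ^+ b :> R by case: b; rewrite ?expr0 ?expr1 ?opprK.
move: ((-1) ^+ b : R) (n.+1%:R : R) => e m.
by rewrite (mulNr e m) (mulNr e m^-1) rmorphN (mulNr ((e * m)%:C)%C) opprK.
Qed.

Lemma cisq_lim E m n0 b x (c := cind (lev (@idc R) m)) :
  cv (fun n => Phi E (cisq (n0 + n) b) (Phi E c x))
     ('i%C *: Phi E (fun s => idc s * c s) x).
Proof.
have bc : bm c by apply: bm_lev; exact: mC_idc.
have bic : bm (fun s => idc s * c s) by apply: bm_cut; exact: mC_idc.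
rewrite -Phi_Z // (_ : (fun n => _) = fun n => Phi E (fun s => cisq (n0 + n) b s * c s) x); last first.
  by apply/funext => n; rewrite Phi_mul //; exact: bm_cisq.
apply: (@Phi_cv _ _ E setT _ _ (2 * m%:R)); first exact: concentratedT.
- by move=> n; apply: bm_M => //; exact: bm_cisq.
- exact: bm_Z.
- move=> n s _; rewrite cnM /c; have [h|h] := pselect (lev (@idc R) m s); last first.
    by rewrite cind_out // cn0 mulr0 mulr_ge0.
  rewrite cind_in // cn1 mulr1 (le_trans (cn_cisq _ _ _)) // ler_wpM2l //.
  by move: h; rewrite /lev /= cn_real.
- move=> s _; have h := cisq_cvg b s.
  apply: (@rcvg_squeeze _ _ (fun n => cn (cisq (n0 + n) b s - 'i%C * s%:C%C))); last first.
    apply/rcvg0P => e e0; have /rcvg0P/(_ _ e0) [N hN] := h.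
    by exists N => n Nn; apply: hN; rewrite (leq_trans Nn) // leq_addl.
  move=> n; rewrite subr0 ger0_norm ?cn_ge0 // mulrA -mulrBl cnM ler_piMr ?cn_ge0 //.
  exact: cn_cind.
Qed.

(** Difference quotients of the groups tend to [i] times the truncated generators. Equal groups thus
    put the graph of one generator in the adjoint of the other, which is selfadjoint; [Fop_id_same]
    concludes. *)
Lemma stone_same E E' : (forall t, Phi E (fun s => cis (t * s)) = Phi E' (fun s => cis (t * s))) ->
  same E E'.
Proof.
move=> h.
have hq n b x : Phi E (cisq n b) x = Phi E' (cisq n b) x.
  have b0 : bm (fun s : R => cis ((-1) ^+ b / n.+1%:R * s) - 1).
    by apply: bm_B; [exact: bm_cisM|exact: bm_cst].
  rewrite /cisq (Phi_Z E _ x b0) (Phi_Z E' _ x b0); congr (_ *: _).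
  have b1 := bm_cisM ((-1) ^+ b / n.+1%:R : R); have b2 := bm_cst (1 : R[i]).
  by rewrite (Phi_B E x b1 b2) (Phi_B E' x b1 b2) h !Phi_cst.
apply: Fop_id_same => -[x y] xy.
have -> : Fop E' idc = adjoint (Fop E' idc).
  rewrite Op_adjoint; last exact: mC_idc.
  by congr (Fop _ _); apply/funext => s; rewrite conj_realC.
move=> x' y' xy' /=.
have mi := @mC_idc R.
have xm m : Phi E (fun s => idc s * cind (lev (@idc R) m) s) x =
            Phi E (cind (lev (@idc R) m)) y by rewrite xy.
have ym m : Phi E' (fun s => idc s * cind (lev (@idc R) m) s) x' =
            Phi E' (cind (lev (@idc R) m)) y' by rewrite xy'.
apply: (cv_ip_eq (lev_cv E' y' mi) (lev_cv E x mi) (lev_cv E' x' mi) (lev_cv E y mi)) => m.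
(* The increments have opposite signs because, by [cisq_conj], the adjoint of a forward quotient is
   minus the backward one. *)
have c1 := cisq_lim E' m 0 false x'; have c2 := cisq_lim E m 0 true x.
move: c1 c2 => /= c1 c2; rewrite xm in c2; rewrite ym in c1.
have e : <|'i%C *: Phi E' (cind (lev (@idc R) m)) y', Phi E (cind (lev (@idc R) m)) x|> =
         <|Phi E' (cind (lev (@idc R) m)) x', - ('i%C *: Phi E (cind (lev (@idc R) m)) y)|>.
  apply: (cv_ip_eq c1 (cv_cst _) (cv_cst _) (cvN c2)) => n.
  rewrite Phi_ip; last exact: bm_cisq.
  congr (<|_, _|>); rewrite hq -scaleN1r -Phi_Z; last exact: bm_cisq.
  by congr (Phi _ _ _); apply/funext => s; rewrite cisq_conj mulN1r.
move: e; rewrite ipZl ipNr ipZr conj_i mulNr opprK => /(congr1 (fun z => - 'i%C * z)).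
by rewrite !mulNr !mulrA mul_ii !mulN1r !opprK.
Qed.

End StoneUniqueness.

(** * Powers and logarithms of strictly positive operators *)

Section Powers.
Variables (R : realType) (H : hilbert R).
Local Notation T := (measurableTypeR R).
Implicit Types (E : spectral_measure H) (A : H ~> H).

Lemma funcalc_uniq A E f T0 : A = Fop E idc -> mC f -> is_funcalc A f T0 -> T0 = Fop E f.
Proof.
move=> AE mf [E' h1 h2]; have m := @mC_idc R.
have {}h1 := spectral_integral_uniq m h1; have -> := spectral_integral_uniq mf h2.
by apply: same_Fop => //; apply: same_sym; apply: Fop_id_same; rewrite -AE h1.
Qed.

Lemma funcalc_Fop E f : mC f -> is_funcalc (Fop E idc) f (Fop E f).
Proof. by move=> mf; exists E; apply: spectral_integral_Op => //; exact: mC_idc. Qed.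

Lemma mC_powR s : mC (fun x : R => (x `^ s)%:C%C).
Proof. by apply: mC_real; exact: measurable_powR. Qed.

Lemma bm_ipowR t : bm (fun x : R => ipowR x t).
Proof.
rewrite (_ : (fun x : R => _) = fun x => cis ((fun x => t * ln x) x)) //.
apply: bm_cis; by apply: measurable_funM; [exact: measurable_cst|exact: measurable_ln].
Qed.

Lemma rpow_Fop E s : rpow (Fop E idc) s = Fop E (fun x => (x `^ s)%:C%C).
Proof.
rewrite /rpow; case: xgetP => [T0 _ h|/(_ _ (funcalc_Fop E (mC_powR s)))//].
exact: (funcalc_uniq erefl (mC_powR s) h).
Qed.

Lemma ipow_Phi E t : ipow (Fop E idc) t = Phi E (fun x => ipowR x t).
Proof.
have b := bm_ipowR t; have [m _] := b.
rewrite /ipow; case: xgetP => [U _ h|].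
  have := funcalc_uniq erefl m h; rewrite Op_bounded // => e.
  by apply/funext => x; have : gr U (x, U x) by []; rewrite e.
by move=> /(_ (Phi E (fun x => ipowR x t))); rewrite /= -Op_bounded //; case; exact: funcalc_Fop.
Qed.

(** Strictly positive operators are written e^X, as [Fop E (ex 1)] with [E] the spectral measure of
    the logarithm: real powers become [ex s], imaginary powers [cis (t * s)]. *)
Definition ex (c s : R) : R[i] := (expR (c * s))%:C%C.

Lemma mC_ex c : mC (ex c).
Proof.
apply: mC_real; apply: (measurableT_comp (@measurable_expR R)).
exact: mulrl_measurable.
Qed.

Lemma exN c s : ex (- c) s * ex c s = 1.
Proof. by rewrite /ex -rmorphM -expRD mulNr addNr expR0. Qed.

Lemma exD c d s : ex (c + d) s = ex c s * ex d s.
Proof. by rewrite /ex mulrDl expRD rmorphM. Qed.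

Lemma ex0 s : ex 0 s = 1.
Proof. by rewrite /ex mul0r expR0. Qed.

Lemma ex_inv E c x y : Fop E (ex c) (x, y) <-> Fop E (ex (- c)) (y, x).
Proof.
split; apply: (Op_inv (concentratedT E)); try exact: mC_ex; move=> s _; first exact: exN.
by rewrite mulrC exN.
Qed.

Lemma ex_selfadjoint E c : selfadjoint (Fop E (ex c)).
Proof.
split; first by apply: Op_dense; exact: mC_ex.
rewrite Op_adjoint; last exact: mC_ex.
by congr (Fop _ _); apply/funext => s; rewrite conj_realC.
Qed.

Lemma ex_ge0 E c x y : Fop E (ex c) (x, y) -> 0 <= <|y, x|>.
Proof.
apply: (Op_ge0 (concentratedT E)); first exact: mC_ex.
by move=> s _; exact: expR_ge0.
Qed.

Lemma ex_strictly_positive E c : strictly_positive (Fop E (ex c)).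
Proof.
split; first by split; [exact: ex_selfadjoint|move=> x y; exact: ex_ge0].
move=> x /ex_inv h; apply: Op_fun h (Op_0 _ _); exact: mC_ex.
Qed.

Let expM : measurable_fun [set: T] (expR : T -> T).
Proof. exact: measurable_expR. Qed.

Lemma ex1_push E : Fop E (ex 1) = Fop (push E expM) idc.
Proof. by rewrite Fop_push; [congr (Fop _ _); apply/funext => s; rewrite /ex mul1r|exact: mC_idc]. Qed.

Lemma rpow_ex E s : rpow (Fop E (ex 1)) s = Fop E (ex s).
Proof.
rewrite ex1_push rpow_Fop Fop_push; last exact: mC_powR.
by congr (Fop _ _); apply/funext => l; rewrite /ex /powR gt_eqF ?expR_gt0 // expRK.
Qed.

Lemma ipow_ex E t : ipow (Fop E (ex 1)) t = Phi E (fun s => cis (t * s)).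
Proof.
rewrite ex1_push ipow_Phi Phi_push; last exact: bm_ipowR.
by congr (Phi _ _); apply/funext => l; rewrite /ipowR expRK.
Qed.

Let lnM : measurable_fun [set: T] (@ln R : T -> T).
Proof. exact: measurable_ln. Qed.

(** Positivity and injectivity force [E] to vanish on []-oo, 0]]; the image of [E] under [ln] is
    then the spectral measure of the logarithm. *)
Lemma strictly_positive_log E : strictly_positive (Fop E idc) ->
  exists E', Fop E idc = Fop E' (ex 1).
Proof.
move=> [[_ pos] inj].
have mi := @mC_idc R.
have mneg : measurable (`]-oo, 0]%classic : set R) by exact: measurable_itv.
have spE0 x : spE E `]-oo, 0]%classic x = 0.
  pose B n : set R := `]- n%:R, 0]%classic.
  have mB n : measurable (B n) by exact: measurable_itv.
  have B0 n : spE E (B n) x = 0.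
    (* On []-n, 0]] the operator is minus the square of [Phi E k], so its form is [- |Phi E k x|^2].
       Positivity makes this zero, and injectivity then kills the vector. *)
    pose k s : R[i] := (Num.sqrt (- s) * \1_(B n) s)%:C%C.
    have kk s : k s * k s = - (idc s * cind (B n) s).
      rewrite /k /idc /cind -!rmorphM -rmorphN /=; congr (_%:C)%C.
      rewrite indicE; case: (boolP (s \in B n)) => [|_] /=; rewrite ?mulr0 ?oppr0 ?mul0r // ?mulr1.
      rewrite inE /B /= in_itv /= => /andP[_ s0].
      by rewrite ?mulr1 -expr2 sqr_sqrtr // oppr_ge0.
    have bk : bm k.
      split.
        apply: mC_real; apply: measurable_funM.
          apply: (measurableT_comp (continuous_measurable_fun (@sqrt_continuous R))).
          by apply: measurableT_comp => //; exact: oppr_measurable.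
        exact: (mC_cind (mB n)).1.
      exists (Num.sqrt n%:R) => s; rewrite /k cn_real indicE.
      case: (boolP (s \in B n)) => [|_]; last by rewrite mulr0 normr0 sqrtr_ge0.
      rewrite inE /B /= in_itv /= => /andP[s1 s0].
      by rewrite mulr1 ger0_norm ?sqrtr_ge0 // ler_sqrt ?ler0n // lerNl ltW.
    have kr s : (k s)^* = k s by exact: conj_realC.
    have bi : bm (fun s => idc s * cind (B n) s).
      have -> : (fun s => idc s * cind (B n) s) = fun s => -1 * (k s * k s).
        by apply/funext => s; rewrite kk mulN1r opprK.
      by apply: bm_Z; exact: bm_M.
    have h := Op_bm E x mi (bm_cind (mB n)) bi.
    have yE : Phi E (fun s => idc s * cind (B n) s) x = - Phi E k (Phi E k x).
      rewrite -Phi_mul // -scaleN1r -Phi_Z; last exact: bm_M.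
      by congr (Phi _ _ _); apply/funext => s; rewrite kk mulN1r opprK.
    have kx : Phi E k x = 0.
      apply: hn0_eq0; apply/eqP; rewrite -sqrf_eq0.
      have /complex_ge0P[_ h0] := pos _ _ h; move: h0.
      rewrite Phi_cind // yE ipNl ReN.
      have -> : <|Phi E k (Phi E k x), spE E (B n) x|> = <|Phi E k x, Phi E k x|>.
        rewrite Phi_ip // (_ : (fun s => (k s)^*) = k); last by apply/funext => s.
        rewrite -Phi_cind // -Phi_mul //; last exact: bm_cind.
        congr (<|_, Phi _ _ _|>); apply/funext => s; rewrite /k /cind -rmorphM.
        congr (_%:C)%C; rewrite -mulrA indicE; case: (s \in B n) => /=; rewrite ?mulr1 ?mulr0 //.
      rewrite -hn2E oppr_ge0 => h0; rewrite eq_le h0 sqr_ge0 //.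
    move: h; rewrite Phi_cind // yE kx (lin_0 (Phi_linear _ bk)) oppr0.
    exact: inj.
  have hc : cv (fun n => Phi E (cind (B n)) x) (Phi E (cind `]-oo, 0]%classic) x).
    apply: (@Phi_cv _ _ E setT _ _ 1); first exact: concentratedT.
    - by move=> n; exact: bm_cind.
    - exact: bm_cind.
    - by move=> n s _; exact: cn_cind.
    - move=> s _; apply/rcvg0P => e e0; exists (Num.bound `|s|) => n hn.
      have hs : - n%:R < s.
        have := archi_boundP (normr_ge0 s); rewrite ltr_norml => /andP[h1 _].
        by apply: le_lt_trans h1; rewrite lerN2 ler_nat.
      suff -> : cind (B n) s = cind `]-oo, 0]%classic s by rewrite subrr cn0 normr0.
      by rewrite /cind !indicE !mem_setE !in_itv /= hs.
  rewrite -Phi_cind //; apply: (cv_unique hc).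
  rewrite (_ : (fun n => _) = fun=> 0); first exact: cv_cst.
  by apply/funext => n; rewrite Phi_cind.
have cE : concentrated E `]0, +oo[%classic.
  split; first exact: measurable_itv.
  apply/funext => x; have m2 : measurable (`]0, +oo[%classic : set R) by exact: measurable_itv.
  rewrite -[RHS]/(id x) -(Phi_1 E) -[LHS]addr0 -(spE0 x) -!Phi_cind //.
  rewrite -Phi_D; try exact: bm_cind.
  congr (Phi _ _ _); apply/funext => s.
  rewrite /cind !indicE !mem_setE !in_itv /= andbT -rmorphD /= leNgt.
  by case: ltP => _ /=; rewrite ?addr0 ?add0r.
(* The values of [ln] outside []0, +oo[] are irrelevant, since [E] is concentrated on that
   half-line. *)
exists (push E lnM); rewrite Fop_push; last exact: mC_ex.
apply: (Op_eqD cE) => //.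
  by apply: mC_real; apply: (measurableT_comp (@measurable_expR R)); exact: measurable_funM.
by move=> s /=; rewrite in_itv /= andbT => s0; rewrite /ex mul1r lnK.
Qed.

End Powers.

(** * The modular conjugation *)

Section ModularConjugation.
Variables (R : realType) (H : hilbert R).
Local Notation T := (measurableTypeR R).
Implicit Types (E : spectral_measure H) (x y z : H).

(** [rpow] is a choice whose default is the empty graph, so a single pair in it certifies that [A]
    has a spectral measure. *)
Lemma rpow_spectral (A : H ~> H) (s : R) x y : rpow A s (x, y) -> exists E, A = Fop E idc.
Proof.
rewrite /rpow; case: xgetP => [T0 _ [E h _] _|//].
by exists E; apply: spectral_integral_uniq => //; exact: mC_idc.
Qed.

Lemma strictly_positive_exp (A : H ~> H) (s : R) x y : strictly_positive A ->
  rpow A s (x, y) -> exists E, A = Fop E (ex 1).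
Proof.
move=> sA /rpow_spectral[E AE]; rewrite AE in sA.
by have [E' h] := strictly_positive_log sA; exists E'; rewrite AE.
Qed.

Lemma same_push_exp E E' : Fop E (ex 1) `<=` Fop E' (ex 1) -> same E E'.
Proof.
rewrite !ex1_push => /Fop_id_same h B mB.
have mln : measurable (@ln R @^-1` B).
  by rewrite -[_ @^-1` _]setTI; apply: (@measurable_ln R) => //; exact: measurableT.
have := h _ mln; rewrite /= (_ : expR @^-1` _ = B) //.
by apply/seteqP; split=> s /=; rewrite expRK.
Qed.

(** The bound [t <= t^2 + 1] at [t = expR (c * s)] puts the domain of the square inside that of the
    root. *)
Lemma ex_half E c x z : Fop E (ex (c + c)) (x, z) ->
  exists2 y, Fop E (ex c) (x, y) & Fop E (ex c) (y, z).
Proof.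
move=> h; have me d := @mC_ex R d.
have [y xy] : exists y, Fop E (ex c) (x, y).
  apply: (Op_dom_le (me c) (me _) _ h) => s; rewrite /ex !cn_real !ger0_norm ?expR_ge0 //.
  rewrite mulrDl expRD; move: (expR (c * s)) (expR_ge0 (c * s)) => t t0.
  have := sqr_ge0 (t - 1); rewrite sqrrB !expr2 => ?; nra.
exists y => //; apply: (Op_decomp (me c) (me c) xy).
have -> : (fun s => ex c s * ex c s) = ex (c + c) by apply/funext => s; rewrite exD.
exact: h.
Qed.

Lemma ex_comp E c d x y z : Fop E (ex c) (x, y) -> Fop E (ex d) (y, z) ->
  Fop E (ex (d + c)) (x, z).
Proof.
move=> xy yz; have := Op_comp (mC_ex c) (mC_ex d) xy yz.
by have -> : (fun s => ex d s * ex c s) = ex (d + c) by apply/funext => s; rewrite exD.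
Qed.

Lemma ex_ran_dense E c : closure (ran (Fop E (ex c))) = setT.
Proof.
rewrite -(Op_dense E (mC_ex (- c))); congr closure.
by apply/seteqP; split=> y [x xy]; exists x; apply/ex_inv; rewrite ?opprK.
Qed.

Lemma antiunitary_semi (J : op H) : antiunitary J -> exists J', semiunitary true J J'.
Proof.
move=> [lJ nJ sJ]; have [J' hJ'] := choice sJ; exists J'; split=> // x.
  by rewrite /hn nJ.
have lJ' : semiunitary true J J' -> True by [].
apply/eqP; rewrite -subr_eq0 -normr_eq0; apply/eqP.
have JB u v : J (u - v) = J u - J v.
  by have := lJ (-1) v u; rewrite !scaleN1r addrC => ->; rewrite rmorphN rmorph1 scaleN1r addrC.
by rewrite -nJ JB hJ' subrr normr0.
Qed.

Let negM : measurable_fun [set: T] (-%R : T -> T).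
Proof. exact: oppr_measurable. Qed.

(* The symmetry of [S = J A], [A = nabla^(1/2)], reads [A = J^-2 (J A^-1 J^-1)], so that
   [A = J A^-1 J^-1] and [J^2 = 1] by uniqueness of the polar decomposition. *)
Lemma modular_conjugation (S nabla : H ~> H) (J : op H) :
  strictly_positive nabla -> antiunitary J -> antilinear_polar S J (rpow nabla 2^-1) ->
  (forall x y, S (x, y) -> S (y, x)) ->
  exists E, [/\ nabla = Fop E (ex 1), semiunitary true J J,
    forall g x, bm g -> J (Phi E g (J x)) = Phi E (fun l => (g (- l))^*) x,
    forall c x y, Fop E (ex c) (x, y) <-> Fop E (ex (- c)) (J x, J y) &
    forall x z, S (x, z) <-> Fop E (ex 2^-1) (x, J z)].
Proof.
move=> sn aJ [[[_ sa] _] SE _ _ _] Ssym.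
have [E nE] : exists E, nabla = Fop E (ex 1).
  (* Selfadjointness alone provides a pair of the graph and so rules out the default value of
     [rpow]. *)
  have h : rpow nabla 2^-1 (0, 0).
    by rewrite -sa /= => x y _; rewrite ip0r ip0r.
  exact: strictly_positive_exp sn h.
rewrite nE rpow_ex in SE; set A := Fop E (ex 2^-1) in SE.
have [J' hJ] := antiunitary_semi aJ; have hJ' := semiunitary_sym hJ.
have K := suK hJ; have K' := suK' hJ.
have SJ x y : S (x, J y) <-> A (x, y).
  rewrite SE; split=> [[w /= [h e]]|h]; last by exists y.
  by move/(can_inj K): e => ->.
have swap x y : A (x, y) <-> A (J y, J' x).
  split=> h; first by apply/SJ; rewrite K'; apply: Ssym; apply/SJ.
  by apply/SJ; apply: Ssym; rewrite -[x]K'; apply/SJ.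
(* The spectral measure of J (- log nabla) J^-1, whose [ex 2^-1] is J A^-1 J^-1. *)
pose E' := transport hJ' (push E negM).
have pushE c x y : Fop (push E negM) (ex c) (x, y) <-> Fop E (ex (- c)) (x, y).
  rewrite Fop_push; last exact: mC_ex.
  have -> : (fun s => ex c (- s)) = ex (- c) by apply/funext => s; rewrite /ex mulrN mulNr.
  exact: iff_refl.
have E'E c x y : Fop E' (ex c) (x, y) <-> Fop E (ex (- c)) (J' x, J' y).
  rewrite -pushE; rewrite Fop_tr; last exact: mC_ex.
  have -> : (fun s => cif true (ex c s)) = ex c by apply/funext => s; exact: conj_realC.
  exact: iff_refl.
have AB x y : A (x, y) <-> Fop E' (ex 2^-1) (x, J (J y)).
  split=> [/(swap x y).1 h|/(E'E _ _ _).1]; last by rewrite K => h; apply/swap; apply/ex_inv.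
  by apply/E'E; rewrite K; exact: (ex_inv E 2^-1 (J y) (J' x)).1.
have J2 x y : <|J (J x), J (J y)|> = <|x, y|> by rewrite !(su_ip hJ) /= conjK.
have JJ x : J (J (J' (J' x))) = x by rewrite !K'.
(* [AB] says that J A^-1 J^-1 = J^2 A. As J^2 is unitary, both selfadjoint operators have the same
   square [nabla], and this determines the spectral measure. *)
have hs : same E E'.
  apply: same_push_exp => -[x z] /=.
  have e1 : (1 : R) = 2^-1 + 2^-1 by field.
  rewrite {1}e1 => /ex_half[y xy yz]; rewrite e1.
  have xy' := (AB _ _).1 xy; apply: (ex_comp xy').
  have [_ <-] := ex_selfadjoint E' 2^-1 => x' v h /=.
  have {}h : A (x', J' (J' v)) by apply/AB; rewrite JJ.
  rewrite -[v]JJ J2; have [_ sA] := ex_selfadjoint E 2^-1.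
  have h2 : adjoint A (y, z) by rewrite /A sA.
  exact: h2 h.
have mex c := @mC_ex R c.
(* Now A = J^2 A, so J^2 is the identity on the dense range of [A]. *)
have J2id y : J (J y) = y.
  apply/eqP; rewrite -subr_eq0; apply/eqP; apply: hn0_eq0; apply/eqP; rewrite eq_le hn_ge0 andbT.
  apply/ler_addgt0Pr => e e0; rewrite add0r.
  have : closure (ran A) y by rewrite /A ex_ran_dense.
  move=> /closureE/(_ (e / 2) _)[|z [[x xz] hz]]; first by rewrite divr_gt0.
  have Jz : J (J z) = z.
    have h2 : Fop E (ex 2^-1) (x, J (J z)) by rewrite (same_Fop hs (mex _)); exact: (AB x z).1.
    exact: (Op_fun (mex _) h2 xz).
  have -> : J (J y) - y = J (J (y - z)) - (y - z).
    by rewrite !(suB hJ) Jz opprB addrA subrK.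
  by rewrite (le_trans (hnB _ _)) // !(su_hn hJ) hnBC; move: hz; set t := hn _ => hz; lra.
have J'J x : J' x = J x by rewrite -[in RHS](K' x) J2id.
have hJJ : semiunitary true J J.
  by case: hJ => h1 h2 _ _; split.
exists E; split; [exact: nE|exact: hJJ| | |].
- move=> g x bg.
  have b1 : bm (fun l => (g (- l))^*) by apply: bm_conj; exact: bm_comp.
  rewrite (same_Phi hs b1) Phi_tr // Phi_push; last exact: bm_cif.
  rewrite /= J'J; congr (J (Phi _ _ _)); apply/funext => l.
  by rewrite conjK opprK.
- by move=> c x y; rewrite {1}(same_Fop hs (mex c)) -!J'J; exact: E'E.
- by move=> x z; rewrite -{1}[z]J2id; exact: SJ.
Qed.

End ModularConjugation.

(** * Weyl commutation relations *)

Section ComplexExp.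
Variable R : realType.
Local Notation T := (measurableTypeR R).
Implicit Types (z w : R[i]) (a b t : R).

Definition cexp z : R[i] := (expR (complex.Re z))%:C%C * cis (complex.Im z).

Lemma cexpD z w : cexp (z + w) = cexp z * cexp w.
Proof. by rewrite /cexp ReD ImD expRD rmorphM cisD; ring. Qed.

Lemma cexp0 : cexp 0 = 1.
Proof. by rewrite /cexp /= expR0 cis0 mulr1. Qed.

Lemma cexpMn z n : cexp (z *+ n) = cexp z ^+ n.
Proof. by elim: n => [|n IH]; rewrite ?expr0 ?cexp0 // mulrS cexpD IH exprS. Qed.

Lemma cn_cexp z : cn (cexp z) = expR (complex.Re z).
Proof. by rewrite /cexp cnM cn_cis cn_real mulr1 ger0_norm // expR_ge0. Qed.

Lemma cexp_real a : cexp a%:C%C = (expR a)%:C%C.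
Proof. by rewrite /cexp /= cis0 mulr1. Qed.

Lemma cexp_i a : cexp ('i%C * a%:C%C) = cis a.
Proof. by rewrite /cexp ReM ImM /= !(mul0r, mul1r, subr0, oppr0, addr0, add0r) expR0 mul1r. Qed.

Lemma mC_cexp f : mC f -> mC (fun s : R => cexp (f s)).
Proof.
move=> [m1 m2]; apply: mC_M.
  by apply: mC_real; apply: (measurableT_comp (@measurable_expR R)).
have [] := @bm_cis R (fun s => complex.Im (f s)); last by [].
exact: m2.
Qed.

Lemma norm_expRB1 (u : R) : `|expR u - 1| <= expR `|u| * `|u|.
Proof.
have := @mvt_bound R expR expR (expR `|u|) u _ _; rewrite expR0; apply => y.
by move=> h; rewrite ger0_norm ?expR_ge0 // ler_expR (le_trans _ h) // ler_norm.
Qed.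

Lemma norm_expRB1B (u : R) : `|expR u - 1 - u| <= expR `|u| * `|u| ^+ 2.
Proof.
have := @mvt_bound R (fun y => expR y - 1 - y) (fun y => expR y - 1) (expR `|u| * `|u|) u _ _.
rewrite expR0 !subrr !subr0 expr2 mulrA; apply => y.
  by apply: is_derive_eq; rewrite subr0.
move=> h; apply: (le_trans (norm_expRB1 y)).
by apply: ler_pM => //; rewrite ?expR_ge0 // ler_expR.
Qed.

Lemma cn_cexpB1B z : cn z <= 1 -> cn (cexp z - 1 - z) <= (4 * expR 1 + 3) * cn z ^+ 2.
Proof.
move=> z1; have := Re_le_cn z; have := Im_le_cn z.
set a := complex.Re z; set b := complex.Im z; set m := cn z => bm am.
have m0 : 0 <= m by exact: cn_ge0.
set K := expR 1; have K0 : 0 <= K by exact: expR_ge0.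
have eK (y : R) : `|y| <= m -> expR `|y| <= K by move=> h; rewrite ler_expR (le_trans h).
have e1 : `|expR a - 1| <= K * m.
  apply: (le_trans (norm_expRB1 a));  by apply: ler_pM => //; exact: eK.
have e2 : `|expR a - 1 - a| <= K * m ^+ 2.
  apply: (le_trans (norm_expRB1B a)); apply: ler_pM; rewrite ?expR_ge0 ?exprn_ge0 ?eK //.
  by apply: lerXn2r; rewrite ?nnegrE.
have e3 : `|cos b - 1| <= m ^+ 2.
  by apply: (le_trans (norm_cosB1_le b)); apply: lerXn2r; rewrite ?nnegrE.
have e4 : `|sin b - b| <= m ^+ 2.
  apply: (le_trans (norm_sinB_le b)); apply: (@le_trans _ _ (m ^+ 3)).
    by apply: lerXn2r; rewrite ?nnegrE.
  by rewrite exprS ler_piMl // exprn_ge0.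
have e5 : expR a <= K by rewrite ler_expR (le_trans _ (le_trans am z1)) // ler_norm.
have e6 : `|sin b| <= m by apply: le_trans bm; exact: norm_sin_le.
apply: (le_trans (cn_le _)).
have -> : complex.Re (cexp z - 1 - z) = (expR a - 1 - a) + expR a * (cos b - 1).
  by rewrite /cexp !(ReD, ReN, ReM) /= -/a -/b; ring.
have -> : complex.Im (cexp z - 1 - z) = (expR a - 1) * sin b + (sin b - b).
  by rewrite /cexp !(ImD, ImN, ImM, ReM) /= -/a -/b; ring.
have h1 : `|(expR a - 1 - a) + expR a * (cos b - 1)| <= K * m ^+ 2 + K * m ^+ 2.
  apply: (le_trans (ler_normD _ _)); apply: lerD => //; rewrite normrM.
  by apply: ler_pM => //; rewrite ger0_norm // expR_ge0.
have h2 : `|(expR a - 1) * sin b + (sin b - b)| <= K * m * m + m ^+ 2.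
  by apply: (le_trans (ler_normD _ _)); apply: lerD => //; rewrite normrM; apply: ler_pM.
apply: (le_trans (lerD h1 h2)); have := sqr_ge0 m; move: K0; rewrite expr2 -mulrA.
move: (m * m) => q; clear; move=> K0 q0; have := mulr_ge0 K0 q0; nra.
Qed.

Lemma cn_expB (z w : R[i]) (k : R) n : 0 <= k -> cn z <= k -> cn w <= k ->
  cn (z ^+ n - w ^+ n) <= n%:R * k ^+ n.-1 * cn (z - w).
Proof.
move=> k0 zk wk; elim: n => [|n IH]; first by rewrite !expr0 subrr cn0 mul0r mul0r.
have -> : z ^+ n.+1 - w ^+ n.+1 = z * (z ^+ n - w ^+ n) + (z - w) * w ^+ n.
  by rewrite !exprS; ring.
apply: (le_trans (cnD _ _)); rewrite !cnM cnX.
have h1 : cn z * cn (z ^+ n - w ^+ n) <= n%:R * k ^+ n * cn (z - w).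
  case: n IH => [|n] IH; first by rewrite !expr0 subrr cn0 mulr0 mul0r mul0r.
  apply: (le_trans (ler_pM (cn_ge0 _) (cn_ge0 _) zk IH)).
  by rewrite [_.+1.-1]/= [X in _ <= _ * X * _]exprS !mulrA [k * _]mulrC.
have h2 : cn (z - w) * cn w ^+ n <= k ^+ n * cn (z - w).
  by rewrite mulrC ler_wpM2r ?cn_ge0 //; apply: lerXn2r; rewrite ?nnegrE ?cn_ge0.
by apply: (le_trans (lerD h1 h2)); rewrite -addn1 natrD !mulrDl mul1r addn1.
Qed.

Lemma cn_1D_le z n : cn (1 + (n.+1%:R^-1)%:C%C * z) <= expR (cn z / n.+1%:R).
Proof.
apply: (le_trans (cnD _ _)); rewrite cn1 cnM cn_real ger0_norm ?invr_ge0 // mulrC.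
exact: expR_ge1Dx.
Qed.

Lemma cn_exp_lim_le z n : cn ((1 + (n.+1%:R^-1)%:C%C * z) ^+ n.+1) <= expR (cn z).
Proof.
rewrite cnX; apply: (@le_trans _ _ (expR (cn z / n.+1%:R) ^+ n.+1)).
  by apply: lerXn2r; rewrite ?nnegrE ?cn_ge0 ?expR_ge0 // cn_1D_le.
by rewrite -expRM_natl mulrC divfK ?pnatr_eq0.
Qed.

(** [1 + z / m] and [cexp (z / m)] differ by order [1 / m^2]; telescoping the [m]-th powers, with
    uniformly bounded factors, leaves order [1 / m]. *)
Lemma cexp_lim z : (fun n => cn ((1 + (n.+1%:R^-1)%:C%C * z) ^+ n.+1 - cexp z)) @ \oo --> (0 : R).
Proof.
pose K := expR 1 * 4 + 3 : R.
pose C := expR (cn z) * (K * cn z ^+ 2).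
have zn n : cexp z = cexp ((n.+1%:R^-1)%:C%C * z) ^+ n.+1.
  rewrite -cexpMn -(mulr_natl ((n.+1%:R^-1)%:C%C * z) n.+1) mulrA -(rmorph_nat (real_complex R)) -rmorphM divff ?pnatr_eq0 //.
  by rewrite mul1r.
suff [N hN] : exists N, forall n, (N <= n)%N ->
    cn ((1 + (n.+1%:R^-1)%:C%C * z) ^+ n.+1 - cexp z) <= n.+1%:R^-1 * C.
  apply/rcvg0P => e e0.
  have /rcvg0P/(_ _ e0)[N' hN'] : (fun n => n.+1%:R^-1 * C) @ \oo --> (0 : R).
    by rewrite -[X in _ --> X](mul0r C); apply: cvgMl; exact: cvg_harmonic.
  exists (maxn N N') => n; rewrite geq_max => /andP[h1 h2].
  rewrite ger0_norm ?cn_ge0 //; apply: le_lt_trans (hN n h1) _.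
  by apply: le_lt_trans (hN' n h2); exact: ler_norm.
exists (Num.bound (cn z)) => n hn; rewrite (zn n).
set w := (n.+1%:R^-1)%:C%C * z.
have cw : cn w = n.+1%:R^-1 * cn z by rewrite cnM cn_real ger0_norm.
have w1 : cn w <= 1.
  rewrite cw mulrC ler_pdivrMr ?ltr0n // mul1r (le_trans (ltW (archi_boundP (cn_ge0 z)))) //.
  by rewrite ler_nat leqW.
have k1 := cn_1D_le z n; rewrite -/w in k1.
have k2 : cn (cexp w) <= expR (cn z / n.+1%:R).
  by rewrite cn_cexp ler_expR mulrC -cw (le_trans _ (Re_le_cn _)) // ler_norm.
apply: (le_trans (cn_expB _ (expR_ge0 _) k1 k2)).
have h1 : cn (1 + w - cexp w) <= K * cn w ^+ 2.
  by rewrite -cnN (_ : - _ = cexp w - 1 - w); [rewrite /K [_ * 4]mulrC cn_cexpB1B|ring].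
have h2 : expR (cn z / n.+1%:R) ^+ n <= expR (cn z).
  rewrite -expRM_natl ler_expR mulrA ler_pdivrMr ?ltr0n // mulrC ler_wpM2l ?cn_ge0 //.
  by rewrite ler_nat leqW.
rewrite /C (_ : n.+1.-1 = n) //.
apply: (@le_trans _ _ (n.+1%:R * expR (cn z) * (K * cn w ^+ 2))).
  apply: ler_pM; rewrite ?mulr_ge0 ?cn_ge0 ?exprn_ge0 ?expR_ge0 //.
  by rewrite ler_wpM2l.
rewrite cw; have : (n.+1%:R : R) != 0 by rewrite pnatr_eq0.
move: (n.+1%:R : R) (expR (cn z)) (cn z) => m e q m0.
by rewrite le_eqVlt; apply/orP; left; apply/eqP; field.
Qed.

End ComplexExp.

(** * Consequences of the Weyl relation for functions of one operator *)

Section Commutation.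
Variables (R : realType) (H : hilbert R).
Local Notation T := (measurableTypeR R).
Implicit Types (E F : spectral_measure H).

Definition ccr E F (r : R) := forall (s t : R) (x : H),
  Phi E (fun l => cis (s * l)) (Phi F (fun l => cis (t * l)) x) =
  cis (r * s * t) *: Phi F (fun l => cis (t * l)) (Phi E (fun l => cis (s * l)) x).

Lemma ccr_sym E F r : ccr E F r -> ccr F E (- r).
Proof.
move=> h s t x; rewrite h scalerA -cisD.
by rewrite (_ : - r * s * t + r * t * s = 0) ?cis0 ?scale1r //; ring.
Qed.

Lemma cis_semi E t : semiunitary false (Phi E (fun l => cis (t * l))) (Phi E (fun l => cis (- t * l))).
Proof.
have b u := bm_cisM (u : R).
have K u : cancel (Phi E (fun l => cis (u * l))) (Phi E (fun l => cis (- u * l))).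
  move=> x; rewrite -Phi_mul //.
  rewrite (_ : (fun s => _) = fun=> 1) ?Phi_1 //; apply/funext => s.
  by rewrite mulNr cisNK.
split; [exact: Phi_linear| | exact: K|].
  move=> x; apply/eqP; rewrite eq_le.
  have hb u y : hn (Phi E (fun l => cis (u * l)) y) <= hn y.
    by have := @Phi_bdd _ _ E _ 1 y (b u); rewrite mul1r; apply => s; rewrite cn_cis.
  by rewrite hb /= -{1}[x](K t) hb.
by have := K (- t); rewrite opprK.
Qed.

Section One.
Variables (E F : spectral_measure H) (r : R).
Hypothesis EF : ccr E F r.

Let shift (s : R) (l : R) : R := l + r * s.

Let m_shift s : measurable_fun [set: T] (shift s : T -> T).
Proof. by apply: measurable_funD => //; exact: measurable_cst. Qed.

Lemma bm_shift s g : bm g -> bm (fun l => g (l + r * s)).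
Proof. by move=> bg; exact: (bm_comp bg (m_shift s)). Qed.

(** By the Weyl relation, conjugation by e^(isE) multiplies e^(itF) by [cis (r * s * t)], just as
    the translation by [r * s] does; [stone_same] passes from these exponentials to all Borel
    functions. *)
Let shift_same s : same (transport (cis_semi E (- s)) F) (push F (m_shift s)).
Proof.
apply: stone_same => t; have b u := bm_cisM (u : R).
rewrite Phi_tr // Phi_push //; apply/funext => x /=; rewrite opprK.
have -> : (fun l => cis (t * shift s l)) = fun l => cis (r * s * t) * cis (t * l).
  by apply/funext => l; rewrite /shift mulrDr cisD mulrC [t * (r * s)]mulrC.
have := EF s t (Phi E (fun l => cis (- s * l)) x).
by rewrite Phi_Z // /cif /= => ->; rewrite (suK' (cis_semi E s)).
Qed.

Lemma ccr_shift s g x : bm g ->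
  Phi E (fun l => cis (s * l)) (Phi F g x) =
  Phi F (fun l => g (l + r * s)) (Phi E (fun l => cis (s * l)) x).
Proof.
move=> bg; have := same_Phi (shift_same s) bg.
rewrite Phi_tr // Phi_push // => /(congr1 (fun f => f (Phi E (fun l => cis (s * l)) x))).
by rewrite /= opprK /cif /= (suK (cis_semi E s)).
Qed.

Lemma ccr_Fop s f x y : mC f ->
  Fop F (fun l => f (l + r * s)) (x, y) <->
  Fop F f (Phi E (fun l => cis (- s * l)) x, Phi E (fun l => cis (- s * l)) y).
Proof.
move=> mf; have h := same_Fop (shift_same s) mf; rewrite Fop_push // in h.
have e : Fop F (fun s0 => f (shift s s0)) (x, y) <->
    Fop (transport (cis_semi E (- s)) F) f (x, y) by rewrite h.
apply: (iff_trans e); apply: (iff_trans (Fop_tr _ _ _ _ mf)); exact: iff_refl.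
Qed.

End One.

Lemma Op_Z E f c x y : mC f -> Fop E f (x, y) -> Fop E (fun s => c * f s) (x, c *: y).
Proof.
move=> mf h; have bc := bm_cst c; apply: (Op_comp mf (bc).1 h).
by rewrite (Op_bounded E bc) /gr /= Phi_cst.
Qed.

(* In the examples [g] is entire and [h l = g (l - i r)]. *)
Definition gpair E F (g h : R -> R[i]) := [/\ bm g, bm h & forall x y,
  Fop E (ex 1) (x, y) -> Fop E (ex 1) (Phi F g x, Phi F h y)].

Section Pairs.
Variables (E F : spectral_measure H) (r : R).
Hypothesis EF : ccr E F r.
Local Notation gp := (gpair E F).
Implicit Types (g h : R -> R[i]).

(** Conjugation by e^(itF) translates [E] by [- r t], so it multiplies e^E by a scalar. The factor
    [expR (r * t)] is the one that evaluates [cis (t * l)] at [l - i r]. *)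
Lemma gpair_cis t : gp (fun l => cis (t * l)) (fun l => (expR (r * t))%:C%C * cis (t * l)).
Proof.
have b := bm_cisM t; split=> //; first exact: bm_Z.
move=> x y xy; rewrite Phi_Z //.
have me := @mC_ex R 1.
have := Op_Z (expR (r * t))%:C%C me xy.
have -> : (fun s => (expR (r * t))%:C%C * ex 1 s) = (fun l => ex 1 (l + - r * - t)).
  apply/funext => l; rewrite /ex -rmorphM -expRD; congr ((expR _)%:C)%C; ring.
move/(ccr_Fop (ccr_sym EF) (- t) _ _ me); rewrite opprK.
by rewrite (lin_Z (Phi_linear _ b)).
Qed.

Lemma gpair_lin c g h g' h' : gp g h -> gp g' h' ->
  gp (fun l => c * g l + g' l) (fun l => c * h l + h' l).
Proof.
move=> [bg bh p] [bg' bh' p']; split; try exact: bm_lincomb.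
by move=> x y xy; rewrite !Phi_lin //; apply: Op_lin; [exact: mC_ex|exact: p|exact: p'].
Qed.

Lemma gpair_cst c : gp (fun=> c) (fun=> c).
Proof.
split; try exact: bm_cst.
move=> x y xy; rewrite !Phi_cst -[c *: x]addr0 -[c *: y]addr0.
by apply: Op_lin => //; [exact: mC_ex|apply: Op_0; exact: mC_ex].
Qed.

Lemma gpair_M g h g' h' : gp g h -> gp g' h' ->
  gp (fun l => g l * g' l) (fun l => h l * h' l).
Proof.
move=> [bg bh p] [bg' bh' p']; split; try exact: bm_M.
by move=> x y xy; rewrite !Phi_mul //; apply: p; apply: p'.
Qed.

Lemma gpair_X g h n : gp g h -> gp (fun l => g l ^+ n) (fun l => h l ^+ n).
Proof.
move=> p; elim: n => [|n IH]; first exact: gpair_cst.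
have := gpair_M p IH.
by congr (gp _ _); apply/funext => l; rewrite exprS.
Qed.

Lemma gpair_lim (g_ h_ : nat -> R -> R[i]) g h (c : R) : bm g -> bm h ->
  (forall n, gp (g_ n) (h_ n)) ->
  (forall n l, cn (g_ n l) <= c) -> (forall n l, cn (h_ n l) <= c) ->
  (forall l, (fun n => cn (g_ n l - g l)) @ \oo --> (0 : R)) ->
  (forall l, (fun n => cn (h_ n l - h l)) @ \oo --> (0 : R)) -> gp g h.
Proof.
move=> bg bh p cg ch lg lh; split=> // x y xy.
apply: (@Op_closed _ _ _ _ (fun n => Phi F (g_ n) x) (fun n => Phi F (h_ n) y)).
- exact: mC_ex.
- by move=> n; have [_ _] := p n; apply.
- apply: (Phi_cv (D := setT) (c := c)) => //; [exact: concentratedT|by move=> n; have [] := p n].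
- apply: (Phi_cv (D := setT) (c := c)) => //; [exact: concentratedT|by move=> n; have [] := p n].
Qed.

Lemma bm_cexp g : bm g -> bm (fun l => cexp (g l)).
Proof.
move=> [mg [c hc]]; split; first exact: mC_cexp.
exists (expR c) => s; rewrite cn_cexp ler_expR (le_trans _ (hc s)) //.
by rewrite (le_trans _ (Re_le_cn _)) // ler_norm.
Qed.

(** Euler's limit builds the exponential from sums and products, under which pairs are stable;
    [cn_exp_lim_le] bounds the approximants uniformly. *)
Lemma gpair_cexp g h : gp g h -> gp (fun l => cexp (g l)) (fun l => cexp (h l)).
Proof.
move=> p; have [bg bh _] := p.
have [c1 c10 hc1] := bm_ge0 bg; have [c2 c20 hc2] := bm_ge0 bh.
pose a (g : R -> R[i]) n l := (1 + (n.+1%:R^-1)%:C%C * g l) ^+ n.+1.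
apply: (@gpair_lim (a g) (a h) _ _ (expR (c1 + c2))); try exact: bm_cexp.
- move=> n; apply: gpair_X; have := gpair_lin (n.+1%:R^-1)%:C%C p (gpair_cst 1).
  by congr (gp _ _); apply/funext => l; rewrite addrC.
- by move=> n l; rewrite (le_trans (cn_exp_lim_le _ _)) // ler_expR (le_trans (hc1 l)) // lerDl.
- by move=> n l; rewrite (le_trans (cn_exp_lim_le _ _)) // ler_expR (le_trans (hc2 l)) // lerDr.
- by move=> l; exact: cexp_lim.
- by move=> l; exact: cexp_lim.
Qed.

End Pairs.

End Commutation.

Section ComplexLimits.
Variable R : realType.
Implicit Types (u v : nat -> R[i]) (z w : R[i]).

Definition ccv u z := (fun n => cn (u n - z)) @ \oo --> (0 : R).

Lemma ccvP u z : ccv u z <-> forall e : R, 0 < e -> exists N, forall n, (N <= n)%N -> cn (u n - z) < e.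
Proof.
rewrite /ccv rcvg0P; split=> h e e0; have [N hN] := h e e0; exists N => n /hN;
  by rewrite ger0_norm ?cn_ge0.
Qed.

Lemma ccv_squeeze u z (b : nat -> R) : (forall n, cn (u n - z) <= b n) ->
  b @ \oo --> (0 : R) -> ccv u z.
Proof.
by move=> h; apply: rcvg_squeeze => n; rewrite subr0 ger0_norm ?cn_ge0.
Qed.

Lemma ccv_cst z : ccv (fun=> z) z.
Proof. by apply: (@ccv_squeeze _ _ (fun=> 0)) => [n|]; [rewrite subrr cn0|exact: cvg_cst]. Qed.

Lemma ccvD u v z w : ccv u z -> ccv v w -> ccv (fun n => u n + v n) (z + w).
Proof.
move=> h1 h2; apply: (@ccv_squeeze _ _ (fun n => cn (u n - z) + cn (v n - w))) => [n|].
  by rewrite (_ : _ - _ = (u n - z) + (v n - w)) ?cnD //; ring.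
by rewrite -[X in _ --> X]addr0; exact: cvgD.
Qed.

Lemma ccvM u v z w : ccv u z -> ccv v w -> ccv (fun n => u n * v n) (z * w).
Proof.
move=> h1 h2; pose a n := cn (u n - z); pose b n := cn (v n - w).
apply: (@ccv_squeeze _ _ (fun n => a n * b n + (cn z * b n + cn w * a n))) => [n|].
  have -> : u n * v n - z * w = (u n - z) * (v n - w) + (z * (v n - w) + w * (u n - z)) by ring.
  apply: (le_trans (cnD _ _)); rewrite cnM lerD2l.
  by apply: (le_trans (cnD _ _)); rewrite !cnM.
rewrite [X in _ --> X](_ : 0 = 0 * 0 + (cn z * 0 + cn w * 0)); last by rewrite !mulr0 !addr0.
apply: cvgD; first exact: cvgM.
by apply: cvgD; apply: cvgMr.
Qed.

Lemma ccv_cexp u z : ccv u z -> ccv (fun n => cexp (u n)) (cexp z).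
Proof.
move=> /ccvP h; pose K := 1 + (4 * expR 1 + 3) : R.
have K0 : 0 < K by rewrite /K; have := expR_gt0 (1 : R) => ?; lra.
apply/ccvP => e e0.
pose d := Num.min 1 (e / (cn (cexp z) * K + 1)).
have q0 : 0 < cn (cexp z) * K + 1 by rewrite ltr_wpDl // mulr_ge0 ?cn_ge0 // ltW.
have d0 : 0 < d by rewrite lt_min ltr01 divr_gt0.
have [N hN] := h d d0; exists N => n /hN; rewrite lt_min => /andP[h1 h2].
have -> : cexp (u n) - cexp z = cexp z * (cexp (u n - z) - 1).
  by rewrite mulrBr mulr1 -cexpD [z + _]addrC subrK.
set w := u n - z in h1 h2 *.
have h3 : cn (cexp w - 1) <= K * cn w.
  have -> : cexp w - 1 = w + (cexp w - 1 - w) by ring.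
  apply: (le_trans (cnD _ _)); rewrite /K mulrDl mul1r lerD2l.
  apply: (le_trans (cn_cexpB1B (ltW h1))); apply: ler_wpM2l.
    by rewrite addr_ge0 // mulr_ge0 // expR_ge0.
  by rewrite expr2 ler_piMl ?cn_ge0 // ltW.
rewrite cnM; apply: (@le_lt_trans _ _ (cn (cexp z) * (K * cn w))).
  by rewrite ler_wpM2l ?cn_ge0.
move: h2; rewrite ltr_pdivlMr //; apply: le_lt_trans.
by rewrite mulrA mulrC ler_wpM2l ?cn_ge0 // lerDl.
Qed.

End ComplexLimits.

(** * Gaussians of one operator map the domain of the other exponential into itself *)

Section Gaussians.
Variables (R : realType) (H : hilbert R) (E F : spectral_measure H) (r : R).
Hypothesis EF : ccr E F r.
Local Notation gp := (gpair E F).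
Implicit Types (t q l : R).

(* (2 / t) sin (t z / 2) at z = l - i q *)
Let sgm t q l : R[i] := (- 'i%C * (t^-1)%:C%C) *
  ((expR (t / 2 * q))%:C%C * cis (t / 2 * l) - (expR (- (t / 2 * q)))%:C%C * cis (- (t / 2 * l))).

(** The coordinate [l] is unbounded and belongs to no pair; [sgm] is a bounded combination of
    characters that tends to it, and to its shift, as [t] tends to 0. *)
Let sgm_pair t : gp (sgm t 0) (sgm t r).
Proof.
have := gpair_lin (- 'i%C * (t^-1)%:C%C)
  (gpair_lin (-1) (gpair_cis EF (- (t / 2))) (gpair_cis EF (t / 2))) (gpair_cst E F 0).
congr (gp _ _); apply/funext => l; rewrite /sgm ?mulr0 ?oppr0 ?expR0 mulN1r addr0 (mulNr (t / 2) l).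
  by rewrite !mul1r addrC.
by rewrite addrC mulrN [r * _]mulrC.
Qed.

Let zc q l : R[i] := (l +i* (- q))%C.

Let sgmE t q l (w := (t / 2)%:C%C * ('i%C * zc q l)) :
  sgm t q l = (- 'i%C * (t^-1)%:C%C) * (cexp w - cexp (- w)).
Proof.
have wE : w = ((t / 2 * q) +i* (t / 2 * l))%C.
  by apply: complex_eq; rewrite /w /zc !(ReM, ImM) /=; ring.
by rewrite /cexp wE /sgm !(ReN, ImN).
Qed.

Let sgm_cvg q l : ccv (fun n => sgm n.+1%:R^-1 q l) (zc q l).
Proof.
pose K := 4 * expR 1 + 3 : R.
pose C := K * cn (zc q l) ^+ 2.
suff [N hN] : exists N, forall n, (N <= n)%N -> cn (sgm n.+1%:R^-1 q l - zc q l) <= n.+1%:R^-1 * C.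
  apply/ccvP => e e0.
  have /rcvg0P/(_ _ e0)[N' hN'] : (fun n => n.+1%:R^-1 * C) @ \oo --> (0 : R).
    by rewrite -[X in _ --> X](mul0r C); apply: cvgMl; exact: cvg_harmonic.
  exists (maxn N N') => n; rewrite geq_max => /andP[h1 h2].
  apply: le_lt_trans (hN n h1) _.
  by apply: le_lt_trans (hN' n h2); exact: ler_norm.
exists (Num.bound (cn (zc q l))) => n hn; rewrite sgmE.
set t : R := n.+1%:R^-1; set w := _ * ('i%C * _).
have t0 : 0 < t by rewrite invr_gt0 ltr0n.
have ti0 : 0 <= t^-1 by rewrite invr_ge0 ltW.
have cw : cn w = t / 2 * cn (zc q l).
  by rewrite /w cnM cn_real cnM cn_i mul1r ger0_norm // divr_ge0 // ltW.
have w1 : cn w <= 1.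
  rewrite cw; apply: (@le_trans _ _ (t * cn (zc q l))).
    by rewrite ler_wpM2r ?cn_ge0 //; lra.
  rewrite /t mulrC ler_pdivrMr ?ltr0n // mul1r (le_trans (ltW (archi_boundP (cn_ge0 _)))) //.
  by rewrite ler_nat leqW.
have tC : (t%:C%C : R[i]) != 0 by apply/eqP => -[] /eqP; rewrite gt_eqF.
have zE : zc q l = (- 'i%C * (t^-1)%:C%C) * (w + w).
  rewrite /w -mulrDl -rmorphD -splitr.
  have -> : - 'i%C * (t^-1)%:C%C * (t%:C%C * ('i%C * zc q l)) =
      - ('i%C * 'i%C) * ((t^-1)%:C%C * t%:C%C) * zc q l by ring.
  by rewrite mul_ii opprK mul1r -rmorphM mulVf ?gt_eqF // mul1r.
rewrite zE -mulrBr.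
have -> : cexp w - cexp (- w) - (w + w) = (cexp w - 1 - w) - (cexp (- w) - 1 - - w) by ring.
rewrite cnM cnM cnN cn_i mul1r cn_real (ger0_norm ti0).
have h1 := cn_cexpB1B w1; have h2 := @cn_cexpB1B _ (- w); rewrite cnN in h2; have {}h2 := h2 w1.
apply: (@le_trans _ _ (t^-1 * (K * cn w ^+ 2 + K * cn w ^+ 2))).
  rewrite ler_wpM2l //; apply: (le_trans (cnB _ _)); exact: lerD.
rewrite /C cw; have : 0 <= K * cn (zc q l) ^+ 2.
  by rewrite mulr_ge0 ?sqr_ge0 // addr_ge0 // mulr_ge0 // expR_ge0.
move: (cn (zc q l)) => c p0.
have -> : t^-1 * (K * (t / 2 * c) ^+ 2 + K * (t / 2 * c) ^+ 2) = t * (K * c ^+ 2) / 2.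
  by field; rewrite gt_eqF.
by have := mulr_ge0 (ltW t0) p0; lra.
Qed.

(** Gaussians grow with the imaginary part. All approximants stay in one horizontal strip, so their
    Gaussians are uniformly bounded. *)
Let sgm_bound q : exists2 b, 0 <= b & forall n l, `|complex.Im (sgm n.+1%:R^-1 q l)| <= b.
Proof.
exists (expR `|q| * `|q|) => [|n l]; first by rewrite mulr_ge0 ?expR_ge0.
set t : R := n.+1%:R^-1; set u := t / 2 * q.
have t0 : 0 < t by rewrite invr_gt0 ltr0n.
have ti0 : 0 <= t^-1 by rewrite invr_ge0 ltW.
have t1 : t <= 1 by rewrite invf_le1 ?ltr0n // ler1n.
have -> : complex.Im (sgm t q l) = - (t^-1 * ((expR u - 1) - (expR (- u) - 1)) * cos (t / 2 * l)).
  rewrite /sgm -/u !(ReM, ImM, ReN, ImN, ReD, ImD) /= cosN sinN; ring.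
have u1 : `|u| <= t / 2 * `|q| by rewrite /u normrM ger0_norm // divr_ge0 // ltW.
have u2 : `|u| <= `|q|.
  by apply: (le_trans u1); rewrite ler_piMl //; lra.
have h1 : `|expR u - 1 - (expR (- u) - 1)| <= expR `|q| * (t * `|q|).
  apply: (le_trans (ler_normB _ _)).
  apply: (le_trans (lerD (norm_expRB1 u) (norm_expRB1 (- u)))); rewrite normrN.
  have : expR `|u| * `|u| <= expR `|q| * (t / 2 * `|q|).
    by apply: ler_pM; rewrite ?expR_ge0 ?ler_expR.
  have -> : expR `|q| * (t / 2 * `|q|) = expR `|q| * (t * `|q|) / 2 by ring.
  move: (expR `|u| * _) (expR `|q| * _) => x y; lra.
rewrite normrN normrM normrM (ger0_norm ti0).
apply: (@le_trans _ _ (t^-1 * (expR `|q| * (t * `|q|)) * 1)).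
  apply: ler_pM => //; last by rewrite cos_max.
    by rewrite mulr_ge0.
  by rewrite ler_wpM2l.
by rewrite mulr1 mulrCA mulKf ?gt_eqF.
Qed.

Variables (k m : R[i]).
Hypothesis k0 : 0 < complex.Re k.

Definition gauss (z : R[i]) : R[i] := cexp (m * z - k * z ^+ 2).

(** Bounds the real part of the exponent on the strip [|Im z| <= b], by completing the square in
    [|Re z|]. *)
Let Kb (b : R) : R := complex.Re k * b ^+ 2 + `|complex.Im m| * b +
    (2 * `|complex.Im k| * b + `|complex.Re m|) ^+ 2 / (4 * complex.Re k).

Let Re_quad_le (b : R) (z : R[i]) : 0 <= b -> `|complex.Im z| <= b ->
  complex.Re (m * z - k * z ^+ 2) <= Kb b.
Proof.
move=> b0 hb; rewrite /Kb expr2 !(ReD, ReN, ReM, ImM).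
set A := complex.Re z; set B := complex.Im z in hb *.
have k1_gt0 := k0; set k1 := complex.Re k in k1_gt0 *; set k2 := complex.Im k.
set m1 := complex.Re m; set m2 := complex.Im m.
set d : R := 2 * `|k2| * b + `|m1|.
have h1 : - (m2 * B) <= `|m2| * b.
  by apply: (le_trans (ler_norm _)); rewrite normrN normrM ler_wpM2l.
have h2 : B * B <= b ^+ 2 by rewrite -expr2 -[B ^+ 2]real_normK ?num_real // lerXn2r ?nnegrE.
have h3 : 2 * k2 * A * B + m1 * A <= d * `|A|.
  rewrite /d [X in _ <= X]mulrDl; apply: lerD; apply: (le_trans (ler_norm _)); rewrite !normrM //.
  rewrite (ger0_norm (_ : 0 <= 2)) // -!mulrA ler_wpM2l // ler_wpM2l // mulrC.
  by rewrite ler_wpM2r.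
have h4 : d * `|A| - k1 * (A * A) <= d ^+ 2 / (4 * k1).
  have -> : A * A = `|A| ^+ 2 by rewrite real_normK ?num_real // expr2.
  rewrite -subr_ge0.
  have -> : d ^+ 2 / (4 * k1) - (d * `|A| - k1 * `|A| ^+ 2) = k1 * (`|A| - d / (2 * k1)) ^+ 2.
    by field; rewrite gt_eqF.
  by rewrite mulr_ge0 ?sqr_ge0 // ltW.
have h5 : k1 * (B * B) <= k1 * b ^+ 2 by rewrite ler_wpM2l // ltW.
move: h1 h3 h4 h5; move: (`|A|) (`|m2| * b) (k1 * b ^+ 2) (d ^+ 2 / _) => a p q s h1 h3 h4 h5.
have -> : m1 * A - m2 * B - (k1 * (A * A - B * B) - k2 * (A * B + B * A)) =
  - (m2 * B) + (2 * k2 * A * B + m1 * A) - k1 * (A * A) + k1 * (B * B) by ring.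
move: h1 h3 h4 h5; move: (- (m2 * B)) (2 * k2 * A * B + m1 * A) (k1 * (A * A)) (k1 * (B * B)) (d * a).
by move=> *; lra.
Qed.

Let mC_zc q : mC (zc q).
Proof. by split; [exact: measurable_id|exact: measurable_cst]. Qed.

Let bm_gauss q : bm (fun l => gauss (zc q l)).
Proof.
split.
  apply: mC_cexp; apply: mC_B; first by apply: mC_M; [exact: (bm_cst m).1|exact: mC_zc].
  by apply: mC_M; [exact: (bm_cst k).1|apply: mC_X; exact: mC_zc].
have h := @Re_quad_le `|q| _ (normr_ge0 q).
exists (expR (Kb `|q|)) => s; rewrite /gauss cn_cexp ler_expR; apply: h.
by rewrite /= normrN.
Qed.

Let gauss_sgm_cvg q l : ccv (fun n => gauss (sgm n.+1%:R^-1 q l)) (gauss (zc q l)).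
Proof.
have h := sgm_cvg q l; apply: ccv_cexp.
have h2 := ccvM (ccv_cst (- k)) (ccvM h h).
have := ccvD (ccvM (ccv_cst m) h) h2; congr (ccv _ _).
  by apply/funext => n; rewrite mulNr expr2.
by rewrite mulNr expr2.
Qed.

(** Gaussians of [sgm] form pairs by the algebraic rules and [gpair_cexp]; the uniform bound on the
    strip allows [t] to tend to 0. *)
Lemma gpair_gauss : gp (fun l => gauss l%:C%C) (fun l => gauss (l +i* (- r))%C).
Proof.
have e0 : (fun l : R => gauss l%:C%C) = fun l => gauss (zc 0 l).
  by apply/funext => l; congr (gauss _); apply: complex_eq; rewrite /= ?oppr0.
rewrite e0; have [b1 b10 hb1] := sgm_bound 0; have [b2 b20 hb2] := sgm_bound r.
have bnd q (b : R) : 0 <= b -> (forall n l, `|complex.Im (sgm n.+1%:R^-1 q l)| <= b) ->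
    exists c, forall n l, cn (gauss (sgm n.+1%:R^-1 q l)) <= c.
  move=> b_0 hb; have h n l := Re_quad_le b_0 (hb n l).
  by exists (expR (Kb b)) => n l; rewrite /gauss cn_cexp ler_expR; exact: h.
have [c1 hc1] := bnd _ _ b10 hb1; have [c2 hc2] := bnd _ _ b20 hb2.
apply: (@gpair_lim _ _ _ _ (fun n l => gauss (sgm n.+1%:R^-1 0 l))
   (fun n l => gauss (sgm n.+1%:R^-1 r l)) _ _ (Num.max c1 c2)).
- exact: bm_gauss.
- exact: bm_gauss.
- move=> n; apply: gpair_cexp.
  have p := sgm_pair n.+1%:R^-1.
  have := gpair_lin m p (gpair_lin (- k) (gpair_X 2 p) (gpair_cst E F 0)).
  by congr (gp _ _); apply/funext => l; rewrite addr0 mulNr.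
- by move=> n l; rewrite le_max hc1.
- by move=> n l; rewrite le_max hc2 orbT.
- by move=> l; exact: gauss_sgm_cvg.
- by move=> l; exact: gauss_sgm_cvg.
Qed.

End Gaussians.

(** * The product of the two exponentials for a nonzero constant *)

Section WeylProduct.
Variables (R : realType) (H : hilbert R).
Local Notation T := (measurableTypeR R).
Implicit Types (E F X Y Z : spectral_measure H).

Lemma cis_fun_semi E (u : R -> R) : measurable_fun [set: T] (u : T -> R) ->
  semiunitary false (Phi E (fun l => cis (u l))) (Phi E (fun l => cis (- u l))).
Proof.
move=> mu_; have b v : measurable_fun [set: T] (v : T -> R) -> bm (fun l => cis (v l)).
  exact: bm_cis.
have mN v : measurable_fun [set: T] (v : T -> R) -> measurable_fun [set: T] (fun l : T => - v l : R).
  by move=> ?; exact: measurableT_comp.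
have K v : measurable_fun [set: T] (v : T -> R) ->
    cancel (Phi E (fun l => cis (v l))) (Phi E (fun l => cis (- v l))).
  move=> mv x; rewrite -Phi_mul; [|exact: b (mN _ mv)|exact: b].
  by rewrite (_ : (fun s => _) = fun=> 1) ?Phi_1 //; apply/funext => s; rewrite cisNK.
have K' : cancel (Phi E (fun l => cis (- u l))) (Phi E (fun l => cis (u l))).
  move=> x; rewrite -Phi_mul; [|exact: b|exact: b (mN _ mu_)].
  by rewrite (_ : (fun s => _) = fun=> 1) ?Phi_1 //; apply/funext => s; rewrite mulrC cisNK.
split; [exact: Phi_linear (b _ mu_)| |exact: K|exact: K'].
move=> x; apply/eqP; rewrite eq_le.
have hb v y : measurable_fun [set: T] (v : T -> R) -> hn (Phi E (fun l => cis (v l)) y) <= hn y.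
  move=> mv; have := @Phi_bdd _ _ E _ 1 y (b v mv); rewrite mul1r; apply => s.
  by rewrite cn_cis.
by rewrite hb // -{1}[x](K u mu_) hb //; exact: mN.
Qed.

Lemma oscale_closure (A B : H ~> H) c c' : c * c' = 1 ->
  (forall (u v : nat -> H) x y, (forall n, B (u n, v n)) -> cv u x -> cv v y -> B (x, y)) ->
  (forall x y, A (x, y) -> B (x, c *: y)) ->
  (forall x y, B (x, y) -> closure A (x, c' *: y)) -> B = oscale c (closure A).
Proof.
move=> cc' clB AB BA; apply/seteqP; split=> -[x z] /= h.
  by exists (c' *: z); [exact: BA|rewrite scalerA cc' scale1r].
case: h => /= y /closure2_cv[u [v [huv ux vy]]] ->.
by apply: (clB _ _ _ _ _ ux (cvZ c vy)) => n; exact: AB.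
Qed.

Variables (X Y : spectral_measure H) (r : R).
Hypothesis XY : ccr X Y r.
Local Notation Q1 := (ocomp (Fop Y (ex 1)) (Fop X (ex 1))).
Local Notation Q2 := (ocomp (Fop X (ex 1)) (Fop Y (ex 1))).

Let k n : R[i] := (n.+1%:R^-1)%:C%C.
(** [exp (- l^2 / (n + 1))], with [g n] its shift to [l - i r]. Both are bounded approximate
    units. *)
Let e n (l : R) : R[i] := gauss (k n) 0 l%:C%C.
Let g n (l : R) : R[i] := gauss (k n) 0 (l +i* (- r))%C.
Let Rek n : 0 < complex.Re (k n).
Proof. by rewrite /= invr_gt0 ltr0n. Qed.

Let eg n : bm (e n) /\ bm (g n).
Proof.
by have [] := gpair_gauss XY 0 (Rek n).
Qed.

Let kn0 n : 0 <= (n.+1%:R^-1 : R) <= 1.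
Proof. by rewrite invr_ge0 ler0n invf_le1 ?ltr0n // ler1n. Qed.

Let cv_gauss (q l : R) : (fun n => cn (gauss (k n) 0 (l +i* q)%C - 1)) @ \oo --> (0 : R).
Proof.
rewrite -(@cexp0 R); apply: ccv_cexp.
apply: (@ccv_squeeze _ _ _ (fun n => n.+1%:R^-1 * cn (l +i* q)%C ^+ 2)) => [n|].
  by rewrite mul0r sub0r subr0 cnN cnM cnX cn_real ger0_norm.
by rewrite -[X in _ --> X](mul0r (cn (l +i* q)%C ^+ 2)); apply: cvgMl; exact: cvg_harmonic.
Qed.

Let bd_gauss n (q l : R) : cn (gauss (k n) 0 (l +i* q)%C) <= expR (q ^+ 2).
Proof.
rewrite cn_cexp ler_expR expr2 !(ReD, ReN, ReM, ImM) /=; have /andP[h1 h2] := kn0 n.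
move: (n.+1%:R^-1 : R) h1 h2 => m h1 h2; rewrite !mul0r !subr0 add0r.
have := mulr_ge0 h1 (sqr_ge0 l); have : 0 <= (1 - m) * q ^+ 2.
  by rewrite mulr_ge0 ?sqr_ge0 // subr_ge0.
rewrite !expr2; nra.
Qed.

Let cv_e x : cv (fun n => Phi Y (e n) x) x.
Proof.
apply: (@Phi_approx_id _ _ Y setT _ (expR (0 ^+ 2))); first exact: concentratedT.
- by move=> n; case: (eg n).
- by move=> n s _; exact: bd_gauss.
- by move=> s _; exact: cv_gauss.
Qed.

Let cv_g x : cv (fun n => Phi Y (g n) x) x.
Proof.
apply: (@Phi_approx_id _ _ Y setT _ (expR ((- r) ^+ 2))); first exact: concentratedT.
- by move=> n; case: (eg n).
- by move=> n s _; exact: bd_gauss.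
- by move=> s _; exact: cv_gauss.
Qed.

(** Up to a constant phase, [g n * ex b] is the second member of the Gaussian pair with linear
    coefficient [b], hence bounded. *)
Let bG n b : bm (fun l => g n l * ex b l).
Proof.
have [_ bb _] := gpair_gauss XY b%:C%C (Rek n).
have := bm_Z (cis (b * r)) bb; congr (bm _); apply/funext => l.
have -> : gauss (k n) b%:C%C (l +i* - r)%C =
    cexp ((0 * (l +i* - r)%C - k n * (l +i* - r)%C ^+ 2) + (b * l)%:C%C + 'i%C * (- (b * r))%:C%C).
  rewrite /gauss; congr cexp; apply: complex_eq; rewrite !(ReD, ReN, ReM, ImD, ImN, ImM, expr2) /=; ring.
rewrite 2!cexpD cexp_real cexp_i mulrCA -cisD addrN cis0 mulr1.
by [].
Qed.

Lemma gauss_approx : exists g h : nat -> R -> R[i],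
  [/\ forall n, gpair X Y (g n) (h n), forall n, bm (fun l => h n l * ex 1 l),
      forall x, cv (fun n => Phi Y (g n) x) x & forall x, cv (fun n => Phi Y (h n) x) x].
Proof.
exists e, g; split; [|by move=> n; exact: bG|exact: cv_e|exact: cv_g].
by move=> n; exact: gpair_gauss.
Qed.

Section Nonzero.
Hypothesis r0 : r != 0.
(** Conjugation by e^(icY^2) adds [- 2 r c Y] to X, and this has to be Y. *)
Let c := - (2 * r)^-1.

Let cs (a l : R) : R[i] := cis (a * c * l ^+ 2).

(** The phase [cs a] is absorbed in the Gaussian parameter, whose real part stays that of [k n]. At
    [l - i r] it becomes [cs a l * ex (- a) l * cis (a * r / 2)], because [c r = - 1/2]: shifting a
    quadratic phase creates the exponential of Y. *)
Let pair n (a b : R) : gpair X Y (fun l => e n l * ex b l * cs a l)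
  (fun l => g n l * cs a l * ex (b - a) l * cis (a * r / 2 - b * r)).
Proof.
have k0 : 0 < complex.Re (k n - 'i%C * (a * c)%:C%C).
  by have := Rek n; rewrite !(ReD, ReN, ReM) /= !(mul0r, mulr0, subr0, oppr0, addr0).
have := gpair_gauss XY b%:C%C k0; congr (gpair _ _ _ _); apply/funext => l.
  have {1}-> : gauss (k n - 'i%C * (a * c)%:C%C) b%:C%C l%:C%C =
     cexp ((0 * l%:C%C - k n * l%:C%C ^+ 2) + (b * l)%:C%C + 'i%C * (a * c * l ^+ 2)%:C%C).
    by rewrite /gauss; congr cexp; rewrite !(rmorphM, rmorphXn) /=; ring.
  by rewrite 2!cexpD cexp_real cexp_i.
have {1}-> : gauss (k n - 'i%C * (a * c)%:C%C) b%:C%C (l +i* - r)%C =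
   cexp ((0 * (l +i* - r)%C - k n * (l +i* - r)%C ^+ 2) + 'i%C * (a * c * l ^+ 2)%:C%C +
     ((b - a) * l)%:C%C + 'i%C * (a * r / 2 - b * r)%:C%C).
  rewrite /gauss; congr cexp.
  have cr : c * r = - 2^-1 by rewrite /c; field.
  have cr2 : c * r * r = - (r / 2) by rewrite cr; ring.
  apply: complex_eq; rewrite !(ReD, ReN, ReM, ImD, ImN, ImM, expr2) /=.
    have -> : (b - a) * l = b * l + 2 * a * (c * r) * l by rewrite cr; field.
    by ring.
  have -> : a * r / 2 - b * r = - a * (c * r * r) - b * r by rewrite cr2; ring.
  by ring.
by rewrite 3!cexpD cexp_real !cexp_i.
Qed.

Let mu_ : measurable_fun [set: T] (fun l : T => - (c * l ^+ 2) : R).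
Proof.
apply: measurableT_comp => //; apply: measurable_funM; first exact: measurable_cst.
exact: measurable_funX.
Qed.

Let V' : op H := Phi Y (fun l => cis (- (c * l ^+ 2))).
Let V : op H := Phi Y (fun l => cis (- - (c * l ^+ 2))).
Let hV : semiunitary false V' V := cis_fun_semi Y mu_.
(** [V] is e^(icY^2) and [V'] its inverse, so this is the spectral measure of V X V^-1. *)
Let Z := transport hV X.

Let bcs a : bm (cs a).
Proof.
apply: bm_cis; apply: measurable_funM; first exact: measurable_cst.
exact: measurable_funX.
Qed.

Let VE : V = Phi Y (cs 1).
Proof. by congr (Phi _ _); apply/funext => l; rewrite opprK /cs mul1r. Qed.

Let V'E : V' = Phi Y (cs (- 1)).
Proof. by congr (Phi _ _); apply/funext => l; rewrite /cs; congr cis; ring. Qed.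

Let me b := @mC_ex R b.

Let Z_ex x y : Fop Z (ex 1) (x, y) <-> Fop X (ex 1) (V' x, V' y).
Proof. by apply: (iff_trans (Fop_tr hV X _ _ (me 1))); exact: iff_refl. Qed.

Let bE n b : bm (fun l => e n l * ex b l).
Proof.
have [bb _ _] := pair n 0 b; move: bb; congr (bm _); apply/funext => l.
by rewrite /cs !mul0r cis0 mulr1.
Qed.

Let Phi4 n (a b : R) x : Phi Y (fun l => g n l * cs a l * ex b l * cis (a * r / 2 - (b + a) * r)) x =
  cis (a * r / 2 - (b + a) * r) *: Phi Y (fun l => cs a l * (g n l * ex b l)) x.
Proof.
rewrite -Phi_Z; last by apply: bm_M.
by congr (Phi _ _ _); apply/funext => l; ring.
Qed.

Let pairE n (a b : R) x y : Fop X (ex 1) (x, y) ->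
  Fop X (ex 1) (Phi Y (fun l => cs a l * (e n l * ex b l)) x,
    cis (a * r / 2 - b * r) *: Phi Y (fun l => cs a l * (g n l * ex (b - a) l)) y).
Proof.
have [_ _ p] := pair n a b => /p.
have -> : (fun l => e n l * ex b l * cs a l) = (fun l => cs a l * (e n l * ex b l)).
  by apply/funext => l; rewrite mulrC.
by have := Phi4 n a (b - a) y; rewrite subrK => ->.
Qed.

Let ex0E (a : R) (f : R -> R[i]) : (fun l => cs a l * (f l * ex 0 l)) = fun l => cs a l * f l.
Proof. by apply/funext => l; rewrite ex0 mulr1. Qed.

Let V'M f x : bm f -> Phi Y (fun l => cs (-1) l * f l) x = V' (Phi Y f x).
Proof. by move=> bf; rewrite Phi_mul // V'E. Qed.

Let VM f x : bm f -> Phi Y (fun l => cs 1 l * f l) (V' x) = Phi Y f x.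
Proof.
move=> bf; have K : Phi Y (cs 1) (V' x) = x by rewrite -VE (suK hV).
by rewrite Phi_mul // Phi_comm // K.
Qed.

Let Q2Z x z : Q2 (x, z) -> Fop Z (ex 1) (x, cis (r / 2) *: z).
Proof.
move=> [y /= [xy yz]].
apply: (@Op_closed _ _ _ _ (fun n => Phi Y (e n) x) (fun n => cis (r / 2) *: Phi Y (g n) z)).
- exact: me.
(* [a = -1] produces [V']. With [b = -1] the factor [ex (-1)] on the first vector turns [y] back
   into [x], and the second factor is [ex 0]. *)
- move=> n; apply/Z_ex; have := pairE n (-1) (-1) yz.
  rewrite subrr (ex0E (-1) (g n)) (_ : -1 * r / 2 - -1 * r = r / 2); last by field.
  have [be bg] := eg n; have bb := bE n (-1).
  rewrite !V'M // -(suZ hV (cis _)).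
  by have /(_ _ be) -> // := Op_mul (me (-1)) ((ex_inv Y 1 x y).1 xy).
- exact: cv_e.
- by apply: cvZ; exact: cv_g.
Qed.

Let Q1Z x z : Q1 (x, z) -> Fop Z (ex 1) (x, cis (- (r / 2)) *: z).
Proof.
move=> [y /= [xy yz]].
apply: (@Op_closed _ _ _ _ (fun n => Phi Y (e n) x) (fun n => cis (- (r / 2)) *: Phi Y (g n) z)).
- exact: me.
(* With [b = 0] the first vector carries no exponential, and the factor [ex 1] on the second turns
   [y] into [z]. *)
- move=> n; apply/Z_ex; have := pairE n (-1) 0 xy.
  rewrite (ex0E (-1) (e n)) sub0r opprK (_ : -1 * r / 2 - 0 * r = - (r / 2)); last by field.
  have [be bg] := eg n; have bb := bG n 1.
  rewrite !V'M // -(suZ hV (cis _)).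
  by have /(_ _ bg) -> // := Op_mul (me 1) yz.
- exact: cv_e.
- by apply: cvZ; exact: cv_g.
Qed.

Let ZQ2 x z : Fop Z (ex 1) (x, z) -> closure Q2 (x, cis (- (r / 2)) *: z).
Proof.
move=> /Z_ex h.
apply: (@cv_closure2 _ _ _ _ (fun n => Phi Y (e n) x) (fun n => cis (- (r / 2)) *: Phi Y (g n) z)).
(* [a = 1] undoes [V']. With [b = 1] the first vector is e^Y of the smoothed [x], so a pair of [Q2]
   results. *)
- move=> n; have := pairE n 1 1 h.
  rewrite subrr (ex0E 1 (g n)) (_ : 1 * r / 2 - 1 * r = - (r / 2)); last by field.
  have [be bg] := eg n; have bb := bE n 1.
  rewrite !VM // => h2.
  exists (Phi Y (fun l => e n l * ex 1 l) x); split=> //=.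
  have := Op_bm Y x (me 1) be.
  have -> : (fun l => ex 1 l * e n l) = fun l => e n l * ex 1 l.
    by apply/funext => l; rewrite mulrC.
  exact.
- exact: cv_e.
- by apply: cvZ; exact: cv_g.
Qed.

Let ZQ1 x z : Fop Z (ex 1) (x, z) -> closure Q1 (x, cis (r / 2) *: z).
Proof.
move=> /Z_ex h.
apply: (@cv_closure2 _ _ _ _ (fun n => Phi Y (e n) x) (fun n => cis (r / 2) *: Phi Y (g n) z)).
(* With [b = 0] the second vector carries [ex (-1)], so e^Y maps it to the smoothed [z]. *)
- move=> n; have := pairE n 1 0 h.
  rewrite (ex0E 1 (e n)) sub0r (_ : 1 * r / 2 - 0 * r = r / 2); last by field.
  have [be bg] := eg n; have bb := bG n (-1).
  rewrite !VM // => h2.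
  exists (cis (r / 2) *: Phi Y (fun l => g n l * ex (-1) l) z); split=> //=.
  have eqg : (fun l => ex 1 l * (g n l * ex (-1) l)) = g n.
    by apply/funext => l; rewrite mulrCA mulrC [ex 1 l * _]mulrC exN mul1r.
  have := Op_bm Y z (me 1) bb; rewrite eqg => /(_ bg) h3.
  have := Op_lin (cis (r / 2)) (me 1) h3 (Op_0 Y (me 1)).
  by rewrite !addr0.
- exact: cv_e.
- by apply: cvZ; exact: cv_g.
Qed.

(** [c l^2 - c (l + r t)^2 = l t + r t^2 / 2] yields e^(itY) and a phase; exchanging e^(itY) with
    e^(itX) adds [- r t^2] to the phase. *)
Let Z_cis t x : Phi Z (fun l => cis (t * l)) x =
  cis (- (r * t ^+ 2) / 2) *: Phi X (fun l => cis (t * l)) (Phi Y (fun l => cis (t * l)) x).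
Proof.
have bt := bm_cisM t; rewrite (Phi_tr hV X bt) /= /cif V'E.
rewrite (ccr_shift XY) // VE -Phi_mul //; last exact: bm_shift.
rewrite XY scalerA -cisD -Phi_Z //.
congr (Phi _ _ _); apply/funext => l; rewrite /cs -!cisD; congr cis.
have h : c * r = - 2^-1 by rewrite /c; field.
have -> : 1 * c * l ^+ 2 + -1 * c * (l + r * t) ^+ 2 =
  - 2 * (c * r) * (l * t) - (c * r) * (r * t ^+ 2) by ring.
by rewrite h; field.
Qed.

Lemma weyl_product_neq0 : exists Z,
  [/\ forall t x, Phi Z (fun l => cis (t * l)) x =
        cis (- (r * t ^+ 2) / 2) *: Phi X (fun l => cis (t * l)) (Phi Y (fun l => cis (t * l)) x),
      Fop Z (ex 1) = oscale (cis (r / 2)) (closure Q2) &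
      Fop Z (ex 1) = oscale (cis (- (r / 2))) (closure Q1)].
Proof.
exists Z; split; first exact: Z_cis.
  apply: (@oscale_closure _ _ _ (cis (- (r / 2)))); first by rewrite mulrC cisNK.
  - by move=> u v x y; apply: Op_closed; exact: me.
  - exact: Q2Z.
  - exact: ZQ2.
apply: (@oscale_closure _ _ _ (cis (r / 2))); first by rewrite cisNK.
- by move=> u v x y; apply: Op_closed; exact: me.
- exact: Q1Z.
- exact: ZQ1.
Qed.

End Nonzero.

End WeylProduct.

(** * Commuting spectral measures *)

Section ResolutionOfIdentity.
Variables (R : realType) (H : hilbert R).
Local Notation T := (measurableTypeR R).
Implicit Types (p q : op H) (x y : H).

Lemma proj_bop p : projection p -> bounded_op p.
Proof. by case. Qed.

Lemma proj_idem p x : projection p -> p (p x) = p x.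
Proof. by case=> _ h _; rewrite -[p (p x)]/((p \o p) x) h. Qed.

Lemma proj_ip p x y : projection p -> <|p x, y|> = <|x, p y|>.
Proof. by case=> b _ a; rewrite adjP // a. Qed.

Lemma proj_form p x : projection p -> <|p x, x|> = (hn (p x) ^+ 2)%:C%C.
Proof. by move=> pp; rewrite -ipxx -proj_ip // proj_idem // proj_ip. Qed.

Lemma proj_pyth p x : projection p -> hn x ^+ 2 = hn (p x) ^+ 2 + hn (x - p x) ^+ 2.
Proof.
move=> pp; rewrite -{1}[x](subrK (p x)) [_ - _ + _]addrC (hnD2 (p x)).
by rewrite ipBr (proj_ip x x pp) (proj_ip x (p x) pp) proj_idem // subrr /= mulr0 addr0.
Qed.

Lemma proj_hn p x : projection p -> hn (p x) <= hn x.
Proof.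
move=> pp; rewrite -(@ler_pXn2r _ 2) ?nnegrE ?hn_ge0 //.
by rewrite (proj_pyth x pp) lerDl sqr_ge0.
Qed.

Lemma proj_id_compl p : projection p -> projection (id - p).
Proof.
move=> pp; have bp := proj_bop pp; split.
- by apply: bop_B => //; exact: bop_id.
- apply/funext => x /=; rewrite -![(id - p) _]/(_ - p _) (lin_B (bop_lin bp)) proj_idem //.
  by rewrite subrr subr0.
- by rewrite adj_B //; [rewrite adj_id; case: pp => _ _ ->|exact: bop_id].
Qed.

(* [m] stands for a projection-valued measure, [m x B = |E(B) x|^2] *)
Variable m : H -> {measure set T -> \bar R}.
Hypothesis mT : forall x, m x setT = (hn x ^+ 2)%:E.

Let spec (B : set R) p := projection p /\ forall x, m x B = (hn (p x) ^+ 2)%:E.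

Let spec_uniq B p q : spec B p -> spec B q -> p = q.
Proof.
move=> [pp hp] [pq hq]; apply: op_eq_form; [exact: bop_lin (proj_bop pp)|exact: bop_lin (proj_bop pq)|].
move=> x; rewrite !proj_form //; congr (_%:C)%C.
by have := hp x; rewrite hq => - [].
Qed.

Let mU x (A B : set T) : measurable A -> measurable B -> [disjoint A & B]%classic ->
  m x (A `|` B) = (m x A + m x B)%E.
Proof. by move=> mA mB /disj_set2P AB; rewrite measureU. Qed.

(** [m (q x)] gives [B] the mass [|q x|^2], which is its total mass; nothing is left for the
    disjoint set [A]. *)
Let spec_orth (A B : set T) p q : measurable A -> measurable B -> [disjoint A & B]%classic ->
  spec A p -> spec B q -> forall x, p (q x) = 0.
Proof.
move=> mA mB AB [pp hp] [pq hq] x.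
have h : (m (q x) (A `|` B) <= m (q x) setT)%E.
  by apply: le_measure; rewrite ?inE //; exact: measurableU.
move: h; rewrite mU // hp hq mT proj_idem // -EFinD lee_fin gerDr => h.
apply: hn0_eq0; apply/eqP; rewrite -sqrf_eq0 eq_le h sqr_ge0 //.
Qed.

Let spec_U (A B : set T) p q : measurable A -> measurable B -> [disjoint A & B]%classic ->
  spec A p -> spec B q -> spec (A `|` B) (p + q).
Proof.
move=> mA mB AB sp sq; have [pp hp] := sp; have [pq hq] := sq.
have bp := proj_bop pp; have bq := proj_bop pq.
have o1 := spec_orth mA mB AB sp sq; rewrite disj_set_sym in AB.
have o2 := spec_orth mB mA AB sq sp; rewrite disj_set_sym in AB.
have pr : projection (p + q).
  split; first exact: bop_D.
    apply/funext => x /=; rewrite -![(p + q) _]/(p _ + q _).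
    rewrite (lin_D (bop_lin bp)) (lin_D (bop_lin bq)) o1 o2 !proj_idem //.
    by rewrite addr0 add0r.
  by rewrite adj_D //; case: pp => _ _ ->; case: pq => _ _ ->.
split=> // x; rewrite mU //.
rewrite hp hq -EFinD; congr _%:E.
have := proj_form x pr; rewrite -[(p + q) x]/(p x + q x) ipDl !proj_form //.
by rewrite -rmorphD => - [].
Qed.

Let spec_0 : spec set0 0.
Proof.
split=> [|x]; last by rewrite measure0 hn0 expr0n.
by split; [exact: bop_0|apply/funext|rewrite adj0].
Qed.

Hypothesis mI : forall a b : R, exists p, spec `]a, b]%classic p.

(** Half-open intervals form a pi-system, and the sets with a projection form a Dynkin class:
    complements by [1 - p], disjoint unions by the monotone limit of sums of orthogonal
    projections. *)
Let spec_ex B : measurable B -> exists p, spec B p.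
Proof.
move=> mB; apply: (@dynkin_induction _ T (@ocitv R) (fun B => exists p, spec B p) _ _ _ _ _ _ B mB) => //.
- exact: ocitvI.
- by exists id; split=> //; split; [exact: bop_id|by apply/funext|exact: adj_id].
- by move=> _ [[a b] _ <-]; exact: mI.
- move=> S mS [p [pp hp]]; exists (id - p); split=> [|x]; first exact: proj_id_compl.
  rewrite -setTD measureD //= ?mT ?ltry // setTI hp -EFinB; congr _%:E.
  by rewrite (proj_pyth x pp) addrC addKr.
- move=> F mF tF hF; have [p hp] := choice hF.
  pose s n : op H := \sum_(k < n) p k.
  pose U n := \big[setU/set0]_(k < n) F k.
  have dis n : [disjoint U n & F n]%classic.
    apply/disj_set2P; rewrite /U big_distrl /=; apply: big1 => k _.
    by move/trivIsetP : tF; apply => //; rewrite ltn_eqF.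
  have mUn n : measurable (U n) by apply: bigsetU_measurable => k _.
  have ss n : spec (U n) (s n).
    elim: n => [|n IH]; first by rewrite /U /s !big_ord0; exact: spec_0.
    have := spec_U (mUn n) (mF n) (dis n) IH (hp n).
    by rewrite /U /s !big_ord_recr.
  have sp n : projection (s n) by case: (ss n).
  have sq n x : qf (s n) x = hn (s n x) ^+ 2 by rewrite /qf proj_form.
  have mono k n x : (k <= n)%N -> qf (s k) x <= qf (s n) x.
    move=> kn; rewrite !sq -lee_fin -(ss k).2 -(ss n).2.
    by apply: le_measure; rewrite ?inE //; exact: subset_bigsetU.
  have [b [bb pb sb _]] : exists b, [/\ bounded_op b, positive_op b, (forall x, cv (s^~ x) (b x)) & forall n x, qf (s n) x <= qf b x].
    apply: (@vigier _ _ s 1) => //.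
    + by move=> n; exact: proj_bop.
    + by move=> n x; rewrite proj_form // realC_ge0 sqr_ge0.
    + by move=> n x; rewrite sq mul1r; apply: lerXn2r; rewrite ?nnegrE ?hn_ge0 // proj_hn.
  have pb2 : projection b.
    split=> //; last exact: pos_selfadj.
    apply/funext => x /=; apply: (cv_unique _ (sb x)).
    apply: (@cv_squeeze _ _ _ _ (fun n => hn (s n x - b x) + hn (s n (b x) - b (b x)))).
      move=> n; rewrite -{1}(proj_idem x (sp n)).
      apply: (le_trans (hn_triangle _ (s n (b x)) _)); rewrite lerD2r.
      by rewrite -(lin_B (bop_lin (proj_bop (sp n)))) proj_hn.
    by rewrite -[X in _ --> X]addr0; apply: cvgD; exact: sb.
  exists b; split=> // x.
  have h1 : (fun n => (hn (s n x) ^+ 2)%:E) @ \oo --> m x (\bigcup_k F k).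
    rewrite (_ : (fun n => _) = fun n => \sum_(0 <= k < n) m x (F k))%E.
      by apply: measure_semi_sigma_additive => //; exact: bigcup_measurable.
    apply/funext => n; rewrite -(ss n).2 big_mkord /U measure_semi_additive_ord //.
      by apply/trivIsetP => i j _ _ ij; move/trivIsetP : tF; apply.
    by apply: bigsetU_measurable => k _.
  have h2 : (fun n => (hn (s n x) ^+ 2)%:E) @ \oo --> (hn (b x) ^+ 2)%:E.
    apply/fine_cvgP; split; first by near=> n.
    have h := cv_hn (sb x); rewrite /comp /= expr2; under eq_fun do rewrite expr2.
    exact: cvgM.
  by apply: (cvg_unique _ h1 h2).
Unshelve. all: by end_near.
Qed.

Let E B := xget 0 [set p | spec B p].

Let E_spec B : measurable B -> spec B (E B).
Proof. by move=> /spec_ex[p hp]; rewrite /E; case: xgetP => [q _ //|/(_ p)]. Qed.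

Let E_proj B : measurable B -> projection (E B).
Proof. by move=> /E_spec[]. Qed.

Let E_setT : E setT = id.
Proof.
apply: spec_uniq (E_spec measurableT) _; split=> //.
by split; [exact: bop_id|by apply/funext|exact: adj_id].
Qed.

(** Multiplicativity follows from additivity: [B] and [C] are split along their intersection, and
    disjoint pieces have orthogonal projections. *)
Let E_setI B C : measurable B -> measurable C -> E (B `&` C) = E B \o E C.
Proof.
move=> mB mC; have mBC := measurableI _ _ mB mC.
have mB' := measurableD mB mC; have mC' := measurableD mC mB.
have dd (A A' : set R) : A `&` A' = set0 -> [disjoint A & A']%classic by move=> ?; exact/disj_set2P.
have d1 : B `&` C `&` (B `\` C) = set0 by apply/seteqP; split=> // s [[_ ?] [_]].
have d2 : B `&` C `&` (C `\` B) = set0 by apply/seteqP; split=> // s [[? _] [_]].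
have d3 : (B `\` C) `&` (B `&` C) = set0 by rewrite setIC.
have d4 : (B `\` C) `&` (C `\` B) = set0 by apply/seteqP; split=> // s [[_ ?] [?]].
have eB : E B = E (B `&` C) + E (B `\` C).
  apply: spec_uniq (E_spec mB) _; rewrite -{1}(setUIDK B C).
  by apply: spec_U; rewrite ?dd //; exact: E_spec.
have eC : E C = E (B `&` C) + E (C `\` B).
  apply: spec_uniq (E_spec mC) _; rewrite -{1}(setUIDK C B) [C `&` B]setIC.
  by apply: spec_U; rewrite ?dd //; exact: E_spec.
apply/funext => x /=; rewrite eC -[(_ + _) x]/(E (B `&` C) x + E (C `\` B) x) eB.
rewrite -![(E (B `&` C) + E (B `\` C)) _]/(E (B `&` C) _ + E (B `\` C) _).
have bI := bop_lin (proj_bop (E_proj mBC)); have bD := bop_lin (proj_bop (E_proj mB')).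
rewrite (lin_D bI) (lin_D bD) proj_idem; last exact: E_proj.
rewrite (spec_orth mBC mC' (dd _ _ d2) (E_spec mBC) (E_spec mC')).
rewrite (spec_orth mB' mBC (dd _ _ d3) (E_spec mB') (E_spec mBC)).
by rewrite (spec_orth mB' mC' (dd _ _ d4) (E_spec mB') (E_spec mC')) !addr0.
Qed.

Let E_muE x B : measurable B ->
  (fine (m x B))%:C%C = `|E B x| ^+ 2 /\ (m x B < +oo)%E.
Proof. by move=> mB; rewrite (E_spec mB).2 /= hnE -rmorphXn ltry. Qed.

Lemma spectral_measure_of_forms : exists Z : spectral_measure H, sp_mu Z = m.
Proof. by exists (SpectralMeasure E_proj E_setT E_setI E_muE). Qed.

End ResolutionOfIdentity.

(** * From a right-continuous resolution of the identity to a spectral measure *)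

Section Stieltjes.
Variables (R : realType) (H : hilbert R).
Local Notation T := (measurableTypeR R).
Implicit Types (x y v : H).

Variable P : R -> op H.
Hypothesis pP : forall l, projection (P l).
Hypothesis P_mono : forall l k x, l <= k -> P k (P l x) = P l x.
Hypothesis P_rc : forall l x, cv (fun n => P (l + n.+1%:R^-1) x) (P l x).
Hypothesis P_lo : forall x, cv (fun n => P (- n%:R) x) 0.
Hypothesis P_hi : forall x, cv (fun n => P n%:R x) x.

Let P_mono' l k x : l <= k -> P l (P k x) = P l x.
Proof.
move=> lk; apply: ip_inj => z.
by rewrite !(proj_ip _ _ (pP _)) P_mono // -proj_ip.
Qed.

Let F x l := hn (P l x) ^+ 2.

Let F_nd x : {homo F x : l k / l <= k}.
Proof.
move=> l k lk; apply: lerXn2r; rewrite ?nnegrE ?hn_ge0 // -(P_mono' x lk).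
exact: proj_hn.
Qed.

Let F_cv x (u : nat -> R) y : cv (fun n => P (u n) x) y ->
  (fun n => F x (u n)) @ \oo --> hn y ^+ 2.
Proof. by move=> h; rewrite /F expr2; under eq_fun do rewrite expr2; apply: cvgM; exact: cv_hn. Qed.

(** By monotonicity the sequence [l + 1/(n+1)] controls all nearby points to the right of [l]. *)
Let F_rc x : forall l, F x @ at_right l --> F x l.
Proof.
move=> l; apply/cvgrPdist_lt => e e0.
have /cvgrPdist_lt/(_ _ e0)[N _ hN] := F_cv (P_rc l x).
have h := hN N (leqnn N); rewrite /= in h.
near=> k.
have lk : l <= k by near: k; exact: nbhs_right_ge.
have kN : k <= l + N.+1%:R^-1.
  by near: k; apply: nbhs_right_le; rewrite ltrDl invr_gt0 ltr0n.
have h1 := F_nd x lk; have h2 := F_nd x kN; move: h; rewrite -/(F x l).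
move: (F x k) (F x l) (F x _) h1 h2 => a b c h1 h2.
rewrite !ler0_norm ?subr_le0 //; last exact: le_trans h2.
by move=> h3; lra.
Unshelve. all: by end_near.
Qed.

Let Fc x : cumulative R R :=
  Cumulative.Pack (Cumulative.Class (isCumulative.Axioms_ _ R (F x) (@F_nd x) (@F_rc x))).

Let m x : {measure set T -> \bar R} := lebesgue_stieltjes_measure (Fc x).

Let m_itv x (a b : R) : a <= b -> m x `]a, b]%classic = (F x b - F x a)%:E.
Proof.
move=> ab; have h : measurable (`]a, b]%classic : set (ocitv_type R)) by exists (a, b).
rewrite /m /lebesgue_stieltjes_measure /measure_extension.
apply: (etrans (measurable_mu_extE (wlength (Fc x)) h)).
exact: wlength_itv_bnd.
Qed.

Let mT x : m x setT = (hn x ^+ 2)%:E.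
Proof.
pose I n : set T := `](- n%:R), n%:R]%classic.
have IT : \bigcup_n I n = setT.
  apply/seteqP; split=> // s _; exists (Num.bound `|s|).+1 => //.
  rewrite /I /= in_itv /=; have := archi_boundP (normr_ge0 s); rewrite ltr_norml => /andP[h1 h2].
  have h3 : (Num.bound `|s|)%:R <= (Num.bound `|s|).+1%:R :> R by rewrite ler_nat.
  apply/andP; split; last by rewrite (le_trans (ltW h2)).
  by rewrite (le_lt_trans _ h1) // lerN2.
have h1 : (m x \o I) @ \oo --> m x setT.
  rewrite -IT; apply: nondecreasing_cvg_mu.
  - by move=> n; exact: measurable_itv.
  - by rewrite IT; exact: measurableT.
  - move=> i j ij; apply/subsetPset => s; rewrite /I /= !in_itv /= => /andP[h1 h2].
    have h3 : (i%:R : R) <= j%:R by rewrite ler_nat.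
    by apply/andP; split; lra.
have h2 : (m x \o I) @ \oo --> (hn x ^+ 2)%:E.
  rewrite (_ : m x \o I = fun n => (F x n%:R - F x (- n%:R))%:E); last first.
    by apply/funext => n /=; rewrite m_itv // (@le_trans _ _ 0) ?oppr_le0 ?ler0n.
  apply/fine_cvgP; split; first by near=> n.
  rewrite -[X in _ --> X]subr0; apply: cvgB; first exact: F_cv.
  by have := F_cv (P_lo x); rewrite hn0 expr0n.
exact: (cvg_unique _ h1 h2).
Unshelve. all: by end_near.
Qed.

Let m_spec (a b : R) : a <= b -> projection (P b - P a) /\
  forall x, m x `]a, b]%classic = (hn ((P b - P a) x) ^+ 2)%:E.
Proof.
move=> ab; have ba := bop_lin (proj_bop (pP a)); have bb := bop_lin (proj_bop (pP b)).
have pr : projection (P b - P a).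
  split; first by apply: bop_B; exact: proj_bop.
    apply/funext => x /=; rewrite -![(P b - P a) _]/(P b _ - P a _).
    rewrite (lin_B ba) (lin_B bb) !proj_idem // P_mono // P_mono' //.
    by rewrite subrr subr0.
  by rewrite adj_B; try exact: proj_bop; case: (pP a) => _ _ ->; case: (pP b) => _ _ ->.
split=> // x; rewrite m_itv //; congr _%:E.
have := proj_form x pr; rewrite -[in LHS](_ : P b x - P a x = (P b - P a) x) // ipBl.
by rewrite !proj_form // -rmorphB => - [].
Qed.

(** Each [m x] is the Lebesgue-Stieltjes measure of [|P l x|^2]; that it comes from projections is
    checked on half-open intervals only. *)
Lemma spectral_of_resolution : exists Z : spectral_measure H,
  forall a b : R, a <= b -> spE Z `]a, b]%classic = P b - P a.
Proof.
have mI (a b : R) : exists p, projection p /\ forall x, m x `]a, b]%classic = (hn (p x) ^+ 2)%:E.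
  have [ab|ba] := leP a b; first by exists (P b - P a); exact: m_spec.
  exists 0; split; first by split; [exact: bop_0|apply/funext|rewrite adj0].
  move=> x; rewrite set_itv_ge ?bnd_simp -?leNgt ?(ltW ba) // measure0.
  by rewrite (_ : (0 : op H) x = 0) // hn0 expr0n.
have [Z hZ] := spectral_measure_of_forms mT mI.
exists Z => a b ab.
have mab : measurable (`]a, b]%classic : set R) by exact: measurable_itv.
have [pr hm] := m_spec ab.
apply: op_eq_form; [exact: bop_lin (spE_bop Z mab)|exact: bop_lin (proj_bop pr)|] => v.
by rewrite spE_form // hZ hm proj_form.
Qed.

End Stieltjes.

Section OrthogonalProjection.
Variables (R : realType) (H : hilbert R).
Implicit Types (x y v : H).

Lemma orth_projection (V : set H) : subspace V -> seq_closed V ->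
  exists p : op H, [/\ projection p, forall x, V (p x), forall v, V v -> p v = v &
    forall x u, V u -> (forall v, V v -> <|x - u, v|> = 0) -> p x = u].
Proof.
move=> sV cV; have ex x := projection_theorem x sV cV.
have /choice[p hp] : forall x, exists y, V y /\ forall v, V v -> <|x - y, v|> = 0.
  by move=> x; have [y] := ex x; exists y.
have uniq x u : V u -> (forall v, V v -> <|x - u, v|> = 0) -> p x = u.
  move=> Vu hu; apply/eqP; rewrite -subr_eq0; apply/eqP/hn0_eq0/eqP.
  have [V1 h1] := hp x; have V2 := subspaceB sV V1 Vu.
  rewrite -sqrf_eq0 hn2E {1}(_ : p x - u = (x - u) - (x - p x)); last first.
    by rewrite opprB [RHS]addrC addrA subrK.
  by rewrite ipBl hu // h1 // subrr.
have fixp v : V v -> p v = v.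
  by move=> Vv; apply: uniq => // w _; rewrite subrr ip0l.
have lp : linear p.
  move=> c x y; have [V1 h1] := hp x; have [V2 h2] := hp y.
  apply: uniq; first by case: sV => _; apply.
  move=> v Vv; have -> : c *: x + y - (c *: p x + p y) = c *: (x - p x) + (y - p y).
    by rewrite scalerBr opprD addrACA.
  by rewrite ipDl ipZl h1 // h2 // mulr0 addr0.
have ipp x y : <|p x, y|> = <|x, p y|>.
  have [V1 h1] := hp x; have [V2 h2] := hp y.
  rewrite -[y in LHS](subrK (p y)) -[x in RHS](subrK (p x)) ipDr ipDl h1 // add0r.
  by rewrite ipC h2 // conjC0 add0r.
have bp : bounded_op p.
  apply: (@bop_intro _ _ _ _ 1) => // x; rewrite mul1r.
  have [V1 h1] := hp x; rewrite -(@ler_pXn2r _ 2) ?nnegrE ?hn_ge0 //.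
  rewrite -[x in leRHS](subrK (p x)) [x - p x + p x]addrC (hnD2 (p x)) ipC h1 //.
  by rewrite conjC0 /= mulr0 addr0 lerDl sqr_ge0.
exists p; split=> //.
- split=> //; last exact: adj_uniq.
  by apply/funext => x /=; apply: fixp; case: (hp x).
- by move=> x; case: (hp x).
Qed.

(** The complements increase, so [vigier] applies to them. *)
Lemma decreasing_projections (p : nat -> op H) : (forall n, projection (p n)) ->
  (forall m n x, (m <= n)%N -> p m (p n x) = p n x) ->
  exists q : op H, forall x, cv (fun n => p n x) (q x).
Proof.
move=> pp pm.
have pi n := proj_id_compl (pp n).
have qE n x : qf (id - p n) x = hn x ^+ 2 - hn (p n x) ^+ 2.
  by rewrite qfB qf_id /qf proj_form.
have [b [_ _ cb _]] : exists b, [/\ bounded_op b, positive_op b,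
    (forall x, cv (fun n => (id - p n) x) (b x)) & forall n x, qf (id - p n) x <= qf b x].
  apply: (@vigier _ _ (fun n => id - p n) 1) => //.
  - by move=> n; exact: proj_bop.
  - by move=> n x; rewrite proj_form // realC_ge0 sqr_ge0.
  - move=> m n x mn; rewrite !qE lerD2l lerN2; apply: lerXn2r; rewrite ?nnegrE ?hn_ge0 //.
    suff -> : p n x = p n (p m x) by exact: proj_hn.
    apply: ip_inj => z.
    by rewrite (proj_ip _ _ (pp n)) -{1}(pm m n z mn) -!proj_ip.
  - by move=> n x; rewrite qE mul1r gerBl sqr_ge0.
exists (id - b) => x; have := cvB (cv_cst x) (cb x); congr (cv _ _).
by apply/funext => n; rewrite -[(id - p n) x]/(x - p n x) subKr.
Qed.

End OrthogonalProjection.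

(** * The product of the two exponentials when the spectral measures commute *)

Section CommutingProduct.
Variables (R : realType) (H : hilbert R) (X Y : spectral_measure H).
Local Notation T := (measurableTypeR R).
Implicit Types (x y v : H).
Hypothesis XY : ccr X Y 0.

Let cis_comm (E F : spectral_measure H) s g x : ccr E F 0 -> bm g ->
  Phi E (fun l => cis (s * l)) (Phi F g x) = Phi F g (Phi E (fun l => cis (s * l)) x).
Proof.
move=> EF bg; rewrite (ccr_shift EF) //; congr (Phi _ _ _).
by apply/funext => l; rewrite mul0r addr0.
Qed.

(** The symmetry [W = 1 - 2 E(B)] is [cis] of [pi] times the indicator, hence a unitary function of
    X. It commutes with every e^(itY), so conjugation by it fixes Y by [stone_same]. *)
Let ind_comm B g x : measurable B -> bm g ->
  spE X B (Phi Y g x) = Phi Y g (spE X B x).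
Proof.
move=> mB bg; pose u s : R := pi * \1_B s.
have mu_ : measurable_fun [set: T] (u : T -> R).
  by apply: measurable_funM; [exact: measurable_cst|exact: (mC_cind mB).1].
pose W := Phi X (fun l => cis (u l)).
have hW := cis_fun_semi X mu_.
have bW := bm_cis mu_.
have YX : ccr Y X 0 by have := ccr_sym XY; rewrite oppr0.
have h : same (transport hW Y) Y.
  apply: stone_same => t; have bt := bm_cisM t.
  rewrite Phi_tr //; apply/funext => z /=; rewrite /cif /= cis_comm //.
  by rewrite (suK hW).
have WY z : W (Phi Y g z) = Phi Y g (W z).
  have := same_Phi h bg; rewrite Phi_tr // => e.
  rewrite -{1}e; exact: (suK' hW).
have indE : cind B = fun s => 2^-1 * ((fun=> 1) s - cis (u s)).
  apply/funext => s; rewrite cindE /u indicE; case: (s \in B) => /=.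
    rewrite mulr1 /cis cospi sinpi; apply: complex_eq; rewrite !(ReM, ImM, ReD, ImD, ReN, ImN) /=.
      by field.
    by field.
  by rewrite mulr0 cis0 subrr mulr0.
have b1 := bm_cst (1 : R[i]).
have spEE z : spE X B z = 2^-1 *: (z - W z).
  rewrite -Phi_cind // indE Phi_Z; last exact: bm_B.
  by rewrite Phi_B // Phi_cst scale1r.
by rewrite !spEE WY (lin_Z (Phi_linear _ bg)) (lin_B (Phi_linear _ bg)).
Qed.

Let comm f g x : bm f -> bm g -> Phi X f (Phi Y g x) = Phi Y g (Phi X f x).
Proof.
move=> bf bg; move: f bf x; apply: bm_ind.
- by move=> B mB x; rewrite Phi_cind // ind_comm.
- move=> c f h bf bh ef eh x; rewrite !Phi_lin //.
  rewrite -![(c *: Phi X f + Phi X h) _]/(c *: Phi X f _ + Phi X h _) ef eh.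
  by rewrite (Phi_linear Y bg).
- move=> f bf hf x.
  have [k k0 hk] : exists2 k, 0 <= k & bdd (Phi Y g) k by exact/bop_bdd/Phi_bop.
  apply: (@op_le0 _ _ _ _ (4 * hn (Phi Y g x) + k * (4 * hn x))) => e e0.
  have [h [bh hP fh]] := hf e e0.
  apply: (le_trans (hn_triangle _ (Phi X h (Phi Y g x)) _)).
  rewrite mulrDr; apply: lerD.
    by apply: (le_trans (Phi_dist X (Phi Y g x) bf bh fh)); rewrite mulrA [e * 4]mulrC.
  rewrite hP -(lin_B (Phi_linear Y bg)); apply: (le_trans (hk _)).
  rewrite mulrCA ler_wpM2l // hnBC.
  by apply: (le_trans (Phi_dist X x bf bh fh)); rewrite mulrA [e * 4]mulrC.
Qed.

Let hi (a : R) : set R := `]a, +oo[%classic.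
Let mhi a : measurable (hi a). Proof. exact: measurable_itv. Qed.

(** The half-plane [s + t > l] is the union of the quadrants [s > a], [t > b] with [a + b > l].
    Products [A a] and [B b] thus describe the sum without a joint spectral measure. *)
Let A a := spE X (hi a).
Let B b := spE Y (hi b).

(* the range of the spectral projection of [X + Y] for ]-oo, l] *)
Let V (l : R) : set H := [set v | forall a b, l < a + b -> A a (B b v) = 0].

Let bA a : bounded_op (A a). Proof. exact: spE_bop. Qed.

Let bB b : bounded_op (B b). Proof. exact: spE_bop. Qed.

Let AB_comm a b v : A a (B b v) = B b (A a v).
Proof. by rewrite /A /B -!Phi_cind // comm //; exact: bm_cind. Qed.

Let V_sub l : subspace (V l).
Proof.
split=> [a b _|c x y hx hy a b lab].
  by rewrite (lin_0 (bop_lin (bB b))) (lin_0 (bop_lin (bA a))).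
by rewrite (bop_lin (bB b)) (bop_lin (bA a)) hx // hy // scaler0 addr0.
Qed.

Let V_closed l : seq_closed (V l).
Proof.
move=> u x hu ux a b lab; apply: (@cv_unique _ _ (fun n => A a (B b (u n)))).
  by apply: bop_cv => //; apply: bop_cv.
rewrite (_ : (fun n => _) = fun=> 0); first exact: cv_cst.
by apply/funext => n; rewrite hu.
Qed.

Let Pex := fun l => orth_projection (V_sub l) (@V_closed l).
Let P l := projT1 (cid (Pex l)).
Let pP l : projection (P l). Proof. by rewrite /P; case: cid => p [h1 h2 h3 h4]; try exact: h1; exact: h2. Qed.

Let P_V l x : V l (P l x). Proof. by rewrite /P; case: cid => p [h1 h2 h3 h4]; try exact: h1; exact: h2. Qed.

Let P_fix l v : V l v -> P l v = v. Proof. by rewrite /P; case: cid => p [h1 h2 h3 h4]; exact: h3. Qed.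

Let P_uniq l x u : V l u -> (forall v, V l v -> <|x - u, v|> = 0) -> P l x = u.
Proof. by rewrite /P; case: cid => p [h1 h2 h3 h4]; exact: h4. Qed.

Let V_mono l k v : l <= k -> V l v -> V k v.
Proof. by move=> lk h a b ab; apply: h; exact: le_lt_trans ab. Qed.

Let P_mono l k x : l <= k -> P k (P l x) = P l x.
Proof. by move=> lk; apply: P_fix; apply: (V_mono lk); exact: P_V. Qed.

Let P_mono' l k x : l <= k -> P l (P k x) = P l x.
Proof.
move=> lk; apply: ip_inj => z.
by rewrite !(proj_ip _ _ (pP _)) P_mono // -proj_ip.
Qed.

(** What commutes with all quadrants preserves [V l] and, being selfadjoint, also its orthogonal
    complement. *)
Let P_comm (e : op H) l x : bounded_op e -> adj e = e ->
  (forall a b v, e (A a (B b v)) = A a (B b (e v))) -> P l (e x) = e (P l x).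
Proof.
move=> be ae ec.
have eV v : V l v -> V l (e v).
  by move=> h a b lab; rewrite -ec h // (lin_0 (bop_lin be)).
apply: P_uniq => [|v Vv]; first by apply: eV; exact: P_V.
rewrite -(lin_B (bop_lin be)) adjP // ae ipBl (proj_ip _ _ (pP l)) P_fix ?subrr //.
exact: eV.
Qed.

Let cvN_real (e : R) : 0 < e -> exists N, forall n, (N <= n)%N -> n.+1%:R^-1 < e.
Proof.
move=> e0; have /rcvg0P/(_ _ e0)[N hN] := @cvg_harmonic R; exists N => n /hN.
by rewrite /harmonic /= ger0_norm.
Qed.

Let AB_cv0 (u : nat -> H) q a b : cv u q -> (exists N, forall n, (N <= n)%N -> A a (B b (u n)) = 0) ->
  A a (B b q) = 0.
Proof.
move=> uq [N hN].
have h : cv (fun n => A a (B b (u n))) (A a (B b q)) by apply: bop_cv => //; apply: bop_cv.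
apply: (cv_unique (cv_subseq (f := fun n => (N + n)%N) _ h)).
  by move=> n; exact: leq_addl.
rewrite (_ : (fun n => _) = fun=> 0); first exact: cv_cst.
by apply/funext => n; rewrite hN // leq_addr.
Qed.

Let P_rc l x : cv (fun n => P (l + n.+1%:R^-1) x) (P l x).
Proof.
have le1 (n : nat) : l <= l + n.+1%:R^-1 by rewrite lerDl invr_ge0.
have le2 (m n : nat) : (m <= n)%N -> l + n.+1%:R^-1 <= l + m.+1%:R^-1.
  by move=> mn; rewrite lerD2l lef_pV2 ?posrE ?ltr0n // ler_nat.
have [q hq] := @decreasing_projections _ _ (fun n => P (l + n.+1%:R^-1)) (fun n => pP _)
  (fun m n x mn => P_mono x (le2 m n mn)).
have Vq : V l (q x).
  move=> a b lab; apply: (AB_cv0 (hq x)).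
  have [|N hN] := @cvN_real (a + b - l); first by rewrite subr_gt0.
  by exists N => n /hN h; apply: P_V; rewrite -ltrBrDl.
have e : P l x = q x.
  rewrite -[RHS](P_fix Vq); apply: (cv_unique (cv_cst _)).
  have := bop_cv (proj_bop (pP l)) (hq x); congr (cv _ _).
  by apply/funext => n; rewrite P_mono'.
by rewrite e; exact: hq.
Qed.

Let hi_cv (E : spectral_measure H) v : cv (fun n => spE E (hi (- n%:R)) v) v.
Proof.
rewrite (_ : (fun n => _) = fun n => Phi E (cind (hi (- n%:R))) v); last first.
  by apply/funext => n; rewrite Phi_cind.
apply: (@Phi_approx_id _ _ E setT _ 1); first exact: concentratedT.
- by move=> n; exact: bm_cind.
- by move=> n s _; exact: cn_cind.
- move=> s _; apply/rcvg0P => e e0; exists (Num.bound `|s|) => n hn.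
  have hs : - n%:R < s.
    have := archi_boundP (normr_ge0 s); rewrite ltr_norml => /andP[h1 _].
    by apply: le_lt_trans h1; rewrite lerN2 ler_nat.
  by rewrite cind_in ?subrr ?cn0 ?normr0 // /hi /= in_itv /= hs.
Qed.

Let rc_cv (E : spectral_measure H) a v : cv (fun n => spE E (hi (a + n.+1%:R^-1)) v) (spE E (hi a) v).
Proof.
rewrite (_ : (fun n => _) = fun n => Phi E (cind (hi (a + n.+1%:R^-1))) v); last first.
  by apply/funext => n; rewrite Phi_cind.
rewrite -Phi_cind //.
apply: (@Phi_cv _ _ E setT _ _ 1); first exact: concentratedT.
- by move=> n; exact: bm_cind.
- exact: bm_cind.
- by move=> n s _; exact: cn_cind.
- move=> s _; have [sa|as_] := leP s a.
    rewrite (_ : (fun n => _) = fun=> 0); first exact: cvg_cst.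
    apply/funext => n; rewrite !cind_out ?subrr ?cn0 // /hi /= in_itv /= andbT; apply/negP.
      by rewrite -leNgt.
    by rewrite -leNgt (le_trans sa) // lerDl.
  apply/rcvg0P => e e0; have [|N hN] := @cvN_real (s - a); first by rewrite subr_gt0.
  exists N => n /hN h; rewrite !cind_in ?subrr ?cn0 ?normr0 // /hi /= in_itv /= andbT //.
  by rewrite -ltrBrDl.
Qed.

Let AB_lim0 v a0 b0 : (forall a b, a0 < a -> b0 < b -> A a (B b v) = 0) -> A a0 (B b0 v) = 0.
Proof.
move=> h.
have h1 (n : nat) : A (a0 + n.+1%:R^-1) (B b0 v) = 0.
  rewrite AB_comm; apply: (cv_unique (rc_cv Y b0 _)).
  rewrite (_ : (fun k => _) = fun=> 0); first exact: cv_cst.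
  by apply/funext => k; rewrite -[spE Y _ _]/(B _ _) -AB_comm h // ltrDl invr_gt0 ltr0n.
apply: (cv_unique (rc_cv X a0 _)).
rewrite (_ : (fun k => _) = fun=> 0); first exact: cv_cst.
by apply/funext => k; rewrite -[spE X _ _]/(A _ _) h1.
Qed.

Let P_lo x : cv (fun n => P (- n%:R) x) 0.
Proof.
have le1 (m n : nat) : (m <= n)%N -> - n%:R <= - m%:R :> R by move=> mn; rewrite lerN2 ler_nat.
have [q hq] := @decreasing_projections _ _ (fun n => P (- n%:R)) (fun n => pP _)
  (fun m n x mn => P_mono x (le1 m n mn)).
suff <- : q x = 0 by exact: hq.
have q0 a b : A a (B b (q x)) = 0.
  apply: (AB_cv0 (hq x)); exists (Num.bound `|a + b|).+1 => n Nn; apply: P_V.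
  have := archi_boundP (normr_ge0 (a + b)); rewrite ltr_norml => /andP[h1 _].
  by apply: le_lt_trans h1; rewrite lerN2 ler_nat ltnW.
have B0 b : B b (q x) = 0.
  apply: (cv_unique (hi_cv X _)).
  by rewrite (_ : (fun n => _) = fun=> 0); [exact: cv_cst|apply/funext => n; exact: q0].
apply: (cv_unique (hi_cv Y _)).
by rewrite (_ : (fun n => _) = fun=> 0); [exact: cv_cst|apply/funext => n; exact: B0].
Qed.

Let bx (n : nat) : set R := `]- n%:R, n%:R]%classic.
Let mbx n : measurable (bx n). Proof. exact: measurable_itv. Qed.

Let c n x := spE X (bx n) (spE Y (bx n) x).

Let bx_cv (E : spectral_measure H) v : cv (fun n => spE E (bx n) v) v.
Proof.
rewrite (_ : (fun n => _) = fun n => Phi E (cind (bx n)) v); last first.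
  by apply/funext => n; rewrite Phi_cind.
apply: (@Phi_approx_id _ _ E setT _ 1); first exact: concentratedT.
- by move=> n; exact: bm_cind.
- by move=> n s _; exact: cn_cind.
- move=> s _; apply/rcvg0P => e e0; exists (Num.bound `|s|) => n hn.
  rewrite cind_in ?subrr ?cn0 ?normr0 // /bx /= in_itv /=.
  have := archi_boundP (normr_ge0 s); rewrite ltr_norml => /andP[h1 h2].
  have h3 : (Num.bound `|s|)%:R <= n%:R :> R by rewrite ler_nat.
  by apply/andP; split; lra.
Qed.

Let spE_hn (E : spectral_measure H) D x : measurable D -> hn (spE E D x) <= hn x.
Proof. by move=> mD; apply: proj_hn; exact: sp_proj. Qed.

Let c_cv x : cv (fun n => c n x) x.
Proof.
apply: (@cv_squeeze _ _ _ _ (fun n => hn (spE Y (bx n) x - x) + hn (spE X (bx n) x - x))).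
  move=> n; apply: (le_trans (hn_triangle _ (spE X (bx n) x) _)); rewrite lerD2r.
  by rewrite -(lin_B (bop_lin (spE_bop X (mbx n)))) spE_hn.
by rewrite -[X in _ --> X]addr0; apply: cvgD; exact: bx_cv.
Qed.

(** If [a + b > a' + b'] then [a >= a'] or [b > b'], and one of the two half-line projections
    annihilates [v]. *)
Let cell_le a' b' v (D D' : set R) : measurable D -> measurable D' ->
  (forall s, D s -> s <= a') -> (forall s, D' s -> s <= b') ->
  spE X D v = v -> spE Y D' v = v -> V (a' + b') v.
Proof.
move=> mD mD' ha hb hX hY a b lab.
have [aa|aa] := leP a' a.
  rewrite AB_comm -hX /A -[spE X _ _]/((spE X _ \o spE X _) _) -sp_setI //.
  rewrite (_ : hi a `&` D = set0); last first.
    by apply/seteqP; split=> // s []; rewrite /hi /= in_itv /= andbT => h /ha; lra.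
  by rewrite -Phi_cind // (_ : cind set0 = fun=> 0) ?Phi_cst ?scale0r ?(lin_0 (bop_lin (bB b))) //;
    apply/funext => s; rewrite cind_out.
rewrite -hY /B -[spE Y _ _]/((spE Y _ \o spE Y _) _) -sp_setI //.
rewrite (_ : hi b `&` D' = set0); last first.
  by apply/seteqP; split=> // s []; rewrite /hi /= in_itv /= andbT => h /hb; lra.
by rewrite -(Phi_cind Y) // (_ : cind set0 = fun=> 0) ?Phi_cst ?scale0r ?(lin_0 (bop_lin (bA a))) //;
  apply/funext => s; rewrite cind_out.
Qed.

Let spE_comm D D' x : measurable D -> measurable D' ->
  spE X D (spE Y D' x) = spE Y D' (spE X D x).
Proof. by move=> mD mD'; rewrite -!Phi_cind // comm //; exact: bm_cind. Qed.

Let P_hi x : cv (fun n => P n%:R x) x.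
Proof.
apply/cvP => e e0; have /cvP/(_ _ e0)[N hN] := c_cv x.
have VN : V (N%:R + N%:R) (c N x).
  apply: (@cell_le _ _ _ (bx N) (bx N)) => //.
  - by move=> s; rewrite /bx /= in_itv /= => /andP[].
  - by move=> s; rewrite /bx /= in_itv /= => /andP[].
  - by rewrite spE_idem.
  - by rewrite /c -spE_comm // spE_idem.
exists (N + N)%N => n Nn; have {}VN : V n%:R (c N x).
  by apply: V_mono VN; rewrite -natrD ler_nat.
apply: le_lt_trans (hN N (leqnn N)); rewrite hnBC [X in _ <= X]hnBC.
rewrite (_ : x - P n%:R x = (id - P n%:R) (x - c N x)); first exact: proj_hn (proj_id_compl (pP _)).
rewrite -[RHS]/(x - c N x - P n%:R (x - c N x)) (lin_B (bop_lin (proj_bop (pP _)))).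
by rewrite (P_fix VN) opprB addrA subrK.
Qed.

Let Zex := spectral_of_resolution pP P_mono P_rc P_lo P_hi.
Let Z := projT1 (cid Zex).
Let ZE (a b : R) : a <= b -> spE Z `]a, b]%classic = P b - P a.
Proof. by rewrite /Z; case: cid => Z0 h /=; exact: h. Qed.

(** The symmetry [W = 1 - 2 e] commutes with all [P l], so transport by [W] fixes the intervals of Z
    and therefore Z. *)
Let Z_comm (e : op H) g x : projection e ->
  (forall a b v, e (A a (B b v)) = A a (B b (e v))) -> bm g -> Phi Z g (e x) = e (Phi Z g x).
Proof.
move=> pe ec bg; have be := proj_bop pe; have le := bop_lin be.
have ae : adj e = e by case: pe.
have eP l v : P l (e v) = e (P l v) by exact: P_comm.
pose W v := v - (e v + e v).
have WW : cancel W W.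
  move=> v; rewrite /W !(lin_B le) !(lin_D le) (proj_idem _ pe).
  by apply: ip_inj => z; rewrite !(ipDl, ipNl); ring.
have hW : semiunitary false W W.
  split=> // [k v w|v].
    by apply: ip_inj => z; rewrite /W !le /cif !(ipDl, ipNl, ipZl); ring.
  apply/eqP; rewrite -(@eqrXn2 _ 2) ?hn_ge0 //; apply/eqP.
  have h1 : complex.Re <|v, e v|> = hn (e v) ^+ 2 by rewrite -(proj_ip v v pe) proj_form.
  have h2 : complex.Re <|e v, e v|> = hn (e v) ^+ 2 by rewrite ipxx.
  by rewrite /W hnB2 hnD2 !ipDr !ReD h1 h2; ring.
have h : same (transport hW Z) Z.
  apply: same_ocitv => a b.
  have mab : measurable (`]a, b]%classic : set R) by exact: measurable_itv.
  have [ab|ba] := leP a b; last first.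
    rewrite set_itv_ge ?bnd_simp -?leNgt ?(ltW ba) // -!Phi_cind //.
    have c0 : cind set0 = fun=> 0 :> R[i] by apply/funext => s; rewrite cind_out.
    by rewrite c0; apply/funext => v; rewrite !Phi_cst !scale0r.
  apply/funext => v; rewrite -[LHS]/(W (spE Z `]a, b]%classic (W v))) ZE //.
  rewrite -![(P b - P a) _]/(P b _ - P a _) -[RHS]WW; congr W.
  have WP l u : P l (W u) = W (P l u).
    by rewrite /W (lin_B (bop_lin (proj_bop (pP l)))) (lin_D (bop_lin (proj_bop (pP l)))) eP.
  by rewrite !WP (suB hW).
have hg := same_Phi h bg; rewrite Phi_tr // in hg.
have WF v : W (Phi Z g v) = Phi Z g (W v).
  rewrite -{1}hg; exact: (suK' hW).
have eE v : e v = 2^-1 *: (v - W v).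
  by apply: ip_inj => z; rewrite /W !(ipZl, ipDl, ipNl); field.
by rewrite !eE WF (lin_Z (Phi_linear _ bg)) (lin_B (Phi_linear _ bg)).
Qed.

Let AB_X D a b v : measurable D -> spE X D (A a (B b v)) = A a (B b (spE X D v)).
Proof.
move=> mD; have cD := bm_cind mD; have ca := bm_cind (mhi a); have cb := bm_cind (mhi b).
by rewrite /A /B -!Phi_cind // -(comm v cD cb) Phi_comm.
Qed.

Let AB_Y D a b v : measurable D -> spE Y D (A a (B b v)) = A a (B b (spE Y D v)).
Proof.
move=> mD; have cD := bm_cind mD; have ca := bm_cind (mhi a); have cb := bm_cind (mhi b).
by rewrite /A /B -!Phi_cind // -(comm _ ca cD) [Phi Y _ (Phi Y _ _)]Phi_comm.
Qed.

Let Z_commX D g x : measurable D -> bm g -> Phi Z g (spE X D x) = spE X D (Phi Z g x).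
Proof.
by move=> mD bg; apply: Z_comm => // [|a b v]; [exact: sp_proj|exact: AB_X].
Qed.

Let Z_commY D g x : measurable D -> bm g -> Phi Z g (spE Y D x) = spE Y D (Phi Z g x).
Proof.
by move=> mD bg; apply: Z_comm => // [|a b v]; [exact: sp_proj|exact: AB_Y].
Qed.

Let oc (a d : R) : set R := `]a, a + d]%classic.
Let moc a d : measurable (oc a d). Proof. exact: measurable_itv. Qed.

Let cell_Z a b d v : 0 <= d -> spE X (oc a d) v = v -> spE Y (oc b d) v = v ->
  spE Z (oc (a + b) (d + d)) v = v.
Proof.
move=> d0 hX hY; rewrite /oc ZE; last by rewrite lerDl addr_ge0.
rewrite -[(_ - _) v]/(P _ v - P _ v).
have -> : P (a + b + (d + d)) v = v.
  apply: P_fix; rewrite addrACA; apply: (@cell_le _ _ _ (oc a d) (oc b d)) => //.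
  - by move=> s; rewrite /oc /= in_itv /= => /andP[].
  - by move=> s; rewrite /oc /= in_itv /= => /andP[].
suff -> : P (a + b) v = 0 by rewrite subr0.
(* The strict inequality in [V] covers only quadrants with larger corners; right continuity reaches
   the corner itself. *)
have e0 : A a (B b (P (a + b) v)) = 0.
  by apply: AB_lim0 => a1 b1 h1 h2; apply: P_V; exact: ltrD.
have hE l v0 (D : set R) : measurable D -> P l (spE X D v0) = spE X D (P l v0).
  move=> mD; apply: P_comm => [||a1 b1 w]; [exact: spE_bop|exact: spE_adj|exact: AB_X].
have hF l v0 (D : set R) : measurable D -> P l (spE Y D v0) = spE Y D (P l v0).
  move=> mD; apply: P_comm => [||a1 b1 w]; [exact: spE_bop|exact: spE_adj|exact: AB_Y].
have sub (a1 : R) : oc a1 d `&` hi a1 = oc a1 d.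
  apply/seteqP; split=> s; first by case.
  rewrite /oc /= in_itv /= => /andP[h1 h2]; split; last by rewrite /hi /= in_itv /= h1.
  by rewrite ?/oc /= ?in_itv /= h1 h2.
have eX : spE X (hi a) v = v.
  by rewrite -{1}hX -[LHS]/((spE X _ \o spE X _) v) -sp_setI // setIC sub.
have eY : spE Y (hi b) v = v.
  by rewrite -{1}hY -[LHS]/((spE Y _ \o spE Y _) v) -sp_setI // setIC sub.
by move: e0; rewrite /A /B -hF // eY -hE // eX.
Qed.

Let cell_est (E : spectral_measure H) D f k e v : measurable D -> bm f -> spE E D v = v ->
  0 <= e -> (forall s, D s -> cn (f s - k) <= e) -> hn (Phi E f v - k *: v) <= e * hn v.
Proof.
move=> mD bf hv e0 h; have bk := bm_cst k.
have bfk : bm (fun s => f s - k) by exact: bm_B.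
have bc := bm_cind mD.
rewrite -(Phi_cst E k v) -Phi_B // -{1}hv -Phi_cind // -Phi_mul //.
apply: Phi_bdd; first exact: bm_M.
move=> s; have [sD|sD] := pselect (D s); first by rewrite cind_in // mulr1 h.
by rewrite cind_out // mulr0 cn0.
Qed.

Section Product.
Variables (f : R -> R[i]) (n : nat) (K M : R).
Hypotheses (bf : bm f) (K0 : 0 <= K) (M0 : 0 <= M).
Hypothesis fM : forall s, cn (f s) <= M.
Hypothesis fK : forall s t, - (n%:R + n%:R) <= s <= n%:R + n%:R -> - (n%:R + n%:R) <= t <= n%:R + n%:R ->
  cn (f s - f t) <= K * `|s - t|.
Hypothesis fD : forall s t, - n%:R <= s <= n%:R -> - n%:R <= t <= n%:R -> f (s + t) = f s * f t.

Let Df v := Phi Z f v - Phi X f (Phi Y f v).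

Let in_cell (a b d : R) v := [/\ - n%:R <= a, a + d <= n%:R, - n%:R <= b & b + d <= n%:R] /\
  (spE X (oc a d) v = v /\ spE Y (oc b d) v = v).

(** On a cell of side [d] the functions [f] of Z, X and Y are within order [d] of the scalars
    [f (a + b)], [f a] and [f b], and [fD] matches these scalars. *)
Let small (a b d : R) v : 0 <= d -> in_cell a b d v -> hn (Df v) <= K * d * (2 + M + M) * hn v.
Proof.
move=> d0 [[a1 a2 b1 b2] [hX hY]]; have hZ := cell_Z d0 hX hY.
have n0 : (0 : R) <= n%:R by [].
have Kd : 0 <= K * d by rewrite mulr_ge0.
have e1 : hn (Phi Z f v - f (a + b) *: v) <= K * d * 2 * hn v.
  apply: (cell_est (moc (a + b) (d + d))) => //; first by rewrite mulr_ge0.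
  move=> s; rewrite /oc /= in_itv /= => /andP[s1 s2].
  apply: (le_trans (fK _ _)); [apply/andP; split; lra|apply/andP; split; lra|].
  by rewrite -mulrA ler_wpM2l // ger0_norm; [lra|rewrite subr_ge0 ltW].
have hY' : spE X (oc a d) (Phi Y f v) = Phi Y f v by rewrite -{2}hX ind_comm.
have e2 : hn (Phi Y f v - f b *: v) <= K * d * hn v.
  apply: (cell_est (moc b d)) => //.
  move=> s; rewrite /oc /= in_itv /= => /andP[s1 s2].
  apply: (le_trans (fK _ _)); [apply/andP; split; lra|apply/andP; split; lra|].
  by rewrite ler_wpM2l // ger0_norm; [lra|rewrite subr_ge0 ltW].
have e3 : hn (Phi X f (Phi Y f v) - f a *: Phi Y f v) <= K * d * (M * hn v).
  apply: (@le_trans _ _ (K * d * hn (Phi Y f v))).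
    apply: (cell_est (moc a d)) => //.
    move=> s; rewrite /oc /= in_itv /= => /andP[s1 s2].
    apply: (le_trans (fK _ _)); [apply/andP; split; lra|apply/andP; split; lra|].
    by rewrite ler_wpM2l // ger0_norm; [lra|rewrite subr_ge0 ltW].
  by rewrite ler_wpM2l // Phi_bdd.
have e4 : hn (f a *: Phi Y f v - f (a + b) *: v) <= M * (K * d * hn v).
  rewrite fD; [|apply/andP; split; lra|apply/andP; split; lra].
  by rewrite -scalerA -scalerBr hnZ ler_pM ?cn_ge0 ?hn_ge0.
have -> : Df v = (Phi Z f v - f (a + b) *: v) - (Phi X f (Phi Y f v) - f a *: Phi Y f v)
    - (f a *: Phi Y f v - f (a + b) *: v).
  by apply: ip_inj => z; rewrite /Df !(ipDl, ipNl); ring.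
apply: (le_trans (hnB _ _)); apply: (le_trans (lerD (hnB _ _) (lexx _))).
apply: (le_trans (lerD (lerD e1 e3) e4)).
by rewrite le_eqVlt; apply/orP; left; apply/eqP; ring.
Qed.

Let D_X D v : measurable D -> Df (spE X D v) = spE X D (Df v).
Proof.
move=> mD; rewrite /Df Z_commX // -(ind_comm _ mD bf) (lin_B (bop_lin (spE_bop X mD))).
by rewrite -!(Phi_cind X mD) (Phi_comm X _ bf (bm_cind mD)).
Qed.

Let D_Y D v : measurable D -> Df (spE Y D v) = spE Y D (Df v).
Proof.
move=> mD; have bD := bm_cind mD; rewrite /Df Z_commY // (lin_B (bop_lin (spE_bop Y mD))).
by rewrite -!(Phi_cind Y mD) (Phi_comm Y _ bf bD) comm.
Qed.

(* bisection of a cell in one coordinate *)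
Let bisect (E : spectral_measure H) (k : R) (a d : R) v : 0 <= d -> 0 <= k ->
  (forall D w, measurable D -> Df (spE E D w) = spE E D (Df w)) ->
  spE E (oc a (d + d)) v = v ->
  hn (Df (spE E (oc a d) v)) <= k * hn (spE E (oc a d) v) ->
  hn (Df (spE E (oc (a + d) d) v)) <= k * hn (spE E (oc (a + d) d) v) ->
  hn (Df v) <= k * hn v.
Proof.
move=> d0 k0 hD hv h1 h2.
have split w : spE E (oc a (d + d)) w = w ->
    hn w ^+ 2 = hn (spE E (oc a d) w) ^+ 2 + hn (spE E (oc (a + d) d) w) ^+ 2.
  have dis : oc a d `&` oc (a + d) d = set0.
    by apply/seteqP; split=> // s []; rewrite /oc /= !in_itv /= => /andP[s1 s2] /andP[s3 s4]; lra.
  have := @measureU _ _ _ (sp_mu E w) (oc a d) (oc (a + d) d) (moc _ _) (moc _ _) dis.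
  have -> : oc a d `|` oc (a + d) d = oc a (d + d).
    apply/seteqP; split=> s; rewrite /oc /= !in_itv /=.
      by case=> /andP[s1 s2]; apply/andP; split; lra.
    by move=> /andP[s1 s2]; have [h|h] := leP s (a + d); [left|right]; apply/andP; split => //; lra.
  move=> e hw; have := congr1 fine e; rewrite fineD ?ge0_fin_numE ?mu_fin //.
  by rewrite !mu_hn // hw.
rewrite -(@ler_pXn2r _ 2) ?nnegrE ?mulr_ge0 ?hn_ge0 // exprMn (split v hv).
rewrite (split (Df v)); last by rewrite -hD // hv.
rewrite mulrDr -!exprMn -!hD //.
by apply: lerD; apply: lerXn2r; rewrite ?nnegrE ?mulr_ge0 ?hn_ge0.
Qed.

Let ind_step (k d : R) : 0 <= d -> 0 <= k ->
  (forall a b v, in_cell a b d v -> hn (Df v) <= k * hn v) ->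
  forall a b v, in_cell a b (d + d) v -> hn (Df v) <= k * hn v.
Proof.
move=> d0 k0 h a b v [[a1 a2 b1 b2] [hX hY]].
have fixE (E : spectral_measure H) D w : measurable D -> spE E D (spE E D w) = spE E D w.
  by move=> mD; exact: spE_idem.
apply: (bisect d0 k0 (fun D w mD => D_X w mD) hX).
- have hY' : spE Y (oc b (d + d)) (spE X (oc a d) v) = spE X (oc a d) v by rewrite -spE_comm // hY.
  apply: (bisect d0 k0 (fun D w mD => D_Y w mD) hY').
    apply: (h a b).
    split; first by split; lra.
    by split; [rewrite spE_comm // fixE|rewrite fixE].
  apply: (h a (b + d)); split; first by split; lra.
  by split; [rewrite spE_comm // fixE|rewrite fixE].
- have hY' : spE Y (oc b (d + d)) (spE X (oc (a + d) d) v) = spE X (oc (a + d) d) v.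
    by rewrite -spE_comm // hY.
  apply: (bisect d0 k0 (fun D w mD => D_Y w mD) hY').
    apply: (h (a + d) b).
    split; first by split; lra.
    by split; [rewrite spE_comm // fixE|rewrite fixE].
  apply: (h (a + d) (b + d)); split; first by split; lra.
  by split; [rewrite spE_comm // fixE|rewrite fixE].
Qed.

(** The halves of a bisected cell are orthogonal and respected by [Df], so the bound for small cells
    holds on the whole box with the same constant. That constant is proportional to the side of the
    small cells, which is halved at will. *)
Lemma commuting_calculus v : spE X (bx n) v = v -> spE Y (bx n) v = v ->
  Phi Z f v = Phi X f (Phi Y f v).
Proof.
move=> hX hY; apply/eqP; rewrite -subr_eq0; apply/eqP.
have n0 : (0 : R) <= n%:R by [].
pose w : R := n%:R + n%:R; have w0 : 0 <= w by rewrite addr_ge0.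
pose d m : R := w / 2 ^+ m.
have dS m : d m.+1 + d m.+1 = d m.
  by rewrite /d exprS; field; rewrite expf_neq0 // pnatr_eq0.
have d0 m : 0 <= d m by rewrite divr_ge0 // exprn_ge0.
have main m j a b u : in_cell a b (d m) u -> hn (Df u) <= K * d (m + j)%N * (2 + M + M) * hn u.
  elim: j m a b u => [|j IH] m a b u hu; first by rewrite addn0; exact: small hu.
  have k0 : 0 <= K * d (m + j.+1)%N * (2 + M + M) by rewrite !mulr_ge0 // !addr_ge0.
  apply: (@ind_step _ _ (d0 m.+1) k0 _ a b u); last by rewrite dS.
  by move=> a' b' u' hu'; rewrite addnS -addSn; exact: IH hu'.
have hv : in_cell (- n%:R) (- n%:R) (d 0%N) v.
  have ocE : oc (- n%:R) (d 0%N) = bx n.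
    by rewrite /oc /bx /d expr0 divr1 /w addrA addNr add0r.
  by rewrite /in_cell ocE; split=> //; split; rewrite // /d expr0 divr1 /w; lra.
apply: (@op_le0 _ _ _ 0 1) => e e0; rewrite subr0 mulr1 -/(Df v).
pose C := K * w * (2 + M + M) * hn v.
have C0 : 0 <= C by rewrite !mulr_ge0 ?hn_ge0 // !addr_ge0.
have [N hN] : exists N : nat, C <= e * 2 ^+ N.
  exists (Num.bound (C / e)); rewrite mulrC -ler_pdivrMr //.
  apply: (le_trans (ltW (archi_boundP (divr_ge0 C0 (ltW e0))))).
  by rewrite -natrX ler_nat ltnW // ltn_expl.
apply: (le_trans (main 0%N N _ _ _ hv)); rewrite add0n /d.
have -> : K * (w / 2 ^+ N) * (2 + M + M) * hn v = C / 2 ^+ N by rewrite /C; ring.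
by rewrite ler_pdivrMr // exprn_gt0.
Qed.

End Product.

Let cX n x : spE X (bx n) (c n x) = c n x.
Proof. by rewrite /c spE_idem. Qed.

Let cY n x : spE Y (bx n) (c n x) = c n x.
Proof. by rewrite /c -spE_comm // spE_idem. Qed.

Let Z_cis t x : Phi Z (fun l => cis (t * l)) x = Phi X (fun l => cis (t * l)) (Phi Y (fun l => cis (t * l)) x).
Proof.
have bt := bm_cisM t.
have cZ := bop_cv (Phi_bop Z bt) (c_cv x).
have cXY := bop_cv (Phi_bop X bt) (bop_cv (Phi_bop Y bt) (c_cv x)).
apply: (cv_unique cZ); move: cXY; congr (cv _ _); apply/funext => n.
symmetry; apply: (@commuting_calculus _ n (2 * `|t|) 1) => //.
- by move=> s; rewrite cn_cis.
- move=> s u _ _; have -> : cis (t * s) - cis (t * u) = cis (t * u) * (cis (t * (s - u)) - 1).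
    by rewrite mulrBr mulr1 -cisD mulrBr [t * u + _]addrC subrK.
  rewrite cnM cn_cis mul1r; apply: (le_trans (cn_cisB1_le _)); rewrite normrM.
  by move: (`|t|) (`|s - u|) => p q; rewrite le_eqVlt; apply/orP; left; apply/eqP; ring.
- by move=> s u _ _; rewrite mulrDr cisD.
Qed.

(** Sums of two points of [bx n] stay in [sq n], on which the exponential is bounded and Lipschitz,
    as [commuting_calculus] requires. *)
Let sq n : set R := `[- (n%:R + n%:R), n%:R + n%:R]%classic.
Let msq n : measurable (sq n). Proof. exact: measurable_itv. Qed.

Let e n (l : R) : R[i] := ex 1 l * cind (sq n) l.

Let cn_e n l : cn (e n l) <= expR (n%:R + n%:R).
Proof.
rewrite /e; have [h|h] := pselect (sq n l); last by rewrite cind_out // mulr0 cn0 expR_ge0.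
rewrite cind_in // mulr1 /ex mul1r cn_real ger0_norm ?expR_ge0 // ler_expR.
by move: h; rewrite /sq /= in_itv /= => /andP[].
Qed.

Let be n : bm (e n).
Proof.
split; last by exists (expR (n%:R + n%:R)).
by apply: mC_M; [exact: mC_ex|exact: (bm_cind (msq n)).1].
Qed.

Let Z_e n x : Phi Z (e n) (c n x) = Phi X (e n) (Phi Y (e n) (c n x)).
Proof.
have n0 : (0 : R) <= n%:R by [].
apply: (@commuting_calculus _ n (expR (n%:R + n%:R) * expR (n%:R + n%:R + (n%:R + n%:R))) (expR (n%:R + n%:R))) => //.
- move=> s t hs ht; rewrite /e !cind_in; try by rewrite /sq /= in_itv.
  rewrite !mulr1 /ex !mul1r -rmorphB cn_real.
  have -> : expR s - expR t = expR t * (expR (s - t) - 1).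
    by rewrite mulrBr mulr1 -expRD [t + _]addrC subrK.
  rewrite normrM ger0_norm ?expR_ge0 // -mulrA; apply: ler_pM; rewrite ?expR_ge0 //.
    by rewrite ler_expR; case/andP: ht.
  apply: (le_trans (norm_expRB1 _)); rewrite ler_wpM2r // ler_expR.
  case/andP: hs => s1 s2; case/andP: ht => t1 t2; rewrite ler_norml; apply/andP; split; lra.
- move=> s t /andP[s1 s2] /andP[t1 t2]; rewrite /e !cind_in; try by rewrite /sq /= in_itv /=; apply/andP; split; lra.
  by rewrite !mulr1 /ex !mul1r expRD rmorphM.
Qed.

Let bx_sq (E : spectral_measure H) n v : spE E (bx n) v = v -> spE E (sq n) v = v.
Proof.
move=> h; rewrite -{1}h -[LHS]/((spE E _ \o spE E _) v) -sp_setI // (_ : sq n `&` bx n = bx n) //.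
apply/seteqP; split=> s; first by case.
have n0 : (0 : R) <= n%:R by [].
move=> hs; split=> //; move: hs; rewrite /bx /sq /= !in_itv /= => /andP[s1 s2].
by apply/andP; split; lra.
Qed.

Let me := @mC_ex R 1.

Let cut_Fop (E : spectral_measure H) n x y : Fop E (ex 1) (x, y) -> spE E (sq n) x = x ->
  y = Phi E (e n) x.
Proof.
move=> xy hx; have bc := bm_cind (msq n).
have h := Op_bm E x me bc (be n); rewrite Phi_cind // hx in h.
exact: Op_fun me xy h.
Qed.

Let Fop_cut (E : spectral_measure H) n x : spE E (sq n) x = x -> Fop E (ex 1) (x, Phi E (e n) x).
Proof.
move=> hx; have bc := bm_cind (msq n).
by have := Op_bm E x me bc (be n); rewrite Phi_cind // hx.
Qed.

Let c_X n x y : Fop X (ex 1) (x, y) -> Fop X (ex 1) (c n x, c n y).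
Proof.
move=> xy; have bb := bm_cind (mbx n).
have h : Fop X (ex 1) (spE Y (bx n) x, spE Y (bx n) y).
  by move=> k /=; rewrite -!(Phi_cind Y (mbx n)) !comm ?xy //; [exact: bm_cut|exact: bm_lev].
by rewrite /c -!(Phi_cind X (mbx n)); apply: Op_comm.
Qed.

Let c_Y n x y : Fop Y (ex 1) (x, y) -> Fop Y (ex 1) (c n x, c n y).
Proof.
move=> xy; have bb := bm_cind (mbx n).
have h : Fop Y (ex 1) (spE Y (bx n) x, spE Y (bx n) y).
  by rewrite -!(Phi_cind Y (mbx n)); apply: Op_comm.
move=> k /=; rewrite /c -!(Phi_cind X (mbx n)) -!comm ?h //; [exact: bm_cut|exact: bm_lev].
Qed.

Let c_Z n x y : Fop Z (ex 1) (x, y) -> Fop Z (ex 1) (c n x, c n y).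
Proof.
move=> xy k /=; have bl := bm_lev k me; have bk := bm_cut k me.
by rewrite /c !Z_commX // !Z_commY // xy.
Qed.

Let cZ n x : spE Z (sq n) (c n x) = c n x.
Proof.
have n0 : (0 : R) <= n%:R by [].
have bxE : oc (- n%:R) (n%:R + n%:R) = bx n by rewrite /oc /bx addrA addNr add0r.
have := @cell_Z (- n%:R) (- n%:R) (n%:R + n%:R) (c n x); rewrite bxE cX cY.
move=> /(_ _ erefl erefl) h; have {}h := h _.
set D := oc _ _ in h; have {}h : spE Z D (c n x) = c n x by apply: h; rewrite addr_ge0.
rewrite -{1}h -[LHS]/((spE Z _ \o spE Z _) _) -sp_setI //; last exact: moc.
rewrite (_ : sq n `&` D = D) //; apply/seteqP; split=> s; first by case.
move=> hs; split=> //; move: hs; rewrite /D /oc /sq /= !in_itv /= => /andP[s1 s2].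
by apply/andP; split; lra.
Qed.

Let e_commXY n x : Phi X (e n) (Phi Y (e n) x) = Phi Y (e n) (Phi X (e n) x).
Proof. exact: comm. Qed.

Local Notation Q1 := (ocomp (Fop Y (ex 1)) (Fop X (ex 1))).
Local Notation Q2 := (ocomp (Fop X (ex 1)) (Fop Y (ex 1))).

Let eY_sqX n x : spE X (sq n) x = x -> spE X (sq n) (Phi Y (e n) x) = Phi Y (e n) x.
Proof. by move=> h; rewrite ind_comm // h. Qed.

Let eX_sqY n x : spE Y (sq n) x = x -> spE Y (sq n) (Phi X (e n) x) = Phi X (e n) x.
Proof. by move=> h; rewrite -(Phi_cind Y (msq n)) -comm ?Phi_cind ?h //; exact: bm_cind. Qed.

Let Q1Z x z : Q1 (x, z) -> Fop Z (ex 1) (x, z).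
Proof.
move=> [y /= [xy yz]]; apply: (@Op_closed _ _ _ _ (fun n => c n x) (fun n => c n z)) => // n.
have h1 := cut_Fop (c_X n xy) (bx_sq (cX n x)).
have h2 := cut_Fop (c_Y n yz) (bx_sq (cY n y)).
have -> : c n z = Phi Z (e n) (c n x) by rewrite Z_e e_commXY -h1.
exact: Fop_cut.
Qed.

Let Q2Z x z : Q2 (x, z) -> Fop Z (ex 1) (x, z).
Proof.
move=> [y /= [xy yz]]; apply: (@Op_closed _ _ _ _ (fun n => c n x) (fun n => c n z)) => // n.
have h1 := cut_Fop (c_Y n xy) (bx_sq (cY n x)).
have h2 := cut_Fop (c_X n yz) (bx_sq (cX n y)).
have -> : c n z = Phi Z (e n) (c n x) by rewrite Z_e -h1.
exact: Fop_cut.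
Qed.

Let ZQ1 x z : Fop Z (ex 1) (x, z) -> closure Q1 (x, z).
Proof.
move=> xz; apply: (@cv_closure2 _ _ _ _ (fun n => c n x) (fun n => c n z)) => // n.
have -> : c n z = Phi Z (e n) (c n x) by exact: cut_Fop (c_Z n xz) (cZ n x).
rewrite Z_e e_commXY; exists (Phi X (e n) (c n x)); split => /=; apply: Fop_cut.
  by apply: bx_sq; exact: cX.
by apply: eX_sqY; apply: bx_sq; exact: cY.
Qed.

Let ZQ2 x z : Fop Z (ex 1) (x, z) -> closure Q2 (x, z).
Proof.
move=> xz; apply: (@cv_closure2 _ _ _ _ (fun n => c n x) (fun n => c n z)) => // n.
have -> : c n z = Phi Z (e n) (c n x) by exact: cut_Fop (c_Z n xz) (cZ n x).
rewrite Z_e; exists (Phi Y (e n) (c n x)); split => /=; apply: Fop_cut.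
  by apply: bx_sq; exact: cY.
by apply: eY_sqX; apply: bx_sq; exact: cX.
Qed.

Lemma weyl_product0 : exists Z,
  [/\ forall t x, Phi Z (fun l => cis (t * l)) x =
        Phi X (fun l => cis (t * l)) (Phi Y (fun l => cis (t * l)) x),
      Fop Z (ex 1) = closure Q2 & Fop Z (ex 1) = closure Q1].
Proof.
have clZ (Q : H ~> H) : (forall x z, Q (x, z) -> Fop Z (ex 1) (x, z)) ->
    (forall x z, Fop Z (ex 1) (x, z) -> closure Q (x, z)) -> Fop Z (ex 1) = closure Q.
  move=> h1 h2; apply/seteqP; split=> -[x z]; first exact: h2.
  by move=> /closure2_cv[u [v [huv ux vy]]]; apply: (Op_closed me _ ux vy) => n; exact: h1.
exists Z; split; [exact: Z_cis|exact: clZ Q2Z ZQ2|exact: clZ Q1Z ZQ1].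
Qed.

End CommutingProduct.

Section WeylProductAll.
Variables (R : realType) (H : hilbert R).

Lemma weyl_product (X Y : spectral_measure H) (r : R) : ccr X Y r -> exists Z,
  [/\ forall t x, Phi Z (fun l => cis (t * l)) x =
        cis (- (r * t ^+ 2) / 2) *: Phi X (fun l => cis (t * l)) (Phi Y (fun l => cis (t * l)) x),
      Fop Z (ex 1) = oscale (cis (r / 2)) (closure (ocomp (Fop X (ex 1)) (Fop Y (ex 1)))) &
      Fop Z (ex 1) = oscale (cis (- (r / 2))) (closure (ocomp (Fop Y (ex 1)) (Fop X (ex 1))))].
Proof.
have [->|r0] := eqVneq r 0; last by move=> h; exact: weyl_product_neq0.
move=> /weyl_product0[Z [h1 h2 h3]]; exists Z; rewrite mul0r oppr0 cis0.
have sc (A : H ~> H) : oscale 1 A = A.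
  apply/seteqP; split=> -[x z] /=; first by case=> y h /= ->; rewrite scale1r.
  by move=> h; exists z => //; rewrite scale1r.
rewrite !sc; split=> // t x.
by rewrite mul0r oppr0 mul0r cis0 scale1r.
Qed.

End WeylProductAll.

(** * Weights *)

Section ResolventLimits.
Variables (R : realType) (H : hilbert R).
Implicit Types (x y z : H) (a b : op H).

Lemma qf_sum (A : nat -> op H) n x : qf (\sum_(k < n) A k) x = \sum_(k < n) qf (A k) x.
Proof. by elim: n => [|n IH]; [rewrite !big_ord0 /qf ip0l|rewrite !big_ord_recr /= -IH qfD]. Qed.

Lemma pos_D a b : positive_op a -> positive_op b -> positive_op (a + b).
Proof. by move=> ha hb x; rewrite -[(a + b) x]/(a x + b x) ipDl addr_ge0. Qed.

Lemma pos_Z (r : R) a : 0 <= r -> positive_op a -> positive_op (r%:C%C *: a).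
Proof. by move=> r0 ha x; rewrite -[(_ *: a) x]/(r%:C%C *: a x) ipZl mulr_ge0 // realC_ge0. Qed.

(* [res (n a)] decreases strongly to the projection onto the kernel of [a] *)
Lemma res_limit a : bounded_op a -> positive_op a -> exists p : op H,
  [/\ bounded_op p, forall x y, <|p x, y|> = <|x, p y|>,
      forall x, cv (fun n => res (n%:R%:C%C *: a) x) (p x) & forall x, a (p x) = 0].
Proof.
move=> ba pa; pose A n : op H := n%:R%:C%C *: a.
have bA n : bounded_op (A n) by exact: bop_Z.
have pA n : positive_op (A n) by apply: pos_Z.
have [b [bb pb cb _]] : exists b, [/\ bounded_op b, positive_op b,
    (forall x, cv (fun n => (id - res (A n)) x) (b x)) &
    forall n x, qf (id - res (A n)) x <= qf b x].
  apply: (@vigier _ _ (fun n => id - res (A n)) 1) => //.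
  - by move=> n; exact: res_compl_bop.
  - by move=> n; exact: res_compl_pos.
  - move=> m n x mn; apply: res_mono => // y; rewrite !qfZ ler_wpM2r ?pos_qf //.
    by rewrite ler_nat.
  - by move=> n x; rewrite mul1r; exact: res_compl_le1.
have cp x : cv (fun n => res (A n) x) (x - b x).
  have := cvB (cv_cst x) (cb x); congr (cv _ _); apply/funext => n.
  by rewrite -[(id - _) x]/(x - _) subKr.
exists (id - b); split=> //.
- by apply: bop_B => //; exact: bop_id.
- move=> x y; apply: (cv_ip_eq (cp x) (cv_cst y) (cv_cst x) (cp y)) => n.
  exact: res_ip.
- move=> x; have h := bop_cv ba (cp x).
  have h2 : cv (fun n => a (res (A n.+1) x)) 0.
    apply: (@cv_squeeze _ _ _ _ (fun n => n.+1%:R^-1 * (hn x + hn x))) => [n|]; last first.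
      by rewrite -[X in _ --> X](mul0r (hn x + hn x)); apply: cvgMl; exact: cvg_harmonic.
    rewrite subr0; have := res_sub (bA n.+1) (pA n.+1) x.
    rewrite /A -[RHS]/(n.+1%:R%:C%C *: a _) => e.
    have -> : a (res (A n.+1) x) = (n.+1%:R^-1)%:C%C *: (x - res (A n.+1) x).
      rewrite /A e scalerA -rmorphM mulVf ?scale1r // pnatr_eq0 //.
    rewrite hnZ cn_real ger0_norm // ler_wpM2l // (le_trans (hnB _ _)) // lerD2l.
    exact: res_bdd.
  apply: (cv_unique (cv_subseq (f := S) _ h)) => //.
Qed.

End ResolventLimits.

(** * Normal weights and the fullness of their left Hilbert algebras *)

Section WeightTheory.
Variables (R : realType) (H : hilbert R) (M : set (op H)) (phi : op H -> \bar R).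
Hypotheses (HM : von_neumann M) (Hphi : nsf_weight M phi).
Implicit Types (a b : op H).
Local Notation N := (sq_int M phi).

Lemma posM_bop a : pos M a -> bounded_op a.
Proof. by case=> h _; exact: (vn_bop HM). Qed.

Lemma posM_adj a : pos M a -> adj a = a.
Proof. by move=> h; apply: pos_selfadj; [exact: posM_bop|case: h]. Qed.

Lemma posM_D a b : pos M a -> pos M b -> pos M (a + b).
Proof. by move=> [ma pa] [mb pb]; split; [exact: (vn_D HM)|exact: pos_D]. Qed.

Lemma posM_Z (r : R) a : 0 <= r -> pos M a -> pos M (r%:C%C *: a).
Proof. by move=> r0 [ma pa]; split; [exact: (vn_Z HM)|exact: pos_Z]. Qed.

Lemma posM_0 : pos M 0.
Proof. by split; [exact: (vn_0 HM)|move=> x; rewrite ip0l]. Qed.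

Lemma posM_sum (A : nat -> op H) n : (forall k, pos M (A k)) -> pos M (\sum_(k < n) A k).
Proof.
move=> h; elim: n => [|n IH]; first by rewrite big_ord0; exact: posM_0.
by rewrite big_ord_recr /=; exact: posM_D.
Qed.

Lemma posM_le a b : pos M a -> pos M b -> op_le a b <-> forall v, qf a v <= qf b v.
Proof. by move=> ha hb; apply: op_leP; try exact: posM_bop; exact: posM_adj. Qed.

Lemma weight_mono a b : pos M a -> pos M b -> (forall v, qf a v <= qf b v) -> (phi a <= phi b)%E.
Proof.
move=> ha hb /(posM_le ha hb) hab.
have hd : pos M (b - a) by split; [apply: (vn_B HM); [case: hb|case: ha]|].
have -> : b = a + (b - a) by rewrite addrC subrK.
by rewrite (weightD Hphi ha hd) leeDl // (weight_ge0 Hphi).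
Qed.

Lemma weight_0 : phi 0 = 0%E.
Proof.
have := weightZ Hphi (lexx 0) posM_0; rewrite mul0e => <-; congr phi.
by rewrite scale0r.
Qed.

Lemma weight_sum (A : nat -> op H) n : (forall k, pos M (A k)) ->
  phi (\sum_(k < n) A k) = (\sum_(k < n) phi (A k))%E.
Proof.
move=> h; elim: n => [|n IH]; first by rewrite !big_ord0 weight_0.
by rewrite !big_ord_recr /= (weightD Hphi) ?IH //; exact: posM_sum.
Qed.

Lemma sqM (x : op H) : N x -> M x. Proof. by case. Qed.

Lemma sq_bop (x : op H) : N x -> bounded_op x. Proof. by move=> /sqM; exact: (vn_bop HM). Qed.

Lemma sq_ideal a (x : op H) : M a -> N x -> N (a \o x).
Proof.
move=> ma nx; have mx := sqM nx; have max : M (a \o x) by exact: (vn_comp HM).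
have ba := vn_bop HM ma; have bx := vn_bop HM mx; split=> //.
have [c c0 hc] := bop_bdd ba.
have c2 : 0 <= c ^+ 2 by exact: exprn_ge0.
apply: (@le_lt_trans _ _ (phi ((c ^+ 2)%:C%C *: (adj x \o x)))).
  apply: weight_mono; [exact: (vn_adj_comp HM)|apply: posM_Z => //; exact: (vn_adj_comp HM)|].
  move=> v; rewrite qfZ !qf_adj_comp //; last exact: (vn_bop HM).
  by rewrite -exprMn; apply: lerXn2r; rewrite ?nnegrE ?mulr_ge0 ?hn_ge0 ?hc.
rewrite (weightZ Hphi c2 (vn_adj_comp HM mx)).
by apply: lte_mul_pinfty => //; case: nx.
Qed.

Lemma sq_lin k (x y : op H) : N x -> N y -> N (k *: x + y).
Proof.
move=> nx ny; have mx := sqM nx; have my := sqM ny.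
have bx := vn_bop HM mx; have by_ := vn_bop HM my.
have mk : M (k *: x + y) by exact: (vn_lincomb HM).
split=> //; pose c := 2 * cn k ^+ 2.
have c0 : 0 <= c by rewrite mulr_ge0 // exprn_ge0 // cn_ge0.
have p1 := posM_Z c0 (vn_adj_comp HM mx).
have t0 : (0 : R) <= 2 by [].
have p2 := posM_Z t0 (vn_adj_comp HM my).
apply: (@le_lt_trans _ _ (phi (c%:C%C *: (adj x \o x) + 2%:C%C *: (adj y \o y)))).
  apply: weight_mono; [exact: (vn_adj_comp HM)|exact: posM_D|].
  move=> v; rewrite qfD !qfZ !qf_adj_comp //; last exact: (vn_bop HM).
  rewrite -[(k *: x + y) v]/(k *: x v + y v) hnD2 hnZ.
  have := Re_ip_le (k *: x v) (y v); rewrite hnZ /c.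
  move: (cn k) (hn (x v)) (hn (y v)) (complex.Re _) => p q r s h.
  have := sqr_ge0 (p * q - r); rewrite sqrrB !expr2 => ?; nra.
rewrite (weightD Hphi p1 p2) (weightZ Hphi c0 (vn_adj_comp HM mx)) (weightZ Hphi t0 (vn_adj_comp HM my)).
by apply: lte_add_pinfty; apply: lte_mul_pinfty => //; [case: nx|case: ny].
Qed.

Lemma sq_0 : N 0.
Proof.
split; first exact: (vn_0 HM).
rewrite adj0 (_ : 0 \o 0 = 0 :> op H) ?weight_0 ?ltry //.
Qed.

Lemma sq_B (x y : op H) : N x -> N y -> N (x - y).
Proof. by move=> nx ny; rewrite addrC -scaleN1r; exact: sq_lin. Qed.

(** The partial sums S may be unbounded above. Their transforms S (1 + S)^-1 lie below both S and 1,
    increase to some [F] in the algebra, and normality bounds the weight of [F]. *)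
Lemma weight_sup (A : nat -> op H) (C : R) : (forall k, pos M (A k)) ->
  (forall n, (phi (\sum_(k < n) A k)%R <= C%:E)%E) ->
  exists F, [/\ pos M F, (phi F <= C%:E)%E,
    forall v, cv (fun n => (id - res (\sum_(k < n) A k)) v) (F v) &
    forall n v, qf (id - res (\sum_(k < n) A k)) v <= qf F v].
Proof.
move=> pA hC; pose S n := \sum_(k < n) A k; pose F n := id - res (S n).
have pS n : pos M (S n) by exact: posM_sum.
have bS n : bounded_op (S n) by exact: posM_bop.
have poS n : positive_op (S n) by case: (pS n).
have pF n : pos M (F n).
  split; last exact: res_compl_pos.
  by apply: (vn_B HM); [exact: (vn_id HM)|apply: (vn_res HM) => //; case: (pS n)].
have S_mono m n (x : H) : (m <= n)%N -> qf (S m) x <= qf (S n) x.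
  move=> /subnK <-; elim: (n - m)%N => [|j IH] //; apply: (le_trans IH).
  by rewrite addSn /S big_ord_recr /= qfD lerDl pos_qf //; case: (pA (j + m)%N).
have F_mono m n (x : H) : (m <= n)%N -> qf (F m) x <= qf (F n) x.
  by move=> mn; apply: res_mono => // y; exact: S_mono.
have [b [bb pb cb leb]] : exists b, [/\ bounded_op b, positive_op b,
    (forall x, cv (fun n => F n x) (b x)) & forall n x, qf (F n) x <= qf b x].
  apply: (@vigier _ _ F 1) => //.
  - by move=> n; exact: res_compl_bop.
  - by move=> n; exact: res_compl_pos.
  - by move=> n x; rewrite mul1r; exact: res_compl_le1.
have mb : M b by apply: (vn_strong HM (a := F)) => // n; case: (pF n).
exists b; split=> //.
have lub : is_lub M [set F n | n in setT] b.
  split=> //.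
    by move=> _ [n _ <-]; apply/posM_le.
  move=> c pc hc; apply/posM_le => // x.
  apply: (ler_cvg_to (cv_ip_re (cb x) (cv_cst x)) (cvg_cst (qf c x))); apply: nearW => n.
  by apply: op_le_qf; apply: hc; exists n.
rewrite (weight_normal Hphi _ _ _ lub).
- apply: ge_ereal_sup => _ [_ [n _ <-] <-].
  apply: (le_trans _ (hC n)); apply: weight_mono => [||x]; [exact: pF|exact: pS|].
  exact: res_compl_le.
- by exists (F 0%N); exists 0%N.
- by move=> _ [n _ <-].
- move=> _ _ [m _ <-] [n _ <-]; exists (F (maxn m n)); split; first by exists (maxn m n).
    by apply/posM_le => // x; apply: F_mono; exact: leq_maxl.
  by apply/posM_le => // x; apply: F_mono; exact: leq_maxr.
Qed.

Variable Lam : op H -> H.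
Hypothesis Hgns : gns M phi Lam.

Lemma gns_0 : Lam 0 = 0.
Proof.
have := gns_lin Hgns (-1) sq_0 sq_0; by rewrite scaler0 addr0 scaleN1r addNr.
Qed.

Lemma gns_B (x y : op H) : N x -> N y -> Lam (x - y) = Lam x - Lam y.
Proof. by move=> nx ny; rewrite addrC -scaleN1r (gns_lin Hgns) // scaleN1r addrC. Qed.

Lemma gns_phi (x : op H) : N x -> phi (adj x \o x) = (hn (Lam x) ^+ 2)%:E.
Proof.
move=> nx; have := gns_norm Hgns nx; rewrite hnE -rmorphXn => - [->].
by rewrite fineK // ge0_fin_numE; [case: nx|apply: (weight_ge0 Hphi); exact: (vn_adj_comp HM (sqM nx))].
Qed.

(** Iterates [|a + b|^2 <= 2 |a|^2 + 2 |b|^2]; the growing weights are harmless against geometric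
    decay. *)
Lemma hn_sum_le (K : hilbert R) n (d : nat -> K) :
  hn (\sum_(k < n) d k) ^+ 2 <= \sum_(k < n) 2 ^+ k.+1 * hn (d k) ^+ 2.
Proof.
elim: n d => [|n IH] d; first by rewrite !big_ord0 hn0 expr0n.
rewrite !big_ord_recl /= expr1.
apply: (@le_trans _ _ (2 * hn (d 0%N) ^+ 2 + 2 * hn (\sum_(i < n) d i.+1) ^+ 2)).
  rewrite hnD2; have := Re_ip_le (d 0%N) (\sum_(i < n) d i.+1).
  move: (hn _) (hn _) (complex.Re _) => p q r h.
  have := sqr_ge0 (p - q); rewrite sqrrB !expr2 => ?; nra.
rewrite lerD2l; apply: (@le_trans _ _ (2 * \sum_(i < n) 2 ^+ i.+1 * hn (d i.+1) ^+ 2)).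
  by rewrite ler_wpM2l // (IH (fun i => d i.+1)).
by rewrite mulr_sumr; apply: ler_sum => i _; rewrite mulrA -exprS.
Qed.

Let geo_sum n : \sum_(k < n) (2^-1 : R) ^+ k <= 2 - 2 * 2^-1 ^+ n.
Proof.
elim: n => [|n IH]; first by rewrite big_ord0 expr0 mulr1 subrr.
rewrite big_ord_recr /= exprS; move: IH; move: (\sum_(k < n) _) (2^-1 ^+ n) => a b; lra.
Qed.

Let geo_sum2 n : \sum_(k < n) (2^-1 : R) ^+ k <= 2.
Proof. by apply: (le_trans (geo_sum n)); rewrite gerBl mulr_ge0 // exprn_ge0. Qed.

(* If [x_k] tends to [0] fast in the GNS space, then so do the bounded transforms of
   [x_k^* x_k], by faithfulness and normality. *)
Lemma gns_small (x : nat -> op H) : (forall k, N (x k)) ->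
  (forall k, hn (Lam (x k)) ^+ 2 <= 2^-1 ^+ k) ->
  forall v, (fun k => qf (id - res (adj (x k) \o x k)) v) @ \oo --> (0 : R).
Proof.
move=> nx hx; pose B k := adj (x k) \o x k.
have pB k : pos M (B k) by exact: (vn_adj_comp HM (sqM (nx k))).
(* [F m] is built from the tail of index at least [m], hence its weight is at most [2^(1 - m)]. *)
have hm m : exists F, [/\ pos M F, (phi F <= (2 * 2^-1 ^+ m)%:E)%E,
    forall v, cv (fun n => (id - res (\sum_(k < n) B (m + k)%N)) v) (F v) &
    forall n v, qf (id - res (\sum_(k < n) B (m + k)%N)) v <= qf F v].
  apply: (@weight_sup (fun k => B (m + k)%N)) => // n.
  rewrite (weight_sum n (A := fun k => B (m + k)%N)) //.
  have -> : (\sum_(k < n) phi (B (m + k)%N))%E = (\sum_(k < n) hn (Lam (x (m + k)%N)) ^+ 2)%:E.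
    by rewrite -sumEFin; apply: eq_bigr => k _; rewrite gns_phi.
  rewrite lee_fin; apply: (@le_trans _ _ (\sum_(k < n) 2^-1 ^+ m * 2^-1 ^+ k)).
    by apply: ler_sum => k _; rewrite -exprD hx.
  by rewrite -mulr_sumr mulrC ler_wpM2r // exprn_ge0.
have [F hF] := choice hm.
have pF m : pos M (F m) by case: (hF m).
have bF m : bounded_op (F m) by exact: posM_bop.
have pBs m n : pos M (\sum_(k < n) B (m + k)%N) by exact: (posM_sum n (A := fun k => B (m + k)%N)).
have F_dec1 m v : qf (F m.+1) v <= qf (F m) v.
  have [_ _ c1 _] := hF m.+1; have [_ _ _ l0] := hF m.
  apply: (ler_cvg_to (cv_ip_re (c1 v) (cv_cst v)) (cvg_cst (qf (F m) v))); apply: nearW => n.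
  apply: le_trans (l0 n.+1 v).
  apply: res_mono; [exact: posM_bop (pBs m.+1 n)|by case: (pBs m.+1 n)|exact: posM_bop (pBs m n.+1)|by case: (pBs m n.+1)|].
  move=> y; rewrite (qf_sum (fun k => B (m.+1 + k)%N)) (qf_sum (fun k => B (m + k)%N)).
  rewrite big_ord_recl /= addn0.
  rewrite (eq_bigr (fun k : 'I_n => qf (B (m + k.+1)%N) y)); last first.
    by move=> k _; rewrite addSnnS.
  by rewrite lerDr pos_qf //; case: (pB m).
have F_dec m n v : (m <= n)%N -> qf (F n) v <= qf (F m) v.
  by move=> /subnK <-; elim: (n - m)%N => [|j IH] //; apply: le_trans IH; exact: F_dec1.
have F_le1 m v : qf (F m) v <= hn v ^+ 2.
  have [_ _ c _] := hF m.
  apply: (ler_cvg_to (cv_ip_re (c v) (cv_cst v)) (cvg_cst (hn v ^+ 2))); apply: nearW => n.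
  by apply: res_compl_le1; [exact: posM_bop|case: (pBs m n)].
have adjF m : adj (id - F m) = id - F m.
  by rewrite adj_B //; [rewrite adj_id posM_adj|exact: bop_id].
have pIF m : positive_op (id - F m).
  apply: positiveP => //; first by apply: bop_B => //; exact: bop_id.
  by move=> v; rewrite qfB qf_id subr_ge0.
have [b [bb pb cb _]] : exists b, [/\ bounded_op b, positive_op b,
    (forall v, cv (fun m => (id - F m) v) (b v)) & forall m v, qf (id - F m) v <= qf b v].
  apply: (@vigier _ _ (fun m => id - F m) 1) => //.
  - by move=> m; apply: bop_B => //; exact: bop_id.
  - by move=> m n v mn; rewrite !qfB !qf_id lerD2l lerN2 F_dec.
  - by move=> m v; rewrite qfB qf_id mul1r gerBl pos_qf //; case: (pF m).
have cF v : cv (fun m => F m v) ((id - b) v).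
  have := cvB (cv_cst v) (cb v); congr (cv _ _); apply/funext => m.
  by rewrite -[(id - F m) v]/(v - F m v) subKr.
have cq v : (fun m => qf (F m) v) @ \oo --> qf (id - b) v by exact: cv_ip_re (cF v) (cv_cst v).
have G_le m v : qf (id - b) v <= qf (F m) v.
  apply: (ler_cvg_to (cq v) (cvg_cst (qf (F m) v))).
  by exists m => // n /= mn; exact: F_dec.
have bG : bounded_op (id - b) by apply: bop_B => //; exact: bop_id.
have pG : pos M (id - b).
  split; first by apply: (vn_strong HM (a := F)) => // m; case: (pF m).
  apply: positiveP => //; first by rewrite adj_B //; [rewrite adj_id (pos_selfadj bb pb)|exact: bop_id].
  move=> v; apply: (ler_cvg_to (cvg_cst (0 : R)) (cq v)); apply: nearW => m.
  by rewrite pos_qf //; case: (pF m).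
(* The decreasing limit of the [F m] has weight 0, so faithfulness applies. *)
have G0 : id - b = 0.
  apply: (weight_faithful Hphi pG); apply/eqP; rewrite eq_le (weight_ge0 Hphi) // andbT.
  apply/lee_addgt0Pr => e e0; rewrite add0e.
  have /rcvg0P/(_ _ e0)[m /(_ m (leqnn m)) hme] : (fun m => 2 * (2^-1 : R) ^+ m) @ \oo --> (0 : R).
    rewrite -[X in _ --> X](mulr0 (2 : R)); apply: cvgMr; apply: cvg_expr.
    by rewrite ger0_norm // invf_lt1 // ltr1n.
  have [_ h _ _] := hF m; apply: (le_trans (weight_mono pG (pF m) (G_le m))).
  apply: (le_trans h); rewrite lee_fin; apply: ltW; apply: le_lt_trans hme; exact: ler_norm.
(* [B m] is the first term of its tail, so its transform lies below [F m]. *)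
move=> v; apply: (@rcvg_squeeze _ _ (fun m => qf (F m) v)); last first.
  by have := cq v; rewrite G0 /qf ip0l.
move=> m; rewrite subr0 ger0_norm; last first.
  by apply: pos_qf; apply: res_compl_pos; [exact: (posM_bop (pB m))|case: (pB m)].
have [_ _ _ /(_ 1%N v)] := hF m; by rewrite big_ord_recl big_ord0 addr0 addn0.
Qed.

(* The analogue for N_phi /\ N_phi^* of the maximality of full left Hilbert algebras. *)
Lemma weight_fullness (u : op H) (w : nat -> op H) (v : H) : M u -> N (adj u) ->
  (forall n, N (w n) /\ N (adj (w n))) -> cv (fun n => Lam (w n)) v ->
  cv (fun n => Lam (adj (w n))) (Lam (adj u)) -> N u.
Proof.
move=> mu_ nu.
(* Passing to a subsequence makes both convergences geometric; the squared rate beats the weights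
   [2^(k+1)] of [hn_sum_le]. *)
suff fast (w' : nat -> op H) : (forall n, N (w' n) /\ N (adj (w' n))) ->
    (forall n, hn (Lam (w' n) - v) <= 4^-1 ^+ n) ->
    (forall n, hn (Lam (adj (w' n)) - Lam (adj u)) <= 4^-1 ^+ n) -> N u.
  move=> nw /cvP c1 /cvP c2.
  have /choice[f hf] : forall n, exists m, hn (Lam (w m) - v) <= 4^-1 ^+ n /\
      hn (Lam (adj (w m)) - Lam (adj u)) <= 4^-1 ^+ n.
    move=> n; have e0 : (0 : R) < 4^-1 ^+ n by rewrite exprn_gt0 // invr_gt0.
    have [N1 h1] := c1 _ e0; have [N2 h2] := c2 _ e0; exists (maxn N1 N2).
    by split; apply: ltW; [apply: h1; exact: leq_maxl|apply: h2; exact: leq_maxr].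
  by apply: (fast (w \o f)) => n; [exact: nw|case: (hf n)|case: (hf n)].
move=> {w} nw hw hw'.
have q0 n : (0 : R) <= 4^-1 ^+ n by rewrite exprn_ge0 // invr_ge0.
have q1 n : (4^-1 : R) ^+ n <= 1 by rewrite exprn_ile1 ?invr_ge0 // invf_le1 // ler1n.
have nw1 n : N (w' n) by case: (nw n).
have mw n : M (w' n) by exact: sqM.
have bu := vn_bop HM mu_; have bw n := vn_bop HM (mw n).
pose t n := adj (w' n) - adj u.
have nt n : N (t n) by apply: sq_B => //; case: (nw n).
have bt n : bounded_op (t n) by exact: sq_bop.
have tsmall n : hn (Lam (t n)) ^+ 2 <= 2^-1 ^+ n.
  rewrite gns_B //; last by case: (nw n).
  apply: (@le_trans _ _ ((4^-1 ^+ n) ^+ 2)); first by apply: lerXn2r; rewrite ?nnegrE ?hn_ge0 ?hw'.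
  apply: (@le_trans _ _ (4^-1 ^+ n)); first by rewrite expr2 ler_piMl.
  by apply: lerXn2r; rewrite ?nnegrE ?invr_ge0 // lef_pV2 ?posrE // ler_nat.
have tl := gns_small nt tsmall.
pose d n : op H := if n is m.+1 then w' m.+1 - w' m else w' 0%N.
have nd n : N (d n) by case: n => [|n] //=; exact: sq_B.
have bd n : bounded_op (d n) by exact: sq_bop.
have wE n x : w' n x = \sum_(k < n.+1) d k x.
  elim: n => [|n IH]; first by rewrite big_ord_recl big_ord0 addr0.
  by rewrite big_ord_recr /= -IH -[(w' n.+1 - w' n) x]/(w' n.+1 x - w' n x) addrC subrK.
(* By [hn_sum_le] the partial sums [S n] of these operators dominate the squares of the [w' n],
   while their weights stay bounded. *)
pose A k : op H := (2 ^+ k.+1)%:C%C *: (adj (d k) \o d k).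
have k2 k : (0 : R) <= 2 ^+ k by exact: exprn_ge0.
have pA k : pos M (A k) by apply: posM_Z => //; exact: (vn_adj_comp HM (sqM (nd k))).
have phiA k : phi (A k) = (2 ^+ k.+1 * hn (Lam (d k)) ^+ 2)%:E.
  by rewrite /A (weightZ Hphi (k2 _) (vn_adj_comp HM (sqM (nd k)))) gns_phi // -EFinM.
have dle k : 2 ^+ k.+2 * hn (Lam (d k.+1)) ^+ 2 <= 16 * 2^-1 ^+ k.
  have h1 : hn (Lam (d k.+1)) <= 2 * 4^-1 ^+ k.
    rewrite /= gns_B //; apply: (le_trans (hn_triangle _ v _)); rewrite [hn (v - _)]hnBC mulrDl !mul1r.
    apply: lerD => //; apply: (le_trans (hw _)); rewrite exprS ler_piMl //.
    by rewrite invf_le1 // ler1n.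
  apply: (@le_trans _ _ (2 ^+ k.+2 * (2 * 4^-1 ^+ k) ^+ 2)).
    by rewrite ler_wpM2l //; apply: lerXn2r; rewrite ?nnegrE ?hn_ge0 ?mulr_ge0.
  have e4 : (4^-1 : R) ^+ k = (2^-1 ^+ k) ^+ 2.
    by rewrite -exprM mulnC exprM; congr (_ ^+ k); rewrite expr2; field.
  have e2 : (2 : R) ^+ k * 2^-1 ^+ k = 1 by rewrite -exprMn mulfV ?expr1n.
  have i0 : (0 : R) <= 2^-1 ^+ k by rewrite exprn_ge0.
  have i1 : (2^-1 : R) ^+ k <= 1 by rewrite exprn_ile1 // invf_le1 // ler1n.
  rewrite e4 !exprS; move: e2 i0 i1; move: (2 ^+ k : R) (2^-1 ^+ k : R) => p q e2 i0 i1.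
  have -> : 2 * (2 * p) * (2 * (q * (q * q ^+ 0)) * (2 * (q * (q * q ^+ 0)) * (2 * (q * (q * q ^+ 0))) ^+ 0)) =
    16 * (p * q) * (q * q * q) by rewrite !expr0; ring.
  rewrite e2 mulr1 ler_wpM2l //; have : q * q <= 1 by nra.
  nra.
pose C := 2 * hn (Lam (d 0%N)) ^+ 2 + 32.
have hC n : (phi (\sum_(k < n) A k)%R <= C%:E)%E.
  rewrite weight_sum //; rewrite (eq_bigr (fun k : 'I_n => (2 ^+ k.+1 * hn (Lam (d k)) ^+ 2)%:E)); last first.
    by move=> k _; rewrite phiA.
  rewrite sumEFin lee_fin; case: n => [|n].
    by rewrite big_ord0 addr_ge0 // mulr_ge0 // exprn_ge0 // hn_ge0.
  rewrite big_ord_recl /= expr1 lerD2l.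
  apply: (@le_trans _ _ (\sum_(k < n) 16 * 2^-1 ^+ k)); first by apply: ler_sum => k _; exact: dle.
  by rewrite -mulr_sumr; have := geo_sum2 n; move: (\sum_(k < n) _) => s; lra.
have [F [pF phiF cF leF]] := weight_sup pA hC.
pose S n := \sum_(k < n.+1) A k.
have pS n : pos M (S n) by exact: posM_sum.
have bS n : bounded_op (S n) by exact: posM_bop.
have poS n : positive_op (S n) by case: (pS n).
have wS n x : hn (w' n x) ^+ 2 <= qf (S n) x.
  rewrite wE; apply: (le_trans (hn_sum_le _ (fun k => d k x))).
  rewrite qf_sum; apply: ler_sum => k _; by rewrite qfZ qf_adj_comp.
have [k k0 hk] := bop_bdd bu.
(* This bounds [u^* u] by a multiple of [F], of finite weight. The [w' n] are not known to converge
   strongly, so the vectors are regularized: [yn] by the resolvent of [S n], [zn] by that of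
   [t^* t]. *)
have key x : hn (u x) ^+ 2 <= (2 + 2 * k ^+ 2) * qf F x.
  pose y := x - F x; pose yn n := res (S n) x.
  have cy : cv yn y.
    have c1 := cv_subseq (f := succn) (fun n => leqnSn n) (cF x).
    have := cvB (cv_cst x) c1; congr (cv _ _); apply/funext => n.
    by rewrite -[(id - _) x]/(x - _) subKr.
  pose z := u y; pose zn n := res (adj (t n) \o t n) z.
  have pt n : positive_op (adj (t n) \o t n) by exact: pos_adj_comp.
  have btt n : bounded_op (adj (t n) \o t n) by apply: bop_comp => //; exact: bop_adj.
  have zE n : qf (id - res (adj (t n) \o t n)) z = hn (z - zn n) ^+ 2 + hn (t n (zn n)) ^+ 2.
    by rewrite res_minE // qf_adj_comp.
  have sq0 (f g : nat -> R) : (forall n, 0 <= f n) -> (forall n, f n ^+ 2 <= g n) ->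
      g @ \oo --> (0 : R) -> f @ \oo --> (0 : R).
    move=> f0 fg /rcvg0P hg; apply/rcvg0P => e e0.
    have [N0 hN] := hg (e ^+ 2) (exprn_gt0 2 e0); exists N0 => n /hN h.
    rewrite ger0_norm // -(@ltr_pXn2r _ 2) ?nnegrE ?f0 ?ltW //.
    apply: (le_lt_trans (fg n)); apply: le_lt_trans h; exact: ler_norm.
  have cz : cv zn z.
    rewrite /cv; under eq_fun do rewrite hnBC.
    apply: sq0 (tl z) => n; first exact: hn_ge0.
    by rewrite zE lerDl sqr_ge0.
  have ct : cv (fun n => t n (zn n)) 0.
    rewrite /cv; under eq_fun do rewrite subr0.
    apply: sq0 (tl z) => n; first exact: hn_ge0.
    by rewrite zE lerDr sqr_ge0.
  (* Moving [w' n] to the other side replaces it by [u] up to the error [t n (zn n)], so [r] tends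
     to [|u y|^2]; Cauchy-Schwarz with [|w' n (yn n)|^2 <= D n] bounds the same limit. *)
  pose r n := complex.Re <|w' n (yn n), zn n|>.
  have rE n : r n = complex.Re <|u (yn n), zn n|> + complex.Re <|yn n, t n (zn n)|>.
    rewrite /r -ReD; congr complex.Re; rewrite -[t n _]/(adj (w' n) _ - adj u _) ipBr.
    by rewrite -!adjP // addrC subrK.
  have cr : r @ \oo --> hn z ^+ 2.
    rewrite (_ : r = fun n => complex.Re <|u (yn n), zn n|> + complex.Re <|yn n, t n (zn n)|>); last first.
      by apply/funext.
    rewrite -[X in _ --> X]addr0; apply: cvgD.
      by rewrite hn2E; apply: cv_ip_re => //; exact: bop_cv.
    by rewrite -[X in _ --> X](_ : complex.Re <|y, 0|> = 0); [exact: cv_ip_re|rewrite ip0r].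
  pose D n := qf F x - hn (x - yn n) ^+ 2.
  have Dw j : hn (w' j (yn j)) ^+ 2 <= D j.
    rewrite /D lerBrDl; apply: le_trans (leF j.+1 x); rewrite (res_minE (bS j) (poS j)).
    by rewrite lerD2l; exact: wS.
  have cD : D @ \oo --> qf F x - hn (x - y) ^+ 2.
    apply: cvgB; first exact: cvg_cst.
    have h := cv_hn (cvB (cv_cst x) cy); rewrite expr2; under eq_fun do rewrite expr2.
    exact: cvgM.
  have czz : (fun n => hn (zn n)) @ \oo --> hn z by exact: cv_hn.
  have lim1 : hn z ^+ 2 * hn z ^+ 2 <= (qf F x - hn (x - y) ^+ 2) * (hn z * hn z).
    apply: (ler_cvg_to (cvgM cr cr) (cvgM cD (cvgM czz czz))); apply: nearW => n.
    apply: (@le_trans _ _ ((hn (w' n (yn n)) * hn (zn n)) ^+ 2)).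
      rewrite [X in X <= _](_ : _ = r n ^+ 2); last by rewrite expr2.
      rewrite -[r n ^+ 2]real_normK ?num_real //; apply: lerXn2r; rewrite ?nnegrE ?mulr_ge0 ?hn_ge0 //.
      by apply: le_trans (ip_CS _ _); exact: Re_le_cn.
    rewrite exprMn [X in _ <= X](_ : _ = D n * hn (zn n) ^+ 2); last by rewrite expr2.
    by rewrite ler_wpM2r // exprn_ge0 // hn_ge0.
  have D0 : 0 <= qf F x - hn (x - y) ^+ 2.
    apply: (ler_cvg_to (cvg_cst (0 : R)) cD); apply: nearW => n.
    by apply: le_trans (Dw n); rewrite sqr_ge0.
  have lim2 : hn z ^+ 2 <= qf F x - hn (x - y) ^+ 2.
    have [z0|z0] := eqVneq (hn z) 0; first by rewrite z0 expr0n.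
    have zp : 0 < hn z ^+ 2 by rewrite exprn_gt0 // lt_def z0 hn_ge0.
    by rewrite -(ler_pM2r zp); apply: (le_trans lim1); rewrite expr2.
  have ux : hn (u x) <= k * hn (x - y) + hn z.
    rewrite -{1}[x](subrK y) (lin_D (bop_lin bu)); apply: (le_trans (hnD _ _)).
    by rewrite lerD2r.
  apply: (@le_trans _ _ ((k * hn (x - y) + hn z) ^+ 2)).
    by apply: lerXn2r; rewrite ?nnegrE ?addr_ge0 ?mulr_ge0 ?hn_ge0.
  have h1 := sqr_ge0 (k * hn (x - y) - hn z).
  have h2 := mulr_ge0 (sqr_ge0 k) (sqr_ge0 (hn z)).
  have h3 := sqr_ge0 (hn (x - y)).
  have h4 : k ^+ 2 * (hn (x - y) ^+ 2 + hn z ^+ 2) <= k ^+ 2 * qf F x.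
    by rewrite ler_wpM2l ?sqr_ge0 // -lerBrDl.
  move: h1 h2 h3 h4 lim2; rewrite !expr2; move: (hn (x - y)) (hn z) (qf F x) => a b f h1 h2 h3 h4 lim2.
  nra.
split=> //.
have c0 : (0 : R) <= 2 + 2 * k ^+ 2 by rewrite addr_ge0 // mulr_ge0 // exprn_ge0.
apply: (@le_lt_trans _ _ (phi ((2 + 2 * k ^+ 2)%:C%C *: F))).
  apply: weight_mono; [exact: (vn_adj_comp HM)|exact: posM_Z|].
  by move=> x; rewrite qfZ qf_adj_comp.
rewrite (weightZ Hphi c0 pF); apply: lte_mul_pinfty => //.
by apply: le_lt_trans phiF _; rewrite ltry.
Qed.

End WeightTheory.

(** * The operator T' *)

Section ModularElement.
Variables (R : realType) (G : lcqg R).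
Local Notation H := (L2 G).
Local Notation M := (@Linf R G).
Local Notation T := (measurableTypeR R).
Local Notation phi := (@haarl R G).
Local Notation psi := (@haarr R G).
Implicit Types (x y z : H).

Lemma left_tomita_sym x y : closure (@left_tomita R G) (x, y) -> closure (@left_tomita R G) (y, x).
Proof.
move=> /closure2_cv [u [v [h cu cv']]]; apply: (cv_closure2 _ cv' cu) => n.
have [a [Na Naa [-> ->]]] := h n; exists (adj a); split => //.
all: by rewrite (adjK (vn_bop (Linf_vN G) (proj1 Na))).
Qed.

Variables (delta : H ~> H) (Lpsi : op H -> H).
Hypothesis deltaP : modular_element delta Lpsi.

(** Applied to 0, the core property yields a pair of [times_sqrt]. Its graph is not empty, so
    neither is that of the square root of [delta], which excludes the default of [rpow]. *)
Lemma modular_element_exp : exists F, delta = Fop F (ex 1).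
Proof.
have N0 : sq_int M psi 0 by apply: sq_0; [exact: (Linf_vN G)|exact: haarr_nsf].
have ss0 : sq_summable (fun=> 0 : H).
  by exists 0 => n; rewrite big1 // => k _; rewrite normr0 expr0n.
have [x' [y' [[Mx [My _] cl] _ _]]] := modelt_core deltaP N0 ss0 ltr01.
have : closure (ocomp (gr x') (rpow delta 2^-1)) (0, y' 0) by rewrite cl.
move=> /closure2E /(_ 1 ltr01) [a [b [[c [h _]] _ _]]].
exact: strictly_positive_exp (modelt_pos deltaP) h.
Qed.

Variable F : spectral_measure H.
Hypothesis hF : delta = Fop F (ex 1).

Lemma Phi_modular_element g : bm g -> M (Phi F g).
Proof.
move=> bg; apply: (vn_unitary (Linf_vN G)); first exact: Phi_bop.
move=> u Mu uu.
have [bu u1 u2] := uu.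
have su : semiunitary false u (adj u).
  split => [c x y|x|x|x]; first exact: (bop_lin bu).
  - have : hn (u x) ^+ 2 = hn x ^+ 2.
      by rewrite !hn2E (adjP _ _ bu) -[adj u (u x)]/((adj u \o u) x) u2.
    by move/eqP; rewrite eqrXn2 ?hn_ge0 // => /eqP.
  - by rewrite -[RHS]/(id x) -u2.
  - by rewrite -[RHS]/(id x) -u1.
have s : same F (transport su F).
  apply: same_push_exp => -[x y] h; apply/(Fop_tr su F x y (@mC_ex R 1)).
  have := modelt_aff deltaP Mu uu; rewrite hF => /(_ _ _ h).
  by have -> : (fun s : R => cif false (ex 1 s)) = ex 1 by [].
have e := same_Phi s bg.
rewrite [in LHS]e (Phi_tr su F bg) -[cif false]/(id) .
apply/funext => x /=.
by rewrite (suK' su).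
Qed.

End ModularElement.

Section Cutoff.
Variables (R : realType) (H : hilbert R) (M : set (op H)).
Variables (phi : op H -> \bar R) (Lam : op H -> H).
Hypotheses (HM : von_neumann M) (Hphi : nsf_weight M phi) (Hgns : gns M phi Lam).

(** The intertwining relation [y^* (1 + r y y^* ) = (1 + r y^* y) y^*], inverted on both sides. *)
Lemma res_adj_comp (y : op H) (r : R) v : bounded_op y -> 0 <= r ->
  res (r%:C%C *: (adj y \o y)) (adj y v) = adj y (res (r%:C%C *: (y \o adj y)) v).
Proof.
move=> hy r0; have hy' := bop_adj hy.
have b1 : bounded_op (r%:C%C *: (adj y \o y)) by apply: bop_Z; exact: bop_comp.
have b2 : bounded_op (r%:C%C *: (y \o adj y)) by apply: bop_Z; exact: bop_comp.
have p1 : positive_op (r%:C%C *: (adj y \o y)) by apply: pos_Z => //; exact: pos_adj_comp.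
have p2 : positive_op (r%:C%C *: (y \o adj y)).
  by apply: pos_Z => //; rewrite -{1}(adjK hy); exact: pos_adj_comp.
set w := res _ v.
have e : w + r%:C%C *: y (adj y w) = v by exact: (resD b2 p2 v).
rewrite -e (lin_D (bop_lin hy')) (lin_Z (bop_lin hy')).
exact: (resDr b1 p1).
Qed.

(** The resolvents tend strongly to some [p] of the algebra with [y p = 0], hence [p y^* = 0];
    acting on the left, they send the vector to that of [p y^*]. *)
Lemma gns_cutoff (y : op H) : M y -> sq_int M phi (adj y) ->
  cv (fun n => res (n%:R%:C%C *: (adj y \o y)) (Lam (adj y))) 0.
Proof.
move=> My Ny; have hy := vn_bop HM My; have hy' := bop_adj hy.
have b1 : bounded_op (adj y \o y) by exact: bop_comp.
have p1 : positive_op (adj y \o y) by exact: pos_adj_comp.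
have [p [bp sp cp p0]] := res_limit b1 p1.
have Mp : M p.
  apply: (vn_strong HM _ bp cp) => n; apply: (vn_res HM).
    by apply: (vn_Z HM); apply: (vn_comp HM) => //; exact: (vn_adj HM).
  by apply: pos_Z.
have yp v : y (p v) = 0.
  apply: hn0_eq0; apply/eqP; rewrite -sqrf_eq0 hn2E (adjP _ _ hy).
  by rewrite [adj y _]p0 ip0r.
have e : p \o adj y = 0.
  apply/funext => v; apply: ip_inj => z /=.
  by rewrite sp (adjP' _ _ hy) yp ip0r ip0l.
by rewrite -[X in cv _ X](gns_0 HM Hphi Hgns) -e (gns_mul Hgns Mp Ny); exact: cp.
Qed.

End Cutoff.

(** * The closed map T' as the closure of e^Y e^X J *)

Section ModularProduct.
Variables (R : realType) (G : lcqg R).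
Local Notation H := (L2 G).
Local Notation M := (@Linf R G).
Local Notation phi := (@haarl R G).
Local Notation psi := (@haarr R G).
Local Notation Lphi := (@Lphi R G).
Local Notation S := (closure (@left_tomita R G)).
Variables (delta : H ~> H) (Lpsi : op H -> H) (J : op H).
Variables (X Y : spectral_measure H) (r : R).
Hypothesis deltaP : modular_element delta Lpsi.
Hypothesis XY : ccr X Y r.
Hypothesis hJ : semiunitary true J J.
Hypothesis dY : rpow delta 2^-1 = Fop Y (ex (- 1)).
Hypothesis MY : forall g, bm g -> M (Phi Y g).
Hypothesis SX : forall x z, S (x, z) <-> Fop X (ex 1) (J x, z).
Local Notation Q1 := (ocomp (Fop Y (ex 1)) (Fop X (ex 1))).
Local Notation T' := (closure (pre_T' Lpsi)).
Local Notation Nphi := (sq_int M phi).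
Local Notation Npsi := (sq_int M psi).
Let HM := Linf_vN G.
Let Hphi := haarl_nsf G.
Let Hpsi := haarr_nsf G.
Let Lphig := Lphi_gns G.

(** Here delta^(1/2) = e^(-Y). As [y] extends x e^(-Y), adjoints give y^* = e^(-Y) x^*, that is x^*
    = e^Y y^*. *)
Let sqrt_adj (x y : op H) v : times_sqrt delta x y -> Fop Y (ex 1) (adj y v, adj x v).
Proof.
move=> [Mx [My _] cl]; apply/ex_inv.
have [_ <-] := ex_selfadjoint Y (- 1); rewrite /adjoint /= => w z wz.
have hx := vn_bop HM Mx; have hy := vn_bop HM My.
have : closure (ocomp (gr x) (rpow delta 2^-1)) (w, x z).
  by apply: subset_closure; exists z; rewrite dY; split.
by rewrite cl /gr /= -(adjP _ _ hx) -(adjP _ _ hy) => ->.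
Qed.

(** [b y] and its adjoint [y^* b] are both in N_phi, so the Tomita map sends [b (Lphi y)] to
    [y^* (Lphi b)]; then e^Y applies by [sqrt_adj]. *)
Let core_Q1 (x y b : op H) : times_sqrt delta x y -> Nphi b -> adj b = b ->
  Q1 (J (b (Lphi y)), adj x (Lphi b)).
Proof.
move=> xy Nb sb; have [_ Ny _] := xy; have [My _] := Ny; have [Mb _] := Nb.
have e : adj (b \o y) = adj y \o b.
  by rewrite (adj_comp (vn_bop HM Mb) (vn_bop HM My)) sb.
exists (adj y (Lphi b)); split; last exact: sqrt_adj.
apply/SX; apply: subset_closure; exists (b \o y); split.
- exact: (sq_ideal HM Hphi).
- by rewrite e; apply: (sq_ideal HM Hphi) => //; exact: (vn_adj HM).
- by rewrite e (gns_mul Lphig Mb Ny) (gns_mul Lphig (vn_adj HM My) Nb).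
Qed.

Let psi_Q1 (x b : op H) : Npsi x -> Nphi b -> adj b = b ->
  closure Q1 (J (b (Lpsi x)), adj x (Lphi b)).
Proof.
move=> Nx Nb sb; have [Mb _] := Nb; have hb := vn_bop HM Mb.
have hx := vn_bop HM (proj1 Nx).
(* Only one vector has to be controlled, so the sequence defining the seminorm has a single nonzero
   term. *)
pose v := Lphi b; pose xi (k : nat) : H := if k == 0%N then v else 0.
have ss : sq_summable xi.
  exists (`|v| ^+ 2); case=> [|n]; first by rewrite big_ord0 exprn_ge0.
  by rewrite big_ord_recl big1 ?addr0 // => k _; rewrite normr0 expr0n.
have [c c0 bc] := bop_bdd hb.
apply/closure2E => e e0.
pose d := Num.min (e / (c + 1) / 2) (e / 2).
have d0 : 0 < d by rewrite lt_min !divr_gt0 //; apply: ltr_wpDl.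
(* The seminorm bounds squares and the GNS distance does not, hence the minimum of [d] and [d^2]. *)
have dd0 : 0 < (Num.min d (d ^+ 2))%:C%C :> R[i].
  by rewrite ltcR lt_min d0 exprn_gt0.
have [x' [y' [t sn nn]]] := modelt_core deltaP Nx ss dd0.
have [Mx' _ _] := t; have hx' := vn_bop HM Mx'.
have [Nx' Lx'] := modelt_sqrt deltaP t.
exists (J (b (Lphi y'))), (adj x' v); split; first exact: core_Q1.
- rewrite -(suB hJ) (su_hn hJ) -(lin_B (bop_lin hb)) -Lx'.
  apply: le_lt_trans (bc _) _.
  have n1 : hn (Lpsi x' - Lpsi x) <= d.
    by move: nn; rewrite hnE lecR le_min => /andP[].
  apply: (@le_lt_trans _ _ (c * (e / (c + 1) / 2))).
    by rewrite ler_wpM2l // (le_trans n1) // ge_min lexx.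
  have c1 : 0 < c + 1 by apply: ltr_wpDl.
  rewrite mulrA ltr_pdivrMr // mulrA ltr_pdivrMr // mulrAC [_ * 2]mulrC.
  nra.
- have := sn 1%N; rewrite big_ord1 /= => h.
  have h2 : hn (adj (x' - x) v) ^+ 2 <= d ^+ 2.
    rewrite -lecR; apply: le_trans (_ : _ <= (Num.min d (d ^+ 2))%:C%C) _; last first.
      by rewrite lecR ge_min lexx orbT.
    apply: le_trans h; rewrite (hnE (adj _ _)) -rmorphXn /= lerDr.
    by rewrite exprn_ge0.
  rewrite (_ : adj x' v - adj x v = adj (x' - x) v); last by rewrite (adj_B hx' hx).
  apply: (@le_lt_trans _ _ d).
    by rewrite -(@ler_pXn2r _ 2) ?nnegrE ?hn_ge0 // ltW.
  apply: (@le_lt_trans _ _ (e / 2)); first by rewrite ge_min lexx orbT.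
  by rewrite ltr_pdivrMr //; nra.
Qed.

Lemma pre_T'_sub x z : pre_T' Lpsi (x, z) -> closure Q1 (J x, z).
Proof.
move=> [y [Ny Ny' [-> ->]]].
have [My _] := Ny; have hy := vn_bop HM My; have My' := vn_adj HM My.
have Nyy : Npsi (adj (adj y)) by rewrite (adjK hy).
pose A n : op H := n%:R%:C%C *: (y \o adj y).
have bA n : bounded_op (A n) by apply: bop_Z; apply: bop_comp => //; exact: bop_adj.
have pA n : positive_op (A n).
  by apply: pos_Z => //; rewrite -{1}(adjK hy); apply: pos_adj_comp; exact: bop_adj.
have MA n : M (A n) by apply: (vn_Z HM); exact: (vn_comp HM).
pose b n : op H := id - res (A n).
(* Written as n (1 + n y y^* )^-1 y y^*, the operator ends with [y^*] and so lies in the left ideal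
   N_phi. *)
have bE n : b n = (res (A n) \o (n%:R%:C%C *: y)) \o adj y.
  apply/funext => v; rewrite -[b n v]/(v - res (A n) v) -{1}(resDr (bA n) (pA n) v).
  by rewrite (lin_D (bop_lin (res_bop (bA n) (pA n)))) addrAC subrr add0r.
have Nb n : Nphi (b n).
  rewrite bE; apply: (sq_ideal HM Hphi) => //; apply: (vn_comp HM).
    exact: (vn_res HM).
  exact: (vn_Z HM).
apply: (closure_closed2 (u := fun n => J (b n (Lpsi y))) (v := fun n => adj y (Lphi (b n)))).
- by move=> n; apply: psi_Q1 => //; apply: res_compl_adj.
- apply: (su_cv hJ); rewrite -[X in cv _ X]subr0; apply: cvB; first exact: cv_cst.
  have := gns_cutoff HM Hpsi (modelt_gns deltaP) My' Nyy; rewrite (adjK hy); exact.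
- rewrite -[X in cv _ X]subr0.
  have e n : adj y (Lphi (b n)) =
      Lphi (adj y) - res (n%:R%:C%C *: (adj y \o y)) (Lphi (adj y)).
    have Mr : M (res (n%:R%:C%C *: (adj y \o y))).
      apply: (vn_res HM); first by apply: (vn_Z HM); exact: (vn_comp HM).
      by apply: pos_Z => //; exact: pos_adj_comp.
    rewrite -(gns_mul Lphig My' (Nb n)) -(gns_mul Lphig Mr Ny').
    rewrite -(gns_B Lphig Ny' (sq_ideal HM Hphi Mr Ny')); congr Lphi.
    apply/funext => v /=; rewrite -[b n v]/(v - res (A n) v).
    rewrite (lin_B (bop_lin (vn_bop HM My'))).
    by rewrite -[RHS]/(adj y v - res (n%:R%:C%C *: (adj y \o y)) (adj y v)) res_adj_comp.
  rewrite (funext e); apply: cvB; first exact: cv_cst.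
  exact: (gns_cutoff HM Hphi Lphig).
Qed.

Let S_fun x x' z : S (x, z) -> S (x', z) -> x = x'.
Proof.
move=> /SX/ex_inv h /SX/ex_inv h'.
by rewrite -(suK hJ x) -(suK hJ x') (Op_fun (@mC_ex R _) h h').
Qed.

(* With [a = Phi Y h^*], fullness puts [w a] in [N_phi], and [w a = x delta^(1/2)] for
   [x = w Phi Y (h e^l)^*]; so [x] is in [N_psi], and [x^*] is in [N_phi]. *)
Let T'_gpair g h (w : op H) : gpair X Y g h -> bm (fun l => h l * ex 1 l) ->
  Nphi w -> Nphi (adj w) ->
  T' (J (Phi Y g (J (Lphi w))), Phi Y (fun l => h l * ex 1 l) (Lphi (adj w))).
Proof.
move=> [bg bh gh] bh1 Nw Nw'; have [Mw _] := Nw; have hw := vn_bop HM Mw.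
have Mw' := vn_adj HM Mw.
set v := J _; pose a := Phi Y (fun l => (h l)^*).
have bhc : bm (fun l => (h l)^*) by exact: bm_conj.
pose u := w \o a.
have Mu : M u by apply: (vn_comp HM) => //; exact: MY.
have aE : adj a = Phi Y h.
  rewrite /a (Phi_conj Y bhc); congr Phi; apply/funext => l; exact: conjCK.
have uE : adj u = Phi Y h \o adj w by rewrite (adj_comp hw (Phi_bop Y bhc)) aE.
have Nu' : Nphi (adj u) by rewrite uE; apply: (sq_ideal HM Hphi) => //; exact: MY.
have LuE : Lphi (adj u) = Phi Y h (Lphi (adj w)).
  by rewrite uE (gns_mul Lphig (MY bh) Nw').
have Sv : S (v, Lphi (adj u)).
  apply/SX; rewrite (suK hJ) LuE; apply: gh; apply/SX.
  by apply: subset_closure; exists w.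
(* The vector [v] is only known to pair with [Lphi (adj u)] in the closed Tomita graph. Fullness
   puts [u] in N_phi, and injectivity of the closed map then identifies its vector with [v]. *)
have Nu : Nphi u.
  have [a_ [b_ [hab ca cb]]] := closure2_cv Sv.
  have /choice[w_ hw_] : forall n, exists w' : op H, [/\ Nphi w', Nphi (adj w') &
    (a_ n, b_ n) = (Lphi w', Lphi (adj w'))] by move=> n; exact: hab.
  apply: (@weight_fullness _ _ _ _ HM Hphi _ Lphig u w_ v) => //.
  - by move=> n; have [] := hw_ n.
  - by have -> : (fun n => Lphi (w_ n)) = a_
      by apply/funext => n; have [_ _ [-> _]] := hw_ n.
  - by have -> : (fun n => Lphi (adj (w_ n))) = b_
      by apply/funext => n; have [_ _ [_ ->]] := hw_ n.
have vE : Lphi u = v by apply: S_fun Sv; apply: subset_closure; exists u.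
pose k l : R[i] := (h l * ex 1 l)^*.
have bk : bm k by exact: bm_conj.
pose x := w \o Phi Y k.
have Mx : M x by apply: (vn_comp HM) => //; exact: MY.
have xE : adj x = Phi Y (fun l => h l * ex 1 l) \o adj w.
  rewrite (adj_comp hw (Phi_bop Y bk)) (Phi_conj Y bk); congr (Phi _ _ \o _).
  by apply/funext => l; exact: conjCK.
have ku : (fun l => k l * ex (- 1) l) = fun l => (h l)^*.
  apply/funext => l; rewrite /k conjM (_ : (ex 1 l)^* = ex 1 l :> R[i]); last exact: conj_realC.
  by rewrite -mulrA [ex 1 l * _]mulrC exN mulr1.
have bku : bm (fun l => k l * ex (- 1) l) by rewrite ku.
(* [k * ex (- 1)] is the conjugate of [h], so x delta^(1/2) agrees with the bounded [u] on a dense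
   domain. *)
have t : times_sqrt delta x u.
  split => //; apply/seteqP; split => [[p q] /closure2_cv [p_ [q_ [hpq cp cq]]]|[p q]].
  - rewrite /gr /=; apply: (cv_unique cq).
    have -> : q_ = fun n => u (p_ n).
      apply/funext => n; have [y []] := hpq n; rewrite dY /gr /= => h1 ->.
      by rewrite /x /= (Op_mul (@mC_ex R _) h1 bk bku) ku.
    exact: bop_cv (vn_bop HM Mu) cp.
  - rewrite /gr /= => ->; have := Op_dense Y (@mC_ex R (- 1)) => /seteqP[_ /(_ p I)].
    move=> /closure_cv[p_ hp cp]; apply: (cv_closure2 _ cp (bop_cv (vn_bop HM Mu) cp)) => n.
    have [y hy] := hp n; exists y; split; rewrite ?dY //.
    by rewrite /gr /= /x /= (Op_mul (@mC_ex R _) hy bk bku) ku.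
have [Nx Lx] := modelt_sqrt deltaP t.
apply: subset_closure; exists x; split; first exact: Nx.
- by rewrite xE; apply: (sq_ideal HM Hphi) Nw'; exact: MY.
- by rewrite Lx vE xE (gns_mul Lphig (MY bh1) Nw').
Qed.

Let Q1_sub x z : Q1 (x, z) -> T' (J x, z).
Proof.
move=> [y [/= xy yz]].
have [g [h [gh bh1 cg ch]]] := gauss_approx XY.
have bg n : bm (g n) by have [] := gh n.
have bh n : bm (h n) by have [] := gh n.
have /closure2_cv [a_ [b_ [hab ca cb]]] : S (J x, y) by apply/SX; rewrite (suK hJ).
have eh n : Phi Y (fun l => h n l * ex 1 l) y = Phi Y (h n) z.
  by rewrite (Op_mul (@mC_ex R _) yz (bh n) (bh1 n)).
apply: (closure_closed2 (u := fun n => J (Phi Y (g n) x)) (v := fun n => Phi Y (h n) z)).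
(* The inner limit reaches the pair [(J x, y)] of the closed Tomita map from its core; the outer one
   lets the Gaussians tend to 1. *)
- move=> n; rewrite -eh; apply: (closure_closed2
    (u := fun m => J (Phi Y (g n) (J (a_ m))))
    (v := fun m => Phi Y (fun l => h n l * ex 1 l) (b_ m))).
  + by move=> m; have [w [Nw Nw' [-> ->]]] := hab m; exact: T'_gpair.
  + rewrite -[in X in cv _ X](suK hJ x); apply: (su_cv hJ); apply: bop_cv; first exact: Phi_bop.
    exact: (su_cv hJ).
  + by apply: bop_cv => //; exact: Phi_bop.
- by apply: (su_cv hJ); exact: cg.
- exact: ch.
Qed.

Lemma T'_closure x z : T' (x, z) <-> closure Q1 (J x, z).
Proof.
split=> [/closure2_cv [a [b [hab ca cb]]]|/closure2_cv [a [b [hab ca cb]]]].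
- apply: (closure_closed2 _ (su_cv hJ ca) cb) => n; exact: pre_T'_sub.
- rewrite -(suK hJ x); apply: (closure_closed2 _ (su_cv hJ ca) cb) => n; exact: Q1_sub.
Qed.

End ModularProduct.

(** * Halved negative logarithms and the polar decomposition *)

Section HalfPush.
Variables (R : realType) (H : hilbert R).
Local Notation T := (measurableTypeR R).
Implicit Types (E : spectral_measure H).

Lemma measurable_Nhalf : measurable_fun [set: T] (fun s : T => - (s / 2) : R).
Proof. by apply: continuous_measurable_fun => s; apply: cvgN; apply: cvgM; [exact: cvg_id|exact: cvg_cst]. Qed.

Lemma Fop_Nhalf E c : Fop (push E measurable_Nhalf) (ex c) = Fop E (ex (- (c / 2))).
Proof.
rewrite (Fop_push E measurable_Nhalf (@mC_ex R c)); congr Fop; apply/funext => s.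
by rewrite /ex; congr ((expR _)%:C)%C; ring.
Qed.

Lemma cis_Nhalf E t : Phi (push E measurable_Nhalf) (fun s => cis (t * s)) =
  Phi E (fun s => cis (- (t / 2) * s)).
Proof.
rewrite (Phi_push E measurable_Nhalf (bm_cisM t)); congr Phi; apply/funext => s.
by congr cis; ring.
Qed.

End HalfPush.

Theorem corollary4p7 (R : realType) (G : lcqg R)
    (nu : R) (delta nabla : L2 G ~> L2 G) (J : op (L2 G)) (Lpsi : op (L2 G) -> L2 G)
    (Gsc : lcqg_second_countable G) (GI : lcqg_type_I G)
    (nuP : scaling_constant G nu)
    (deltaP : modular_element delta Lpsi)
    (nablaP : modular_operator_conj nabla J)
    (nabla_delta : forall s t x,
       ipow nabla s (ipow delta t x) = ipowR nu (s * t) *: ipow delta t (ipow nabla s x)) :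
  let T' := closure (pre_T' Lpsi) in
  let Q := ocomp (rpow nabla (- 2^-1)) (rpow delta (- 2^-1)) in
  let P := ocomp (gr J) (ocomp (oscale (ipowR nu 8^-1) (closure Q)) (gr J)) in
  let U := fun x => ipowR nu 8^-1 *: J x in
  [/\ closable (pre_T' Lpsi) /\ closable Q,
      antilinear_polar T' U P,
      antiunitary U,
      strictly_positive P &
      forall t x, ipow P t x =
        ipowR nu (8^-1 * t ^+ 2) *: J (ipow nabla (t / 2) (ipow delta (t / 2) (J x)))].
Proof.
have [nabla_pos auJ polar] := nablaP.
have [E [hE hJ _ JX SE]] := modular_conjugation nabla_pos auJ polar (@left_tomita_sym R G).
have [F hF] := modular_element_exp deltaP.
pose X := push E (@measurable_Nhalf R); pose Y := push F (@measurable_Nhalf R).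
(* The groups of [X] and [Y] are imaginary powers with exponents [- s / 2] and [- t / 2], whence the
   quarter. *)
pose r := ln nu / 4.
have ipow_nabla t : ipow nabla t = Phi E (fun s => cis (t * s)) by rewrite hE ipow_ex.
have ipow_delta t : ipow delta t = Phi F (fun s => cis (t * s)) by rewrite hF ipow_ex.
have XY : ccr X Y r.
  move=> s t x; rewrite !cis_Nhalf -!ipow_nabla -!ipow_delta nabla_delta.
  by congr (_ *: _); rewrite -[LHS]/(cis _) /r; congr cis; field.
have rY : rpow delta 2^-1 = Fop Y (ex (- 1)).
  by rewrite Fop_Nhalf hF rpow_ex; congr (Fop _ (ex _)); field.
have MY g : bm g -> Linf (Phi Y g).
  move=> bg; rewrite (Phi_push _ _ bg); apply: (Phi_modular_element deltaP hF).
  exact: bm_comp bg (@measurable_Nhalf R).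
(* The Tomita map is J nabla^(1/2) = nabla^(-1/2) J, that is e^X J. *)
have SX x z : closure (@left_tomita R G) (x, z) <-> Fop X (ex 1) (J x, z).
  rewrite Fop_Nhalf; apply: iff_trans (SE x z) _; rewrite JX (suK hJ).
  by rewrite div1r; exact: iff_refl.
have T'E := T'_closure deltaP XY hJ rY MY SX.
have [Z [Zcis ZQ2 ZQ1]] := weyl_product XY.
move=> T' Q P U.
have cE : ipowR nu 8^-1 = cis (r / 2) by rewrite -[LHS]/(cis _) /r; congr cis; field.
have QE : Q = ocomp (Fop X (ex 1)) (Fop Y (ex 1)).
  by rewrite /Q hE hF !rpow_ex !Fop_Nhalf !div1r.
have cK (x : L2 G) : cis (r / 2) *: (cis (- (r / 2)) *: x) = x.
  by rewrite scalerA mulrC cisNK scale1r.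
have cK' (x : L2 G) : cis (- (r / 2)) *: (cis (r / 2) *: x) = x.
  by rewrite scalerA cisNK scale1r.
have T'Z x z : T' (x, z) <-> Fop Z (ex 1) (J x, cis (- (r / 2)) *: z).
  apply: iff_trans (T'E x z) _; rewrite ZQ1 /oscale /=; split=> [h|[y h /(congr1 ( *:%R (cis (r / 2))))]].
    by exists z.
  by rewrite !cK => ->.
have QZ x z : closure Q (x, z) <-> Fop Z (ex 1) (x, cis (r / 2) *: z).
  rewrite QE ZQ2 /oscale /=; split=> [h|[y h /(congr1 ( *:%R (cis (- (r / 2)))))]].
    by exists z.
  by rewrite !cK' => ->.
(* This belongs to J Z J. By [ZQ1], T' = nu^(i/8) e^Z J = (nu^(i/8) J) (J e^Z J), and by [ZQ2] the
   last factor is [P]. *)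
pose Z' := transport hJ Z.
have cx1 : (fun s : R => cif true (ex 1 s)) = ex 1.
  by apply/funext => s; exact: conj_realC.
have Z'E x y : Fop Z' (ex 1) (x, y) <-> Fop Z (ex 1) (J x, J y).
  by apply: iff_trans (Fop_tr hJ Z x y (@mC_ex R 1)) _; rewrite cx1; exact: iff_refl.
have PE : P = Fop Z' (ex 1).
  apply/seteqP; split => [[x y]|[x y]].
    move=> [y1 [[y2 []]]]; rewrite /gr /= => -> [y3 /= h ->] ->.
    by apply/Z'E; rewrite (suK hJ) cE; apply/QZ.
  move/Z'E => h; exists (J y); split; last by rewrite /gr /= (suK hJ).
  exists (J x); split => //; exists (cis (- (r / 2)) *: J y); last by rewrite /= cE cK.
  by apply/QZ; rewrite cK.
have UE x : U x = cis (r / 2) *: J x by rewrite /U cE.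
have aU : antiunitary U.
  split.
  - move=> c x y; rewrite !UE; have [-> _ _] := auJ.
    by rewrite scalerDr !scalerA [cis _ * _]mulrC.
  - move=> x; rewrite UE !hnE hnZ cn_cis mul1r; congr (_%:C)%C; exact: (su_hn hJ).
  - by move=> y; exists (J (cis (- (r / 2)) *: y)); rewrite UE (suK hJ) cK.
have [aU1 aU2 _] := aU.
have sP : strictly_positive P by rewrite PE; exact: ex_strictly_positive.
split => //.
- split => x y y'.
    move=> /T'Z h /T'Z h'.
    by rewrite -[y]cK -[y']cK (Op_fun (@mC_ex R 1) h h').
  move=> /QZ h /QZ h'.
  by rewrite -[y]cK' -[y']cK' (Op_fun (@mC_ex R 1) h h').
- split => //; first by have [] := sP.
  + apply/seteqP; split => [[x z] /T'Z h|[x z] [y []]].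
      exists (J (cis (- (r / 2)) *: z)); split; last by rewrite /gr /= UE (suK hJ) cK.
      by rewrite PE; apply/Z'E; rewrite (suK hJ).
    rewrite PE => /Z'E h; rewrite /gr /= => ->.
    by apply/T'Z; rewrite UE cK'.
  (* The range of [P] is dense, so the condition on its orthogonal complement concerns 0 only. *)
  + move=> x h; have -> : x = 0.
      apply: (dense_orth (ex_ran_dense Z' 1)) => v; rewrite -PE; exact: h.
    by rewrite UE (su0 hJ) scaler0.
- move=> t x; rewrite PE ipow_ex (Phi_tr hJ Z (bm_cisM t)) /=.
  (* The antiunitary [J] turns [t] into [- t], and the factor [- 1/2] in [X] and [Y] restores the
     sign. The phase of [Zcis] is conjugated on leaving [J], which makes its exponent [r t^2 / 2],
     that is [ln nu * t^2 / 8]. *)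
  have -> : (fun s => (cis (t * s))^*) = fun s => cis (- t * s).
    by apply/funext => s; rewrite mulNr cisN.
  rewrite Zcis !cis_Nhalf (suZ hJ) ipow_nabla ipow_delta.
  have -> : - (- t / 2) = t / 2 by rewrite mulNr opprK.
  congr (_ *: _).
  by rewrite -[LHS]/(_^*) -cisN -[RHS]/(cis _) /r; congr cis; field.
Qed.
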